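(* For every positive integer $r$, there exists a smooth complex projective rational surface $X$ with at least $r$ real forms that are pairwise non-isomorphic over $\mathbb{R}$.
   Context: A real form of a complex algebraic variety $X$ is a real algebraic variety $X_0$ (i.e. a variety over $\mathbb{R}$) together with a $\mathbb{C}$-isomorphism $X_0\times_{\operatorname{Spec}\mathbb{R}}\operatorname{Spec}\mathbb{C}\overset{\sim}{\rightarrow}X$. Two real forms are considered up to isomorphism of the underlying varieties over $\mathbb{R}$. *)

(* Defs.v *)
From mathcomp Require Export all_boot all_order all_algebra.
From mathcomp Require Export boolp classical_sets reals.
From mathcomp Require Export mpoly complex.

Set Implicit Arguments.
Unset Strict Implicit.
Unset Printing Implicit Defensive.

Import Order.TTheory GRing.Theory Num.Theory.

Local Open Scope classical_set_scope.
Local Open Scope ring_scope.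

(* Classical (Weil-style) language of projective varieties.  [K] is meant to be
   algebraically closed; a subset of P^n(K) is represented by the set of all
   the nonzero vectors of homogeneous coordinates of its points. *)

Definition same_point (K : fieldType) n (x y : 'rV[K]_n.+1) : Prop :=
  exists2 c : K, c != 0 & y = c *: x.

Definition proj_space (K : fieldType) (n : nat) : set 'rV[K]_n.+1 :=
  [set x | x != 0].

Definition peval (K : fieldType) n (p : {mpoly K[n.+1]}) (x : 'rV[K]_n.+1) : K :=
  p.@[x 0].

Definition zeros (K : fieldType) n (S : set {mpoly K[n.+1]}) : set 'rV[K]_n.+1 :=
  [set x | x != 0 /\ forall p, S p -> peval p x = 0].

Definition zclosed (K : fieldType) n (Z : set 'rV[K]_n.+1) : Prop :=
  exists2 S : set {mpoly K[n.+1]},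
    (forall p, S p -> p \is homog mdeg) & Z = zeros S.

Definition zopen_in (K : fieldType) n (A U : set 'rV[K]_n.+1) : Prop :=
  exists2 Z, zclosed Z & U = A `\` Z.

Definition zirreducible (K : fieldType) n (A : set 'rV[K]_n.+1) : Prop :=
  A !=set0 /\
  forall Z1 Z2, zclosed Z1 -> zclosed Z2 ->
    A `<=` Z1 `|` Z2 -> A `<=` Z1 \/ A `<=` Z2.

Definition irreducible_chain (K : fieldType) n (A : set 'rV[K]_n.+1)
    (l : nat) (Z : nat -> set 'rV[K]_n.+1) : Prop :=
  (forall i, (i <= l)%N -> [/\ zclosed (Z i), zirreducible (Z i) & Z i `<=` A]) /\
  (forall i, (i < l)%N -> Z i `<` Z i.+1).

(* Krull dimension of a closed set. *)
Definition has_dim (K : fieldType) n (A : set 'rV[K]_n.+1) (d : nat) : Prop :=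
  (exists Z, irreducible_chain A d Z) /\
  ~ (exists Z, irreducible_chain A d.+1 Z).

(* Zariski tangent space at [x] of the affine cone over [A], cut out by the
   differentials of all the elements of the homogeneous ideal of [A].  It
   contains the line through [x], and its quotient by that line is the tangent
   space of [A] at [x], up to a twist. *)
Definition cone_tangent (K : fieldType) n (A : set 'rV[K]_n.+1)
    (x : 'rV[K]_n.+1) : set 'rV[K]_n.+1 :=
  [set v | forall p : {mpoly K[n.+1]}, p \is homog mdeg ->
     (forall y, A y -> peval p y = 0) ->
     \sum_(i < n.+1) peval p^`M(i) x * v 0 i = 0].

Definition smooth_of_dim (K : fieldType) n (A : set 'rV[K]_n.+1) (d : nat) : Prop :=
  has_dim A d /\
  forall x, A x -> exists2 M : 'M[K]_n.+1, \rank M = d.+1 &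
    forall v : 'rV[K]_n.+1, (v <= M)%MS <-> cone_tangent A x v.

(* Regular maps between locally closed sets, defined over a subfield
   [iota : F -> K]: around every [K]-point the map is given by homogeneous
   polynomials of the same degree, with coefficients in [F], that do not vanish
   simultaneously at that point. *)
Definition poly_map (F K : fieldType) (iota : {rmorphism F -> K}) n m
    (P : 'I_m.+1 -> {mpoly F[n.+1]}) (x : 'rV[K]_n.+1) : 'rV[K]_m.+1 :=
  \row_j peval (map_mpoly iota (P j)) x.

Definition regular_map (F K : fieldType) (iota : {rmorphism F -> K}) n m
    (A : set 'rV[K]_n.+1) (B : set 'rV[K]_m.+1)
    (phi : 'rV[K]_n.+1 -> 'rV[K]_m.+1) : Prop :=
  (forall x, A x -> B (phi x)) /\
  forall x, A x ->
    exists (d : nat) (P : 'I_m.+1 -> {mpoly F[n.+1]}),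
      [/\ forall j, P j \is d.-homog,
          poly_map iota P x != 0 &
          forall y, A y -> poly_map iota P y != 0 ->
            same_point (poly_map iota P y) (phi y)].

Definition isomorphic_sets (F K : fieldType) (iota : {rmorphism F -> K}) n m
    (A : set 'rV[K]_n.+1) (B : set 'rV[K]_m.+1) : Prop :=
  exists (phi : 'rV[K]_n.+1 -> 'rV[K]_m.+1) (psi : 'rV[K]_m.+1 -> 'rV[K]_n.+1),
    [/\ regular_map iota A B phi, regular_map iota B A psi,
        forall x, A x -> same_point x (psi (phi x)) &
        forall y, B y -> same_point y (phi (psi y))].

(* [A] (irreducible, of dimension [d]) is birational to P^d. *)
Definition rational_of_dim (K : fieldType) n (A : set 'rV[K]_n.+1) (d : nat) : Prop :=
  exists (U : set 'rV[K]_n.+1) (V : set 'rV[K]_d.+1),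
    [/\ zopen_in A U, U !=set0, zopen_in (@proj_space K d) V, V !=set0 &
        isomorphic_sets (idfun : {rmorphism K -> K}) U V].

(* A projective variety over [F], given by finitely many homogeneous equations
   and considered with its reduced structure.  Irreducibility is not built in. *)
Record projvar (F : fieldType) := ProjVar {
  ambient : nat;
  eqns : seq {mpoly F[ambient.+1]};
  eqns_homog : all (fun p => p \is homog mdeg) eqns }.

(* The [K]-points of the base change of [X] along [iota : F -> K].  When [F] is
   perfect and [K] algebraically closed, the base change of the reduced variety
   [X] is reduced, hence it is determined by this set. *)
Definition points (F K : fieldType) (iota : {rmorphism F -> K}) (X : projvar F) :
    set 'rV[K]_(ambient X).+1 :=
  zeros [set` map (map_mpoly iota) (eqns X)].
Arguments points {F K} iota X.

Section RealForms.
Variable R : realType.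

Definition cpoints (X : projvar R[i]) := points (idfun : {rmorphism R[i] -> R[i]}) X.
Arguments cpoints X : clear implicits.

Definition complexification (X0 : projvar R) :=
  points (real_complex R : {rmorphism R -> R[i]}) X0.
Arguments complexification X0 : clear implicits.

Definition smooth_rational_surface (X : projvar R[i]) : Prop :=
  [/\ zirreducible (cpoints X), smooth_of_dim (cpoints X) 2 &
      rational_of_dim (cpoints X) 2].

Definition real_form (X : projvar R[i]) (X0 : projvar R) : Prop :=
  isomorphic_sets (idfun : {rmorphism R[i] -> R[i]})
    (complexification X0) (cpoints X).

(* The morphisms of real varieties are the regular maps between the
   complexifications that are given, around every complex point, by real
   polynomials. *)
Definition isomorphic_over_R (X0 Y0 : projvar R) : Prop :=
  isomorphic_sets (real_complex R : {rmorphism R -> R[i]})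
    (complexification X0) (complexification Y0).

End RealForms.

(* Main.v *)
(* Let Y be the blow-up of P^1 x P^1 at the points (rho_j, w_j). If an involution
   pi of the index set satisfies w_(pi j) = conj rho_j, then the involution
   (y, w) -> (conj w, conj y) lifts to Y and defines a real form of Y.

   The points are taken on the curves y w = 1 and y w = -1, so w_j = eps_j / rho_j.
   The indices are grouped in blocks {z, -z, 1/z, -1/z} of values of rho, with z on
   the unit circle or z real, and eps is constant on each block. If two blocks carry
   opposite signs, multiplying (y w - 1) / (y w + 1) by the quotient of their
   quartics y^4 - (z^2 + 1/z^2) y^2 + 1 defines an isomorphism of Y with the blow-up
   in which the two signs are exchanged. Exchanging the signs of a circular and a
   real block therefore does not change the complex surface; but it changes pi,
   whose fixed points are the points of the circular blocks with eps = 1.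

   The number of fixed points is an invariant of the real form, since the number of
   orbits of pi is: it is one less than the rank of the group spanned by the degrees
   of the real curves. An isomorphism acts on degrees through a linear formula, so it
   suffices to send to the other surface one general real line of bidegree (1, 1) for
   each orbit of pi, passing through the points of that orbit, and one that passes
   through none of the points. *)

(* The shape of the blocks comes from reality: a centre with [rho] equal to z and sign e must go to
   the one with e / conj z, which is e z on the unit circle and e / z for real z. As z^2 is neither
   1 nor -1, only circular blocks with e = 1 have fixed points. The two quartics agree at y = 0 and
   at y = infinity, where the curves y w = 1 and y w = -1 meet, so the exchange has no base point
   there. The linear formula stands in for intersection theory. A regular map from the blow-up to a
   projective space is given by forms of bidegree (n, m) without common factor, with a multiplicity
   al_j at each centre. A polynomial curve with degrees dY, dW, dZ_j in the factors meets the j-th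
   exceptional curve dY + dW - dZ_j times, and its image has degree n dY + m dW - sum_j al_j (dY +
   dW - dZ_j). Reality forces dY = dW and makes dZ constant on orbits, which leaves one number more
   than there are orbits, whereas the degree vectors of the chosen lines are independent. This gives
   an inequality, and equality by symmetry. Local questions are settled on polynomial arcs: every
   point of Y lies on one whose general points are generic. *)
From mathcomp Require Import ring lra.
Require Import Defs.

Set Implicit Arguments.
Unset Strict Implicit.
Unset Printing Implicit Defensive.

Import Order.TTheory GRing.Theory Num.Theory.

Local Open Scope classical_set_scope.
Local Open Scope ring_scope.

(** * Homogeneous polynomial functions and regular maps *)

Section HomogeneousFunctions.
Variable K : fieldType.

(** Forms are handled as functions: closure lemmas track the degree, and identities are left to
    pointwise [ring]. *)
Definition hpoly N (d : nat) (F : 'rV[K]_N.+1 -> K) : Prop :=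
  exists2 p : {mpoly K[N.+1]}, p \is d.-homog & forall x, peval p x = F x.

Lemma hpoly_ext N d (F G : 'rV[K]_N.+1 -> K) :
  F =1 G -> hpoly d F -> hpoly d G.
Proof. by move=> e [p hp pE]; exists p => // x; rewrite pE e. Qed.

Lemma hpoly0 N d : hpoly d (fun _ : 'rV[K]_N.+1 => 0).
Proof. by exists 0; [exact: dhomog0 | move=> x; rewrite /peval meval0]. Qed.

Lemma hpolyC N c : hpoly 0 (fun _ : 'rV[K]_N.+1 => c).
Proof.
exists (c *: 1); first by apply: dhomogZ; exact: dhomog1.
by move=> x; rewrite /peval mevalZ meval1 mulr1.
Qed.

Lemma hpolyX N (i : 'I_N.+1) : hpoly 1 (fun x : 'rV[K]_N.+1 => x 0 i).
Proof.
exists 'X_i; first by rewrite dhomogX /= mdeg1.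
by move=> x; rewrite /peval mevalXU.
Qed.

Lemma hpolyD N d (F G : 'rV[K]_N.+1 -> K) :
  hpoly d F -> hpoly d G -> hpoly d (fun x => F x + G x).
Proof.
move=> [p hp pE] [q hq qE]; exists (p + q); first exact: dhomogD.
by move=> x; rewrite -pE -qE /peval mevalD.
Qed.

Lemma hpolyM N d e (F G : 'rV[K]_N.+1 -> K) :
  hpoly d F -> hpoly e G -> hpoly (d + e) (fun x => F x * G x).
Proof.
move=> [p hp pE] [q hq qE]; exists (p * q); first exact: dhomogM.
by move=> x; rewrite -pE -qE /peval mevalM.
Qed.

Lemma hpolyZ N d c (F : 'rV[K]_N.+1 -> K) :
  hpoly d F -> hpoly d (fun x => c * F x).
Proof. by move=> h; have := hpolyM (hpolyC N c) h; rewrite add0n. Qed.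

Lemma hpolyN N d (F : 'rV[K]_N.+1 -> K) : hpoly d F -> hpoly d (fun x => - F x).
Proof. by move=> /(hpolyZ (-1)); apply: hpoly_ext => x; rewrite mulN1r. Qed.

Lemma hpolyB N d (F G : 'rV[K]_N.+1 -> K) :
  hpoly d F -> hpoly d G -> hpoly d (fun x => F x - G x).
Proof. by move=> hF /hpolyN; apply: hpolyD. Qed.

Lemma hpoly_sum N d (T : Type) (s : seq T) (P : pred T)
    (F : T -> 'rV[K]_N.+1 -> K) :
  (forall t, hpoly d (F t)) -> hpoly d (fun x => \sum_(t <- s | P t) F t x).
Proof.
move=> h; elim: s => [|t s IH].
  by apply: hpoly_ext (hpoly0 N d) => x; rewrite big_nil.
case Pt: (P t).
  by apply: hpoly_ext (hpolyD (h t) IH) => x; rewrite big_cons Pt.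
by apply: hpoly_ext IH => x; rewrite big_cons Pt.
Qed.

Lemma hpoly_prod N (T : Type) (s : seq T) (P : pred T) (d : T -> nat)
    (F : T -> 'rV[K]_N.+1 -> K) :
  (forall t, hpoly (d t) (F t)) ->
  hpoly (\sum_(t <- s | P t) d t) (fun x => \prod_(t <- s | P t) F t x).
Proof.
move=> h; elim: s => [|t s IH].
  by rewrite big_nil; apply: hpoly_ext (hpolyC N 1) => x; rewrite big_nil.
rewrite big_cons; case Pt: (P t).
  by apply: hpoly_ext (hpolyM (h t) IH) => x; rewrite big_cons Pt.
by apply: hpoly_ext IH => x; rewrite big_cons Pt.
Qed.

Lemma hpolyXn N d n (F : 'rV[K]_N.+1 -> K) :
  hpoly d F -> hpoly (d * n) (fun x => F x ^+ n).
Proof.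
move=> h; elim: n => [|n IH].
  by rewrite muln0; apply: hpoly_ext (hpolyC N 1) => x; rewrite expr0.
by rewrite mulnS; apply: hpoly_ext (hpolyM h IH) => x; rewrite exprS.
Qed.

Lemma hpoly_comp N M d e (F : 'rV[K]_M.+1 -> K) (G : 'I_M.+1 -> 'rV[K]_N.+1 -> K) :
  hpoly e F -> (forall i, hpoly d (G i)) ->
  hpoly (d * e) (fun x => F (\row_i G i x)).
Proof.
move=> [p hp pE] hG.
apply: (@hpoly_ext _ _ (fun x => \sum_(m <- msupp p)
   p@_m * \prod_i (G i x) ^+ m i)) => [x|].
  rewrite -pE /peval mevalE; apply: eq_bigr => m _; congr (_ * _).
  by apply: eq_bigr => i _; rewrite mxE.
(* [hpoly_sum] asks for the degree of every summand, in the support or not; the test on [mdeg m]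
   replaces the others by zero. *)
pose Q := fun x : 'rV[K]_N.+1 => \sum_(m <- msupp p | mdeg m == e)
   p@_m * \prod_i (G i x) ^+ m i.
have hQ : hpoly (d * e) Q.
  pose Q2 := fun (x : 'rV[K]_N.+1) => \sum_(m <- msupp p)
     (if mdeg m == e then p@_m * \prod_i (G i x) ^+ m i else 0).
  apply: (@hpoly_ext _ _ Q2) => [x|]; first by rewrite /Q /Q2 [RHS]big_mkcond.
  apply: hpoly_sum => m; case: eqP => [<-|_]; last exact: hpoly0.
  apply: hpolyZ.
  have -> : (d * mdeg m = \sum_i d * m i)%N.
    by rewrite mdegE big_distrr.
  by apply: hpoly_prod => i; apply: hpolyXn.
apply: hpoly_ext hQ => x; rewrite /Q big_seq_cond [RHS]big_seq.
apply: eq_bigl => m; case hm: (m \in msupp p) => //=.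
by rewrite (dhomog_mf hp hm) eqxx.
Qed.

Lemma hpoly_scale N d (F : 'rV[K]_N.+1 -> K) (c : K) x :
  hpoly d F -> F (c *: x) = c ^+ d * F x.
Proof.
move=> [p hp pE]; rewrite -!pE /peval !mevalE mulr_sumr big_seq [RHS]big_seq.
apply: eq_bigr => m hm; rewrite mulrCA; congr (_ * _).
have <- : mdeg m = d := dhomog_mf hp hm.
rewrite mdegE -prodrXr -big_split /=.
by apply: eq_bigr => i _; rewrite mxE exprMn.
Qed.

Lemma hpoly_nz0 N d (F : 'rV[K]_N.+1 -> K) : (0 < d)%N -> hpoly d F -> F 0 = 0.
Proof.
move=> d0 h; have := hpoly_scale 0 0 h; rewrite scaler0 => ->.
by rewrite expr0n gtn_eqF // mul0r.
Qed.

(** Proportionality through 2 x 2 minors: a polynomial condition, true also when a vector vanishes,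
    so that it passes from a dense subset to the whole set. *)
Definition par N (x y : 'rV[K]_N) := forall i j, x 0 i * y 0 j = x 0 j * y 0 i.

Lemma par_sym N (x y : 'rV[K]_N) : par x y -> par y x.
Proof. by move=> h i j; rewrite mulrC -h mulrC. Qed.

Lemma rV_neq0 N (x : 'rV[K]_N) : x != 0 -> exists i, x 0 i != 0.
Proof. by move=> /rV0Pn. Qed.

Lemma rV_neq0P N (x : 'rV[K]_N) i : x 0 i != 0 -> x != 0.
Proof. by move=> h; apply/rV0Pn; exists i. Qed.

Lemma par_trans N (y x z : 'rV[K]_N) : y != 0 -> par x y -> par y z -> par x z.
Proof.
move=> /rV_neq0 [k yk] xy yz i j.
apply: (mulfI yk); rewrite !mulrA.
have e1 := xy i k; have e2 := xy j k.
rewrite [y 0 k * x 0 i]mulrC [y 0 k * x 0 j]mulrC e1 e2.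
by rewrite -!mulrA yz.
Qed.

Lemma same_point_par N (x y : 'rV[K]_N.+1) : same_point x y -> par x y.
Proof. by move=> [c _ ->] i j; rewrite !mxE; ring. Qed.

Lemma par_same_point N (x y : 'rV[K]_N.+1) :
  x != 0 -> y != 0 -> par x y -> same_point x y.
Proof.
move=> /rV_neq0 [i xi] /rV_neq0 [j yj] h.
have xj : y 0 i != 0.
  apply/eqP => e; have := h i j; rewrite e mulr0 => /eqP.
  by rewrite mulf_eq0 (negPf xi) (negPf yj).
exists (y 0 i / x 0 i); first by rewrite mulf_neq0 // invr_eq0.
apply/rowP => k; rewrite !mxE mulrAC; apply: (mulIf xi).
by rewrite mulfVK // [RHS]mulrC -h mulrC.
Qed.

Lemma same_point_neq0 N (x y : 'rV[K]_N.+1) : same_point x y -> x != 0 -> y != 0.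
Proof. by move=> [c c0 ->] x0; rewrite scaler_eq0 negb_or c0. Qed.

Lemma same_point_refl N (x : 'rV[K]_N.+1) : same_point x x.
Proof. by exists 1; [exact: oner_neq0 | rewrite scale1r]. Qed.

Lemma same_point_sym N (x y : 'rV[K]_N.+1) : same_point x y -> same_point y x.
Proof.
by move=> [c c0 ->]; exists c^-1; rewrite ?invr_eq0 // scalerA mulVf // scale1r.
Qed.

Lemma same_point_trans N (y x z : 'rV[K]_N.+1) :
  same_point x y -> same_point y z -> same_point x z.
Proof.
move=> [c c0 ->] [d d0 ->]; exists (d * c); first by rewrite mulf_neq0.
by rewrite scalerA.
Qed.

Lemma hpoly_same_point N d (F : 'rV[K]_N.+1 -> K) x y :
  hpoly d F -> same_point x y -> (F y == 0) = (F x == 0).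
Proof.
move=> h [c c0 ->]; rewrite (hpoly_scale _ _ h) mulf_eq0.
by rewrite expf_eq0 (negPf c0) andbF.
Qed.

Lemma zclosed_hpoly N (A : set 'rV[K]_N.+1) (I : Type) (F : I -> 'rV[K]_N.+1 -> K) :
  (forall i, exists d, hpoly d (F i)) ->
  A = [set x | x != 0 /\ forall i, F i x = 0] -> zclosed A.
Proof.
move=> h ->.
exists [set p : {mpoly K[N.+1]} | p \is homog mdeg /\
   exists i, forall x, peval p x = F i x]; first by move=> p [].
apply/seteqP; split=> x [x0 hx]; split=> //.
  by move=> p [_ [i ->]]; exact: hx.
move=> i; have [d [p hp pE]] := h i; rewrite -pE; apply: hx; split.
  by apply/homogP; exists d.
by exists i.
Qed.

Lemma zclosedP N (A : set 'rV[K]_N.+1) : zclosed A ->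
  exists (S : set ('rV[K]_N.+1 -> K)),
    (forall F, S F -> exists d, hpoly d F) /\
    A = [set x | x != 0 /\ forall F, S F -> F x = 0].
Proof.
move=> [S hS ->].
exists [set F | exists2 p, S p & F = peval p]; split.
  move=> F [p Sp ->]; have /homogP [d hd] := hS _ Sp.
  by exists d; exists p.
apply/seteqP; split=> x [x0 hx]; split=> //.
  by move=> F [p Sp ->]; exact: hx.
by move=> p Sp; apply: hx; exists p.
Qed.

Lemma zclosed_neq0 N (A : set 'rV[K]_N.+1) x : zclosed A -> A x -> x != 0.
Proof. by move=> [S _ ->] []. Qed.

Lemma zclosed_same_point N (A : set 'rV[K]_N.+1) x y :
  zclosed A -> same_point x y -> A x -> A y.
Proof.
move=> /zclosedP [S [hS ->]] xy [x0 hx]; split; first exact: same_point_neq0 xy x0.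
move=> F SF; have [d hd] := hS _ SF; apply/eqP.
by rewrite (hpoly_same_point hd xy) hx.
Qed.

Lemma zclosedI N (A B : set 'rV[K]_N.+1) : zclosed A -> zclosed B -> zclosed (A `&` B).
Proof.
move=> [S hS ->] [S' hS' ->]; exists (S `|` S').
  by move=> p [/hS|/hS'].
apply/seteqP; split=> x.
  by move=> [[x0 h] [_ h']]; split=> // p [/h|/h'].
by move=> [x0 h]; split; split=> // p Sp; apply: h; [left|right].
Qed.

Lemma map_mpoly_idfun N (p : {mpoly K[N]}) :
  map_mpoly (idfun : {rmorphism K -> K}) p = p.
Proof.
by apply/mpolyP => m; rewrite mcoeff_map_mpoly.
Qed.

Definition regmap N M (A : set 'rV[K]_N.+1) (B : set 'rV[K]_M.+1)
    (phi : 'rV[K]_N.+1 -> 'rV[K]_M.+1) : Prop :=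
  regular_map (idfun : {rmorphism K -> K}) A B phi.

Lemma regmapP N M (A : set 'rV[K]_N.+1) (B : set 'rV[K]_M.+1) phi :
  regmap A B phi <->
  (forall x, A x -> B (phi x)) /\
  forall x, A x -> exists (d : nat) (F : 'I_M.+1 -> 'rV[K]_N.+1 -> K),
    [/\ forall j, hpoly d (F j), \row_j F j x != 0 &
        forall y, A y -> \row_j F j y != 0 -> same_point (\row_j F j y) (phi y)].
Proof.
have pm P (y : 'rV[K]_N.+1) : poly_map (idfun : {rmorphism K -> K}) P y
   = \row_(j < M.+1) peval (P j) y.
  by apply/rowP => j; rewrite !mxE map_mpoly_idfun.
split=> [[h1 h2]|[h1 h2]]; split=> // x Ax; have [d [P [a b c]]] := h2 x Ax.
  exists d, (fun j => peval (P j)); rewrite -pm; split=> //.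
    by move=> j; exists (P j).
  by move=> y Ay; rewrite -pm; exact: c.
have /choice [Q hQ] : forall j, exists q : {mpoly K[N.+1]},
    q \is d.-homog /\ forall y, peval q y = P j y.
  by move=> j; have [q q1 q2] := a j; exists q.
have e y : poly_map (idfun : {rmorphism K -> K}) Q y = \row_j P j y.
  by rewrite pm; apply/rowP => j; rewrite !mxE (hQ j).2.
exists d, Q; split=> [j||y Ay]; rewrite ?e //; first exact: (hQ j).1.
exact: c.
Qed.

End HomogeneousFunctions.

(** * Composition, extension and uniqueness of regular maps *)

Section RegularMaps.
Variable K : fieldType.

Lemma hpoly_deg0 N (F : 'rV[K]_N.+1 -> K) x : hpoly 0 F -> F x = F 0.
Proof. by move=> h; have := hpoly_scale 0 x h; rewrite scale0r expr0 mul1r. Qed.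

Lemma row_hpoly_same_point N M d (F : 'I_M.+1 -> 'rV[K]_N.+1 -> K) x y :
  (forall j, hpoly d (F j)) -> same_point x y ->
  same_point (\row_j F j x) (\row_j F j y).
Proof.
move=> h [c c0 ->]; exists (c ^+ d); first by rewrite expf_neq0.
by apply/rowP => j; rewrite !mxE (hpoly_scale _ _ (h j)).
Qed.

Lemma regmap_comp N M L (A : set 'rV[K]_N.+1) (B : set 'rV[K]_M.+1)
    (C : set 'rV[K]_L.+1) phi psi :
  regmap A B phi -> regmap B C psi -> regmap A C (psi \o phi).
Proof.
move=> /regmapP [p1 p2] /regmapP [q1 q2]; apply/regmapP; split.
  by move=> x /p1 /q1.
move=> x Ax; have [d [G [hG Gx Gs]]] := p2 x Ax.
have [e [F [hF Fx Fs]]] := q2 _ (p1 _ Ax).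
exists (d * e)%N, (fun j x => F j (\row_i G i x)); split.
- by move=> j; apply: hpoly_comp.
- have := row_hpoly_same_point hF (same_point_sym (Gs x Ax Gx)).
  by move=> /same_point_neq0; apply.
move=> y Ay Fy.
have sF : same_point (\row_j F j (\row_i G i y)) (\row_j F j (phi y)).
  (* The inner representative may vanish at y. The outer one, being nonzero there, then has degree 0
     and is constant. *)
  have [Gy|Gy] := eqVneq (\row_i G i y) 0; last exact: row_hpoly_same_point hF (Gs y Ay Gy).
  have [e0|e0] := posnP e; last first.
    case/negP: Fy; apply/eqP/rowP => j; rewrite !mxE Gy.
    exact: hpoly_nz0 e0 (hF j).
  have -> : \row_j F j (phi y) = \row_j F j (\row_i G i y).
    apply/rowP => j; rewrite !mxE Gy; apply: hpoly_deg0.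
    by rewrite -e0.
  exact: same_point_refl.
apply: (same_point_trans sF); apply: Fs; first exact: p1.
exact: same_point_neq0 sF Fy.
Qed.

Lemma regmap_id N (A : set 'rV[K]_N.+1) : (forall x, A x -> x != 0) -> regmap A A id.
Proof.
have e (x : 'rV[K]_N.+1) : \row_j x 0 j = x by apply/rowP => j; rewrite mxE.
move=> A0; apply/regmapP; split=> // x Ax; exists 1%N, (fun j y => y 0 j).
by split=> [j||y Ay _]; [exact: hpolyX | rewrite e A0 | rewrite e; exact: same_point_refl].
Qed.

Lemma regmap_mulmx N M (A : set 'rV[K]_N.+1) (B : set 'rV[K]_M.+1)
    (P : 'M[K]_(N.+1, M.+1)) :
  (forall x, A x -> B (x *m P)) -> (forall x, B x -> x != 0) ->
  regmap A B (fun x => x *m P).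
Proof.
move=> h B0; apply/regmapP; split=> // x Ax.
have e (y : 'rV[K]_N.+1) : \row_j (\sum_i y 0 i * P i j) = y *m P.
  by apply/rowP => j; rewrite !mxE.
exists 1%N, (fun j (y : 'rV[K]_N.+1) => \sum_i y 0 i * P i j); split.
- move=> j; apply: hpoly_sum => i; apply: hpoly_ext (hpolyZ (P i j) (hpolyX K i)) => z.
  by rewrite mulrC.
- by rewrite e; apply/B0/h.
- by move=> y Ay _; rewrite e; exact: same_point_refl.
Qed.

Definition ziso N M (A : set 'rV[K]_N.+1) (B : set 'rV[K]_M.+1) : Prop :=
  isomorphic_sets (idfun : {rmorphism K -> K}) A B.

Lemma ziso_sym N M (A : set 'rV[K]_N.+1) (B : set 'rV[K]_M.+1) : ziso A B -> ziso B A.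
Proof. by move=> [phi [psi [a b c d]]]; exists psi, phi. Qed.

Lemma regmap_same_point N M (A : set 'rV[K]_N.+1) (B : set 'rV[K]_M.+1) phi x y :
  regmap A B phi -> A x -> A y -> same_point x y -> same_point (phi x) (phi y).
Proof.
move=> /regmapP [_ h] Ax Ay xy; have [d [F [hF Fx Fs]]] := h x Ax.
have s := row_hpoly_same_point hF xy.
apply: same_point_trans (same_point_sym (Fs x Ax Fx)) _.
apply: (same_point_trans s); apply: Fs => //.
exact: same_point_neq0 s Fx.
Qed.

Lemma ziso_trans N M L (B : set 'rV[K]_M.+1) (A : set 'rV[K]_N.+1) (C : set 'rV[K]_L.+1) :
  ziso A B -> ziso B C -> ziso A C.
Proof.
move=> [f [g [rf rg fg gf]]] [f' [g' [rf' rg' fg' gf']]].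
exists (f' \o f), (g \o g'); split.
- exact: regmap_comp rf rf'.
- exact: regmap_comp rg' rg.
- move=> x Ax; have Bx := rf.1 _ Ax; apply: same_point_trans (fg x Ax) _ => /=.
  apply: (regmap_same_point rg) => //; last exact: fg'.
  exact: rg'.1 (rf'.1 _ Bx).
- move=> x Cx; have Bx := rg'.1 _ Cx; apply: same_point_trans (gf' x Cx) _ => /=.
  apply: (regmap_same_point rf') => //; last exact: gf.
  exact: rf.1 (rg.1 _ Bx).
Qed.

Lemma ziso_refl N (A : set 'rV[K]_N.+1) : (forall x, A x -> x != 0) -> ziso A A.
Proof.
move=> h; exists id, id; split; try exact: regmap_id.
- by move=> *; exact: same_point_refl.
- by move=> *; exact: same_point_refl.
Qed.

(** Identity principle: A is covered by the zeros of F and those of q, and the latter do not contain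
    A. *)
Lemma irreducible_vanish N (A : set 'rV[K]_N.+1) d e (F q : 'rV[K]_N.+1 -> K) :
  zirreducible A -> (forall x, A x -> x != 0) -> hpoly d F -> hpoly e q ->
  (exists2 x, A x & q x != 0) -> (forall x, A x -> q x != 0 -> F x = 0) ->
  forall x, A x -> F x = 0.
Proof.
move=> [_ irr] A0 hF hq [y Ay qy] h x Ax.
have cl d' (G : 'rV[K]_N.+1 -> K) : hpoly d' G -> zclosed [set x | x != 0 /\ G x = 0].
  move=> hG; apply: (@zclosed_hpoly _ _ _ unit (fun=> G)); first by exists d'.
  by apply/seteqP; split=> z [z0 hz]; split=> //; apply: (hz tt).
have sub0 : A `<=` [set x | x != 0 /\ F x = 0] `|` [set x | x != 0 /\ q x = 0].
  move=> z Az; have [qz|qz] := eqVneq (q z) 0; [right|left]; split; rewrite ?A0 //.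
  exact: h.
have [sub|sub] := irr _ _ (cl _ _ hF) (cl _ _ hq) sub0.
- by have [] := sub x Ax.
- by have [_] := sub y Ay; move: qy => /eqP.
Qed.

(** The local representatives only have to be proportional to [phi0] on a dense set. The minors of
    two of them are forms that vanish on this dense set, hence on A, so the representatives agree
    wherever they are nonzero. *)
Lemma regmap_extend N M (A : set 'rV[K]_N.+1) (B : set 'rV[K]_M.+1) e
    (q : 'rV[K]_N.+1 -> K) (phi0 : 'rV[K]_N.+1 -> 'rV[K]_M.+1) :
  zirreducible A -> (forall x, A x -> x != 0) -> hpoly e q ->
  (exists2 x, A x & q x != 0) -> zclosed B ->
  (forall x, A x -> q x != 0 -> B (phi0 x)) ->
  (forall P, A P -> exists d (G : 'I_M.+1 -> 'rV[K]_N.+1 -> K),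
     [/\ forall j, hpoly d (G j), \row_j G j P != 0 &
       forall x, A x -> q x != 0 -> par (\row_j G j x) (phi0 x)]) ->
  exists2 phi, regmap A B phi & forall x, A x -> q x != 0 -> same_point (phi0 x) (phi x).
Proof.
move=> irr A0 hq qA cB phiB loc.
have /choice [G hG] : forall P, exists dG : nat * ('I_M.+1 -> 'rV[K]_N.+1 -> K),
    A P -> [/\ forall j, hpoly dG.1 (dG.2 j), \row_j dG.2 j P != 0 &
       forall x, A x -> q x != 0 -> par (\row_j dG.2 j x) (phi0 x)].
  move=> P; have [AP|nAP] := pselect (A P); last by exists (0%N, fun _ _ => 0).
  by have [d [G h]] := loc P AP; exists (d, G).
(* Each point is evaluated by its own representative, the one known not to vanish there. *)
pose phi P := \row_j (G P).2 j P.
have phi0_neq0 x : A x -> q x != 0 -> phi0 x != 0.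
  by move=> Ax qx; apply: zclosed_neq0 cB _; exact: phiB.
have agree P x : A P -> A x -> par (\row_j (G P).2 j x) (phi x).
  move=> AP Ax i j; rewrite !mxE.
  have [h1 _ p1] := hG P AP; have [h2 _ p2] := hG x Ax.
  apply/eqP; rewrite -subr_eq0; apply/eqP.
  have hm : hpoly ((G P).1 + (G x).1)
     (fun y => (G P).2 i y * (G x).2 j y - (G P).2 j y * (G x).2 i y).
    by apply: hpolyB; apply: hpolyM.
  apply: (irreducible_vanish irr A0 hm hq qA _ Ax) => y Ay qy.
  have := par_trans (phi0_neq0 y Ay qy) (p1 y Ay qy) (par_sym (p2 y Ay qy)) i j.
  by rewrite !mxE => ->; rewrite subrr.
exists phi.
  apply/regmapP; split.
    move=> P AP; have [hP nzP pP] := hG P AP.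
    have [S [hS BE]] := zclosedP cB; rewrite BE; split=> // F SF.
    have [d hd] := hS F SF.
    have hFG := hpoly_comp hd hP.
    apply: (irreducible_vanish irr A0 hFG hq qA _ AP) => y Ay qy.
    have := phiB y Ay qy; rewrite BE => -[b0 /(_ F SF) Fy].
    (* Where the representative vanishes, F is taken at 0: this gives 0 in positive degree, and in
       degree 0 the value of F at [phi0 y]. *)
    have [Gy|Gy] := eqVneq (\row_i (G P).2 i y) 0; last first.
      have sp := par_same_point b0 Gy (par_sym (pP y Ay qy)).
      by apply/eqP; rewrite (hpoly_same_point hd sp) Fy.
    rewrite Gy; have [d0|d0] := posnP d; last exact: hpoly_nz0 d0 hd.
    by move: hd; rewrite d0 => hd0; rewrite -(hpoly_deg0 (phi0 y) hd0).
  move=> P AP; have [hP nzP pP] := hG P AP; exists (G P).1, (G P).2; split=> //.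
  move=> y Ay Gy; apply: par_same_point => //; last exact: agree.
  by have [] := hG y Ay.
move=> x Ax qx; have [_ nz p] := hG x Ax.
apply: par_same_point => //; first exact: phi0_neq0.
exact/par_sym/p.
Qed.

Lemma regmap_eq_dense N M (A : set 'rV[K]_N.+1) (B : set 'rV[K]_M.+1) e
    (q : 'rV[K]_N.+1 -> K) phi psi :
  zirreducible A -> (forall x, A x -> x != 0) -> hpoly e q ->
  (exists2 x, A x & q x != 0) -> regmap A B phi -> regmap A B psi ->
  (forall x, B x -> x != 0) ->
  (forall x, A x -> q x != 0 -> same_point (phi x) (psi x)) ->
  forall x, A x -> same_point (phi x) (psi x).
Proof.
move=> irr A0 hq qA /regmapP [f1 f2] /regmapP [g1 g2] B0 h x Ax.
have [d [F [hF Fx Fs]]] := f2 x Ax; have [d' [G [hG Gx Gs]]] := g2 x Ax.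
apply: same_point_trans (same_point_sym (Fs x Ax Fx)) _.
apply: same_point_trans _ (Gs x Ax Gx); apply: par_same_point => // i j; rewrite !mxE.
apply/eqP; rewrite -subr_eq0; apply/eqP.
have hm : hpoly (d + d') (fun y => F i y * G j y - F j y * G i y).
  by apply: hpolyB; apply: hpolyM.
apply: (irreducible_vanish irr A0 hm hq qA _ Ax) => y Ay qy.
have [Fy|Fy] := eqVneq (\row_i F i y) 0.
  have e0 k : F k y = 0 by have /rowP /(_ k) := Fy; rewrite !mxE.
  by rewrite !e0 !mul0r subrr.
have [Gy|Gy] := eqVneq (\row_i G i y) 0.
  have e0 k : G k y = 0 by have /rowP /(_ k) := Gy; rewrite !mxE.
  by rewrite !e0 !mulr0 subrr.
have s := same_point_trans (Fs y Ay Fy) (same_point_trans (h y Ay qy)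
   (same_point_sym (Gs y Ay Gy))).
by have := same_point_par s i j; rewrite !mxE => ->; rewrite subrr.
Qed.

End RegularMaps.

(** * Segre coordinates on a product of projective planes *)

Definition o0 : 'I_3 := @Ordinal 3 0 isT.
Definition o1 : 'I_3 := @Ordinal 3 1 isT.
Definition o2 : 'I_3 := @Ordinal 3 2 isT.

Lemma I3P (P : 'I_3 -> Prop) : P o0 -> P o1 -> P o2 -> forall k, P k.
Proof. by move=> p0 p1 p2 [[|[|[|k]]] lt] //; rewrite (bool_irrelevance lt isT). Qed.

Definition vec3 (L : Type) (a b c : L) : 'I_3 -> L :=
  fun k => match val k with 0 => a | 1 => b | _ => c end.

Section Segre.
Variable T : finType.

Definition idx : finType := option (option T).
Definition iy : idx := None.
Definition iw : idx := Some None.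
Definition iz (j : T) : idx := Some (Some j).

Lemma idxP (P : idx -> Prop) : P iy -> P iw -> (forall j, P (iz j)) -> forall i, P i.
Proof. by move=> py pw pz [[j|]|]; [exact: pz | exact: pw | exact: py]. Qed.

(** A Segre coordinate of a product of projective planes is the choice of one coordinate in each
    factor. *)
Definition mon : finType := {ffun idx -> 'I_3}.
Definition amb := #|mon|.-1.

Lemma card_mon : #|mon| = amb.+1.
Proof. by rewrite /amb prednK //; apply/card_gt0P; exists [ffun=> o0]. Qed.

Definition enc (e : mon) : 'I_amb.+1 := cast_ord card_mon (enum_rank e).
Definition dec (k : 'I_amb.+1) : mon := enum_val (cast_ord (esym card_mon) k).

Lemma encK : cancel enc dec.
Proof. by move=> e; rewrite /dec /enc cast_ordK enum_rankK. Qed.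

Lemma decK : cancel dec enc.
Proof. by move=> k; rewrite /dec /enc enum_valK cast_ordKV. Qed.

Definition upd (e : mon) (i : idx) (k : 'I_3) : mon :=
  [ffun i' => if i' == i then k else e i'].

Lemma upd_same e i k : upd e i k i = k.
Proof. by rewrite ffunE eqxx. Qed.

Lemma upd_other e i k i' : i' != i -> upd e i k i' = e i'.
Proof. by rewrite ffunE => /negPf ->. Qed.

Lemma upd_id e i : upd e i (e i) = e.
Proof. by apply/ffunP => i'; rewrite ffunE; case: eqP => // ->. Qed.

Lemma updd e i k k' : upd (upd e i k) i k' = upd e i k'.
Proof. by apply/ffunP => i'; rewrite !ffunE; case: eqP. Qed.

Section Tensor.
Variable L : comNzRingType.

Definition tens (v : idx -> 'I_3 -> L) : mon -> L := fun e => \prod_i v i (e i).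

Lemma tens_upd v e i k :
  tens v (upd e i k) = (\prod_(i' | i' != i) v i' (e i')) * v i k.
Proof.
rewrite /tens (bigD1 i) //= upd_same mulrC; congr (_ * _).
by apply: eq_bigr => i' ii'; rewrite upd_other.
Qed.

Lemma tensZ v (c : idx -> L) e :
  tens (fun i k => c i * v i k) e = (\prod_i c i) * tens v e.
Proof. by rewrite /tens big_split. Qed.

Lemma tens_swap v e f i :
  tens v e * tens v f = tens v (upd e i (f i)) * tens v (upd f i (e i)).
Proof.
by rewrite -{1}(upd_id e i) -{1}(upd_id f i) !tens_upd; ring.
Qed.

End Tensor.

Section SegreEquations.
Variable K : fieldType.

Definition co (x : 'rV[K]_amb.+1) (e : mon) : K := x 0 (enc e).
Definition mkx (u : mon -> K) : 'rV[K]_amb.+1 := \row_k u (dec k).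

Lemma coE u e : co (mkx u) e = u e.
Proof. by rewrite /co mxE encK. Qed.

Lemma coK x : mkx (co x) = x.
Proof. by apply/rowP => k; rewrite mxE /co decK. Qed.

Lemma co_inj x y : co x =1 co y -> x = y.
Proof.
move=> h; rewrite -(coK x) -(coK y); apply/rowP => k.
by rewrite !mxE h.
Qed.

Lemma co_neq0 x : x != 0 -> exists e, co x e != 0.
Proof.
move=> /rV_neq0 [k xk]; exists (dec k); by rewrite /co decK.
Qed.

Lemma co_neq0P x e : co x e != 0 -> x != 0.
Proof. exact: rV_neq0P. Qed.

(** A tensor that satisfies the Segre relations has rank one: the indices of e replace those of [e0]
    one at a time, each through one exchange with [e0] modified at that single index. *)
Lemma segre_tens x e0 : co x e0 != 0 ->
  (forall e f i, co x e * co x f = co x (upd e i (f i)) * co x (upd f i (e i))) ->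
  forall e, co x e = co x e0 * tens (fun i k => co x (upd e0 i k) / co x e0) e.
Proof.
move=> x0 h e; set v := fun i k => _.
pose es (s : seq idx) : mon := [ffun i => if i \in s then e i else e0 i].
have H s : uniq s -> co x (es s) = co x e0 * \prod_(i <- s) v i (e i).
  elim: s => [|i s IH] /=.
    move=> _; rewrite big_nil mulr1; congr (co x _).
    by apply/ffunP => i; rewrite ffunE in_nil.
  move=> /andP [ins us]; rewrite big_cons.
  have := h (es s) (upd e0 i (e i)) i; rewrite upd_same.
  have -> : upd (es s) i (e i) = es (i :: s).
    apply/ffunP => i'; rewrite !ffunE in_cons; case: eqP => [->|//] //.
  have -> : upd (upd e0 i (e i)) i (es s i) = e0.
    by rewrite updd /es ffunE (negPf ins) upd_id.
  rewrite IH // => e1; apply: (mulIf x0); rewrite -e1 /v; field.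
  exact: x0.
rewrite /tens; have := H (index_enum idx) (index_enum_uniq _).
move=> <-; congr (co x _).
by apply/ffunP => i; rewrite ffunE mem_index_enum.
Qed.

End SegreEquations.
End Segre.
Arguments co {T K} x e.
Arguments mkx {T K} u.
Arguments iy {T}.
Arguments iw {T}.

(** * Blow-ups of P^1 x P^1 *)

Section BlowUp.
Variables (T : finType) (K : fieldType) (rho w : T -> K).

(* The coordinates [y = v iy] and [w = v iw] of P^1 x P^1 are padded by a zero.
   The factor [v (iz j)] is the point (1/(y - rho j) : 1/(w - w j) : 1) of P^2;
   its graph is the blow-up of P^1 x P^1 at (rho j, w j), with exceptional curve
   the line where the last coordinate vanishes. *)
Definition onY (L : comNzRingType) (k : K -> L) (v : idx T -> 'I_3 -> L) : Prop :=
  [/\ v iy o2 = 0, v iw o2 = 0,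
     forall j, v (iz j) o0 * (v iy o1 - k (rho j) * v iy o0) = v (iz j) o2 * v iy o0 &
     forall j, v (iz j) o1 * (v iw o1 - k (w j) * v iw o0) = v (iz j) o2 * v iw o0].

Local Notation N := (amb T).

Definition segre_eq (t : mon T * mon T * idx T) : {mpoly K[N.+1]} :=
  'X_(enc t.1.1) * 'X_(enc t.1.2)
  - 'X_(enc (upd t.1.1 t.2 (t.1.2 t.2))) * 'X_(enc (upd t.1.2 t.2 (t.1.1 t.2))).

Definition pad_eq (i : idx T) (e : mon T) : {mpoly K[N.+1]} := 'X_(enc (upd e i o2)).

(** The bilinear relation of [onY] between the factors i and [iz j], multiplied by a monomial in the
    remaining factors, is linear in the Segre coordinates. *)
Definition center_eq (i : idx T) (l : 'I_3) (c : T -> K) (t : mon T * T) :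
    {mpoly K[N.+1]} :=
  'X_(enc (upd (upd t.1 i o1) (iz t.2) l))
  - c t.2 *: 'X_(enc (upd (upd t.1 i o0) (iz t.2) l))
  - 'X_(enc (upd (upd t.1 i o0) (iz t.2) o2)).

Definition Y_eqns : seq {mpoly K[N.+1]} :=
  [seq segre_eq t | t : mon T * mon T * idx T]
  ++ [seq pad_eq iy e | e : mon T] ++ [seq pad_eq iw e | e : mon T]
  ++ [seq center_eq iy o0 rho t | t : mon T * T]
  ++ [seq center_eq iw o1 w t | t : mon T * T].

Lemma Y_eqns_homog : all (fun p => p \is homog mdeg) Y_eqns.
Proof.
have hX (i : 'I_N.+1) : ('X_i : {mpoly K[N.+1]}) \is 1.-homog.
  by rewrite dhomogX /= mdeg1.
rewrite /Y_eqns !all_cat; apply/and5P; split; apply/allP => p /mapP [t _ ->];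
  apply/homogP.
- exists 2%N; apply: rpredB; exact: (dhomogM (hX _) (hX _)).
- by exists 1%N; exact: hX.
- by exists 1%N; exact: hX.
- by exists 1%N; apply: rpredB => //; apply: rpredB => //; exact: rpredZ.
- by exists 1%N; apply: rpredB => //; apply: rpredB => //; exact: rpredZ.
Qed.

Definition Yvar : projvar K := ProjVar Y_eqns_homog.
Definition Yset : set 'rV[K]_N.+1 := points (idfun : {rmorphism K -> K}) Yvar.

Lemma Yset_closed : zclosed Yset.
Proof.
exists [set` map (map_mpoly (idfun : {rmorphism K -> K})) Y_eqns] => // p /=.
case/mapP => q hq ->; rewrite map_mpoly_idfun.
by have /allP := Y_eqns_homog; apply.
Qed.

Lemma Yset_neq0 x : Yset x -> x != 0.
Proof. by case. Qed.

Lemma Yset_eqs x : Yset x <-> x != 0 /\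
  [/\ forall e f i, co x e * co x f = co x (upd e i (f i)) * co x (upd f i (e i)),
      forall e, co x (upd e iy o2) = 0, forall e, co x (upd e iw o2) = 0,
      forall e j, co x (upd (upd e iy o1) (iz j) o0)
        - rho j * co x (upd (upd e iy o0) (iz j) o0)
        - co x (upd (upd e iy o0) (iz j) o2) = 0 &
      forall e j, co x (upd (upd e iw o1) (iz j) o1)
        - w j * co x (upd (upd e iw o0) (iz j) o1)
        - co x (upd (upd e iw o0) (iz j) o2) = 0].
Proof.
have mp (S : seq {mpoly K[N.+1]}) :
   (forall p, [set` map (map_mpoly (idfun : {rmorphism K -> K})) S] p -> peval p x = 0)
   <-> (forall p, p \in S -> peval p x = 0).
  split=> h p; last by move=> /mapP [q hq ->]; rewrite map_mpoly_idfun; apply: h.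
  by move=> hp; apply: h => /=; apply/mapP; exists p; rewrite ?map_mpoly_idfun.
split=> [[x0 /mp h]|[x0 [h1 h2 h3 h4 h5]]]; split=> //.
  have H p : p \in Y_eqns -> peval p x = 0 by exact: h.
  split.
  - move=> e f i; have := H (segre_eq (e, f, i)).
    rewrite /Y_eqns mem_cat fintype.image_f // => /(_ isT).
    by rewrite /peval mevalB !mevalM !mevalXU => /eqP; rewrite subr_eq0 => /eqP.
  - move=> e; have := H (pad_eq iy e); rewrite /Y_eqns !mem_cat fintype.image_f // ?orbT.
    by move=> /(_ isT); rewrite /peval mevalXU.
  - move=> e; have := H (pad_eq iw e); rewrite /Y_eqns !mem_cat fintype.image_f // ?orbT.
    by move=> /(_ isT); rewrite /peval mevalXU.
  - move=> e j; have := H (center_eq iy o0 rho (e, j)).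
    rewrite /Y_eqns !mem_cat fintype.image_f // ?orbT.
    by move=> /(_ isT); rewrite /peval !mevalB mevalZ !mevalXU.
  - move=> e j; have := H (center_eq iw o1 w (e, j)).
    rewrite /Y_eqns !mem_cat fintype.image_f // ?orbT.
    by move=> /(_ isT); rewrite /peval !mevalB mevalZ !mevalXU.
apply/mp => p; rewrite /Y_eqns !mem_cat => /or4P [|||/orP[]] /mapP [t _ ->];
  rewrite /peval ?mevalB ?mevalM ?mevalZ !mevalXU.
- by apply/eqP; rewrite subr_eq0; apply/eqP; exact: h1.
- exact: h2.
- exact: h3.
- exact: h4.
- exact: h5.
Qed.

Definition nondeg (v : idx T -> 'I_3 -> K) := forall i, exists k, v i k != 0.

Lemma tens_neq0 v : nondeg v -> exists e, tens v e != 0.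
Proof.
move=> /choice [f hf]; exists [ffun i => f i].
by apply/prodf_neq0 => i _; rewrite ffunE.
Qed.

Lemma tens_eqs (L : comNzRingType) (k : K -> L) v : onY k v ->
  [/\ forall e f i, tens v e * tens v f = tens v (upd e i (f i)) * tens v (upd f i (e i)),
      forall e, tens v (upd e iy o2) = 0, forall e, tens v (upd e iw o2) = 0,
      forall e j, tens v (upd (upd e iy o1) (iz j) o0)
        - k (rho j) * tens v (upd (upd e iy o0) (iz j) o0)
        - tens v (upd (upd e iy o0) (iz j) o2) = 0 &
      forall e j, tens v (upd (upd e iw o1) (iz j) o1)
        - k (w j) * tens v (upd (upd e iw o0) (iz j) o1)
        - tens v (upd (upd e iw o0) (iz j) o2) = 0].
Proof.
move=> [y2 w2 hy hw].
have two e i i' a b : i != i' -> tens v (upd (upd e i a) i' b)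
   = (\prod_(l | (l != i) && (l != i')) v l (e l)) * v i a * v i' b.
  move=> ii'; rewrite tens_upd (bigD1 i) //= upd_same.
  rewrite [v i a * _]mulrC; congr (_ * _ * _).
  apply: eq_big => [l|l /andP [l1 l2]]; first by rewrite andbC.
  by rewrite upd_other.
split.
- by move=> e f i; exact: tens_swap.
- by move=> e; rewrite tens_upd y2 mulr0.
- by move=> e; rewrite tens_upd w2 mulr0.
- move=> e j; rewrite !two //; set c := \prod_(l | _) _.
  have -> : c * v iy o1 * v (iz j) o0 - k (rho j) * (c * v iy o0 * v (iz j) o0)
    - c * v iy o0 * v (iz j) o2 = c * (v (iz j) o0 * (v iy o1 - k (rho j) * v iy o0)
      - v (iz j) o2 * v iy o0) by ring.
  by rewrite hy subrr mulr0.
- move=> e j; rewrite !two //; set c := \prod_(l | _) _.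
  have -> : c * v iw o1 * v (iz j) o1 - k (w j) * (c * v iw o0 * v (iz j) o1)
    - c * v iw o0 * v (iz j) o2 = c * (v (iz j) o1 * (v iw o1 - k (w j) * v iw o0)
      - v (iz j) o2 * v iw o0) by ring.
  by rewrite hw subrr mulr0.
Qed.

Lemma Yset_tens v : nondeg v -> onY id v -> Yset (mkx (tens v)).
Proof.
move=> nv hv; apply/Yset_eqs; split.
  by have [e he] := tens_neq0 nv; apply: (@co_neq0P _ _ _ e); rewrite coE.
have [h1 h2 h3 h4 h5] := tens_eqs hv.
by split=> *; rewrite !coE.
Qed.

(** The factors of a point are recovered, each up to a scalar, by freezing all indices but one at
    those of a nonzero coordinate. They are linear in x, hence usable in local representatives. *)
Definition slice (x : 'rV[K]_N.+1) (e0 : mon T) : idx T -> 'I_3 -> K :=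
  fun i k => co x (upd e0 i k).

Lemma slice_diag x e0 i : slice x e0 i (e0 i) = co x e0.
Proof. by rewrite /slice upd_id. Qed.

Lemma Yset_slice x e0 : Yset x -> co x e0 != 0 ->
  [/\ nondeg (slice x e0), onY id (slice x e0) &
      exists2 c, c != 0 & x = c *: mkx (tens (slice x e0))].
Proof.
move=> /Yset_eqs [x0 [h1 h2 h3 h4 h5]] xe0.
have nz i : exists k, slice x e0 i k != 0.
  by exists (e0 i); rewrite slice_diag.
have E := segre_tens xe0 h1.
(* [segre_tens] divides each factor by [co x e0]; passing to the undivided slices costs one inverse
   of it per factor. *)
have Ex e : co x e = co x e0 * (\prod_(i : idx T) (co x e0)^-1) * tens (slice x e0) e.
  rewrite E -mulrA; congr (_ * _); rewrite -tensZ /tens.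
  by apply: eq_bigr => i _; rewrite mulrC.
set c := _ * _ in Ex.
have c0 : c != 0.
  rewrite mulf_neq0 //; apply/prodf_neq0 => i _; by rewrite invr_eq0.
split=> //; last first.
  by exists c => //; apply: co_inj => e; rewrite Ex /co !mxE encK.
have two i i' a b : i != i' ->
    co x (upd (upd e0 i a) i' b) * co x e0 = slice x e0 i a * slice x e0 i' b.
  move=> ii'; rewrite /slice [RHS](h1 _ _ i') upd_same upd_other 1?eq_sym //.
  by rewrite updd upd_id.
split.
- exact: h2.
- exact: h3.
- move=> j; have := h4 e0 j; move: (two iy (iz j) o1 o0 isT) (two iy (iz j) o0 o0 isT)
    (two iy (iz j) o0 o2 isT) => a1 a2 a3 /(congr1 ( *%R^~ (co x e0))).
  rewrite mul0r !mulrBl a1 a3 -mulrA a2 => e1.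
  by apply/eqP; rewrite -subr_eq0; apply/eqP; rewrite -[RHS]e1; ring.
- move=> j; have := h5 e0 j; move: (two iw (iz j) o1 o1 isT) (two iw (iz j) o0 o1 isT)
    (two iw (iz j) o0 o2 isT) => a1 a2 a3 /(congr1 ( *%R^~ (co x e0))).
  rewrite mul0r !mulrBl a1 a3 -mulrA a2 => e1.
  by apply/eqP; rewrite -subr_eq0; apply/eqP; rewrite -[RHS]e1; ring.
Qed.

Lemma YsetP x : Yset x -> exists v, [/\ nondeg v, onY id v & x = mkx (tens v)].
Proof.
move=> Yx; have [e0 he0] := co_neq0 (Yset_neq0 Yx).
have [nv hv [c c0 xE]] := Yset_slice Yx he0.
(* The scalar is absorbed into the factor [iy]: the relations of [onY] are homogeneous in each
   factor. *)
pose v i k := (if i == iy then c else 1) * slice x e0 i k.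
have vE : x = mkx (tens v).
  rewrite xE; apply: co_inj => e.
  rewrite {1}/co mxE -/(co _ _) !coE /v tensZ; congr (_ * _).
  by rewrite (bigD1 iy) //= big1 ?mulr1 // => i /negPf ->.
exists v; split=> //.
- move=> i; have [k hk] := nv i; exists k; rewrite /v mulf_neq0 //.
  by case: ifP => _; rewrite ?oner_neq0.
- have [a1 a2 a3 a4] := hv; split; rewrite /v ?a1 ?a2 ?mulr0 //= => j.
    rewrite !mul1r mulrCA -mulrBr mulrCA a3; ring.
  by rewrite !mul1r a4.
Qed.

End BlowUp.

(** * Polynomial arcs and their tangent vectors *)

Section PolynomialCurves.
Variable K : closedFieldType.

Lemma horner_mmap n (g : 'I_n -> {poly K}) (p : {mpoly K[n]}) t :
  (mmap (polyC : {rmorphism K -> {poly K}}) g p).[t] = p.@[fun k => (g k).[t]].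
Proof.
rewrite /mmap horner_sum mevalE; apply: eq_bigr => m _.
rewrite hornerM hornerC; congr (_ * _).
rewrite /mmap1 horner_prod; apply: eq_bigr => i _; exact: horner_exp.
Qed.

Lemma deriv_mmap n (g : 'I_n -> {poly K}) (p : {mpoly K[n]}) :
  (mmap (polyC : {rmorphism K -> {poly K}}) g p)^`() =
  \sum_i mmap (polyC : {rmorphism K -> {poly K}}) g p^`M(i) * (g i)^`().
Proof.
pose f : {rmorphism K -> {poly K}} := polyC.
rewrite -/f; set P := fun p : {mpoly K[n]} =>
  (mmap f g p)^`() = \sum_i mmap f g p^`M(i) * (g i)^`().
have PX i : P 'X_i.
  rewrite /P mmapX mmap1U (bigD1 i) //= mderivX mnm1E eqxx.
  rewrite (_ : (U_(i) - U_(i))%MM = 0%MM) ?mpolyX0 ?scale1r ?rmorph1 ?mul1r; last first.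
    by apply/mnmP => k; rewrite mnmBE subnn mnm0E.
  rewrite big1 ?addr0 // => k ki; rewrite mderivX mnm1E eq_sym (negPf ki) scale0r.
  by rewrite rmorph0 mul0r.
have PD q r : P q -> P r -> P (q + r).
  move=> hq hr; rewrite /P rmorphD derivD hq hr -big_split /=.
  by apply: eq_bigr => i _; rewrite mderivD rmorphD mulrDl.
have PM q r : P q -> P r -> P (q * r).
  move=> hq hr; rewrite /P rmorphM derivM hq hr mulr_suml mulr_sumr -big_split /=.
  by apply: eq_bigr => i _; rewrite mderivM rmorphD !rmorphM /=; ring.
have PC c : P c%:MP.
  rewrite /P mmapC derivC big1 // => i _.
  by rewrite mderivC rmorph0 mul0r.
have PXm m : P 'X_[m].
  rewrite mpolyXE_id; apply: (big_ind P) => [||i _]; [exact: (PC 1) | exact: PM |].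
  elim: (m i) => [|k IH]; first exact: (PC 1).
  by rewrite exprS; apply: PM.
suff : P p by [].
elim/mpolyind: p => [|c m p _ _ Pp]; first exact: (PC 0).
by apply: PD => //; rewrite -mul_mpolyC; apply: PM.
Qed.

Lemma hpoly_curve N d (F : 'rV[K]_N.+1 -> K) (g : 'I_N.+1 -> {poly K}) :
  hpoly d F -> exists f : {poly K}, forall t, f.[t] = F (\row_k (g k).[t]).
Proof.
move=> [p _ pE]; exists (mmap (polyC : {rmorphism K -> {poly K}}) g p) => t.
rewrite horner_mmap -pE /peval; apply: meval_eq => k; by rewrite mxE.
Qed.

(** The composite of an equation of A with the arc vanishes wherever q does not, hence identically,
    since an algebraically closed field is infinite. Its derivative at 0 is the tangency
    condition. *)
Lemma cone_tangent_curve N (A : set 'rV[K]_N.+1) (g : 'I_N.+1 -> {poly K}) (q : {poly K}) :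
  q != 0 -> (forall t, q.[t] != 0 -> A (\row_k (g k).[t])) ->
  cone_tangent A (\row_k (g k).[0]) (\row_k (g k)^`().[0]).
Proof.
move=> q0 h p hp pA; pose f := mmap (polyC : {rmorphism K -> {poly K}}) g p.
have f0 : f = 0.
  apply/eqP; have [//|f0] := eqVneq f 0.
  have fq : f * q != 0 by rewrite mulf_neq0.
  have /closed_nonrootP [t] := fq; rewrite /root hornerM mulf_eq0 negb_or => /andP [ft qt].
  case/negP: ft; rewrite /f horner_mmap; apply/eqP.
  by rewrite -[RHS](pA _ (h t qt)) /peval; apply: meval_eq => k; rewrite mxE.
have := congr1 (fun f => f^`().[0]) f0; rewrite /= deriv0 horner0 /f deriv_mmap horner_sum.
move=> e; rewrite -[RHS]e; apply: eq_bigr => i _; rewrite hornerM horner_mmap mxE.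
by congr (_ * _); apply: meval_eq => k; rewrite mxE.
Qed.

End PolynomialCurves.

Lemma rmorph_tens (T : finType) (L L' : comNzRingType) (h : {rmorphism L -> L'})
    (v : idx T -> 'I_3 -> L) e :
  h (tens v e) = tens (fun i k => h (v i k)) e.
Proof. exact: rmorph_prod. Qed.

(** * Explicit charts of the blow-up *)

Section Charts.
Variables (T : finType) (K : fieldType) (rho w : T -> K).

Section Over.
Variables (L : comNzRingType) (k : {rmorphism K -> L}).

(** The point (1/(y - rho j) : 1/(w - w j) : 1) without denominators; for points of P^1 x P^1 it
    vanishes only at the centre j. The ring L is K for points, [{poly K}] for arcs and
    [{poly {poly K}}] for charts of the surface. *)
Definition cvec (j : T) (y z : 'I_3 -> L) : 'I_3 -> L :=
  vec3 ((z o1 - k (w j) * z o0) * y o0) ((y o1 - k (rho j) * y o0) * z o0)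
       ((y o1 - k (rho j) * y o0) * (z o1 - k (w j) * z o0)).

Definition chart (y z : 'I_3 -> L) (i : idx T) : 'I_3 -> L :=
  match i with None => y | Some None => z | Some (Some j) => cvec j y z end.

Definition pt (a b : L) : 'I_3 -> L := vec3 a b 0.

(* The chart of the blow-up in which the ideal of (rho i0, w i0) is generated by
   [s]; the exceptional curve is [s = 0], with direction (a : b). *)
Definition echart (i0 : T) (s a b : L) (i : idx T) : 'I_3 -> L :=
  let y := pt 1 (k (rho i0) + s * b) in let z := pt 1 (k (w i0) + s * a) in
  match i with
  | None => y | Some None => z
  | Some (Some j) => if j == i0 then vec3 a b (s * a * b) else cvec j y z
  end.

Lemma chart_onY y z : y o2 = 0 -> z o2 = 0 -> onY rho w k (chart y z).
Proof. by move=> y2 z2; split=> //= j; rewrite /cvec /vec3 /=; ring. Qed.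

Lemma echart_onY i0 s a b : onY rho w k (echart i0 s a b).
Proof.
split=> //= j; case: eqP => [->|_]; rewrite /cvec /vec3 /pt /vec3 /=; ring.
Qed.

End Over.

End Charts.

Section PointsOfBlowUp.
Variables (T : finType) (K : fieldType) (rho w : T -> K).
Hypothesis rho_inj : injective rho.

Local Notation idK := (idfun : {rmorphism K -> K}).
Local Notation Y := (Yset rho w).
Local Notation cvK := (cvec rho w idK).
Local Notation chart := (chart rho w idK).
Local Notation echart := (echart rho w idK).

Lemma vec3P (f g : 'I_3 -> K) : f o0 = g o0 -> f o1 = g o1 -> f o2 = g o2 -> f =1 g.
Proof. by move=> *; apply: I3P. Qed.

Lemma nz3 (f : 'I_3 -> K) : (exists k, f k != 0) -> f o2 = 0 -> f o0 = 0 -> f o1 != 0.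
Proof. by move=> [k hk] f2 f0; move: k hk; apply: I3P => //; rewrite ?f2 ?f0 eqxx. Qed.

Lemma mkx_tensZ (v v' : idx T -> 'I_3 -> K) (c : idx T -> K) :
  (forall i, c i != 0) -> (forall i k, v' i k = c i * v i k) ->
  same_point (mkx (tens v)) (mkx (tens v')).
Proof.
move=> c0 h; exists (\prod_i c i); first by apply/prodf_neq0.
apply: co_inj => e; rewrite [RHS]/co mxE -/(co _ _) !coE -tensZ.
by apply: eq_bigr => i _; rewrite h.
Qed.

(** The relations are linear in the factor [iz j] and have rank 2 unless y - rho j and w - w j both
    vanish. When only one of them does, the solution is (1 : 0 : 0) or (0 : 1 : 0). *)
Lemma center_or_cvec j v : nondeg v -> onY rho w idK v ->
  (v iy o1 = rho j * v iy o0 /\ v iw o1 = w j * v iw o0) \/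
  (exists2 c, c != 0 & forall k, v (iz j) k = c * cvK j (v iy) (v iw) k).
Proof.
move=> nv [y2 w2 /(_ j) hy /(_ j) hw]; rewrite /= in hy hw.
set A := (v iy o1 - rho j * v iy o0) in hy; set B := (v iw o1 - w j * v iw o0) in hw.
have y1 := nz3 (nv iy) y2; have w1 := nz3 (nv iw) w2.
have Ay : A = 0 -> v iy o0 != 0.
  move=> A0; apply/eqP => e; have := y1 e; move: A0; rewrite /A e mulr0 subr0 => ->.
  by rewrite eqxx.
have Bw : B = 0 -> v iw o0 != 0.
  move=> B0; apply/eqP => e; have := w1 e; move: B0; rewrite /B e mulr0 subr0 => ->.
  by rewrite eqxx.
have [A0|A0] := eqVneq A 0; have [B0|B0] := eqVneq B 0.
- by left; split; apply/eqP; rewrite -subr_eq0; apply/eqP.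
- have c0 : v (iz j) o2 = 0.
    by move: hy; rewrite A0 mulr0 => /esym/eqP; rewrite mulf_eq0 (negPf (Ay A0)) orbF => /eqP.
  have b0 : v (iz j) o1 = 0.
    by move: hw; rewrite c0 mul0r => /eqP; rewrite mulf_eq0 (negPf B0) orbF => /eqP.
  have a0 : v (iz j) o0 != 0.
    by have [k] := nv (iz j); move: k; apply: I3P => //; rewrite ?b0 ?c0 eqxx.
  right; exists (v (iz j) o0 / (B * v iy o0)).
    by rewrite mulf_neq0 // invr_neq0 // mulf_neq0 // Ay.
  have Y0 := Ay A0.
  apply: vec3P; rewrite /cvec /vec3 /= -/A -/B ?A0 ?b0 ?c0 ?mul0r ?mulr0 //.
  by rewrite divfK // mulf_neq0.
- have c0 : v (iz j) o2 = 0.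
    by move: hw; rewrite B0 mulr0 => /esym/eqP; rewrite mulf_eq0 (negPf (Bw B0)) orbF => /eqP.
  have a0 : v (iz j) o0 = 0.
    by move: hy; rewrite c0 mul0r => /eqP; rewrite mulf_eq0 (negPf A0) orbF => /eqP.
  have b0 : v (iz j) o1 != 0.
    by have [k] := nv (iz j); move: k; apply: I3P => //; rewrite ?a0 ?c0 eqxx.
  right; exists (v (iz j) o1 / (A * v iw o0)).
    by rewrite mulf_neq0 // invr_neq0 // mulf_neq0 // Bw.
  have W0 := Bw B0.
  apply: vec3P; rewrite /cvec /vec3 /= -/A -/B ?B0 ?a0 ?c0 ?mul0r ?mulr0 //.
  by rewrite divfK // mulf_neq0.
- have ea : v (iz j) o0 = v (iz j) o2 * v iy o0 / A by rewrite -hy mulfK.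
  have eb : v (iz j) o1 = v (iz j) o2 * v iw o0 / B by rewrite -hw mulfK.
  have c0 : v (iz j) o2 != 0.
    apply/eqP => e; have [k] := nv (iz j).
    by move: k; apply: I3P; rewrite ?ea ?eb e ?mul0r eqxx.
  right; exists (v (iz j) o2 / (A * B)).
    by rewrite mulf_neq0 // invr_neq0 // mulf_neq0.
  apply: vec3P; rewrite /cvec /vec3 /= -/A -/B ?ea ?eb; field; exact/andP.
Qed.

Lemma Y_points x : Y x ->
  (exists y z : 'I_3 -> K, [/\ y o2 = 0, z o2 = 0, nondeg (chart y z) &
     same_point (mkx (tens (chart y z))) x]) \/
  (exists j a b, (a != 0) || (b != 0) /\ same_point (mkx (tens (echart j 0 a b))) x).
Proof.
move=> /YsetP [v [nv hv ->]]; have [y2 w2 _ _] := hv.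
have [[j0 [ey ew]]|nc] := pselect (exists j0,
   v iy o1 = rho j0 * v iy o0 /\ v iw o1 = w j0 * v iw o0); last first.
  left; exists (v iy), (v iw).
  have /choice [c hc] : forall j, exists c, c != 0 /\
      forall k, v (iz j) k = c * cvK j (v iy) (v iw) k.
    move=> j; have [h|[c c0 h]] := center_or_cvec j nv hv; first by case: nc; exists j.
    by exists c.
  pose c' (i : idx T) := match i with Some (Some j) => c j | _ => 1 end.
  have c'0 i : c' i != 0.
    by case: i => [[j|]|]; rewrite /= ?oner_neq0 //; case: (hc j).
  have E i k : v i k = c' i * chart (v iy) (v iw) i k.
    by case: i => [[j|]|] /=; rewrite ?mul1r //; case: (hc j).
  split=> //; last exact: mkx_tensZ c'0 E.
  by move=> i; have [k] := nv i; rewrite E mulf_eq0 negb_or => /andP [_ h]; exists k.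
right; exists j0, (v (iz j0) o0), (v (iz j0) o1).
have y0 : v iy o0 != 0.
  apply/eqP => e; have := nz3 (nv iy) y2 e; by rewrite ey e mulr0 eqxx.
have z0 : v iw o0 != 0.
  apply/eqP => e; have := nz3 (nv iw) w2 e; by rewrite ew e mulr0 eqxx.
have c0 : v (iz j0) o2 = 0.
  have [_ _ /(_ j0) h _] := hv; move: h; rewrite ey subrr mulr0 => /esym/eqP.
  by rewrite mulf_eq0 (negPf y0) orbF => /eqP.
split.
  have [k] := nv (iz j0); move: k; apply: I3P; rewrite ?c0 ?eqxx // => -> //.
  by rewrite orbT.
(* No other centre has the same y, because [rho] is injective. *)
have /choice [c hc] : forall j, exists c, c != 0 /\ (j != j0 ->
      forall k, v (iz j) k = c * cvK j (v iy) (v iw) k).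
  move=> j; have [[h _]|[c c0' h]] := center_or_cvec j nv hv; last by exists c.
  exists 1; split; first exact: oner_neq0.
  move=> /eqP nj; case: nj; apply: rho_inj; apply: (mulIf y0).
  by rewrite -h -ey.
pose c' (i : idx T) := match i with
  | Some (Some j) => if j == j0 then 1 else c j * (v iy o0 * v iw o0)
  | Some None => v iw o0 | None => v iy o0 end.
apply: (@mkx_tensZ _ _ c').
  case=> [[j|]|] //=; case: ifP => _; rewrite ?oner_neq0 // !mulf_neq0 //.
  by case: (hc j).
case=> [[j|]|] /=.
- case: eqP => [->|/eqP nj].
    by apply: I3P; rewrite /vec3 /= ?c0 ?mul1r ?mul0r.
  have [_ /(_ nj) h] := hc j.
  by apply: I3P; rewrite h /cvec /pt /vec3 /= ?ey ?ew; ring.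
- by apply: I3P; rewrite /pt /vec3 /= ?ew ?w2; ring.
- by apply: I3P; rewrite /pt /vec3 /= ?ey ?y2; ring.
Qed.

Lemma chart_nondeg (y z : 'I_3 -> K) : (exists k, y k != 0) -> (exists k, z k != 0) ->
  (forall j, exists k, cvK j y z k != 0) -> nondeg (chart y z).
Proof. by move=> hy hz hc; case=> [[j|]|]; [exact: hc | exact: hz | exact: hy]. Qed.

Lemma chart_Y (y z : 'I_3 -> K) : y o2 = 0 -> z o2 = 0 ->
  nondeg (chart y z) -> Y (mkx (tens (chart y z))).
Proof. by move=> y2 z2 nd; apply: Yset_tens => //; exact: chart_onY. Qed.

Definition gpt (a b : K) := mkx (tens (chart (pt 1 a) (pt 1 b))).

Definition generic (a b : K) := (forall j, a != rho j) /\ (forall j, b != w j).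

Lemma generic_nondeg a b : generic a b -> nondeg (chart (pt 1 a) (pt 1 b)).
Proof.
move=> [ha hb]; apply: chart_nondeg.
- by exists o0; rewrite /pt /vec3 /= oner_neq0.
- by exists o0; rewrite /pt /vec3 /= oner_neq0.
- by move=> j; exists o0; rewrite /cvec /pt /vec3 /= !mulr1 subr_eq0.
Qed.

Lemma gpt_Y a b : generic a b -> Y (gpt a b).
Proof. by move=> /generic_nondeg; apply: chart_Y. Qed.

Definition e00 : mon T := [ffun=> o0].

(** Where it does not vanish, y and w are finite and avoid all [rho j] and [w j], so that they
    determine the point. The ring L allows evaluation along arcs. *)
Definition qform (L : comNzRingType) (k : K -> L) (u : mon T -> L) : L :=
  u e00 * \prod_j (u (upd e00 iy o1) - k (rho j) * u e00)
        * \prod_j (u (upd e00 iw o1) - k (w j) * u e00).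

Definition qY (x : 'rV[K]_(amb T).+1) : K := qform id (co x).

Lemma qform_tens (L : idomainType) (k : K -> L) (v : idx T -> 'I_3 -> L) :
  (qform k (tens v) != 0) =
  [&& tens v e00 != 0, [forall j, v iy o1 - k (rho j) * v iy o0 != 0] &
      [forall j, v iw o1 - k (w j) * v iw o0 != 0]].
Proof.
rewrite /qform !mulf_eq0 !negb_or -andbA.
case t0: (tens v e00 == 0) => //=.
have H i (c : T -> L) : (\prod_j (tens v (upd e00 i o1) - c j * tens v e00) != 0) =
   [forall j, v i o1 - c j * v i o0 != 0].
  have E : tens v e00 = tens v (upd e00 i o0).
    by congr (tens v _); apply/ffunP => i'; rewrite !ffunE; case: eqP.
  have : tens v e00 != 0 by rewrite t0.
  rewrite E tens_upd mulf_eq0 negb_or => /andP [c0 _].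
  apply/prodf_neq0/forallP => h j; have := h j.
    move=> /(_ isT); rewrite !tens_upd mulrCA -mulrBr mulf_eq0 negb_or => /andP [] //.
  by move=> hj _; rewrite !tens_upd mulrCA -mulrBr mulf_neq0.
by rewrite !H.
Qed.

Lemma qY_hpoly : exists d, hpoly d qY.
Proof.
have hX e : hpoly 1 (fun x : 'rV[K]_(amb T).+1 => co x e) by exact: hpolyX.
have hP i (c : T -> K) : hpoly (\sum_(j : T) 1)
   (fun x : 'rV[K]_(amb T).+1 => \prod_j (co x (upd e00 i o1) - c j * co x e00)).
  by apply: hpoly_prod => j; apply: hpolyB => //; exact: hpolyZ.
by eexists; apply: hpolyM; [apply: hpolyM; [exact: hX | exact: hP] | exact: hP].
Qed.

Lemma qY_generic x : Y x -> qY x != 0 ->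
  exists a b, generic a b /\ same_point (gpt a b) x.
Proof.
move=> /YsetP [v [nv hv ->]]; have [y2 w2 _ _] := hv.
rewrite /qY (_ : co _ = tens v); last by apply/funext => e; rewrite coE.
rewrite qform_tens => /and3P [t0 /forallP hy /forallP hz].
have t0i i : v i o0 != 0.
  by move: t0 => /prodf_neq0 /(_ i isT); rewrite ffunE.
exists (v iy o1 / v iy o0), (v iw o1 / v iw o0).
have ga j : v iy o1 / v iy o0 != rho j.
  apply/eqP => e; have := hy j; rewrite -e divfK // subrr eqxx //.
have gb j : v iw o1 / v iw o0 != w j.
  apply/eqP => e; have := hz j; rewrite -e divfK // subrr eqxx //.
split=> //.
have /choice [c hc] : forall j, exists c, c != 0 /\
    forall k, v (iz j) k = c * cvK j (v iy) (v iw) k.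
  move=> j; have [[h _]|[c c0 h]] := center_or_cvec j nv hv; last by exists c.
  by have := hy j; rewrite h subrr eqxx.
pose c' (i : idx T) := match i with Some (Some j) => c j * (v iy o0 * v iw o0)
   | Some None => v iw o0 | None => v iy o0 end.
apply: (@mkx_tensZ _ _ c').
  case=> [[j|]|] //=; rewrite !mulf_neq0 //; by case: (hc j).
case=> [[j|]|] /=.
- have [_ h] := hc j; apply: I3P; rewrite h /cvec /pt /vec3 /=; field; rewrite ?t0i //.
- by apply: I3P; rewrite /pt /vec3 /= ?w2 ?mulr1 ?mulr0 // mulrCA divff ?mulr1.
- by apply: I3P; rewrite /pt /vec3 /= ?y2 ?mulr1 ?mulr0 // mulrCA divff ?mulr1.
Qed.

Lemma qY_gpt a b : generic a b -> qY (gpt a b) != 0.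
Proof.
move=> [ha hb]; rewrite /qY /gpt (_ : co _ = tens (chart (pt 1 a) (pt 1 b))); last first.
  by apply/funext => e; rewrite coE.
rewrite qform_tens; apply/and3P; split.
- apply/prodf_neq0; case=> [[j|]|] _; rewrite ffunE /= /cvec /pt /vec3 /= ?oner_neq0 //.
  by rewrite !mulr1 subr_eq0.
- by apply/forallP => j; rewrite /= /pt /vec3 /= mulr1 subr_eq0.
- by apply/forallP => j; rewrite /= /pt /vec3 /= mulr1 subr_eq0.
Qed.

End PointsOfBlowUp.

(** * Arcs through every point, and density of the generic points *)

Section CurvesOnBlowUp.
Variables (T : finType) (K : closedFieldType) (rho w : T -> K).
Hypothesis rho_inj : injective rho.

Local Notation idK := (idfun : {rmorphism K -> K}).
Local Notation cK := (polyC : {rmorphism K -> {poly K}}).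
Local Notation Y := (Yset rho w).
Local Notation N := (amb T).

Definition at_ (t : K) (v : idx T -> 'I_3 -> {poly K}) (i : idx T) (k : 'I_3) : K :=
  (v i k).[t].

Definition prow (u : mon T -> {poly K}) (t : K) : 'rV[K]_N.+1 :=
  \row_l (u (dec l)).[t].

Lemma prow_tens v t : prow (tens v) t = mkx (tens (at_ t v)).
Proof. by apply/rowP => l; rewrite !mxE /tens horner_prod. Qed.

Lemma onY_at v t : onY rho w cK v -> onY rho w idK (at_ t v).
Proof.
move=> [h1 h2 h3 h4]; split; rewrite /at_ ?h1 ?h2 ?horner0 // => j.
  by have := congr1 (horner^~ t) (h3 j); rewrite !(hornerM, hornerD, hornerN, hornerC).
by have := congr1 (horner^~ t) (h4 j); rewrite !(hornerM, hornerD, hornerN, hornerC).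
Qed.

Lemma Y_curve v t e : onY rho w cK v -> (tens v e).[t] != 0 -> Y (prow (tens v) t).
Proof.
move=> hv; rewrite /tens horner_prod => /prodf_neq0 h.
rewrite prow_tens; apply: Yset_tens; last exact: onY_at.
by move=> i; exists (e i); apply: h.
Qed.

Lemma horner_qform v t : (qform rho w cK (tens v)).[t] = qY rho w (mkx (tens (at_ t v))).
Proof.
have e e' : (tens v e').[t] = co (mkx (tens (at_ t v))) e'.
  by rewrite coE /tens horner_prod.
rewrite /qform /qY /qform 2!hornerM e; congr (_ * _ * _); rewrite horner_prod;
  by apply: eq_bigr => j _; rewrite hornerD hornerN hornerM hornerC !e.
Qed.

Definition lin (y y' : 'I_3 -> K) (k : 'I_3) : {poly K} := (y k)%:P + 'X * (y' k)%:P.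

Lemma lin_at y y' k t : (lin y y' k).[t] = y k + t * y' k.
Proof. by rewrite /lin !(hornerD, hornerM, hornerC, hornerX). Qed.

Lemma lin_neq0 (a b : K) : (a != 0) || (b != 0) -> a%:P + 'X * b%:P != 0.
Proof.
move=> h; apply/eqP => e; have := congr1 (fun p : {poly K} => (p`_0, p`_1)) e.
rewrite !coef0 !coefD !coefC mulrC !coefMX !coefC /= addr0 add0r => -[a0 b0].
by move: h; rewrite a0 b0 eqxx.
Qed.

(** A vector that completes y to a basis, so that no nonzero linear form vanishes along the line y +
    t [compl y]. *)
Definition compl (y : 'I_3 -> K) : 'I_3 -> K := if y o0 == 0 then pt 1 0 else pt 0 1.

Lemma compl2 y : compl y o2 = 0.
Proof. by rewrite /compl; case: ifP. Qed.

Lemma compl_det y : y o2 = 0 -> (exists k, y k != 0) ->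
  y o0 * compl y o1 - y o1 * compl y o0 != 0.
Proof.
move=> y2 nz; rewrite /compl; case: ifPn => [/eqP y0|y0].
  by rewrite /pt /vec3 /= y0 mul0r mulr1 sub0r oppr_eq0; exact: nz3.
by rewrite /pt /vec3 /= mulr1 mulr0 subr0.
Qed.

Lemma det_lin (y y' : 'I_3 -> K) (c0 c1 : K) : y o0 * y' o1 - y o1 * y' o0 != 0 ->
  (c0 != 0) || (c1 != 0) ->
  c0%:P * lin y y' o0 + c1%:P * lin y y' o1 != 0.
Proof.
move=> d c; rewrite /lin.
have -> : c0%:P * ((y o0)%:P + 'X * (y' o0)%:P) + c1%:P * ((y o1)%:P + 'X * (y' o1)%:P)
  = (c0 * y o0 + c1 * y o1)%:P + 'X * (c0 * y' o0 + c1 * y' o1)%:P.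
  by rewrite !rmorphD !rmorphM /=; ring.
apply: lin_neq0; rewrite -negb_and; apply/negP => /andP [/eqP e1 /eqP e2].
have E1 : c0 * (y o0 * y' o1 - y o1 * y' o0) = 0.
  have -> : c0 * (y o0 * y' o1 - y o1 * y' o0) =
     (c0 * y o0 + c1 * y o1) * y' o1 - (c0 * y' o0 + c1 * y' o1) * y o1 by ring.
  by rewrite e1 e2 !mul0r subrr.
have E2 : c1 * (y o0 * y' o1 - y o1 * y' o0) = 0.
  have -> : c1 * (y o0 * y' o1 - y o1 * y' o0) =
     (c0 * y' o0 + c1 * y' o1) * y o0 - (c0 * y o0 + c1 * y o1) * y' o0 by ring.
  by rewrite e1 e2 !mul0r subrr.
move: E1 E2 => /eqP; rewrite mulf_eq0 (negPf d) orbF => /eqP c00 /eqP.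
by rewrite mulf_eq0 (negPf d) orbF => c10; move: c; rewrite c00 c10 eqxx.
Qed.

(** A point off the exceptional curves is moved in y and w at once. A point of an exceptional curve
    is moved away from it by s = t, and its direction (a : b) moves too. *)
Lemma generic_curve x : Y x -> exists v, [/\ onY rho w cK v,
   same_point (mkx (tens (at_ 0 v))) x & qform rho w cK (tens v) != 0].
Proof.
move=> /(Y_points rho_inj) [[y [z [y2 z2 nd sp]]]|[j0 [a [b [ab sp]]]]].
  pose y' := lin y (compl y); pose z' := lin z (compl z).
  have dy := compl_det y2 (nd iy); have dz := compl_det z2 (nd iw).
  have l2 (u : 'I_3 -> K) : u o2 = 0 -> lin u (compl u) o2 = 0.
    by move=> e; rewrite /lin e compl2 mulr0 addr0.
  exists (chart rho w cK y' z'); split.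
  - by apply: chart_onY; apply: l2.
  - rewrite (_ : at_ 0 _ = chart rho w idK y z) //.
    apply/funext => i; apply/funext => k; rewrite /at_.
    move: i k; apply: idxP => [k|k|j]; [| |apply: I3P];
      rewrite /= /cvec /vec3 /=; rewrite /y' /z' !(lin_at, hornerM, hornerD, hornerN, hornerC);
      by rewrite !mul0r !addr0.
  - have l0 (u : 'I_3 -> K) : u o0 * compl u o1 - u o1 * compl u o0 != 0 ->
       lin u (compl u) o0 != 0.
      move=> d; have := @det_lin u _ 1 0 d; rewrite oner_neq0 => /(_ isT).
      by rewrite mul1r mul0r addr0.
    have l1 (u : 'I_3 -> K) c : u o0 * compl u o1 - u o1 * compl u o0 != 0 ->
       lin u (compl u) o1 - c%:P * lin u (compl u) o0 != 0.
      move=> d; have := @det_lin u _ (- c) 1 d; rewrite oner_neq0 orbT => /(_ isT).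
      by rewrite mul1r polyCN mulNr addrC.
    rewrite qform_tens; apply/and3P; split.
    + apply/prodf_neq0; case=> [[j|]|] _; rewrite ffunE /=; [|exact: l0|exact: l0].
      by rewrite /cvec /vec3 /= mulf_neq0 //; [apply: l1 | apply: l0].
    + by apply/forallP => j; apply: l1.
    + by apply/forallP => j; apply: l1.
pose ab' := pt a b.
have d : ab' o0 * compl ab' o1 - ab' o1 * compl ab' o0 != 0.
  apply: compl_det => //; case/orP: ab => h; [by exists o0|by exists o1].
(* With a fixed direction such that a = 0 or b = 0, the arc would stay on the line w = w j0 or y =
   rho j0. *)
pose A := lin ab' (compl ab') o0; pose B := lin ab' (compl ab') o1.
have A0 : A != 0.
  by have := @det_lin ab' _ 1 0 d; rewrite oner_neq0 mul1r mul0r addr0; apply.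
have B0 : B != 0.
  have := @det_lin ab' _ 0 1 d; rewrite oner_neq0 orbT mul1r mul0r add0r; exact.
exists (echart rho w cK j0 'X A B); split.
- exact: echart_onY.
- rewrite (_ : at_ 0 _ = echart rho w idK j0 0 a b) //.
  apply/funext => i; apply/funext => k; rewrite /at_.
  have eA : A.[0] = a by rewrite lin_at mul0r addr0.
  have eB : B.[0] = b by rewrite lin_at mul0r addr0.
  move: i k; apply: idxP; [apply: I3P | apply: I3P | move=> j /=; case: ifP => _; apply: I3P];
   rewrite /= /cvec /pt /vec3 /= ?(eA, eB, hornerM, hornerD, hornerN, hornerC, hornerX);
   ring.
- have lX c (p : {poly K}) : p != 0 -> c%:P + 'X * p != 0.
    move=> p0; apply/eqP => e; move: p0; have := congr1 (fun q => q.[0]) e.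
    rewrite !(hornerD, hornerM, hornerC, hornerX) mul0r addr0 => c0.
    move: e; rewrite c0 add0r => /eqP.
    by rewrite mulf_eq0 polyX_eq0 /= => /eqP ->; rewrite eqxx.
  have lXc (c : T -> K) j p : p != 0 -> (c j0)%:P + 'X * p - (c j)%:P * 1 != 0.
    move=> p0; rewrite mulr1 (_ : _ - _ = (c j0 - c j)%:P + 'X * p); first exact: lX.
    by rewrite rmorphB /=; ring.
  rewrite qform_tens; apply/and3P; split.
  + apply/prodf_neq0; case=> [[j|]|] _; rewrite ffunE /= /pt /vec3 /= ?oner_neq0 //.
    case: ifP => _ //; by rewrite /cvec /vec3 /= mulr1; apply: lXc.
  + by apply/forallP => j /=; rewrite /pt /vec3 /=; apply: lXc.
  + by apply/forallP => j /=; rewrite /pt /vec3 /=; apply: lXc.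
Qed.

(** Along an arc of [generic_curve] the form becomes a polynomial in t that vanishes at almost all
    t, hence also at t = 0. *)
Lemma Y_dense d (F : 'rV[K]_N.+1 -> K) : hpoly d F ->
  (forall x, Y x -> qY rho w x != 0 -> F x = 0) -> forall x, Y x -> F x = 0.
Proof.
move=> hF h x /generic_curve [v [hv sp q0]].
have [f fE] := hpoly_curve (fun l => tens v (dec l)) hF.
have f0 : f = 0.
  apply/eqP; apply/negPn/negP => f0.
  have /closed_nonrootP [t] : f * qform rho w cK (tens v) != 0 by rewrite mulf_neq0.
  rewrite /root hornerM mulf_eq0 negb_or => /andP [ft qt]; case/negP: ft.
  rewrite fE; apply/eqP/h.
    apply: (Y_curve (e := e00 T) hv); move: q0 qt; rewrite horner_qform /qY /qform.
    by rewrite coE -/(at_ t v) /tens horner_prod !mulf_eq0 !negb_or => _ /andP [/andP []].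
  by rewrite -/(prow (tens v) t) prow_tens -horner_qform.
apply/eqP; rewrite (hpoly_same_point hF sp); apply/eqP.
by rewrite -prow_tens -[LHS]fE f0 horner0.
Qed.

End CurvesOnBlowUp.

(** * Irreducibility and tangent spaces *)

Section SmoothIrreducible.
Variables (T : finType) (K : closedFieldType) (rho w : T -> K).
Hypothesis rho_inj : injective rho.

Local Notation idK := (idfun : {rmorphism K -> K}).
Local Notation cK := (polyC : {rmorphism K -> {poly K}}).
Local Notation Y := (Yset rho w).
Local Notation N := (amb T).
Local Notation gpt := (gpt rho w).

Lemma generic_avoid (s : seq K) : exists a : K, a \notin s.
Proof.
have p0 : \prod_(c <- s) ('X - c%:P) != 0 :> {poly K}.
  rewrite prodf_seq_neq0; apply/allP => c _; rewrite /=  polyXsubC_eq0; exact: isT.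
have /closed_nonrootP [a ha] := p0; exists a; by rewrite -root_prod_XsubC.
Qed.

Lemma ex_generic : exists a b, generic rho w a b.
Proof.
have [a ha] := generic_avoid (codom rho); have [b hb] := generic_avoid (codom w).
exists a, b; split=> j; apply/eqP => e.
  by move: ha; rewrite e codom_f.
by move: hb; rewrite e codom_f.
Qed.

(** If Y lies in neither closed set, density gives for each of them a form that vanishes on it but
    not at some generic point. The two points are joined by a segment in the (y, w)-plane, along
    which neither form vanishes identically; a general point of it lies on Y and in neither set. *)
Lemma Y_irreducible : zirreducible Y.
Proof.
split; first by have [a [b g]] := ex_generic; exists (gpt a b); exact: gpt_Y.
move=> Z1 Z2 /zclosedP [S1 [h1 E1]] /zclosedP [S2 [h2 E2]] sub.
have [|n1] := pselect (Y `<=` Z1); first by left.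
have [|n2] := pselect (Y `<=` Z2); first by right.
exfalso.
have key S Z : (forall F, S F -> exists d, hpoly d F) ->
   Z = [set x | x != 0 /\ forall F, S F -> F x = 0] -> ~ Y `<=` Z ->
   exists d (F : 'rV[K]_N.+1 -> K), [/\ hpoly d F, (forall x, Z x -> F x = 0) &
     exists a b, generic rho w a b /\ F (gpt a b) != 0].
  move=> hS -> /existsNP [x /not_implyP [Yx /not_andP nx]].
  have [|/existsNP [F /not_implyP [SF Fx]]] := nx.
    by move/negP; rewrite (Yset_neq0 Yx).
  have [d hd] := hS F SF; exists d, F; split=> //; first by move=> z [_]; apply.
  apply: contrapT => none; apply: Fx; apply: (Y_dense rho_inj hd) Yx.
  move=> z Yz qz; have [a [b [g sp]]] := qY_generic Yz qz.
  apply/eqP; rewrite (hpoly_same_point hd sp); apply/negPn/negP => ne.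
  by apply: none; exists a, b.
have [d1 [F1 [hF1 v1 [a1 [b1 [g1 nz1]]]]]] := key _ _ h1 E1 n1.
have [d2 [F2 [hF2 v2 [a2 [b2 [g2 nz2]]]]]] := key _ _ h2 E2 n2.
pose a : {poly K} := a1%:P + 'X * (a2 - a1)%:P.
pose b : {poly K} := b1%:P + 'X * (b2 - b1)%:P.
pose v := chart rho w cK (pt 1 a) (pt 1 b).
have vt t : prow (tens v) t = gpt a.[t] b.[t].
  rewrite prow_tens /gpt; congr mkx; congr tens.
  apply/funext => i; apply/funext => k; rewrite /at_ /v.
  move: i k; apply: idxP; [apply: I3P | apply: I3P | move=> j; apply: I3P];
   by rewrite /= /cvec /pt /vec3 /=; rewrite !(hornerM, hornerD, hornerN, hornerC).
have [f1 e1] := hpoly_curve (fun l => tens v (dec l)) hF1.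
have [f2 e2] := hpoly_curve (fun l => tens v (dec l)) hF2.
have a0 : a.[0] = a1 by rewrite !(hornerD, hornerM, hornerC, hornerX); ring.
have b0 : b.[0] = b1 by rewrite !(hornerD, hornerM, hornerC, hornerX); ring.
have a11 : a.[1] = a2 by rewrite !(hornerD, hornerM, hornerC, hornerX); ring.
have b11 : b.[1] = b2 by rewrite !(hornerD, hornerM, hornerC, hornerX); ring.
have nf1 : f1 != 0.
  by apply/eqP => e; move: nz1; rewrite -a0 -b0 -vt -e1 e horner0 eqxx.
have nf2 : f2 != 0.
  by apply/eqP => e; move: nz2; rewrite -a11 -b11 -vt -e2 e horner0 eqxx.
have hv : onY rho w cK v by exact: chart_onY.
pose g : {poly K} := qform rho w cK (tens v).
have ng : g != 0.
  apply/eqP => e; have := horner_qform rho w v 0; rewrite -/g e horner0 => /esym/eqP.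
  by rewrite -prow_tens vt a0 b0 (negPf (qY_gpt g1)).
have /closed_nonrootP [t] : f1 * f2 * g != 0 by exact: mulf_neq0 (mulf_neq0 nf1 nf2) ng.
rewrite /root 2!hornerM 2!mulf_eq0 !negb_or => /andP [/andP [t1 t2] t3].
have Yt : Y (prow (tens v) t).
  apply: (Y_curve (e := e00 T) hv); move: t3; rewrite /g horner_qform /qY /qform.
  by rewrite coE -/(at_ t v) /tens horner_prod !mulf_eq0 !negb_or => /andP [/andP []].
have [/v1|/v2] := sub _ Yt; rewrite -[X in X = _]/(_ (\row__ _)).
  by rewrite -e1 => /eqP; rewrite (negPf t1).
by rewrite -e2 => /eqP; rewrite (negPf t2).
Qed.

Lemma cone_tangentD (A : set 'rV[K]_N.+1) x u v c :
  cone_tangent A x u -> cone_tangent A x v -> cone_tangent A x (u + c *: v).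
Proof.
move=> hu hv p hp pA.
transitivity (\sum_i peval p^`M(i) x * u 0 i + c * \sum_i peval p^`M(i) x * v 0 i).
  rewrite mulr_sumr -big_split; apply: eq_bigr => i _; rewrite !mxE /=; ring.
by rewrite hu // hv // mulr0 addr0.
Qed.

Lemma cone_tangent0 (A : set 'rV[K]_N.+1) x : cone_tangent A x 0.
Proof. by move=> p _ _; rewrite big1 // => i _; rewrite mxE mulr0. Qed.

Lemma cone_tangentZ (A : set 'rV[K]_N.+1) x u c :
  cone_tangent A x u -> cone_tangent A x (c *: u).
Proof.
by move=> h; have := cone_tangentD c (@cone_tangent0 A x) h; rewrite add0r.
Qed.

(** Up to the square of [co x e], the derivative at x along u of the affine coordinate
    [co (upd e i k) / co e]. It kills the direction x of the cone. *)
Definition mfun (x u : 'rV[K]_N.+1) (e : mon T) i k :=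
  co u (upd e i k) * co x e - co u e * co x (upd e i k).

Lemma coD (u v : 'rV[K]_N.+1) c e : co (u + c *: v) e = co u e + c * co v e.
Proof. by rewrite /co !mxE. Qed.

(** The coordinate [co e0] and the two derivatives show that x, t1 and t2 are independent.
    Subtracting a combination of them from a tangent vector makes these three functions vanish, and
    the last hypothesis applies. *)
Lemma tangent_span x e0 t1 t2 (i1 i2 : idx T) k1 k2 :
  co x e0 != 0 -> cone_tangent Y x x -> cone_tangent Y x t1 -> cone_tangent Y x t2 ->
  mfun x t1 e0 i1 k1 != 0 -> mfun x t1 e0 i2 k2 = 0 ->
  mfun x t2 e0 i1 k1 = 0 -> mfun x t2 e0 i2 k2 != 0 ->
  (forall u, cone_tangent Y x u -> co u e0 = 0 -> co u (upd e0 i1 k1) = 0 ->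
     co u (upd e0 i2 k2) = 0 -> u = 0) ->
  exists2 M : 'M[K]_N.+1, \rank M = 3 & forall v, (v <= M)%MS <-> cone_tangent Y x v.
Proof.
move=> x0 hx h1 h2 m11 m12 m21 m22 inj.
pose S : 'M[K]_(1 + (1 + 1), N.+1) := col_mx x (col_mx t1 t2).
have Sv (a : 'rV[K]_(1 + (1 + 1))) : exists a0 a1 a2, a *m S = a0 *: x + a1 *: t1 + a2 *: t2
    /\ (a0 = 0 -> a1 = 0 -> a2 = 0 -> a = 0).
  rewrite -[a]hsubmxK -[rsubmx a]hsubmxK /S !mul_row_col.
  set p := lsubmx a; set q := lsubmx _; set r := rsubmx _.
  exists (p 0 0), (q 0 0), (r 0 0); split.
    by rewrite -!mul_scalar_mx -!mx11_scalar addrA.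
  move=> p0 q0 r0; rewrite (mx11_scalar p) (mx11_scalar q) (mx11_scalar r) p0 q0 r0.
  by rewrite !raddf0 !row_mx0.
have mD u v c i k : mfun x (u + c *: v) e0 i k = mfun x u e0 i k + c * mfun x v e0 i k.
  rewrite /mfun !coD; ring.
have mx0 i k : mfun x x e0 i k = 0 by rewrite /mfun; ring.
have comb a0 a1 a2 : a0 *: x + a1 *: t1 + a2 *: t2 = 0 + a0 *: x + a1 *: t1 + a2 *: t2.
  by rewrite add0r.
have m0 i k : mfun x 0 e0 i k = 0 by rewrite /mfun /co !mxE; ring.
exists <<S>>%MS.
  rewrite mxrank_gen; apply/eqP; rewrite -/(row_free S); apply: inj_row_free => a aS.
  have [a0 [a1 [a2 [E z]]]] := Sv a; move: E; rewrite aS comb => /esym E.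
  have f1 : a1 = 0.
    have := congr1 (fun u => mfun x u e0 i1 k1) E; rewrite /= !mD mx0 !m0 m21 !(mulr0, add0r, addr0).
    by move=> /eqP; rewrite mulf_eq0 (negPf m11) orbF => /eqP.
  have f2 : a2 = 0.
    have := congr1 (fun u => mfun x u e0 i2 k2) E; rewrite /= !mD mx0 !m0 m12 !(mulr0, add0r, addr0).
    by move=> /eqP; rewrite mulf_eq0 (negPf m22) orbF => /eqP.
  apply: z => //; move: E; rewrite f1 f2 !scale0r !addr0 add0r.
  move=> /(congr1 (fun u => co u e0)) /=; rewrite /co !mxE => /eqP.
  by rewrite mulf_eq0 => /orP [/eqP //|]; rewrite -/(co x e0) (negPf x0).
move=> v; rewrite genmxE; split.
  case/submxP => a ->; have [a0 [a1 [a2 [-> _]]]] := Sv a.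
  by apply: cone_tangentD => //; apply: cone_tangentD => //; apply: cone_tangentZ.
move=> hv.
pose a1 := mfun x v e0 i1 k1 / mfun x t1 e0 i1 k1.
pose a2 := mfun x v e0 i2 k2 / mfun x t2 e0 i2 k2.
pose v1 := v + (- a1) *: t1 + (- a2) *: t2.
pose a0 := co v1 e0 / co x e0.
pose u := v1 + (- a0) *: x.
have hu : cone_tangent Y x u by do 3!apply: cone_tangentD => //.
have u0 : co u e0 = 0.
  by rewrite /u coD mulNr /a0 divfK // subrr.
have mu1 : mfun x u e0 i1 k1 = 0.
  by rewrite /u /v1 !mD mx0 m21 !mulr0 !addr0 mulNr /a1 divfK // subrr.
have mu2 : mfun x u e0 i2 k2 = 0.
  by rewrite /u /v1 !mD mx0 m12 !mulr0 !addr0 mulNr /a2 divfK // subrr.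
have cu i k : mfun x u e0 i k = 0 -> co u (upd e0 i k) = 0.
  by rewrite /mfun u0 mul0r subr0 => /eqP; rewrite mulf_eq0 (negPf x0) orbF => /eqP.
have uz : u = 0 by apply: inj => //; apply: cu.
have -> : v = a0 *: x + a1 *: t1 + a2 *: t2.
  move: uz; rewrite /u /v1 !scaleNr => /eqP; rewrite subr_eq0 => /eqP <-.
  by rewrite addrAC subrK subrK.
rewrite /S; apply: addmx_sub; [apply: addmx_sub|]; apply: scalemx_sub.
- by rewrite -addsmxE addsmxSl.
- rewrite -addsmxE; apply: (submx_trans _ (addsmxSr _ _)); by rewrite -addsmxE addsmxSl.
- rewrite -addsmxE; apply: (submx_trans _ (addsmxSr _ _)); by rewrite -addsmxE addsmxSr.
Qed.

Lemma tangent_curve (v : idx T -> 'I_3 -> {poly K}) c e :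
  onY rho w cK v -> (tens v e).[0] != 0 -> c != 0 ->
  cone_tangent Y (c *: prow (tens v) 0) (\row_l (c * (tens v (dec l))^`().[0])).
Proof.
move=> hv v0 c0; pose g l := c%:P * tens v (dec l).
have gt t : \row_l (g l).[t] = c *: prow (tens v) t.
  by apply/rowP => l; rewrite !mxE /g hornerM hornerC.
have -> : \row_l (c * (tens v (dec l))^`().[0]) = \row_l (g l)^`().[0].
  apply/rowP => l; rewrite !mxE /g derivM derivC mul0r add0r.
  by rewrite hornerM hornerC.
rewrite -gt; apply: (@cone_tangent_curve _ _ _ _ (tens v e)).
  by apply/eqP => h; move: v0; rewrite h horner0 eqxx.
move=> t vt; rewrite gt; have Yt := Y_curve hv vt.
apply: zclosed_same_point (Yset_closed rho w) _ Yt.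
by exists c.
Qed.

Lemma tangent_self x : Y x -> cone_tangent Y x x.
Proof.
move=> Yx; pose g l : {poly K} := (1 + 'X) * (x 0 l)%:P.
have e0 : x = \row_l (g l).[0].
  by apply/rowP => l; rewrite mxE !(hornerM, hornerD, hornerC, hornerX) addr0 mul1r.
have e1 : x = \row_l (g l)^`().[0].
  apply/rowP => l; rewrite mxE /g derivM derivC mulr0 addr0 derivD derivC derivX add0r.
  by rewrite mul1r hornerC.
have H := @cone_tangent_curve _ _ Y g (1 + 'X); rewrite -e0 -e1 in H; apply: H.
  by apply/eqP => /(congr1 (fun p : {poly K} => p.[0])); rewrite hornerD hornerC hornerX horner0 addr0 => /eqP; rewrite oner_eq0.
move=> t t0; rewrite (_ : \row__ _ = (1 + t) *: x); last first.
  by apply/rowP => l; rewrite !mxE !(hornerM, hornerD, hornerC, hornerX).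
apply: zclosed_same_point (Yset_closed rho w) _ Yx; exists (1 + t) => //.
by move: t0; rewrite !(hornerD, hornerC, hornerX).
Qed.

Lemma mfun_curve (v : idx T -> 'I_3 -> {poly K}) c e i k :
  mfun (c *: prow (tens v) 0) (\row_l (c * (tens v (dec l))^`().[0])) e i k =
  c ^+ 2 * (\prod_(i' | i' != i) v i' (e i')).[0] ^+ 2 *
   ((v i k)^`().[0] * (v i (e i)).[0] - (v i (e i))^`().[0] * (v i k).[0]).
Proof.
have E1 e' : co (c *: prow (tens v) 0) e' = c * (tens v e').[0].
  by rewrite /co !mxE encK.
have E2 e' : co (\row_l (c * (tens v (dec l))^`().[0])) e' = c * (tens v e')^`().[0].
  by rewrite /co !mxE encK.
rewrite /mfun !E1 !E2; set R := \prod_(i' | i' != i) _.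
have -> : tens v e = R * v i (e i) by rewrite -{1}(upd_id e i) tens_upd.
have -> : tens v (upd e i k) = R * v i k by rewrite tens_upd.
rewrite !derivM !(hornerD, hornerM); ring.
Qed.

(** Each equation of Y is composed with x + t u, and the derivative at t = 0 is read off. *)
Lemma tangent_eqs x u : cone_tangent Y x u ->
  [/\ forall e f i, co u e * co x f + co x e * co u f =
        co u (upd e i (f i)) * co x (upd f i (e i)) + co x (upd e i (f i)) * co u (upd f i (e i)),
      forall e, co u (upd e iy o2) = 0, forall e, co u (upd e iw o2) = 0,
      forall e j, co u (upd (upd e iy o1) (iz j) o0)
        - rho j * co u (upd (upd e iy o0) (iz j) o0)
        - co u (upd (upd e iy o0) (iz j) o2) = 0 &
      forall e j, co u (upd (upd e iw o1) (iz j) o1)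
        - w j * co u (upd (upd e iw o0) (iz j) o1)
        - co u (upd (upd e iw o0) (iz j) o2) = 0].
Proof.
move=> hu; pose g l : {poly K} := (x 0 l)%:P + 'X * (u 0 l)%:P.
have H (p : {mpoly K[N.+1]}) : p \in Y_eqns rho w -> (mmap cK g p)^`().[0] = 0.
  move=> hp; rewrite -[RHS](hu p); first last.
  - move=> y [_ hy]; apply: hy => /=; apply/mapP; exists p => //.
    by rewrite map_mpoly_idfun.
  - by have /allP := Y_eqns_homog rho w; apply.
  rewrite deriv_mmap horner_sum; apply: eq_bigr => l _; rewrite hornerM horner_mmap.
  congr (_ * _).
    by apply: meval_eq => l'; rewrite /g !(hornerD, hornerM, hornerC, hornerX) mul0r addr0.
  rewrite /g derivD derivC derivM derivX derivC mul1r mulr0 add0r addr0.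
  by rewrite hornerC.
have gX e : mmap cK g 'X_(enc e) = (co x e)%:P + 'X * (co u e)%:P.
  by rewrite mmapX mmap1U.
have d0 (a b : K) : (a%:P + 'X * b%:P).[0] = a.
  by rewrite !(hornerD, hornerM, hornerC, hornerX) mul0r addr0.
have d1 (a b : K) : (a%:P + 'X * b%:P)^`() = b%:P.
  by rewrite derivD derivC derivM derivX derivC mulr0 add0r addr0 mul1r.
split.
- move=> e f i; have := H (segre_eq K (e, f, i)).
  rewrite /Y_eqns mem_cat fintype.image_f // => /(_ isT).
  rewrite /segre_eq /= rmorphB !rmorphM /= !gX derivB !derivM !d1.
  rewrite !(d0, hornerD, hornerN, hornerM, hornerC) => /eqP.
  by rewrite subr_eq0 => /eqP.
- move=> e; have := H (pad_eq K iy e); rewrite /Y_eqns !mem_cat fintype.image_f // ?orbT.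
  by move=> /(_ isT); rewrite gX d1 hornerC.
- move=> e; have := H (pad_eq K iw e); rewrite /Y_eqns !mem_cat fintype.image_f // ?orbT.
  by move=> /(_ isT); rewrite gX d1 hornerC.
- move=> e j; have := H (center_eq iy o0 rho (e, j)).
  rewrite /Y_eqns !mem_cat fintype.image_f // ?orbT => /(_ isT).
  rewrite /center_eq !rmorphB /= -mul_mpolyC rmorphM /= !gX mmapC /= !derivB derivM !d1 derivC.
  by rewrite !(d0, hornerD, hornerN, hornerM, hornerC) mul0r add0r.
- move=> e j; have := H (center_eq iw o1 w (e, j)).
  rewrite /Y_eqns !mem_cat fintype.image_f // ?orbT => /(_ isT).
  rewrite /center_eq !rmorphB /= -mul_mpolyC rmorphM /= !gX mmapC /= !derivB derivM !d1 derivC.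
  by rewrite !(d0, hornerD, hornerN, hornerM, hornerC) mul0r add0r.
Qed.

End SmoothIrreducible.

(** * Smoothness *)

Section Smooth.
Variables (T : finType) (K : closedFieldType) (rho w : T -> K).
Hypothesis rho_inj : injective rho.

Local Notation idK := (idfun : {rmorphism K -> K}).
Local Notation cK := (polyC : {rmorphism K -> {poly K}}).
Local Notation Y := (Yset rho w).
Local Notation N := (amb T).

(** The linearized Segre relations propagate the vanishing from the slices to all coordinates, by
    the induction of [segre_tens]. *)
Lemma tangent_slice_eq0 x u e0 : cone_tangent Y x u -> co x e0 != 0 ->
  (forall i k, co u (upd e0 i k) = 0) -> u = 0.
Proof.
move=> /tangent_eqs [h1 _ _ _ _] x0 h.
have u0 : co u e0 = 0 by rewrite -(upd_id e0 iy) h.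
apply: co_inj => e; rewrite [RHS]/co mxE.
pose es (s : seq (idx T)) : mon T := [ffun i => if i \in s then e i else e0 i].
have H s : uniq s -> co u (es s) = 0.
  elim: s => [|i s IH] /=.
    move=> _; rewrite -[RHS]u0; congr (co u _).
    by apply/ffunP => i; rewrite ffunE in_nil.
  move=> /andP [ins us].
  have := h1 (es s) (upd e0 i (e i)) i; rewrite upd_same.
  have -> : upd (es s) i (e i) = es (i :: s).
    apply/ffunP => i'; rewrite !ffunE in_cons; case: eqP => [->|//] //.
  have -> : upd (upd e0 i (e i)) i (es s i) = e0.
    by rewrite updd /es ffunE (negPf ins) upd_id.
  rewrite IH // h u0 !(mul0r, mulr0, addr0) => /esym/eqP.
  by rewrite mulf_eq0 (negPf x0) orbF => /eqP.
rewrite -(H (index_enum (idx T)) (index_enum_uniq _)); congr (co u _).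
by apply/ffunP => i; rewrite ffunE mem_index_enum.
Qed.

Lemma tangent_slices x u e0 : cone_tangent Y x u -> co x e0 != 0 -> co u e0 = 0 ->
  let U i k := co u (upd e0 i k) in let S := slice x e0 in
  [/\ U iy o2 = 0, U iw o2 = 0,
    forall j, U iy o1 * S (iz j) o0 + S iy o1 * U (iz j) o0
      - rho j * (U iy o0 * S (iz j) o0 + S iy o0 * U (iz j) o0)
      = U iy o0 * S (iz j) o2 + S iy o0 * U (iz j) o2 &
    forall j, U iw o1 * S (iz j) o1 + S iw o1 * U (iz j) o1
      - w j * (U iw o0 * S (iz j) o1 + S iw o0 * U (iz j) o1)
      = U iw o0 * S (iz j) o2 + S iw o0 * U (iz j) o2].
Proof.
move=> /tangent_eqs [h1 h2 h3 h4 h5] x0 u0 U S.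
have two i i' a b : i != i' ->
   U i a * S i' b + S i a * U i' b = co u (upd (upd e0 i a) i' b) * co x e0.
  move=> ii'; have := h1 (upd e0 i a) (upd e0 i' b) i'.
  rewrite upd_same upd_other 1?eq_sym // updd upd_id u0 mulr0 addr0.
  by rewrite /U /S /slice.
split; [exact: h2 | exact: h3 | |] => j; rewrite !two //.
  have /(congr1 ( *%R^~ (co x e0))) := h4 e0 j; rewrite mul0r => e.
  by apply/eqP; rewrite -subr_eq0; apply/eqP; rewrite -[RHS]e; ring.
have /(congr1 ( *%R^~ (co x e0))) := h5 e0 j; rewrite mul0r => e.
by apply/eqP; rewrite -subr_eq0; apply/eqP; rewrite -[RHS]e; ring.
Qed.

(** Away from the centre the two relations have rank 2, so U is a multiple of S; it vanishes in a
    coordinate where S does not. *)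
Lemma noncenter_rigid (S U : 'I_3 -> K) (A B y0 w0 : K) l :
  S l != 0 -> U l = 0 -> (A != 0) || (B != 0) -> (A != 0) || (y0 != 0) ->
  (B != 0) || (w0 != 0) -> A * S o0 = y0 * S o2 -> B * S o1 = w0 * S o2 ->
  A * U o0 = y0 * U o2 -> B * U o1 = w0 * U o2 -> forall k, U k = 0.
Proof.
move=> Sl Ul AB Ay Bw s0 s1 u0 u1.
have e02 : U o0 * S o2 = U o2 * S o0.
  apply/eqP; rewrite -subr_eq0; case/orP: Ay => h.
    rewrite -(mulrI_eq0 _ (mulfI h)); apply/eqP.
    have -> : A * (U o0 * S o2 - U o2 * S o0) = (A * U o0) * S o2 - (A * S o0) * U o2 by ring.
    by rewrite u0 s0; ring.
  rewrite -(mulrI_eq0 _ (mulfI h)); apply/eqP.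
  have -> : y0 * (U o0 * S o2 - U o2 * S o0) = U o0 * (y0 * S o2) - (y0 * U o2) * S o0 by ring.
  by rewrite -s0 -u0; ring.
have e12 : U o1 * S o2 = U o2 * S o1.
  apply/eqP; rewrite -subr_eq0; case/orP: Bw => h.
    rewrite -(mulrI_eq0 _ (mulfI h)); apply/eqP.
    have -> : B * (U o1 * S o2 - U o2 * S o1) = (B * U o1) * S o2 - (B * S o1) * U o2 by ring.
    by rewrite u1 s1; ring.
  rewrite -(mulrI_eq0 _ (mulfI h)); apply/eqP.
  have -> : w0 * (U o1 * S o2 - U o2 * S o1) = U o1 * (w0 * S o2) - (w0 * U o2) * S o1 by ring.
  by rewrite -s1 -u1; ring.
have e01 : U o0 * S o1 = U o1 * S o0.
  have [S2|S2] := eqVneq (S o2) 0; last first.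
    apply: (mulIf S2).
    have -> : U o0 * S o1 * S o2 = (U o0 * S o2) * S o1 by ring.
    have -> : U o1 * S o0 * S o2 = (U o1 * S o2) * S o0 by ring.
    by rewrite e02 e12; ring.
  have U2 : U o2 = 0.
    move: l Sl Ul; apply: I3P => Sl Ul //.
      by move: e02; rewrite S2 mulr0 => /esym/eqP; rewrite mulf_eq0 (negPf Sl) orbF => /eqP.
    by move: e12; rewrite S2 mulr0 => /esym/eqP; rewrite mulf_eq0 (negPf Sl) orbF => /eqP.
  move: s0 s1 u0 u1; rewrite S2 U2 !mulr0 => /eqP + /eqP + /eqP + /eqP.
  rewrite !mulf_eq0; case/orP: AB => /negPf ->; rewrite /=.
    by move=> /eqP -> _ /eqP -> _; rewrite mul0r mulr0.
  by move=> _ /eqP -> _ /eqP ->; rewrite mul0r mulr0.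
have E k : U k * S l = U l * S k.
  move: k l {Sl Ul}; apply: I3P; apply: I3P; rewrite ?e02 ?e12 ?e01 //.
by move=> k; have /eqP := E k; rewrite Ul mul0r mulf_eq0 (negPf Sl) orbF => /eqP.
Qed.

Lemma slice_rigid x u e0 : Y x -> cone_tangent Y x u -> co x e0 != 0 -> co u e0 = 0 ->
  (forall k, co u (upd e0 iy k) = 0) -> (forall k, co u (upd e0 iw k) = 0) ->
  forall j, (slice x e0 iy o1 - rho j * slice x e0 iy o0 != 0) ||
            (slice x e0 iw o1 - w j * slice x e0 iw o0 != 0) ->
  forall k, co u (upd e0 (iz j) k) = 0.
Proof.
move=> Yx tu x0 u0 uy uw j nc k.
have [nS [y2 w2 /(_ j) sy /(_ j) sw] _] := Yset_slice Yx x0.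
have [_ _ /(_ j) hy /(_ j) hw] := tangent_slices tu x0 u0.
rewrite !uy in hy; rewrite !uw in hw; rewrite /= in sy sw.
set S := slice x e0 in nc nS y2 w2 sy sw hy hw.
apply: (@noncenter_rigid (S (iz j)) (fun k => co u (upd e0 (iz j) k)) (S iy o1 - rho j * S iy o0)
   (S iw o1 - w j * S iw o0) (S iy o0) (S iw o0) (e0 (iz j))) => //.
- by rewrite /S slice_diag.
- by rewrite upd_id.
- rewrite -negb_and; apply/negP => /andP [/eqP a /eqP b].
  by have := nz3 (nS iy) y2 b; move: a; rewrite b mulr0 subr0 => ->; rewrite eqxx.
- rewrite -negb_and; apply/negP => /andP [/eqP a /eqP b].
  by have := nz3 (nS iw) w2 b; move: a; rewrite b mulr0 subr0 => ->; rewrite eqxx.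
- by rewrite mulrC sy mulrC.
- by rewrite mulrC sw mulrC.
- move: hy; rewrite !mul0r !add0r => <-; ring.
- move: hw; rewrite !mul0r !add0r => <-; ring.
Qed.

(** The numerator of the affine coordinate of P^1 whose denominator is the coordinate k. *)
Definition flip (k : 'I_3) : 'I_3 := if k == o0 then o1 else o0.

Lemma pad_zero (f : 'I_3 -> K) k0 : k0 != o2 -> f o2 = 0 -> f k0 = 0 -> f (flip k0) = 0 ->
  forall k, f k = 0.
Proof.
move=> k02 f2 fk ff; move: k0 k02 fk ff; apply: I3P; rewrite /flip /= ?eqxx //.
  by move=> _ f0 f1; apply: I3P.
by move=> _ f1 f0; apply: I3P.
Qed.

Lemma lin_wronskian (y y' : 'I_3 -> K) k : k != o2 ->
  y o0 * y' o1 - y o1 * y' o0 != 0 ->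
  (lin y y' (flip k))^`().[0] * (lin y y' k).[0]
   - (lin y y' k)^`().[0] * (lin y y' (flip k)).[0] != 0.
Proof.
have d l : (lin y y' l)^`().[0] = y' l.
  by rewrite /lin derivD derivC derivM derivX derivC mulr0 addr0 add0r mul1r hornerC.
rewrite !d !lin_at !mul0r !addr0; move: k; apply: I3P => // _ h; rewrite /flip /=.
  by rewrite mulrC [X in _ - X]mulrC.
by rewrite -oppr_eq0 opprB mulrC [X in _ - X]mulrC.
Qed.

Lemma onY_slice_iy x e0 : Y x -> co x e0 != 0 -> e0 iy != o2 /\ e0 iw != o2.
Proof.
move=> /Yset_eqs [_ [_ h2 h3 _ _]] x0; split; apply/eqP => e.
  by move: x0; rewrite -(upd_id e0 iy) e h2 eqxx.
by move: x0; rewrite -(upd_id e0 iw) e h3 eqxx.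
Qed.

(** Here y and w are local coordinates: v1 moves y and keeps w, v2 does the opposite, and the
    factors [iz j] are determined by rigidity. *)
Lemma chart_smooth y z x : y o2 = 0 -> z o2 = 0 -> nondeg (chart rho w idK y z) ->
  same_point (mkx (tens (chart rho w idK y z))) x -> Y x ->
  exists2 M : 'M[K]_N.+1, \rank M = 3 & forall v, (v <= M)%MS <-> cone_tangent Y x v.
Proof.
move=> y2 z2 nd [c c0 xE] Yx.
have [e0 x0] := co_neq0 (Yset_neq0 Yx).
have [ey ez] := onY_slice_iy Yx x0.
have xe e : co x e = c * tens (chart rho w idK y z) e.
  by rewrite xE {1}/co mxE -/(co _ _) coE.
have t0 : tens (chart rho w idK y z) e0 != 0.
  by move: x0; rewrite xe mulf_eq0 negb_or => /andP [].
have dy := compl_det y2 (nd iy); have dz := compl_det z2 (nd iw).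
pose cst (u : 'I_3 -> K) k := (u k)%:P : {poly K}.
pose v1 := chart rho w cK (lin y (compl y)) (cst z).
pose v2 := chart rho w cK (cst y) (lin z (compl z)).
have l2 (u : 'I_3 -> K) : u o2 = 0 -> lin u (compl u) o2 = 0.
  by move=> e; rewrite /lin e compl2 mulr0 addr0.
have o1Y : onY rho w cK v1 by apply: chart_onY; [exact: l2 | rewrite /cst z2].
have o2Y : onY rho w cK v2 by apply: chart_onY; [rewrite /cst y2 | exact: l2].
have at1 : at_ 0 v1 = chart rho w idK y z.
  apply/funext => i; apply/funext => k; rewrite /at_ /v1.
  move: i k; apply: idxP => [k|k|j]; [| |apply: I3P];
    rewrite /= /cvec /vec3 /= /cst; rewrite !(lin_at, hornerM, hornerD, hornerN, hornerC);
    by rewrite ?mul0r ?addr0.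
have at2 : at_ 0 v2 = chart rho w idK y z.
  apply/funext => i; apply/funext => k; rewrite /at_ /v2.
  move: i k; apply: idxP => [k|k|j]; [| |apply: I3P];
    rewrite /= /cvec /vec3 /= /cst; rewrite !(lin_at, hornerM, hornerD, hornerN, hornerC);
    by rewrite ?mul0r ?addr0.
have x1 : x = c *: prow (tens v1) 0 by rewrite prow_tens at1.
have x2 : x = c *: prow (tens v2) 0 by rewrite prow_tens at2.
have n1 : (tens v1 e0).[0] != 0.
  by rewrite /tens horner_prod; move: t0; rewrite -at1.
have n2 : (tens v2 e0).[0] != 0.
  by rewrite /tens horner_prod; move: t0; rewrite -at2.
have pn (v : idx T -> 'I_3 -> {poly K}) i : (tens v e0).[0] != 0 ->
    (\prod_(i' | i' != i) v i' (e0 i')).[0] != 0.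
  by rewrite /tens (bigD1 i) //= hornerM mulf_eq0 negb_or => /andP [].
have c2 : c ^+ 2 != 0 by rewrite expf_neq0.
have T1 := tangent_curve o1Y n1 c0; have T2 := tangent_curve o2Y n2 c0.
rewrite -x1 in T1; rewrite -x2 in T2.
have dC (u : 'I_3 -> K) k : (cst u k)^`() = 0 by rewrite derivC.
apply: (tangent_span (i1 := iy) (k1 := flip (e0 iy)) (i2 := iw) (k2 := flip (e0 iw))
   x0 (tangent_self Yx) T1 T2).
- rewrite {1}x1 mfun_curve mulf_neq0 //; first by rewrite mulf_neq0 // expf_neq0 // pn.
  exact: lin_wronskian.
- by rewrite {1}x1 mfun_curve /v1 /= !dC horner0 !mul0r subrr mulr0.
- by rewrite {1}x2 mfun_curve /v2 /= !dC horner0 !mul0r subrr mulr0.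
- rewrite {1}x2 mfun_curve mulf_neq0 //; first by rewrite mulf_neq0 // expf_neq0 // pn.
  exact: lin_wronskian.
move=> u tu u0 uy uw.
have [U1 U2 _ _] := tangent_slices tu x0 u0.
have uy' : forall k, co u (upd e0 iy k) = 0.
  by apply: (pad_zero ey) => //; rewrite upd_id.
have uw' : forall k, co u (upd e0 iw k) = 0.
  by apply: (pad_zero ez) => //; rewrite upd_id.
apply: (tangent_slice_eq0 tu x0); apply: idxP => // j k.
apply: (slice_rigid Yx tu x0 u0) => //.
have [cy cy0 Sy] : exists2 d, d != 0 & forall k, slice x e0 iy k = d * y k.
  exists (c * \prod_(i' | i' != iy) chart rho w idK y z i' (e0 i')).
    by rewrite mulf_neq0 //; move: t0; rewrite /tens (bigD1 iy) //= mulf_eq0 negb_or => /andP [].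
  by move=> l; rewrite /slice xe tens_upd mulrA.
have [cz cz0 Sz] : exists2 d, d != 0 & forall k, slice x e0 iw k = d * z k.
  exists (c * \prod_(i' | i' != iw) chart rho w idK y z i' (e0 i')).
    by rewrite mulf_neq0 //; move: t0; rewrite /tens (bigD1 iw) //= mulf_eq0 negb_or => /andP [].
  by move=> l; rewrite /slice xe tens_upd mulrA.
have fac (d r p q : K) : d * p - r * (d * q) = d * (p - r * q) by ring.
rewrite !Sy !Sz !fac !mulf_eq0 !negb_or cy0 cz0 /=.
have [l] := nd (iz j); rewrite -negb_and => hl; apply/negP => /andP [/eqP a /eqP b].
by move: l hl; apply: I3P; rewrite /= /cvec /vec3 /= ?a ?b ?mul0r eqxx.
Qed.

(** On the exceptional curve, one local coordinate is the direction (a : b), moved by v1 with s = 0.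
    The other is w if a is nonzero and y otherwise; it is moved by v2 through s, with the direction
    fixed. *)
Lemma echart_smooth j0 a b x : (a != 0) || (b != 0) ->
  same_point (mkx (tens (echart rho w idK j0 0 a b))) x -> Y x ->
  exists2 M : 'M[K]_N.+1, \rank M = 3 & forall v, (v <= M)%MS <-> cone_tangent Y x v.
Proof.
move=> ab [c c0 xE] Yx.
set ch := echart rho w idK j0 0 a b in xE.
have xe e : co x e = c * tens ch e.
  by rewrite xE {1}/co mxE -/(co _ _) coE.
pose l0 := if a == 0 then o1 else o0.
have [e1 he1] := co_neq0 (Yset_neq0 Yx).
(* The reference coordinate has index o0 at y and w, which are finite at a centre, and at [iz j0]
   the index of a nonzero coordinate of the direction. *)
pose e0 : mon T := upd (upd (upd e1 iy o0) iw o0) (iz j0) l0.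
have ey : e0 iy = o0 by rewrite /e0 !ffunE.
have ez : e0 iw = o0 by rewrite /e0 !ffunE.
have ej : e0 (iz j0) = l0 by rewrite upd_same.
have t0 : tens ch e0 != 0.
  move: he1; rewrite xe mulf_eq0 negb_or => /andP [_ /prodf_neq0 h].
  apply/prodf_neq0; apply: idxP => [_|_|j _].
  - by rewrite ey /ch /= /pt /vec3 /= oner_neq0.
  - by rewrite ez /ch /= /pt /vec3 /= oner_neq0.
  have [->|nj] := eqVneq j j0.
    rewrite ej /ch /= eqxx /l0 /vec3; have [a0|//] := eqVneq a 0.
    by move: ab; rewrite a0 eqxx.
  have ne : iz j != iz j0 by apply/eqP => -[e]; move: nj; rewrite e eqxx.
  by rewrite /e0 !upd_other //; apply: h.
have x0 : co x e0 != 0 by rewrite xe mulf_neq0.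
pose d := pt a b.
have dd : d o0 * compl d o1 - d o1 * compl d o0 != 0.
  apply: compl_det => //; case/orP: ab => h; [by exists o0|by exists o1].
pose v1 := echart rho w cK j0 0 (lin d (compl d) o0) (lin d (compl d) o1).
pose v2 := echart rho w cK j0 'X a%:P b%:P.
have o1Y : onY rho w cK v1 by exact: echart_onY.
have o2Y : onY rho w cK v2 by exact: echart_onY.
have eA k : (lin d (compl d) k).[0] = d k by rewrite lin_at mul0r addr0.
have at1 : at_ 0 v1 = ch.
  apply/funext => i; apply/funext => k; rewrite /at_ /v1 /ch.
  move: i k; apply: idxP; [apply: I3P | apply: I3P | move=> j /=; case: ifP => _; apply: I3P];
   rewrite /= /cvec /pt /vec3 /= ?(eA, hornerM, hornerD, hornerN, hornerC, hornerX) /d /pt /vec3 /=;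
   ring.
have at2 : at_ 0 v2 = ch.
  apply/funext => i; apply/funext => k; rewrite /at_ /v2 /ch.
  move: i k; apply: idxP; [apply: I3P | apply: I3P | move=> j /=; case: ifP => _; apply: I3P];
   rewrite /= /cvec /pt /vec3 /= ?(hornerM, hornerD, hornerN, hornerC, hornerX); ring.
have x1 : x = c *: prow (tens v1) 0 by rewrite prow_tens at1.
have x2 : x = c *: prow (tens v2) 0 by rewrite prow_tens at2.
have n1 : (tens v1 e0).[0] != 0.
  by rewrite /tens horner_prod; move: t0; rewrite -at1.
have n2 : (tens v2 e0).[0] != 0.
  by rewrite /tens horner_prod; move: t0; rewrite -at2.
have pn (v : idx T -> 'I_3 -> {poly K}) i : (tens v e0).[0] != 0 ->
    (\prod_(i' | i' != i) v i' (e0 i')).[0] != 0.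
  by rewrite /tens (bigD1 i) //= hornerM mulf_eq0 negb_or => /andP [].
have c2 : c ^+ 2 != 0 by rewrite expf_neq0.
have T1 := tangent_curve o1Y n1 c0; have T2 := tangent_curve o2Y n2 c0.
rewrite -x1 in T1; rewrite -x2 in T2.
have l02 : l0 != o2 by rewrite /l0; case: ifP.
have w1 : mfun x (\row_l (c * (tens v1 (dec l))^`().[0])) e0 (iz j0) (flip l0) != 0.
  rewrite {1}x1 mfun_curve mulf_neq0 //; first by rewrite mulf_neq0 // expf_neq0 // pn.
  have v1E k : k != o2 -> v1 (iz j0) k = lin d (compl d) k.
    by move: k; apply: I3P => // _; rewrite /v1 /= eqxx.
  rewrite ej !v1E //; first exact: lin_wronskian.
  by rewrite /flip; case: ifP.
have w2 : mfun x (\row_l (c * (tens v2 (dec l))^`().[0])) e0 (iz j0) (flip l0) = 0.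
  rewrite {1}x2 mfun_curve ej /v2 /= eqxx.
  have dz k : k != o2 -> (vec3 a%:P b%:P ('X * a%:P * b%:P) k : {poly K})^`() = 0.
    by move: k; apply: I3P => // _; rewrite /vec3 /= derivC.
  rewrite !dz // ?horner0 ?mul0r ?subrr ?mulr0 //.
  by rewrite /flip; case: ifP.
have cst1 i k k' : (i == iy) || (i == iw) -> e0 i = k' ->
    mfun x (\row_l (c * (tens v1 (dec l))^`().[0])) e0 i k = 0.
  move=> hi hk; rewrite {1}x1 mfun_curve hk.
  have dz l : (v1 i l)^`() = 0.
    case/orP: hi => /eqP ->; rewrite /v1 /= /pt /vec3 !mul0r !addr0;
      by case: (val l) => [|[|m]]; rewrite ?derivC.
  by rewrite !dz horner0 !mul0r subrr mulr0.
have der (p q : K) : (p%:P + 'X * q%:P)^`() = q%:P :> {poly K}.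
  by rewrite derivD derivC derivM derivX derivC mulr0 add0r addr0 mul1r.
have [nS [y2 w2' sy sw] _] := Yset_slice Yx x0.
have sl i k : slice x e0 i k =
   c * (\prod_(i' | i' != i) ch i' (e0 i')) * ch i k.
  by rewrite /slice xe tens_upd mulrA.
have Ay : slice x e0 iy o1 - rho j0 * slice x e0 iy o0 = 0.
  by rewrite !sl /ch /= /pt /vec3 /=; ring.
have Aw : slice x e0 iw o1 - w j0 * slice x e0 iw o0 = 0.
  by rewrite !sl /ch /= /pt /vec3 /=; ring.
have sly : slice x e0 iy o0 != 0 by rewrite -ey slice_diag.
have slw : slice x e0 iw o0 != 0 by rewrite -ez slice_diag.
have slz2 : slice x e0 (iz j0) o2 = 0 by rewrite sl /ch /= eqxx /vec3 /=; ring.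
have fin u : cone_tangent Y x u -> co u e0 = 0 -> co u (upd e0 (iz j0) (flip l0)) = 0 ->
   co u (upd e0 (iz j0) o2) = 0 -> co u (upd e0 iy o1) = 0 -> co u (upd e0 iw o1) = 0 -> u = 0.
  move=> tu u0 uz uz2 uy uw.
  have [U1 U2 _ _] := tangent_slices tu x0 u0.
  have uy' : forall k, co u (upd e0 iy k) = 0.
    by apply: I3P => //; rewrite -ey upd_id.
  have uw' : forall k, co u (upd e0 iw k) = 0.
    by apply: I3P => //; rewrite -ez upd_id.
  apply: (tangent_slice_eq0 tu x0); apply: idxP => // j k.
  have [->|nj] := eqVneq j j0.
    move: k; apply: (pad_zero l02) => //.
    by rewrite -ej upd_id.
  apply: (slice_rigid Yx tu x0 u0) => //; apply/orP; left.
  rewrite !sl /ch /= /pt /vec3 /= mul0r addr0 !mulr1 [rho j * _]mulrC -mulrBr.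
  have : slice x e0 iy o0 != 0 by [].
  rewrite sl mulf_eq0 negb_or => /andP [k0 _]; rewrite mulf_neq0 // subr_eq0.
  by apply/eqP => /rho_inj e; move: nj; rewrite e eqxx.
(* At a centre the linearized relations of the factor [iz j0] tie the variations of y and w to that
   of its last coordinate. *)
have lin0 u : cone_tangent Y x u -> co u e0 = 0 ->
   co u (upd e0 iy o1) * slice x e0 (iz j0) o0 = slice x e0 iy o0 * co u (upd e0 (iz j0) o2) /\
   co u (upd e0 iw o1) * slice x e0 (iz j0) o1 = slice x e0 iw o0 * co u (upd e0 (iz j0) o2).
  move=> tu u0; have [_ _ /(_ j0) hy /(_ j0) hw] := tangent_slices tu x0 u0.
  have uy0 : co u (upd e0 iy o0) = 0 by rewrite -ey upd_id.
  have uw0 : co u (upd e0 iw o0) = 0 by rewrite -ez upd_id.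
  rewrite uy0 in hy; rewrite uw0 in hw; rewrite slz2 in hy hw; split.
    transitivity (co u (upd e0 iy o1) * slice x e0 (iz j0) o0 +
      (slice x e0 iy o1 - rho j0 * slice x e0 iy o0) * co u (upd e0 (iz j0) o0)).
      by rewrite Ay mul0r addr0.
    by move: hy; rewrite !mul0r !add0r => <-; ring.
  transitivity (co u (upd e0 iw o1) * slice x e0 (iz j0) o1 +
      (slice x e0 iw o1 - w j0 * slice x e0 iw o0) * co u (upd e0 (iz j0) o1)).
    by rewrite Aw mul0r addr0.
  by move: hw; rewrite !mul0r !add0r => <-; ring.
have slz : slice x e0 (iz j0) l0 != 0 by rewrite -ej slice_diag.
have [a0|a0] := eqVneq a 0.
  have b0 : b != 0 by move: ab; rewrite a0 eqxx.
  have l0E : l0 = o1 by rewrite /l0 a0 eqxx.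
  apply: (tangent_span (i1 := iz j0) (k1 := flip l0) (i2 := iy) (k2 := o1)
     x0 (tangent_self Yx) T1 T2) => //.
  - exact: (cst1 _ _ _ _ ey).
  - rewrite {1}x2 mfun_curve ey mulf_neq0 //; first by rewrite mulf_neq0 // expf_neq0 // pn.
    rewrite /v2 /= /pt /vec3 /= der !hornerC derivC horner0 mul0r subr0 mulr1 //.
  move=> u tu u0 uz uy; have [h1 h2] := lin0 u tu u0.
  have u2 : co u (upd e0 (iz j0) o2) = 0.
    by move: h1; rewrite uy mul0r => /esym/eqP; rewrite mulf_eq0 (negPf sly) => /eqP.
  apply: fin => //; move: h2; rewrite u2 mulr0 => /eqP; rewrite mulf_eq0.
  by move: slz; rewrite l0E => /negPf ->; rewrite orbF => /eqP.
have l0E : l0 = o0 by rewrite /l0 (negPf a0).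
apply: (tangent_span (i1 := iz j0) (k1 := flip l0) (i2 := iw) (k2 := o1)
     x0 (tangent_self Yx) T1 T2) => //.
- exact: (cst1 _ _ _ _ ez).
- rewrite {1}x2 mfun_curve ez mulf_neq0 //; first by rewrite mulf_neq0 // expf_neq0 // pn.
  rewrite /v2 /= /pt /vec3 /= der !hornerC derivC horner0 mul0r subr0 mulr1 //.
move=> u tu u0 uz uw; have [h1 h2] := lin0 u tu u0.
have u2 : co u (upd e0 (iz j0) o2) = 0.
  by move: h2; rewrite uw mul0r => /esym/eqP; rewrite mulf_eq0 (negPf slw) => /eqP.
apply: fin => //; move: h1; rewrite u2 mulr0 => /eqP; rewrite mulf_eq0.
by move: slz; rewrite l0E => /negPf ->; rewrite orbF => /eqP.
Qed.

Lemma Y_smooth x : Y x ->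
  exists2 M : 'M[K]_N.+1, \rank M = 3 & forall v, (v <= M)%MS <-> cone_tangent Y x v.
Proof.
move=> Yx; have [[y [z [y2 z2 nd sp]]]|[j0 [a [b [ab sp]]]]] := Y_points rho_inj Yx.
  exact: chart_smooth sp Yx.
exact: echart_smooth sp Yx.
Qed.

End Smooth.

(** * Dimension *)

Section Plane.
Variable K : closedFieldType.

(** The inner variable of [{poly {poly K}}] is s, the outer one is t. *)
Definition ev2 (s t : K) (f : {poly {poly K}}) : K := f.[t%:P].[s].

Lemma ev2M s t f g : ev2 s t (f * g) = ev2 s t f * ev2 s t g.
Proof. by rewrite /ev2 !hornerM. Qed.

Lemma ev2C s t c : ev2 s t c%:P = c.[s].
Proof. by rewrite /ev2 hornerC. Qed.

Lemma ev2D s t f g : ev2 s t (f + g) = ev2 s t f + ev2 s t g.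
Proof. by rewrite /ev2 !hornerD. Qed.

Definition vanish (W : set (K * K)) (f : {poly {poly K}}) :=
  forall s t, W (s, t) -> ev2 s t f = 0.

(** Irreducibility through the primality of the vanishing ideal, which suits images of closed sets
    that are only locally closed. *)
Definition prime_set (W : set (K * K)) :=
  W !=set0 /\ forall f g, vanish W (f * g) -> vanish W f \/ vanish W g.

Lemma prime_vanish_roots W (m : K -> {poly {poly K}}) (r : seq K) c :
  prime_set W -> c != 0 ->
  vanish W (c%:P%:P * \prod_(z <- r) m z) -> exists2 z, z \in r & vanish W (m z).
Proof.
move=> [[[s t] Wst] pW] c0; elim: r => [|z r IH].
  rewrite big_nil mulr1 => /(_ s t Wst); rewrite ev2C hornerC => /eqP.
  by rewrite (negPf c0).
rewrite big_cons mulrCA => /pW [h|/IH [z' rz' h]].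
  by exists z; rewrite ?mem_head.
by exists z'; rewrite // in_cons rz' orbT.
Qed.

Lemma prime_vanish_const W (c : {poly K}) : prime_set W -> c != 0 -> vanish W c%:P ->
  exists z, vanish W ('X - z%:P)%:P.
Proof.
move=> pW c0; have [r {1}->] := closed_field_poly_normal c.
rewrite -mul_polyC polyCM rmorph_prod => h.
have lc0 : lead_coef c != 0 by rewrite lead_coef_eq0.
have [z _ hz] := prime_vanish_roots (m := fun z => ('X - z%:P)%:P) pW lc0 h.
by exists z.
Qed.

Lemma prime_vanish_map W (c : {poly K}) : prime_set W -> c != 0 ->
  vanish W (map_poly polyC c) -> exists z, vanish W ('X - z%:P%:P).
Proof.
move=> pW c0; have [r e] := closed_field_poly_normal c.
rewrite {1}e map_polyZ /= rmorph_prod /= -mul_polyC => h.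
have lc0 : lead_coef c != 0 by rewrite lead_coef_eq0.
have [z _ hz] := prime_vanish_roots (m := fun z => map_poly polyC ('X - z%:P)) pW lc0 h.
by exists z; move: hz; rewrite rmorphB /= map_polyX map_polyC.
Qed.

Lemma vanish_mul W f g : vanish W f -> vanish W (f * g).
Proof. by move=> h s t Wst; rewrite ev2M h // mul0r. Qed.

Lemma vanish_add W f g : vanish W f -> vanish W g -> vanish W (f + g).
Proof. by move=> h h' s t Wst; rewrite ev2D h // h' // addr0. Qed.

Definition subs0 (z : K) (f : {poly {poly K}}) : {poly K} := map_poly (horner_eval z) f.

Lemma ev2_subs0 z t f : ev2 z t f = (subs0 z f).[t].
Proof.
by rewrite /ev2 /subs0 -horner_evalE -[in RHS](hornerC t z) -horner_evalE horner_map.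
Qed.

Lemma subs0_eq0 z f : subs0 z f = 0 -> exists g, f = ('X - z%:P)%:P * g.
Proof.
move=> h.
have /choice [q hq] : forall i, exists q, f`_i = q * ('X - z%:P).
  move=> i; apply/factor_theorem; rewrite /root -horner_evalE.
  by have := congr1 (fun p : {poly K} => p`_i) h; rewrite coef_map coef0 => ->.
exists (\poly_(i < size f) q i); apply/polyP => i; rewrite coefCM coef_poly.
case: ltnP => [_|hi]; first by rewrite hq mulrC.
by rewrite mulr0 nth_default.
Qed.

Lemma point_of_vanish W s1 t1 : vanish W ('X - s1%:P)%:P -> vanish W ('X - t1%:P%:P) ->
  forall s t, W (s, t) -> s = s1 /\ t = t1.
Proof.
move=> h1 h2 s t Wst; have := h1 s t Wst; have := h2 s t Wst.
rewrite ev2C /ev2 !(hornerD, hornerN, hornerX, hornerC) => /eqP e2 /eqP e1.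
by split; apply/eqP; rewrite -subr_eq0.
Qed.

(** Take a nonzero h vanishing on W2, of least degree in t and then in s. If t does not occur in it,
    W2 lies on a line s = s1, where g leaves one point for W1. Otherwise a nonzero polynomial in s,
    from the resultant of h and g, confines W1 to such a line, where h leaves one point. In both
    cases g0, which has a zero in W1, would vanish on all of W1. *)
Lemma no_plane_chain (W1 W2 W3 : set (K * K)) (g0 g f : {poly {poly K}}) :
  W1 `<=` W2 -> W2 `<=` W3 -> prime_set W1 -> prime_set W2 ->
  (exists s t, W1 (s, t) /\ ev2 s t g0 = 0) -> ~ vanish W1 g0 ->
  vanish W1 g -> ~ vanish W2 g -> vanish W2 f -> ~ vanish W3 f -> False.
Proof.
move=> W12 W23 p1 p2 g00 ng0 g1 ng2 f2 nf3.
have sub h : vanish W2 h -> vanish W1 h by move=> H s t /W12; apply: H.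
have point s1 t1 : vanish W1 ('X - s1%:P)%:P -> vanish W1 ('X - t1%:P%:P) -> False.
  move=> h1 h2; apply: ng0 => s t Wst; have [s' [t' [W' e]]] := g00.
  have [-> ->] := point_of_vanish h1 h2 Wst.
  by have [<- <-] := point_of_vanish h1 h2 W'.
have line s1 h : vanish W1 ('X - s1%:P)%:P -> vanish W1 h -> subs0 s1 h != 0 -> False.
  move=> hs hh nz.
  have [t1 ht] : exists z, vanish W1 ('X - z%:P%:P).
    apply: (prime_vanish_map p1 nz) => s t Wst.
    have e : s = s1.
      have := hs s t Wst; rewrite ev2C !(hornerD, hornerN, hornerX, hornerC) => /eqP.
      by rewrite subr_eq0 => /eqP.
    have := hh s t Wst; rewrite e ev2_subs0 => e'.
    by rewrite /ev2 horner_map /= e' horner0.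
  exact: point hs ht.
have f0 : f != 0 by apply/eqP => e; apply: nf3 => s t _; rewrite e /ev2 !horner0.
have g0' : g != 0 by apply/eqP => e; apply: ng2 => s t _; rewrite e /ev2 !horner0.
pose P1 n := `[< exists h, [/\ h != 0, vanish W2 h & size h = n] >].
have ex1 : exists n, P1 n by exists (size f); apply/asboolP; exists f.
case: (ex_minnP ex1) => n /asboolP [h1 [h10 h1v h1s]] min1.
have min1' h : h != 0 -> vanish W2 h -> (n <= size h)%N.
  by move=> h0 hv; apply: min1; apply/asboolP; exists h.
pose P2 m := `[< exists h, [/\ h != 0, vanish W2 h, size h = n & size (swapXY h) = m] >].
have ex2 : exists m, P2 m by exists (size (swapXY h1)); apply/asboolP; exists h1.
case: (ex_minnP ex2) => m /asboolP [h [hn0 hv hs hm]] min2 {h1 h10 h1v h1s ex1 ex2 min1}.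
have [n1|n1] := leqP n 1.
  have hC : h = (h`_0)%:P by apply: size1_polyC; rewrite hs.
  have c0 : h`_0 != 0 by apply/eqP => e; move: hn0; rewrite hC e eqxx.
  have [s1 hs1] : exists z, vanish W2 ('X - z%:P)%:P.
    by apply: (prime_vanish_const p2 c0); rewrite -hC.
  apply: (line s1 g (sub _ hs1) g1); apply/eqP => /subs0_eq0 [g' e].
  by apply: ng2; rewrite e; apply: vanish_mul.
have nconst (c : {poly K}) : c != 0 -> ~ vanish W2 c%:P.
  move=> c0 hc; have := min1' c%:P; rewrite polyC_eq0 c0 => /(_ isT hc).
  by rewrite size_polyC c0 leqNgt n1.
have [c c0 c1] : exists2 c : {poly K}, c != 0 & vanish W1 c%:P.
  have [sg|sg] := leqP (size g) 1.
    have gC : g = (g`_0)%:P by apply: size1_polyC.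
    exists g`_0; last by rewrite -gC.
    by apply/eqP => e; move: g0'; rewrite gC e eqxx.
  (* If the resultant vanishes, h and g have a common divisor of positive degree in t. By primality,
     either the cofactor of h vanishes on W2 with smaller degree in t, or g vanishes on W2 up to a
     factor in s alone. *)
  have [r0|r0] := eqVneq (resultant h g) 0; last first.
    exists (resultant h g) => //.
    have [[u v] _ ->] := resultant_in_ideal (eq_ind_r (fun k => (1 < k)%N) n1 hs) sg.
    by apply: vanish_add; rewrite mulrC; apply: vanish_mul => //; apply: sub.
  exfalso; have := resultant_eq0 h g; rewrite r0 eqxx => /esym sD.
  have /Pdiv.Idomain.dvdpP [[c1 h'] /= c10 e1] := dvdp_gcdl h g.
  have /Pdiv.Idomain.dvdpP [[c2 g'] /= c20 e2] := dvdp_gcdr h g.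
  set D := gcdp h g in sD e1 e2.
  have : vanish W2 (h' * D) by rewrite -e1 -mul_polyC mulrC; apply: vanish_mul.
  case/p2.2 => [vh'|vD].
    have h'0 : h' != 0.
      by apply/eqP => e; move/eqP: e1; rewrite -mul_polyC e mul0r mulf_eq0 polyC_eq0 (negPf c10) (negPf hn0).
    have D0 : D != 0 by apply/eqP => e; move: sD; rewrite e size_poly0.
    have := min1' h' h'0 vh'; rewrite leqNgt -hs -(size_scale h c10) e1 size_mul //.
    move: sD; case: (size D) => [|[|k]] // _; rewrite addnS /= addnS ltnS leq_addr //.
  have : vanish W2 (c2%:P * g) by rewrite mul_polyC e2 mulrC; apply: vanish_mul.
  by case/p2.2 => // /(nconst _ c20).
have [s1 hs1] := prime_vanish_const p1 c0 c1.
(* h does not vanish on the whole line: dividing it by s - s1 would keep the degree in t and lower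
   the degree in s. *)
apply: (line s1 h hs1 (sub _ hv)); apply/eqP => /subs0_eq0 [h' e].
have : vanish W2 h by []; rewrite e => /p2.2 [|vh'].
  by apply: nconst; rewrite polyXsubC_eq0.
have h'0 : h' != 0 by apply/eqP => e'; move: hn0; rewrite e e' mulr0 eqxx.
have X0 : 'X - s1%:P != 0 :> {poly K} by rewrite polyXsubC_eq0.
have sz : size h' = n.
  by rewrite -hs e size_Cmul.
have := min2 (size (swapXY h')); rewrite -hm => H.
have : (size (swapXY h) <= size (swapXY h'))%N by apply: H; apply/asboolP; exists h'.
rewrite e rmorphM /= swapXY_polyC rmorphB /= map_polyX map_polyC /=.
rewrite size_mul ?polyXsubC_eq0 ?swapXY_eq0 // size_XsubC /=.
by rewrite ltnn.
Qed.

End Plane.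

(** * Plane charts bound the dimension by two *)

Section PlaneCharts.
Variable K : closedFieldType.

Lemma zclosed_sep N (A Z : set 'rV[K]_N.+1) : zclosed Z -> (forall x, A x -> x != 0) ->
  ~ A `<=` Z ->
  exists d (F : 'rV[K]_N.+1 -> K), [/\ hpoly d F, forall x, Z x -> F x = 0 &
    exists2 x, A x & F x != 0].
Proof.
move=> /zclosedP [S [hS ->]] A0 /existsNP [x /not_implyP [Ax /not_andP nx]].
have [/negP|/existsNP [F /not_implyP [SF Fx]]] := nx; first by rewrite A0.
have [d hd] := hS F SF; exists d, F; split=> //; first by move=> z [_]; apply.
by exists x => //; apply/eqP.
Qed.

Definition ev2m (s t : K) : {rmorphism {poly {poly K}} -> K} :=
  horner_eval s \o horner_eval t%:P.

Lemma hpoly_ev2 N d (F : 'rV[K]_N.+1 -> K) (G : 'I_N.+1 -> {poly {poly K}}) :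
  hpoly d F -> exists f, forall s t, ev2 s t f = F (\row_l ev2 s t (G l)).
Proof.
move=> [p _ pE].
exists (mmap ((polyC \o polyC) : {rmorphism K -> {poly {poly K}}}) G p) => s t.
rewrite -pE /peval mevalE /mmap -[LHS]/(ev2m s t _) rmorph_sum; apply: eq_bigr => m _.
rewrite rmorphM /= /horner_eval /= !hornerC; congr (_ * _).
rewrite -[LHS]/(ev2m s t _) rmorph_prod; apply: eq_bigr => i _.
by rewrite rmorphXn mxE.
Qed.

Lemma hpoly_homogenize N (l a b : 'rV[K]_N.+1 -> K) (f : {poly {poly K}}) :
  hpoly 1 l -> hpoly 1 a -> hpoly 1 b ->
  exists d F, hpoly d F /\
    forall x, l x != 0 -> F x = l x ^+ d * ev2 (a x / l x) (b x / l x) f.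
Proof.
move=> hl ha hb; pose n := size f; pose m := (\max_(j < n) size (f`_j)%R)%N.
exists (m + n)%N, (fun x => \sum_(j < n) \sum_(i < m)
    f`_j`_i * (a x ^+ i * l x ^+ (m - i) * (b x ^+ j * l x ^+ (n - j)))); split.
  apply: hpoly_sum => j; apply: hpoly_sum => i; apply: hpolyZ.
  have hX F k : hpoly 1 F -> hpoly k (fun x : 'rV[K]_N.+1 => F x ^+ k).
    by move=> /(hpolyXn k); rewrite mul1n.
  have -> : (m + n = i + (m - i) + (j + (n - j)))%N.
    by rewrite !subnKC // ltnW.
  by apply: hpolyM; apply: hpolyM; apply: hX.
move=> x lx; rewrite /ev2 (horner_coef f) horner_sum mulr_sumr; apply: eq_bigr => j _.
rewrite -rmorphXn hornerM hornerC (@horner_coef_wide _ m f`_j); last first.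
  by rewrite /m (bigD1 j) //= leq_maxl.
rewrite mulr_suml mulr_sumr; apply: eq_bigr => i _.
have -> : l x ^+ (m + n) = l x ^+ i * l x ^+ (m - i) * (l x ^+ j * l x ^+ (n - j)).
  by rewrite -!exprD !subnKC ?exprD // ltnW.
rewrite !expr_div_n; field.
by rewrite !expf_neq0.
Qed.

(** Near P the set embeds in the plane by a/l and b/l, with an inverse G that is polynomial in these
    two functions. *)
Definition plane_chart N (A : set 'rV[K]_N.+1) (P : 'rV[K]_N.+1) :=
  exists d (q l a b : 'rV[K]_N.+1 -> K) (G : 'I_N.+1 -> {poly {poly K}}),
  [/\ hpoly d q, q P != 0, [/\ hpoly 1 l, hpoly 1 a & hpoly 1 b] &
      forall x, A x -> q x != 0 -> l x != 0 /\
        same_point (\row_j ev2 (a x / l x) (b x / l x) (G j)) x].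

(** A chart at a point of the smallest member meets the whole chain. The traces in the plane are
    prime and still increase strictly, because a form that vanishes on one member and not on the
    next becomes a polynomial with the same property. [no_plane_chain] applies to the three largest
    traces, the smallest one showing that the next is not a point. *)
Lemma plane_charts_dim N (A : set 'rV[K]_N.+1) : (forall x, A x -> x != 0) ->
  (forall P, A P -> plane_chart A P) -> ~ exists Z, irreducible_chain A 3 Z.
Proof.
move=> A0 ch [Z [hZ lt]].
have [c0 [[P ZP] i0] s0] := hZ 0 isT.
have [d [q [l [a [b [G [hq qP [hl ha hb] H]]]]]]] := ch P (s0 _ ZP).
have ZA i x : (i <= 3)%N -> Z i x -> A x by move=> /hZ [_ _]; apply.
have mono i : (i < 3)%N -> Z i `<=` Z i.+1 by move=> /lt [].
have ZiP i : (i <= 3)%N -> Z i P.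
  by elim: i => // i IH hi; apply: (mono) => //; apply: IH; apply: ltnW.
pose W i : set (K * K) := [set st | exists x,
  [/\ Z i x, q x != 0 & st = (a x / l x, b x / l x)]].
have vW i f : vanish (W i) f <-> forall x, Z i x -> q x != 0 -> ev2 (a x / l x) (b x / l x) f = 0.
  split=> [h x Zx qx|h s t [x [Zx qx [-> ->]]]]; last exact: h.
  by apply: h; exists x.
have pW i : (i <= 3)%N -> prime_set (W i).
  move=> hi; have [ci ii si] := hZ i hi; split.
    by exists (a P / l P, b P / l P), P; split=> //; exact: ZiP.
  move=> f g; have [df [Ff [hFf Ef]]] := hpoly_homogenize f hl ha hb.
  have [dg [Fg [hFg Eg]]] := hpoly_homogenize g hl ha hb.
  move=> /vW fg.
  have Z0 x : Z i x -> x != 0 by move=> /(ZA i x hi) /A0.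
  have van x : Z i x -> Ff x * Fg x = 0.
    move: x; apply: (irreducible_vanish ii Z0 (hpolyM hFf hFg) hq).
      by exists P => //; exact: ZiP.
    move=> x Zx qx; have [lx _] := H x (ZA i x hi Zx) qx.
    by rewrite Ef // Eg // mulrACA -ev2M fg // mulr0.
  have back h dh (Fh : 'rV[K]_N.+1 -> K) :
     (forall x, l x != 0 -> Fh x = l x ^+ dh * ev2 (a x / l x) (b x / l x) h) ->
     Z i `<=` [set x | x != 0 /\ forall u : unit, Fh x = 0] -> vanish (W i) h.
    move=> Eh sub; apply/vW => x Zx qx; have [lx _] := H x (ZA i x hi Zx) qx.
    have [_ /(_ tt)] := sub x Zx; rewrite Eh // => /eqP.
    by rewrite mulf_eq0 expf_eq0 (negPf lx) andbF => /eqP.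
  have cl dh (Fh : 'rV[K]_N.+1 -> K) : hpoly dh Fh ->
     zclosed [set x | x != 0 /\ forall u : unit, Fh x = 0].
    by move=> hF; apply: (zclosed_hpoly (F := fun _ : unit => Fh)) => // _; exists dh.
  have [|sub|sub] := ii.2 _ _ (cl _ _ hFf) (cl _ _ hFg).
  - move=> x Zx; have /eqP := van x Zx; rewrite mulf_eq0 => /orP [] /eqP e; [left|right];
      by split=> //; exact: Z0.
  - by left; apply: back Ef sub.
  - by right; apply: back Eg sub.
have sep i : (i < 3)%N -> exists f, vanish (W i) f /\ ~ vanish (W i.+1) f.
  move=> hi; have [_ nsub] := lt i hi; have [ci _ _] := hZ i (ltnW hi).
  have [ci' ii' _] := hZ i.+1 hi.
  have Z0 x : Z i.+1 x -> x != 0 by move=> /(ZA i.+1 x hi) /A0.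
  have [e [F [hF v0 [x Zx Fx]]]] := zclosed_sep ci Z0 nsub.
  have [f fE] := hpoly_ev2 G hF; exists f.
  have ev x' : A x' -> q x' != 0 -> (ev2 (a x' / l x') (b x' / l x') f == 0) = (F x' == 0).
    move=> Ax' qx'; have [_ sp] := H x' Ax' qx'.
    by rewrite fE (hpoly_same_point hF sp).
  split.
    apply/vW => x' Zx' qx'; apply/eqP; rewrite ev ?v0 //.
    exact: (ZA i x' (ltnW hi)).
  move=> /vW vf; move/eqP: Fx; apply.
  apply: (irreducible_vanish ii' Z0 hF hq) Zx.
    by exists P => //; exact: ZiP.
  move=> x' Zx' qx'; apply/eqP; rewrite -ev; [exact/eqP/vf | exact: (ZA i.+1) | exact: qx'].
have WS i : (i < 3)%N -> W i `<=` W i.+1.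
  by move=> hi st [x [Zx qx ->]]; exists x; split=> //; exact: mono.
have [g0 [g0a g0b]] := sep 0 isT; have [g [ga gb]] := sep 1 isT.
have [f [fa fb]] := sep 2 isT.
apply: (no_plane_chain (WS 1 isT) (WS 2 isT) (pW 1 isT) (pW 2 isT) _ g0b ga gb fa fb).
exists (a P / l P), (b P / l P); split.
  by exists P; split=> //; exact: ZiP.
by apply: g0a; exists P.
Qed.

End PlaneCharts.

(** * Plane charts of the blow-up *)

Section ChartsOfY.
Variables (T : finType) (K : closedFieldType) (rho w : T -> K).
Hypothesis rho_inj : injective rho.

Local Notation idK := (idfun : {rmorphism K -> K}).
Local Notation kk := ((polyC \o polyC) : {rmorphism K -> {poly {poly K}}}).
Local Notation Y := (Yset rho w).
Local Notation N := (amb T).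
Local Notation coK := (@co T K).

Lemma hpoly_co e : hpoly 1 (fun x : 'rV[K]_N.+1 => coK x e).
Proof. exact: hpolyX. Qed.

Definition std (L : comNzRingType) (k : 'I_3) (s : L) : 'I_3 -> L :=
  if k == o0 then pt 1 s else pt s 1.

(* A linear form that does not vanish at P, and outside of whose zeros
   the points of Y do not lie on the exceptional curve E_j. *)
Lemma not_center_form P e0 j : Y P -> coK P e0 != 0 ->
  ~ (slice P e0 iy o1 = rho j * slice P e0 iy o0 /\
     slice P e0 iw o1 = w j * slice P e0 iw o0) ->
  exists q : 'rV[K]_N.+1 -> K, [/\ hpoly 1 q, q P != 0 & forall x, q x != 0 ->
  ~ (slice x e0 iy o1 = rho j * slice x e0 iy o0 /\
     slice x e0 iw o1 = w j * slice x e0 iw o0)].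
Proof.
move=> YP P0 /not_andP [n|n].
  exists (fun x => coK x (upd e0 iy o1) - rho j * coK x (upd e0 iy o0)); split.
  - by apply: hpolyB; [|apply: hpolyZ]; exact: hpoly_co.
  - by rewrite subr_eq0; apply/eqP.
  - by move=> x; rewrite subr_eq0 => /eqP h [].
exists (fun x => coK x (upd e0 iw o1) - w j * coK x (upd e0 iw o0)); split.
- by apply: hpolyB; [|apply: hpolyZ]; exact: hpoly_co.
- by rewrite subr_eq0; apply/eqP.
- by move=> x; rewrite subr_eq0 => /eqP h [].
Qed.

Lemma ev2N (s t : K) f : ev2 s t (- f) = - ev2 s t f.
Proof. by rewrite /ev2 !hornerN. Qed.

Lemma ev2CC (s t : K) c : ev2 s t c%:P%:P = c.
Proof. by rewrite /ev2 /= !hornerC. Qed.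

Lemma ev2_1 (s t : K) : ev2 s t 1 = 1.
Proof. exact: (ev2CC s t 1). Qed.

Lemma ev2_0 (s t : K) : ev2 s t 0 = 0.
Proof. exact: (ev2CC s t 0). Qed.

Let ev2E := (ev2CC, ev2M, ev2D, ev2N, ev2_1, ev2_0).

Lemma ev2_chart s t (y z : 'I_3 -> {poly {poly K}}) i k :
  ev2 s t (chart rho w kk y z i k) =
  chart rho w idK (fun k => ev2 s t (y k)) (fun k => ev2 s t (z k)) i k.
Proof.
by move: i k; apply: idxP => // j; apply: I3P; rewrite /chart /cvec /vec3 /= !ev2E.
Qed.

Lemma ev2_echart s t j0 (S A B : {poly {poly K}}) i k :
  ev2 s t (echart rho w kk j0 S A B i k) =
  echart rho w idK j0 (ev2 s t S) (ev2 s t A) (ev2 s t B) i k.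
Proof.
move: i k; apply: idxP => [||j]; apply: I3P; rewrite /echart /=;
  by try case: (j == j0); rewrite /cvec /pt /vec3 /= ?ev2E.
Qed.

Lemma ev2_std s t k (u : {poly {poly K}}) k' :
  ev2 s t (std k u k') = std k (ev2 s t u) k'.
Proof.
rewrite -[LHS]/(ev2m s t _) /std; case: ifP => _; move: k'; apply: I3P;
  by rewrite /pt /vec3 /= ?rmorph1 ?rmorph0.
Qed.

Lemma ev2_tens s t (v : idx T -> 'I_3 -> {poly {poly K}}) e : ev2 s t (tens v e) = tens (fun i k => ev2 s t (v i k)) e.
Proof. exact: (rmorph_tens (ev2m s t)). Qed.

Lemma ev2_s (s t : K) : ev2 s t ('X%:P) = s.
Proof. by rewrite /ev2 hornerC hornerX. Qed.

Lemma ev2_t (s t : K) : ev2 s t 'X = t.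
Proof. by rewrite /ev2 hornerX hornerC. Qed.

Lemma std_slice x e0 i : i = iy \/ i = iw -> Y x -> coK x e0 != 0 ->
  forall k, slice x e0 i k = coK x e0 * std (e0 i) (coK x (upd e0 i (flip (e0 i))) / coK x e0) k.
Proof.
move=> hi Yx x0; have [nv [y2 w2 _ _] _] := Yset_slice Yx x0.
have s2 : slice x e0 i o2 = 0 by case: hi => ->.
have ex : slice x e0 i (e0 i) = coK x e0 by exact: slice_diag.
have e0i : e0 i != o2 by apply/eqP => e; move: x0; rewrite -ex e s2 eqxx.
rewrite /std /flip; move: ex e0i; move: (e0 i); apply: I3P => // ex _; apply: I3P;
  rewrite /pt /vec3 /= ?mulr0 ?mulr1 ?s2 // mulrC divfK //.
Qed.

(** The plane coordinates are the affine coordinates of y and w given by [e0]; the form q removes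
    the exceptional curves, none of which contains P. *)
Lemma nchart P e0 : Y P -> coK P e0 != 0 ->
  (forall j, ~ (slice P e0 iy o1 = rho j * slice P e0 iy o0 /\
     slice P e0 iw o1 = w j * slice P e0 iw o0)) -> plane_chart Y P.
Proof.
move=> YP P0 nc.
have /choice [q hq] := fun j => not_center_form YP P0 (nc j).
exists (1 + \sum_(j : T) 1)%N, (fun x => coK x e0 * \prod_j q j x), (fun x => coK x e0),
  (fun x => coK x (upd e0 iy (flip (e0 iy)))), (fun x => coK x (upd e0 iw (flip (e0 iw)))),
  (fun l => tens (chart rho w kk (std (e0 iy) 'X%:P) (std (e0 iw) 'X)) (dec l)).
split.
- apply: hpolyM; first exact: hpoly_co.
  by apply: hpoly_prod => j; case: (hq j).
- by rewrite mulf_neq0 //; apply/prodf_neq0 => j _; case: (hq j).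
- by split; exact: hpoly_co.
move=> x Yx; rewrite mulf_eq0 negb_or => /andP [x0 /prodf_neq0 qx]; split=> //.
have [nv hv [c c0 xE]] := Yset_slice Yx x0.
apply: (@same_point_trans _ _ (mkx (tens (slice x e0)))); last by exists c.
set s := coK x (upd e0 iy _) / _; set t := coK x (upd e0 iw _) / _.
have sy : forall k, slice x e0 iy k = coK x e0 * std (e0 iy) s k by apply: std_slice; auto.
have sw : forall k, slice x e0 iw k = coK x e0 * std (e0 iw) t k by apply: std_slice; auto.
have /choice [cj hcj] : forall j, exists c, c != 0 /\
      forall k, slice x e0 (iz j) k = c * cvec rho w idK j (slice x e0 iy) (slice x e0 iw) k.
  move=> j; have [h|[c' c0' h]] := center_or_cvec j nv hv; last by exists c'.
  by have [_ _ /(_ x (qx j isT))] := hq j; case.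
have -> : (\row_l ev2 s t (tens (chart rho w kk (std (e0 iy) 'X%:P) (std (e0 iw) 'X)) (dec l)))
    = mkx (tens (chart rho w idK (std (e0 iy) s) (std (e0 iw) t))) :> 'rV[K]_N.+1.
  apply/rowP => l; rewrite !mxE ev2_tens; apply: eq_bigr => i _; rewrite ev2_chart.
  congr (chart _ _ _ _ _ _ _); apply/funext => k; by rewrite ev2_std ?ev2_s ?ev2_t.
pose c' (i : idx T) := match i with Some (Some j) => cj j * (coK x e0 * coK x e0)
   | _ => coK x e0 end.
apply: (@mkx_tensZ _ _ _ _ c').
  by case=> [[j|]|] //=; rewrite !mulf_neq0 //; case: (hcj j).
case=> [[j|]|] k /=; rewrite ?sy ?sw //.
have [_ ->] := hcj j; move: k; apply: I3P; rewrite /cvec /vec3 /= !sy !sw; ring.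
Qed.

Definition eab (L : comNzRingType) (l0 : 'I_3) (t : L) : L * L :=
  if l0 == o0 then (1, t) else (t, 1).

(** The plane coordinates are those of [echart]: the parameter s transverse to the exceptional
    curve, and the direction in affine form. *)
Lemma e_chart P e0 j0 : Y P -> coK P e0 != 0 ->
  slice P e0 iy o1 = rho j0 * slice P e0 iy o0 ->
  slice P e0 iw o1 = w j0 * slice P e0 iw o0 -> plane_chart Y P.
Proof.
move=> YP P0 cy cw.
have [nv hv [c c0 PE]] := Yset_slice YP P0; have [y2 w2 /(_ j0) hy /(_ j0) hw] := hv.
set v := slice P e0 in nv hv y2 w2 hy hw cy cw PE.
have vy : v iy o0 != 0.
  apply/eqP => e; have [k] := nv iy; move: k; apply: I3P; by rewrite ?cy ?e ?y2 ?mulr0 eqxx.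
have vw : v iw o0 != 0.
  apply/eqP => e; have [k] := nv iw; move: k; apply: I3P; by rewrite ?cw ?e ?w2 ?mulr0 eqxx.
have z2 : v (iz j0) o2 = 0.
  move: hy; rewrite cy /= subrr mulr0 => /esym/eqP.
  by rewrite mulf_eq0 (negPf vy) orbF => /eqP.
have [l0 l01 vz] : exists2 l0, (l0 == o0) || (l0 == o1) & v (iz j0) l0 != 0.
  have [k] := nv (iz j0); move: k; apply: I3P => h; last by rewrite z2 eqxx in h.
    by exists o0.
  by exists o1.
pose e1 := upd (upd (upd e0 iy o0) iw o0) (iz j0) l0.
have e1y : e1 iy = o0 by rewrite /e1 !ffunE.
have e1w : e1 iw = o0 by rewrite /e1 !ffunE.
have e1z : e1 (iz j0) = l0 by rewrite /e1 upd_same.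
have P1 : coK P e1 != 0.
  rewrite PE /coK mxE -/(coK _ _) coE mulf_neq0 //; apply/prodf_neq0.
  have h i : e1 i = e0 i -> v i (e1 i) != 0.
    by move=> ->; rewrite /v slice_diag.
  case=> [[j|]|] _; rewrite ?e1y ?e1w //.
  have [->|nj] := eqVneq j j0; first by rewrite e1z.
  apply: h; rewrite /e1 !ffunE; case: eqP => // -[e]; by rewrite e eqxx in nj.
have nc j : j != j0 -> ~ (slice P e1 iy o1 = rho j * slice P e1 iy o0 /\
     slice P e1 iw o1 = w j * slice P e1 iw o0).
  move=> nj [e _]; have [nv1 hv1 _] := Yset_slice YP P1.
  have s0 : slice P e1 iy o0 != 0 by rewrite -e1y slice_diag.
  have E : slice P e1 iy o1 = rho j0 * slice P e1 iy o0.
    have cz u e' : coK (c *: mkx u) e' = c * u e' by rewrite /co mxE -/(co _ _) coE.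
    by rewrite /slice PE !cz !tens_upd cy; ring.
  case/eqP: nj; apply: rho_inj; apply: (mulIf s0); by rewrite -e -E.
have /choice [q hq] : forall j, exists q : 'rV[K]_N.+1 -> K,
   [/\ hpoly 1 q, q P != 0 & j != j0 -> forall x, q x != 0 ->
  ~ (slice x e1 iy o1 = rho j * slice x e1 iy o0 /\
     slice x e1 iw o1 = w j * slice x e1 iw o0)].
  move=> j; have [->|/nc nj] := eqVneq j j0.
    by exists (fun x => coK x e1); split=> //; exact: hpoly_co.
  by have [q [h1 h2 h3]] := not_center_form YP P1 nj; exists q.
(* The numerator of s: in the direction (1 : t) one has w = w j0 + s, and in the direction (t : 1)
   one has y = rho j0 + s. *)
pose a (x : 'rV[K]_N.+1) := if l0 == o0 then coK x (upd e1 iw o1) - w j0 * coK x e1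
   else coK x (upd e1 iy o1) - rho j0 * coK x e1.
exists (1 + \sum_(j : T) 1)%N, (fun x => coK x e1 * \prod_j q j x), (fun x => coK x e1),
  a, (fun x => coK x (upd e1 (iz j0) (flip l0))),
  (fun l => tens (echart rho w kk j0 'X%:P (eab l0 'X).1 (eab l0 'X).2) (dec l)).
split.
- apply: hpolyM; first exact: hpoly_co.
  by apply: hpoly_prod => j; case: (hq j).
- by rewrite mulf_neq0 //; apply/prodf_neq0 => j _; case: (hq j).
- split; [exact: hpoly_co | | exact: hpoly_co].
  by rewrite /a; case: (l0 == o0); (apply: hpolyB; [|apply: hpolyZ]); exact: hpoly_co.
move=> x Yx; rewrite mulf_eq0 negb_or => /andP [x0 /prodf_neq0 qx]; split=> //.
have {c c0 PE} [nu hu [c c0 xE]] := Yset_slice Yx x0.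
apply: (@same_point_trans _ _ (mkx (tens (slice x e1)))); last by exists c.
set s := a x / _; set t := coK x (upd e1 (iz j0) _) / _.
have -> : (\row_l ev2 s t (tens (echart rho w kk j0 'X%:P (eab l0 'X).1 (eab l0 'X).2) (dec l)))
    = mkx (tens (echart rho w idK j0 s (eab l0 t).1 (eab l0 t).2)) :> 'rV[K]_N.+1.
  have ea : ev2 s t (eab l0 'X).1 = (eab l0 t).1.
    by rewrite /eab; case: ifP => _; rewrite /= ?ev2_t // -[1]/(1%:P : {poly {poly K}}) ev2C hornerC.
  have eb : ev2 s t (eab l0 'X).2 = (eab l0 t).2.
    by rewrite /eab; case: ifP => _; rewrite /= ?ev2_t // -[1]/(1%:P : {poly {poly K}}) ev2C hornerC.
  apply/rowP => l; rewrite !mxE ev2_tens; apply: eq_bigr => i _.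
  by rewrite ev2_echart ea eb ev2_s.
have {hu} [u2 u2' hu hu'] := hu.
have sy : slice x e1 iy o0 = coK x e1 by rewrite -e1y slice_diag.
have sw : slice x e1 iw o0 = coK x e1 by rewrite -e1w slice_diag.
have sz : slice x e1 (iz j0) l0 = coK x e1 by rewrite -e1z slice_diag.
move: (hu j0) (hu' j0); rewrite /= sy sw => k1 k2.
have stf : slice x e1 (iz j0) (flip l0) = coK x e1 * t by rewrite /t mulrC divfK.
have sE : a x = coK x e1 * s by rewrite /s mulrC divfK.
have [sz0 [sz1 sz2]] : slice x e1 (iz j0) o0 = coK x e1 * (eab l0 t).1 /\
   slice x e1 (iz j0) o1 = coK x e1 * (eab l0 t).2 /\
   [/\ slice x e1 (iz j0) o2 = coK x e1 * (s * (eab l0 t).1 * (eab l0 t).2),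
    slice x e1 iy o1 = coK x e1 * (rho j0 + s * (eab l0 t).2) &
    slice x e1 iw o1 = coK x e1 * (w j0 + s * (eab l0 t).1)].
  move: sE sz stf l01; rewrite /a /eab /flip; case: eqP => [->|_] sE sz stf.
    move=> _; rewrite sz stf mulr1; do 2!split=> //.
    have e3 : slice x e1 iw o1 - w j0 * coK x e1 = coK x e1 * s by rewrite -sE.
    have e2 : slice x e1 (iz j0) o2 = coK x e1 * (s * t).
      apply: (mulIf x0); rewrite -k2 e3 stf; ring.
    split; first by rewrite mulr1.
      apply: (mulfI x0); move: k1; rewrite sz e2 => k1.
      have -> : coK x e1 * slice x e1 iy o1 = coK x e1 * (slice x e1 iy o1 - rho j0 * coK x e1)
         + coK x e1 * coK x e1 * rho j0 by ring.
      by rewrite k1 /=; ring.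
    by rewrite mulr1 mulrDr -e3; ring.
  rewrite orFb => /eqP l1; rewrite l1 in sz; rewrite sz stf mulr1; do 2!split=> //.
  have e3 : slice x e1 iy o1 - rho j0 * coK x e1 = coK x e1 * s by rewrite -sE.
  have e2 : slice x e1 (iz j0) o2 = coK x e1 * (s * t).
    by apply: (mulIf x0); rewrite -k1 e3 stf; ring.
  split; first by rewrite mulr1.
    by rewrite mulr1 mulrDr -e3; ring.
  apply: (mulfI x0); move: k2; rewrite sz e2 => k2.
  have -> : coK x e1 * slice x e1 iw o1 = coK x e1 * (slice x e1 iw o1 - w j0 * coK x e1)
     + coK x e1 * coK x e1 * w j0 by ring.
  by rewrite k2 /=; ring.
have [szc suy suw] := sz2.
have /choice [cj hcj] : forall j, exists c, c != 0 /\ (j != j0 ->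
      forall k, slice x e1 (iz j) k = c * cvec rho w idK j (slice x e1 iy) (slice x e1 iw) k).
  move=> j; have [->|nj] := eqVneq j j0.
    by exists 1; split; [exact: oner_neq0|].
  have [h|[c' c0' h]] := center_or_cvec j nu (And4 u2 u2' hu hu'); last by exists c'.
  by have [_ _ /(_ nj x (qx j isT))] := hq j; case.
pose c' (i : idx T) := match i with
   | Some (Some j) => if j == j0 then coK x e1 else cj j * (coK x e1 * coK x e1)
   | _ => coK x e1 end.
apply: (@mkx_tensZ _ _ _ _ c').
  by case=> [[j|]|] //=; case: ifP => // _; rewrite !mulf_neq0 //; case: (hcj j).
case=> [[j|]|] k /=.
- have [->|nj] := eqVneq j j0; first by move: k; apply: I3P.
  have [_ /(_ nj) ->] := hcj j.
  move: k; apply: I3P; rewrite /cvec /pt /vec3 /= ?sy ?sw ?suy ?suw; ring.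
- by move: k; apply: I3P; rewrite /pt /vec3 /= ?sw ?suw ?u2' ?mulr1 ?mulr0.
- by move: k; apply: I3P; rewrite /pt /vec3 /= ?sy ?suy ?u2 ?mulr1 ?mulr0.
Qed.

Lemma Y_plane_chart P : Y P -> plane_chart Y P.
Proof.
move=> YP; have [e0 P0] := co_neq0 (Yset_neq0 YP).
have [[j0 [h1 h2]]|nc] := pselect (exists j0, slice P e0 iy o1 = rho j0 * slice P e0 iy o0 /\
     slice P e0 iw o1 = w j0 * slice P e0 iw o0).
  exact: e_chart P0 h1 h2.
by apply: (nchart YP P0) => j h; apply: nc; exists j.
Qed.

Lemma Y_no_chain : ~ exists Z, irreducible_chain Y 3 Z.
Proof.
apply: plane_charts_dim; [exact: Yset_neq0 | exact: Y_plane_chart].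
Qed.

End ChartsOfY.

(** * Dimension two and rationality *)

Section DimensionRationality.
Variables (T : finType) (K : closedFieldType) (rho w : T -> K).
Hypothesis rho_inj : injective rho.

Local Notation idK := (idfun : {rmorphism K -> K}).
Local Notation cK := (polyC : {rmorphism K -> {poly K}}).
Local Notation Y := (Yset rho w).
Local Notation N := (amb T).
Local Notation coK := (@co T K).
Local Notation gpt := (gpt rho w).

Lemma nondeg_coord (v : idx T -> 'I_3 -> K) i k : nondeg v -> v i k != 0 ->
  exists e, tens v (upd e i k) != 0.
Proof.
move=> /choice [f hf] vik; exists [ffun i => f i].
apply/prodf_neq0 => i' _; rewrite !ffunE; have [->|_] := eqVneq i' i => //.
Qed.

(** The fibre over y = infinity contains no centre, so it is a projective line with coordinate w. *)
Definition fibre : set 'rV[K]_N.+1 :=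
  Y `&` [set x | x != 0 /\ forall e, coK x (upd e iy o0) = 0].
Definition fibre_pt : set 'rV[K]_N.+1 :=
  fibre `&` [set x | x != 0 /\ forall e, coK x (upd e iw o0) = 0].

Lemma fibre_closed : zclosed fibre.
Proof.
apply: zclosedI; first exact: Yset_closed.
apply: (zclosed_hpoly (F := fun e x => coK x (upd e iy o0))) => // e.
by exists 1%N; exact: hpoly_co.
Qed.

Lemma fibre_pt_closed : zclosed fibre_pt.
Proof.
apply: zclosedI; first exact: fibre_closed.
apply: (zclosed_hpoly (F := fun e x => coK x (upd e iw o0))) => // e.
by exists 1%N; exact: hpoly_co.
Qed.

Lemma inf_nondeg (z : 'I_3 -> K) : z o2 = 0 -> (exists k, z k != 0) ->
  nondeg (chart rho w idK (pt 0 1) z).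
Proof.
move=> z2 nz; apply: chart_nondeg => //.
  by exists o1; rewrite /pt /vec3 /= oner_neq0.
move=> j; rewrite /cvec /pt /vec3 /=.
have [z0|z0] := eqVneq (z o0) 0.
  by exists o2 => /=; rewrite z0 !mulr0 !subr0 mul1r; apply: nz3.
by exists o1 => /=; rewrite mulr0 subr0 mul1r.
Qed.

Lemma inf_fibre (z : 'I_3 -> K) : z o2 = 0 -> (exists k, z k != 0) ->
  fibre (mkx (tens (chart rho w idK (pt 0 1) z))).
Proof.
move=> z2 nz; have nd := inf_nondeg z2 nz.
have Yx := chart_Y (rho := rho) (w := w) (y := pt 0 1) (z := z) erefl z2 nd.
split=> //; split; first exact: Yset_neq0 Yx.
by move=> e; rewrite coE tens_upd /= /pt /vec3 /= mulr0.
Qed.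

Lemma fibreP x : fibre x -> exists z : 'I_3 -> K, [/\ z o2 = 0, exists k, z k != 0 &
  same_point (mkx (tens (chart rho w idK (pt 0 1) z))) x].
Proof.
case=> /YsetP [v [nv hv ->]] [_ he]; have [y2 w2 _ _] := hv.
have y0 : v iy o0 = 0.
  apply/eqP/negPn/negP => h; have [e] := nondeg_coord nv h.
  by have := he e; rewrite coE => ->; rewrite eqxx.
have y1 := nz3 (nv iy) y2 y0.
exists (v iw); split=> //.
have /choice [c hc] : forall j, exists c, c != 0 /\
    forall k, v (iz j) k = c * cvec rho w idK j (v iy) (v iw) k.
  move=> j; have [[h _]|[c c0 h]] := center_or_cvec j nv hv; last by exists c.
  by move: y1; rewrite h y0 mulr0 eqxx.
pose c' (i : idx T) := match i with Some (Some j) => c j * v iy o1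
   | Some None => 1 | None => v iy o1 end.
apply: (@mkx_tensZ _ _ _ _ c').
  case=> [[j|]|] //=; rewrite ?oner_neq0 // mulf_neq0 //; by case: (hc j).
case=> [[j|]|] /=; last by apply: I3P; rewrite /pt /vec3 /= ?y0 ?y2 ?mulr0 ?mulr1.
  have [_ h] := hc j; by apply: I3P; rewrite h /cvec /pt /vec3 /= y0; ring.
by move=> k; rewrite mul1r.
Qed.

Lemma fibre_irreducible : zirreducible fibre.
Proof.
split; first by exists (mkx (tens (chart rho w idK (pt 0 1) (pt 0 1))));
  apply: inf_fibre => //; exists o1; rewrite /pt /vec3 /= oner_neq0.
have fib0 x : fibre x -> x != 0 by case=> /Yset_neq0.
move=> Z1 Z2 c1 c2 sub.
have [|n1] := pselect (fibre `<=` Z1); first by left.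
have [|n2] := pselect (fibre `<=` Z2); first by right.
exfalso.
have [d1 [F1 [hF1 v1 [x1 X1 nz1]]]] := zclosed_sep c1 fib0 n1.
have [d2 [F2 [hF2 v2 [x2 X2 nz2]]]] := zclosed_sep c2 fib0 n2.
have [z1 [z12 nd1 sp1]] := fibreP X1; have [z2 [z22 nd2 sp2]] := fibreP X2.
pose z : 'I_3 -> {poly K} := lin z1 (fun k => z2 k - z1 k).
pose v := chart rho w cK (pt 0 1) z.
have hv : onY rho w cK v.
  by apply: chart_onY => //; rewrite /z /lin z12 z22 subrr mulr0 addr0.
have vt t : prow (tens v) t =
    mkx (tens (chart rho w idK (pt 0 1) (fun k => z1 k + t * (z2 k - z1 k)))).
  rewrite prow_tens; congr mkx; congr tens.
  apply/funext => i; apply/funext => k; rewrite /at_ /v.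
  move: i k; apply: idxP; [apply: I3P | move=> k | move=> j; apply: I3P];
   rewrite /= /cvec /pt /vec3 /= /z
     !(lin_at, hornerM, hornerD, hornerN, hornerC) ?horner0 //.
have [f1 e1] := hpoly_curve (fun l => tens v (dec l)) hF1.
have [f2 e2] := hpoly_curve (fun l => tens v (dec l)) hF2.
have v0 : prow (tens v) 0 = mkx (tens (chart rho w idK (pt 0 1) z1)).
  by rewrite vt; congr (mkx (tens (chart _ _ _ _ _))); apply/funext => k; rewrite mul0r addr0.
have v11 : prow (tens v) 1 = mkx (tens (chart rho w idK (pt 0 1) z2)).
  by rewrite vt; congr (mkx (tens (chart _ _ _ _ _))); apply/funext => k; rewrite mul1r addrC subrK.
have nf1 : f1 != 0.
  apply/eqP => e; move: nz1; rewrite (hpoly_same_point hF1 sp1) -v0 /prow -e1 e horner0.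
  by rewrite eqxx.
have nf2 : f2 != 0.
  apply/eqP => e; move: nz2; rewrite (hpoly_same_point hF2 sp2) -v11 /prow -e2 e horner0.
  by rewrite eqxx.
have [e he] : exists e, tens v e != 0.
  have [e he] := tens_neq0 (inf_nondeg z12 nd1); exists e; apply/eqP => te.
  by move: he; rewrite -coE -v0 /prow /co mxE encK te horner0 eqxx.
have /closed_nonrootP [t] : f1 * f2 * tens v e != 0 by exact: mulf_neq0 (mulf_neq0 nf1 nf2) he.
rewrite /root 2!hornerM 2!mulf_eq0 !negb_or => /andP [/andP [t1 t2] t3].
have Yt := Y_curve hv t3.
have Dt : fibre (prow (tens v) t).
  split=> //; split; first exact: Yset_neq0 Yt.
  by move=> e'; rewrite /co mxE encK tens_upd /= /pt /vec3 /= mulr0 horner0.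
have [/v1|/v2] := sub _ Dt; rewrite -[X in X = _]/(_ (\row__ _)).
  by rewrite -e1 => /eqP; rewrite (negPf t1).
by rewrite -e2 => /eqP; rewrite (negPf t2).
Qed.

Lemma fibre_pt_irreducible : zirreducible fibre_pt.
Proof.
pose p0 := mkx (tens (chart rho w idK (pt 0 1) (pt 0 1))) : 'rV[K]_N.+1.
have p0f : fibre_pt p0.
  have f : fibre p0 by apply: inf_fibre => //; exists o1; rewrite /pt /vec3 /= oner_neq0.
  split=> //; split; first by case: f => /Yset_neq0.
  by move=> e; rewrite coE tens_upd /= /pt /vec3 /= mulr0.
have all x : fibre_pt x -> same_point p0 x.
  move=> [/fibreP [z [z2 nz sp]] [_ h]].
  have z0 : z o0 = 0.
    apply/eqP/negPn/negP => h0; have [e] := nondeg_coord (i := iw) (inf_nondeg z2 nz) h0.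
    have := hpoly_same_point (hpoly_co K (upd e iw o0)) sp.
    by rewrite h eqxx coE => <-.
  apply: same_point_trans sp; apply: (@mkx_tensZ _ _ _ _ (fun i => match i with
     | None => 1 | _ => z o1 end)).
    by have := nz3 nz z2 z0; move=> z1; case=> [[j|]|]; rewrite ?oner_neq0.
  apply: idxP => [k|k|j k]; rewrite ?mul1r //; move: k; apply: I3P;
    rewrite /= /cvec /pt /vec3 /= ?z0 ?z2; ring.
split; first by exists p0.
move=> Z1 Z2 c1 c2 sub; have [h|h] := sub _ p0f; [left|right];
  by move=> x /all sp; apply: zclosed_same_point sp h.
Qed.

Lemma Y_dim : has_dim Y 2.
Proof.
split; last exact: Y_no_chain.
exists (fun i => match i with 0 => fibre_pt | 1 => fibre | _ => Y end)%N; split.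
  case=> [|[|[|//]]] _; split.
  - exact: fibre_pt_closed.
  - exact: fibre_pt_irreducible.
  - by move=> x [[]].
  - exact: fibre_closed.
  - exact: fibre_irreducible.
  - by move=> x [].
  - exact: Yset_closed.
  - exact: Y_irreducible.
  - by [].
case=> [|[|//]] _; split; first by move=> x [].
- pose p1 := mkx (tens (chart rho w idK (pt 0 1) (pt 1 0))) : 'rV[K]_N.+1.
  have nd : nondeg (chart rho w idK (pt 0 1) (pt 1 0)).
    by apply: inf_nondeg => //; exists o0; rewrite /pt /vec3 /= oner_neq0.
  move=> /(_ p1) []; first by apply: inf_fibre => //; exists o0; rewrite /pt /vec3 /= oner_neq0.
  have [|e he] := nondeg_coord (i := iw) (k := o0) nd; first by rewrite /pt /vec3 /= oner_neq0.
  by move=> _ [_ /(_ e)]; rewrite coE => /eqP; rewrite (negPf he).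
- by move=> x [].
- have [a [b g]] := ex_generic rho w.
  move=> /(_ _ (gpt_Y g)) [_ [_ h]].
  have [|e he] := nondeg_coord (i := iy) (k := o0) (generic_nondeg g).
    by rewrite /pt /vec3 /= oner_neq0.
  by have := h e; rewrite coE => /eqP; rewrite (negPf he).
Qed.

(* The birational map to P^2 is (y0 w0 : y1 w0 : y0 w1). *)

Definition eU : mon T := [ffun i => match i with Some (Some _) => o1 | _ => o0 end].

(** At the factors [iz j] the index o1 of [eU] selects the coordinate (y - rho j) w0. Hence only the
    lines y = rho j and those at infinity are removed, and the two open sets correspond exactly. *)
Definition qU (x : 'rV[K]_N.+1) : K :=
  coK x eU * \prod_j (coK x (upd eU iy o1) - rho j * coK x eU).

Lemma qU_hpoly : exists d, hpoly d qU.
Proof.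
exists (1 + \sum_(j : T) 1)%N; apply: hpolyM; first exact: hpoly_co.
by apply: hpoly_prod => j; apply: hpolyB; [|apply: hpolyZ]; exact: hpoly_co.
Qed.

Definition qV (p : 'rV[K]_3) : K := p 0 o0 * \prod_j (p 0 o1 - rho j * p 0 o0).

Lemma qV_hpoly : exists d, hpoly d qV.
Proof.
exists (1 + \sum_(j : T) 1)%N; apply: hpolyM; first exact: (hpolyX K o0).
apply: hpoly_prod => j; apply: hpolyB; first exact: (hpolyX K o1).
by apply: hpolyZ; exact: (hpolyX K o0).
Qed.

Lemma gpt_nondeg a b : (forall j, a != rho j) -> nondeg (chart rho w idK (pt 1 a) (pt 1 b)).
Proof.
move=> ha; apply: chart_nondeg.
- by exists o0; rewrite /pt /vec3 /= oner_neq0.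
- by exists o0; rewrite /pt /vec3 /= oner_neq0.
- by move=> j; exists o1; rewrite /cvec /pt /vec3 /= !mulr1 subr_eq0.
Qed.

Lemma eU_gpt a b i : (forall j, a != rho j) -> i = iy \/ i = iw ->
  exists2 c, c != 0 & forall k, coK (gpt a b) (upd eU i k) =
     c * chart rho w idK (pt 1 a) (pt 1 b) i k.
Proof.
move=> ha hi; exists (\prod_(i' | i' != i) chart rho w idK (pt 1 a) (pt 1 b) i' (eU i')).
  apply/prodf_neq0; case=> [[j|]|] _; rewrite ffunE /= /cvec /pt /vec3 /= ?oner_neq0 //.
  by rewrite !mulr1 subr_eq0.
by move=> k'; rewrite coE tens_upd.
Qed.

Lemma eU_iy : upd eU iy o0 = eU. Proof. by apply/ffunP => i; rewrite !ffunE; case: eqP => [->|]. Qed.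
Lemma eU_iw : upd eU iw o0 = eU. Proof. by apply/ffunP => i; rewrite !ffunE; case: eqP => [->|]. Qed.

Lemma qU_gpt a b : (forall j, a != rho j) -> qU (gpt a b) != 0.
Proof.
move=> ha; have [c c0 hc] := eU_gpt b ha (or_introl erefl).
have e0 := hc o0; have e1 := hc o1; rewrite eU_iy in e0.
rewrite /qU e0 e1 /pt /vec3 /= mulf_neq0 ?mulr1 //.
by apply/prodf_neq0 => j _; rewrite mulrC -mulrBl mulf_neq0 // subr_eq0.
Qed.

Lemma qU_points x : Y x -> qU x != 0 ->
  exists a b, (forall j, a != rho j) /\ same_point (gpt a b) x.
Proof.
move=> /YsetP [v [nv hv ->]]; have [y2 w2 _ _] := hv.
rewrite /qU mulf_eq0 negb_or => /andP [e0 /prodf_neq0 hy]; rewrite !coE in e0.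
have t0 i : v i (eU i) != 0 by move: e0 => /prodf_neq0 /(_ i isT).
have y0 : v iy o0 != 0 by have := t0 iy; rewrite ffunE.
have z0 : v iw o0 != 0 by have := t0 iw; rewrite ffunE.
have hyj j : v iy o1 != rho j * v iy o0.
  apply/eqP => e; have /eqP := hy j isT; apply; rewrite -[in X in _ - X]eU_iy !coE !tens_upd e; ring.
exists (v iy o1 / v iy o0), (v iw o1 / v iw o0); split.
  move=> j; apply/eqP => e; have := hyj j; rewrite -e divfK // eqxx //.
have /choice [c hc] : forall j, exists c, c != 0 /\
    forall k, v (iz j) k = c * cvec rho w idK j (v iy) (v iw) k.
  move=> j; have [[h _]|[c c0 h]] := center_or_cvec j nv hv; last by exists c.
  by have := hyj j; rewrite h eqxx.
pose c' (i : idx T) := match i with Some (Some j) => c j * (v iy o0 * v iw o0)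
   | Some None => v iw o0 | None => v iy o0 end.
apply: (@mkx_tensZ _ _ _ _ c').
  case=> [[j|]|] //=; rewrite !mulf_neq0 //; by case: (hc j).
case=> [[j|]|] /=.
- by have [_ h] := hc j; apply: I3P; rewrite h /cvec /pt /vec3 /=; field; rewrite ?y0 ?z0.
- by apply: I3P; rewrite /pt /vec3 /= ?w2 ?mulr1 ?mulr0 // mulrCA divff ?mulr1.
- by apply: I3P; rewrite /pt /vec3 /= ?y2 ?mulr1 ?mulr0 // mulrCA divff ?mulr1.
Qed.

Definition toP2 (k : 'I_3) (x : 'rV[K]_N.+1) : K :=
  vec3 (coK x eU) (coK x (upd eU iy o1)) (coK x (upd eU iw o1)) k.

Definition ofP2 (k : 'I_N.+1) (p : 'rV[K]_3) : K :=
  tens (chart rho w idK (pt (p 0 o0) (p 0 o1)) (pt (p 0 o0) (p 0 o2))) (dec k).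

Definition aff (a b : K) : 'rV[K]_3 := \row_k vec3 1 a b k.

Lemma toP2_hpoly k : hpoly 1 (toP2 k).
Proof. by move: k; apply: I3P; exact: hpoly_co. Qed.

Lemma ofP2_hpoly : exists d, forall k, hpoly d (ofP2 k).
Proof.
pose dg (i : idx T) := match i with Some (Some _) => 2 | _ => 1 end%N.
exists (\sum_i dg i)%N => k; apply: hpoly_prod => i; move: (dec k i).
have hX l : hpoly 1 (fun p : 'rV[K]_3 => p 0 l) by exact: (hpolyX K).
have hB l c : hpoly 1 (fun p : 'rV[K]_3 => p 0 l - c * p 0 o0).
  by apply: hpolyB => //; exact: hpolyZ.
by move: i; apply: idxP => [||j]; apply: I3P; rewrite /= /cvec /pt /vec3 /=;
  [exact: hX | exact: hX | exact: hpoly0 | exact: hX | exact: hX | exact: hpoly0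
  | exact: (@hpolyM _ _ 1 1) | exact: (@hpolyM _ _ 1 1) | exact: (@hpolyM _ _ 1 1)].
Qed.

Lemma ofP2_aff a b : \row_k ofP2 k (aff a b) = gpt a b.
Proof.
apply/rowP => k; rewrite !mxE /ofP2; congr (tens (chart _ _ _ _ _) _);
 by apply/funext; apply: I3P; rewrite /pt /vec3 /= ?mxE.
Qed.

Lemma toP2_gpt a b : (forall j, a != rho j) ->
  same_point (aff a b) (\row_k toP2 k (gpt a b)).
Proof.
move=> ha; have [c c0 hc] := eU_gpt b ha (or_introl erefl).
have [c' c'0 hc'] := eU_gpt b ha (or_intror erefl).
have e0 := hc o0; have e1 := hc o1; have e2 := hc' o1; have e3 := hc' o0.
rewrite eU_iy in e0; rewrite eU_iw e0 in e3.
rewrite /pt /vec3 /= !mulr1 in e0 e1 e2 e3; rewrite -e3 in e2.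
exists c => //; apply/rowP; apply: I3P; rewrite !mxE /toP2 /vec3 /= ?e0 ?e1 ?e2 ?mulr1 //.
Qed.

Lemma Y_rational : rational_of_dim Y 2.
Proof.
have cl N' d (q : 'rV[K]_N'.+1 -> K) : hpoly d q ->
   zclosed [set x | x != 0 /\ forall u : unit, q x = 0].
  by move=> hq; apply: (zclosed_hpoly (F := fun _ : unit => q)) => // _; exists d.
have [dU hU] := qU_hpoly; have [dV hV] := qV_hpoly; have [dO hO] := ofP2_hpoly.
pose U := Y `\` [set x | x != 0 /\ forall u : unit, qU x = 0].
pose V := @proj_space K 2 `\` [set x | x != 0 /\ forall u : unit, qV x = 0].
have UE x : U x <-> Y x /\ qU x != 0.
  split=> [[Yx nx]|[Yx nx]]; split=> //; last by case=> _ /(_ tt) /eqP; rewrite (negPf nx).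
  by apply/eqP => e; apply: nx; split=> //; exact: Yset_neq0 Yx.
have VE p : V p <-> qV p != 0.
  split=> [[p0 np]|np].
    by apply/eqP => e; apply: np.
  split; last by case=> _ /(_ tt) /eqP; rewrite (negPf np).
  move: np; rewrite /qV mulf_eq0 negb_or => /andP [p0 _]; exact: rV_neq0P p0.
have Up a b : (forall j, a != rho j) -> U (gpt a b).
  move=> ha; apply/UE; split; last exact: qU_gpt.
  by apply: chart_Y => //; exact: gpt_nondeg.
have Vp a b : (forall j, a != rho j) -> V (aff a b).
  move=> ha; apply/VE; rewrite /qV !mxE /vec3 /= mulf_neq0 ?oner_neq0 //.
  by apply/prodf_neq0 => j _; rewrite mulr1 subr_eq0.
have UP x : U x -> exists a b, (forall j, a != rho j) /\ same_point (gpt a b) x.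
  by move=> /UE [Yx qx]; exact: qU_points.
have VP p : V p -> exists a b, (forall j, a != rho j) /\ same_point (aff a b) p.
  move=> /VE; rewrite /qV mulf_eq0 negb_or => /andP [p0 /prodf_neq0 h].
  exists (p 0 o1 / p 0 o0), (p 0 o2 / p 0 o0); split.
    move=> j; have := h j isT; rewrite subr_eq0; apply: contra => /eqP <-.
    by rewrite divfK.
  exists (p 0 o0) => //; apply/rowP; apply: I3P; rewrite !mxE /vec3 /= ?mulr1 //;
    by rewrite mulrCA divff ?mulr1.
have Vsp p p' : same_point p p' -> V p -> V p'.
  by move=> sp; rewrite !VE (hpoly_same_point hV sp).
have Usp x x' : same_point x x' -> U x -> U x'.
  move=> sp /UE [Yx qx]; apply/UE; rewrite (hpoly_same_point hU sp); split=> //.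
  exact: zclosed_same_point (@Yset_closed _ _ _ _) sp Yx.
pose phi (x : 'rV[K]_N.+1) := \row_k toP2 k x.
pose psi (p : 'rV[K]_3) := \row_k ofP2 k p.
have phiP x a b : (forall j, a != rho j) -> same_point (gpt a b) x -> same_point (aff a b) (phi x).
  move=> ha sp; apply: same_point_trans (toP2_gpt b ha) _.
  exact: row_hpoly_same_point toP2_hpoly sp.
have psiP p a b : same_point (aff a b) p -> same_point (gpt a b) (psi p).
  move=> sp; rewrite -ofP2_aff.
  exact: row_hpoly_same_point hO sp.
have gpt0 a b : (forall j, a != rho j) -> gpt a b != 0.
  by move=> /(Up _ b) /UE [] /Yset_neq0.
have aff0 a b : aff a b != 0 by apply: (@rV_neq0P _ _ _ o0); rewrite mxE /vec3 /= oner_neq0.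
have [a [b [ha hb]]] := ex_generic rho w.
exists U, V; split.
- by exists [set x | x != 0 /\ forall u : unit, qU x = 0] => //; exact: cl hU.
- by exists (gpt a b); apply: Up.
- by exists [set x | x != 0 /\ forall u : unit, qV x = 0] => //; exact: cl hV.
- by exists (aff a b); apply: Vp.
exists phi, psi; split.
- apply/regmapP; split=> [x /UP [a' [b' [g sp]]]|x /UP [a' [b' [g sp]]]].
    exact: Vsp (phiP _ _ _ g sp) (Vp _ _ g).
  exists 1%N, toP2; split; [exact: toP2_hpoly | | by move=> *; exact: same_point_refl].
  exact: same_point_neq0 (phiP _ _ _ g sp) (aff0 _ _).
- apply/regmapP; split=> [p /VP [a' [b' [g sp]]]|p /VP [a' [b' [g sp]]]].
    exact: Usp (psiP _ _ _ sp) (Up _ _ g).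
  exists dO, ofP2; split; [exact: hO | | by move=> *; exact: same_point_refl].
  exact: same_point_neq0 (psiP _ _ _ sp) (gpt0 _ _ g).
- move=> x /UP [a' [b' [g sp]]]; apply: same_point_trans (same_point_sym sp) _.
  exact: psiP (phiP _ _ _ g sp).
- move=> p /VP [a' [b' [g sp]]]; apply: same_point_trans (same_point_sym sp) _.
  exact: phiP g (psiP _ _ _ sp).
Qed.

End DimensionRationality.

(** * Real structures *)

Section RealStructures.
Variable R : realType.
Local Notation C := R[i].
Local Notation rc := (real_complex R : {rmorphism R -> C}).
Local Notation conj := (@conjc R).
Local Notation ci := (Complex 0 1 : C).

Lemma ci2 : ci * ci = -1. Proof. by rewrite -expr2 sqr_i. Qed.
Lemma conj_ci : conj ci = - ci. Proof. by apply/eqP; rewrite eq_complex /= oppr0 !eqxx. Qed.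
Lemma conj_rc a : conj (rc a) = rc a. Proof. exact: conjc_real. Qed.
Lemma conjM (x y : C) : conj (x * y) = conj x * conj y. Proof. exact: rmorphM. Qed.
Lemma conjD (x y : C) : conj (x + y) = conj x + conj y. Proof. exact: rmorphD. Qed.
Lemma conjN (x : C) : conj (- x) = - conj x. Proof. exact: rmorphN. Qed.
Lemma conj1 : conj 1 = 1. Proof. exact: rmorph1. Qed.
Lemma two_neq0 : (2%:R : C) != 0. Proof. by rewrite pnatr_eq0. Qed.

Definition cbar N (x : 'rV[C]_N) : 'rV[C]_N := map_mx conj x.

Definition theta N (s : 'I_N -> 'I_N) (x : 'rV[C]_N) : 'rV[C]_N :=
  \row_k conj (x 0 (s k)).

Lemma cbarK N : involutive (@cbar N).
Proof. by move=> x; apply/rowP => k; rewrite !mxE conjcK. Qed.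

Lemma same_point_cbar N (x y : 'rV[C]_N.+1) : same_point x y -> same_point (cbar x) (cbar y).
Proof.
move=> [c c0 ->]; exists (conj c); first by rewrite conjc_eq0.
by apply/rowP => k; rewrite !mxE rmorphM.
Qed.

Lemma same_point_theta N s (x y : 'rV[C]_N.+1) :
  same_point x y -> same_point (theta s x) (theta s y).
Proof.
move=> [c c0 ->]; exists (conj c); first by rewrite conjc_eq0.
by apply/rowP => k; rewrite !mxE rmorphM.
Qed.

(* [bm s] conjugates [theta s] into the standard conjugation. *)
Definition bm N (s : 'I_N -> 'I_N) : 'M[C]_N :=
  \matrix_(j, k) ((1 + ci) * (j == k)%:R + (1 - ci) * (j == s k)%:R).
Definition bm' N (s : 'I_N -> 'I_N) : 'M[C]_N :=
  \matrix_(j, k) (((1 + ci) * (j == k)%:R - (1 - ci) * (j == s k)%:R) / (4%:R * ci)).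

Lemma mul_bm N s (x : 'rV[C]_N) k :
  (x *m bm s) 0 k = (1 + ci) * x 0 k + (1 - ci) * x 0 (s k).
Proof.
rewrite mxE (eq_bigr (fun j => (1 + ci) * (x 0 j * (j == k)%:R)
   + (1 - ci) * (x 0 j * (j == s k)%:R))); last by move=> j _; rewrite mxE; ring.
rewrite big_split -!mulr_sumr /=; congr (_ * _ + _ * _).
  by rewrite (bigD1 k) //= eqxx mulr1 big1 ?addr0 // => j /negPf ->; rewrite mulr0.
by rewrite (bigD1 (s k)) //= eqxx mulr1 big1 ?addr0 // => j /negPf ->; rewrite mulr0.
Qed.

Lemma mul_bm' N s (x : 'rV[C]_N) k :
  (x *m bm' s) 0 k = ((1 + ci) * x 0 k - (1 - ci) * x 0 (s k)) / (4%:R * ci).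
Proof.
rewrite mxE (eq_bigr (fun j => (1 + ci) / (4%:R * ci) * (x 0 j * (j == k)%:R)
   - (1 - ci) / (4%:R * ci) * (x 0 j * (j == s k)%:R))); last first.
  by move=> j _; rewrite mxE; ring.
rewrite sumrB -!mulr_sumr /=.
have E k' : \sum_j x 0 j * (j == k')%:R = x 0 k'.
  by rewrite (bigD1 k') //= eqxx mulr1 big1 ?addr0 // => j /negPf ->; rewrite mulr0.
by rewrite !E; ring.
Qed.

Lemma four_ci : 4%:R * ci != 0 :> C.
Proof.
by rewrite mulf_neq0 ?pnatr_eq0 // eq_complex /= oner_eq0 andbF.
Qed.

(** The constant of [bm'] comes from (1 + i)^2 - (1 - i)^2 = 4 i; the terms in the permuted
    coordinate cancel. *)
Lemma bmK N s (x : 'rV[C]_N) : involutive s -> x *m bm s *m bm' s = x.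
Proof.
move=> inv; apply/rowP => k; rewrite mul_bm' !mul_bm inv.
have -> : (1 + ci) * ((1 + ci) * x 0 k + (1 - ci) * x 0 (s k)) -
   (1 - ci) * ((1 + ci) * x 0 (s k) + (1 - ci) * x 0 k) = 4%:R * ci * x 0 k by ring.
by rewrite mulrAC divff ?mul1r // four_ci.
Qed.

Lemma bmK' N s (x : 'rV[C]_N) : involutive s -> x *m bm' s *m bm s = x.
Proof.
move=> inv; apply/rowP => k; rewrite mul_bm !mul_bm' inv.
have -> : (1 + ci) * (((1 + ci) * x 0 k - (1 - ci) * x 0 (s k)) / (4%:R * ci)) +
   (1 - ci) * (((1 + ci) * x 0 (s k) - (1 - ci) * x 0 k) / (4%:R * ci)) =
   4%:R * ci * x 0 k / (4%:R * ci) by ring.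
by rewrite mulrAC divff ?mul1r // four_ci.
Qed.

(** Conjugation exchanges 1 + i and 1 - i, and the permutation s exchanges them back. *)
Lemma theta_bm N s (x : 'rV[C]_N) : involutive s -> theta s (x *m bm s) = cbar x *m bm s.
Proof.
move=> inv; apply/rowP => k; rewrite mul_bm mxE mul_bm inv !mxE.
by rewrite !(conjD, conjM, conjN, conj1, conj_ci, opprK); ring.
Qed.

Definition re_poly N (q : {mpoly C[N]}) : {mpoly R[N]} :=
  \sum_(m <- msupp q) complex.Re q@_m *: 'X_[m].
Definition im_poly N (q : {mpoly C[N]}) : {mpoly R[N]} :=
  \sum_(m <- msupp q) complex.Im q@_m *: 'X_[m].

Lemma part_homog N (q : {mpoly C[N]}) (f : C -> R) :
  q \is homog mdeg -> \sum_(m <- msupp q) f q@_m *: 'X_[m] \is homog mdeg.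
Proof.
move=> /homogP [d hq]; apply/homogP; exists d; rewrite big_seq; apply: rpred_sum => m hm.
by apply: rpredZ; rewrite dhomogX; have /dhomogP /(_ m hm) -> := hq.
Qed.

Lemma peval_part N (q : {mpoly C[N.+1]}) (f : C -> R) x :
  peval (map_mpoly rc (\sum_(m <- msupp q) f q@_m *: 'X_[m])) x =
  \sum_(m <- msupp q) rc (f q@_m) * \prod_i x 0 i ^+ m i.
Proof.
rewrite rmorph_sum /peval raddf_sum /=; apply: eq_bigr => m _.
by rewrite map_mpolyZ map_mpolyX mevalZ mevalX.
Qed.

Lemma peval_re N (q : {mpoly C[N.+1]}) x : peval (map_mpoly rc (re_poly q)) x =
  \sum_(m <- msupp q) rc (complex.Re q@_m) * \prod_i x 0 i ^+ m i.
Proof. exact: peval_part. Qed.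

Lemma peval_im N (q : {mpoly C[N.+1]}) x : peval (map_mpoly rc (im_poly q)) x =
  \sum_(m <- msupp q) rc (complex.Im q@_m) * \prod_i x 0 i ^+ m i.
Proof. exact: peval_part. Qed.

Lemma peval_re_im N (q : {mpoly C[N.+1]}) x :
  peval q x = peval (map_mpoly rc (re_poly q)) x + ci * peval (map_mpoly rc (im_poly q)) x.
Proof.
rewrite [X in _ = X + _]peval_re [X in _ = _ + _ * X]peval_im /peval mevalE mulr_sumr -big_split; apply: eq_bigr => m _ /=.
by rewrite {1}[q@_m]complexE mulrDl mulrA.
Qed.

Lemma peval_re_im_conj N (q : {mpoly C[N.+1]}) x :
  conj (peval q (cbar x)) =
  peval (map_mpoly rc (re_poly q)) x - ci * peval (map_mpoly rc (im_poly q)) x.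
Proof.
rewrite [X in _ = X + _]peval_re [X in _ = _ - _ * X]peval_im /peval mevalE mulr_sumr -sumrB rmorph_sum; apply: eq_bigr => m _ /=.
rewrite rmorphM rmorph_prod mulrA -mulrBl; congr (_ * _); last first.
  by apply: eq_bigr => i _; rewrite rmorphXn /= mxE conjcK.
rewrite {1}[q@_m]complexE -/(rc _) -/(rc _).
by rewrite -[LHS]/(conj (rc _ + ci * rc _)) conjD conjM !conj_rc conj_ci mulNr.
Qed.

Lemma ci_eq0 (a b : C) : a + ci * b = 0 -> a - ci * b = 0 -> a = 0 /\ b = 0.
Proof.
move=> e1 e2; have a0 : a = 0.
  apply: (mulfI two_neq0); rewrite mulr0 -[RHS](addr0 0) -{1}e1 -e2; ring.
split=> //; apply: (mulfI four_ci); rewrite mulr0.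
have -> : 4%:R * ci * b = 2%:R * (a + ci * b) - 2%:R * (a - ci * b) by ring.
by rewrite e1 e2 !mulr0 subrr.
Qed.

(** The equations are pulled back by [bm s] and split into real and imaginary parts. As the zero set
    is stable under [theta s], its pullback is stable under conjugation, so an equation and its
    conjugate vanish together there, and with them both parts. *)
Lemma real_model N s (eqs : seq {mpoly C[N.+1]}) : involutive s ->
  all (fun p => p \is homog mdeg) eqs ->
  (forall x, zeros [set` eqs] x -> zeros [set` eqs] (theta s x)) ->
  exists (S : seq {mpoly R[N.+1]}) (hS : all (fun p => p \is homog mdeg) S),
    @complexification R (ProjVar hS) = [set x | zeros [set` eqs] (x *m bm s)].
Proof.
move=> inv /allP heqs stab.
have /choice [tr htr] : forall q : {mpoly C[N.+1]}, exists q' : {mpoly C[N.+1]},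
    q \in eqs -> q' \is homog mdeg /\ forall x, peval q' x = peval q (x *m bm s).
  move=> q; have [/heqs /homogP [d hd]|_] := boolP (q \in eqs); last by exists 0.
  have [|k|q' hq' q'E] := @hpoly_comp _ N N 1 d (peval q) (fun k x => (x *m bm s) 0 k).
  - by exists q.
  - apply: (hpoly_ext (F := fun x : 'rV[C]_N.+1 => (1 + ci) * x 0 k + (1 - ci) * x 0 (s k))).
      by move=> x; rewrite mul_bm.
    by apply: hpolyD; apply: hpolyZ; exact: hpolyX.
  exists q' => _; split; first by apply/homogP; exists (1 * d)%N.
  by move=> x; rewrite q'E; congr peval; apply/rowP => l; rewrite mxE.
pose S := [seq re_poly (tr q) | q <- eqs] ++ [seq im_poly (tr q) | q <- eqs].
have hS : all (fun p => p \is homog mdeg) S.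
  rewrite all_cat; apply/andP; split; apply/allP => p /mapP [q hq ->];
    by apply: part_homog; case: (htr q hq).
exists S, hS; apply/seteqP; split=> x /=.
  move=> [x0 hx]; split.
    apply/eqP => e; move: x0; rewrite -(bmK x inv) e mul0mx eqxx //.
  move=> q hq; have [_ <-] := htr q hq; rewrite peval_re_im.
  have e1 : peval (map_mpoly rc (re_poly (tr q))) x = 0.
    by apply: hx; apply: map_f; rewrite mem_cat; apply/orP; left; apply: map_f.
  have e2 : peval (map_mpoly rc (im_poly (tr q))) x = 0.
    by apply: hx; apply: map_f; rewrite mem_cat; apply/orP; right; apply: map_f.
  by rewrite [X in X + _]e1 [X in _ + _ * X]e2 mulr0 addr0.
move=> Zx; have [x0 hx] := Zx.
split; first by apply/eqP => e; move: x0; rewrite e mul0mx eqxx.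
have [_ hx'] := stab _ Zx; rewrite theta_bm // in hx'.
have van q : q \in eqs -> peval (map_mpoly rc (re_poly (tr q))) x = 0 /\
    peval (map_mpoly rc (im_poly (tr q))) x = 0.
  move=> hq; have [_ e] := htr q hq.
  apply: ci_eq0.
    by apply: etrans (esym (peval_re_im (tr q) x)) _; rewrite e hx.
  by apply: etrans (esym (peval_re_im_conj (tr q) x)) _; rewrite e hx' // conjc0.
move=> p /mapP [p' hp' ->]; move: hp'; rewrite mem_cat => /orP [] /mapP [q hq ->].
  exact: (van q hq).1.
exact: (van q hq).2.
Qed.

(** Polynomials with real coefficients commute with conjugation, so the representative at x serves
    at the conjugate point too. *)
Lemma real_map_cbar N M (A : set 'rV[C]_N.+1) (B : set 'rV[C]_M.+1) phi :
  regular_map rc A B phi -> (forall x, A x -> A (cbar x)) ->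
  forall x, A x -> same_point (phi (cbar x)) (cbar (phi x)).
Proof.
move=> [_ h] cA x Ax; have [d [P [hP nz H]]] := h x Ax.
have e : poly_map rc P (cbar x) = cbar (poly_map rc P x).
  apply/rowP => j; rewrite !mxE /peval !mevalE rmorph_sum; apply: eq_bigr => m _.
  rewrite rmorphM rmorph_prod /= mcoeff_map_mpoly conj_rc; congr (_ * _).
  by apply: eq_bigr => i _; rewrite mxE rmorphXn.
have nz' : poly_map rc P (cbar x) != 0.
  rewrite e; apply: contra nz => /eqP e'; apply/eqP.
  by rewrite -[LHS]cbarK e'; apply/rowP => j; rewrite !mxE conjc0.
have := H _ (cA _ Ax) nz'; rewrite e => s1; apply: same_point_trans (same_point_sym s1) _.
by apply: same_point_cbar; apply: H.
Qed.

Lemma real_regmap N M (A : set 'rV[C]_N.+1) (B : set 'rV[C]_M.+1) phi :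
  regular_map rc A B phi -> regmap A B phi.
Proof.
move=> [h1 h2]; split=> // x Ax; have [d [P [hP nz H]]] := h2 x Ax.
have E y : poly_map (idfun : {rmorphism C -> C}) (fun j => map_mpoly rc (P j)) y = poly_map rc P y.
  have Ej j : map_mpoly (idfun : {rmorphism C -> C}) (map_mpoly rc (P j)) = map_mpoly rc (P j).
    exact: map_mpoly_idfun.
  rewrite /poly_map.
  apply/rowP => j.
  rewrite [LHS]mxE.
  rewrite [RHS]mxE.
  rewrite Ej.
  reflexivity.
exists d, (fun j => map_mpoly rc (P j)); split.
- move=> j; apply/dhomogP => m; rewrite mcoeff_msupp mcoeff_map_mpoly => hm.
  have /dhomogP := hP j; apply; rewrite mcoeff_msupp; apply: contra hm => /eqP ->.
  by apply/eqP; exact: (rmorph0 rc).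
- by rewrite E.
- by move=> y Ay; rewrite E; exact: H.
Qed.

Lemma real_form_model N s (A : set 'rV[C]_N.+1) (S : seq {mpoly R[N.+1]})
    (hS : all (fun p => p \is homog mdeg) S) : involutive s -> (forall x, A x -> x != 0) ->
  @complexification R (ProjVar hS) = [set x | A (x *m bm s)] ->
  ziso (@complexification R (ProjVar hS)) A.
Proof.
move=> inv A0 E; rewrite E; exists (fun x => x *m bm s), (fun x => x *m bm' s); split.
- by apply: regmap_mulmx.
- apply: regmap_mulmx => [x Ax|x /A0] /=; first by rewrite bmK'.
  by apply: contra => /eqP ->; rewrite mul0mx.
- by move=> x _; rewrite bmK //; exact: same_point_refl.
- by move=> x _; rewrite bmK' //; exact: same_point_refl.
Qed.

Lemma real_map_theta N M s s' (A : set 'rV[C]_N.+1) (B : set 'rV[C]_M.+1) phi :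
  involutive s -> involutive s' -> (forall x, A x -> x != 0) -> (forall x, B x -> x != 0) ->
  (forall x, A x -> A (theta s x)) ->
  regular_map rc [set x | A (x *m bm s)] [set y | B (y *m bm s')] phi ->
  let F x := phi (x *m bm' s) *m bm s' in
  regmap A B F /\ forall x, A x -> same_point (F (theta s x)) (theta s' (F x)).
Proof.
move=> inv inv' A0 B0 sA rphi F; split.
  have r1 : regmap A [set x | A (x *m bm s)] (fun x => x *m bm' s).
    apply: regmap_mulmx => [x Ax|x /A0] /=; first by rewrite bmK'.
    by apply: contra => /eqP ->; rewrite mul0mx.
  have r2 : regmap [set y | B (y *m bm s')] B (fun x => x *m bm s') by exact: regmap_mulmx.
  exact: (regmap_comp (regmap_comp r1 (real_regmap rphi)) r2).
move=> x Ax; set y := x *m bm' s.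
have yA : A (y *m bm s) by rewrite bmK'.
have e : theta s x *m bm' s = cbar y.
  by rewrite -[in LHS](bmK' x inv) theta_bm // bmK.
have := @real_map_cbar _ _ _ _ _ rphi _ y yA.
rewrite /= /F e => -[|c c0 ce].
  by move=> z /= Az; rewrite -theta_bm //; apply: sA.
exists c => //.
by rewrite theta_bm // ce scalemxAl.
Qed.

(** Transport through [bm], which turns the standard conjugation into [theta], makes the reality of
    an isomorphism an equivariance. *)
Lemma real_iso_theta N M s s' (A : set 'rV[C]_N.+1) (B : set 'rV[C]_M.+1)
    (S : seq {mpoly R[N.+1]}) (hS : all (fun p => p \is homog mdeg) S)
    (S' : seq {mpoly R[M.+1]}) (hS' : all (fun p => p \is homog mdeg) S') :
  involutive s -> involutive s' -> (forall x, A x -> x != 0) -> (forall x, B x -> x != 0) ->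
  (forall x, A x -> A (theta s x)) -> (forall x, B x -> B (theta s' x)) ->
  @complexification R (ProjVar hS) = [set x | A (x *m bm s)] ->
  @complexification R (ProjVar hS') = [set x | B (x *m bm s')] ->
  isomorphic_over_R (ProjVar hS) (ProjVar hS') ->
  exists F G, [/\ regmap A B F, regmap B A G, 
    forall x, A x -> same_point x (G (F x)), forall y, B y -> same_point y (F (G y)) &
    forall x, A x -> same_point (F (theta s x)) (theta s' (F x))].
Proof.
move=> inv inv' A0 B0 sA sB E E' [phi [psi]]; rewrite E E' => -[r1 r2 h1 h2].
have [rF eF] := real_map_theta inv inv' A0 B0 sA r1.
have [rG _] := real_map_theta inv' inv B0 A0 sB r2.
exists (fun x => phi (x *m bm' s) *m bm s'), (fun x => psi (x *m bm' s') *m bm s).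
split=> //.
- move=> x Ax; rewrite bmK //; have [|c c0 ->] := h1 (x *m bm' s); first by rewrite /= bmK'.
  by exists c => //; rewrite -scalemxAl bmK'.
- move=> x Ax; rewrite bmK //; have [|c c0 ->] := h2 (x *m bm' s'); first by rewrite /= bmK'.
  by exists c => //; rewrite -scalemxAl bmK'.
Qed.

End RealStructures.

(** * Exchange isomorphisms *)

Lemma hpolyM_eq (K : fieldType) N d e n (F G : 'rV[K]_N.+1 -> K) :
  hpoly d F -> hpoly e G -> n = (d + e)%N -> hpoly n (fun x => F x * G x).
Proof. by move=> hF hG ->; exact: hpolyM. Qed.

Ltac hp := lazymatch goal with
  | |- hpoly _ (fun x => _ + _) => apply: hpolyD; hp
  | |- hpoly _ (fun x => - _) => apply: hpolyN; hp
  | |- hpoly _ (fun x => _ * _) => (eapply hpolyM_eq; [hp | hp | reflexivity])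
  | |- hpoly _ (fun x => 0) => exact: hpoly0
  | |- hpoly _ (fun x => slice x _ _ _) => exact: hpolyX
  | |- hpoly _ (fun x => co x _) => exact: hpolyX
  | |- _ => exact: hpolyC
  end.

Section Exchange.
Variables (T : finType) (K : closedFieldType).
Variables (rho : T -> K) (eps eps' : T -> bool) (cc : bool -> K) (sw : pred T).

Definition sg (b : bool) : K := if b then 1 else -1.
Definition wof (e : T -> bool) (j : T) : K := sg (e j) / rho j.
(** The homogenized quartic y^4 + cc b y^2 + 1. Under the hypotheses below, its roots are the
    [rho j] of the exchanged centres whose sign is opposite to b. *)
Definition HH (b : bool) (y0 y1 : K) : K :=
  y1 * y1 * y1 * y1 + cc b * (y1 * y1 * (y0 * y0)) + y0 * y0 * y0 * y0.
(** The quotient of [HH b] by y - rho j, as Horner division gives it when [rho j] is a root. *)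
Definition Hq (b : bool) (j : T) (y0 y1 : K) : K :=
  y1 * y1 * y1 + rho j * (y1 * y1 * y0) + (rho j * rho j + cc b) * (y1 * (y0 * y0))
  + rho j * (rho j * rho j + cc b) * (y0 * y0 * y0).

Hypothesis two0 : (2%:R : K) != 0.
Hypothesis rho_inj : injective rho.
Hypothesis rho0 : forall j, rho j != 0.
Hypothesis HH_root : forall j, sw j -> HH (~~ eps j) 1 (rho j) = 0.
Hypothesis HH_neq0 : forall j b, ~~ (sw j && (b == ~~ eps j)) -> HH b 1 (rho j) != 0.
Hypothesis Hq_neq0 : forall j, sw j -> Hq (~~ eps j) j 1 (rho j) != 0.
Hypothesis HH_roots : forall b y0 y1, (y0 != 0) || (y1 != 0) -> HH b y0 y1 = 0 ->
  exists2 j, sw j && (b == ~~ eps j) & y1 = rho j * y0.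
Hypothesis eps'E : forall j, eps' j = (if sw j then ~~ eps j else eps j).

Local Notation idK := (idfun : {rmorphism K -> K}).
Local Notation w := (wof eps).
Local Notation w' := (wof eps').
Local Notation Y := (Yset rho w).
Local Notation Y' := (Yset rho w').
Local Notation N := (amb T).
Local Notation cvK := (cvec rho w idK).
Local Notation cvec' := (cvec rho w' idK).
Local Notation chart' := (chart rho w' idK).
Implicit Types (v : idx T -> 'I_3 -> K) (y z : 'I_3 -> K).

Lemma sg2 b : sg b * sg b = 1.
Proof. by case: b; rewrite /sg ?mulr1 // mulrNN mulr1. Qed.

Lemma sg_neq0 b : sg b != 0.
Proof. by case: b; rewrite /sg ?oppr_eq0 oner_neq0. Qed.

Lemma sgN b : sg (~~ b) = - sg b.
Proof. by case: b; rewrite /sg ?opprK. Qed.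

Lemma wofE e j : rho j * wof e j = sg (e j).
Proof. by rewrite /wof mulrC divfK. Qed.

Lemma wof_neq0 e j : wof e j != 0.
Proof. by rewrite mulf_neq0 ?sg_neq0 ?invr_neq0. Qed.

(* The forms y1 w1 - w0 y0 and y1 w1 + w0 y0 of the image are multiples of the
   same forms of the source, see [exchange_form]. *)
Definition W y z : 'I_3 -> K :=
  vec3 ((HH false (y o0) (y o1) + HH true (y o0) (y o1)) * z o0
         + (cc false - cc true) * (y o0 * y o1 * y o1 * y o1 * z o1))
       ((HH false (y o0) (y o1) + HH true (y o0) (y o1)) * z o1
         + (cc false - cc true) * (y o1 * y o0 * y o0 * y o0 * z o0)) 0.

Definition XX (s : K) y z : K := y o1 * z o1 - s * (y o0 * z o0).

Lemma exchange_form e y z : XX (sg e) y (W y z) = 2%:R * HH e (y o0) (y o1) * XX (sg e) y z.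
Proof. by case: e; rewrite /XX /W /HH /sg /vec3 /=; ring. Qed.

Lemma HqE j (y0 y1 : K) : sw j -> (y1 - rho j * y0) * Hq (~~ eps j) j y0 y1 = HH (~~ eps j) y0 y1.
Proof.
move=> /HH_root; rewrite /HH /Hq !mulr1 => h.
rewrite -[RHS]subr0 -(mulr0 (y0 * y0 * y0 * y0)) -h; ring.
Qed.

Lemma HH_scale b (l y0 y1 : K) : HH b (l * y0) (l * y1) = l ^+ 4 * HH b y0 y1.
Proof. by rewrite /HH; ring. Qed.

Lemma Hq_scale b j (l y0 y1 : K) : Hq b j (l * y0) (l * y1) = l ^+ 3 * Hq b j y0 y1.
Proof. by rewrite /Hq; ring. Qed.

Lemma W_scale (l m : K) y z k : W (fun k => l * y k) (fun k => m * z k) k = l ^+ 4 * m * W y z k.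
Proof. by move: k; apply: I3P; rewrite /W /HH /vec3 /=; ring. Qed.

Definition center j v := v iy o1 = rho j * v iy o0 /\ v iw o1 = w j * v iw o0.

(** If W vanishes, both products in [exchange_form] do. A root of one quartic is y = rho j with j
    exchanged; the other quartic is then nonzero, and its form puts w at w j, which is a centre. If
    no quartic vanishes, both forms do, which happens only at (0, infinity) and (infinity, 0), where
    W is computed directly. *)
Lemma W_neq0 v : nondeg v -> onY rho w idK v -> (forall j, sw j -> ~ center j v) ->
  exists k, W (v iy) (v iw) k != 0.
Proof.
move=> nv [y2 w2 _ _] nc; apply: contrapT => none.
have W0 k : W (v iy) (v iw) k = 0.
  by apply/eqP/negPn/negP => h; apply: none; exists k.
have X0 e : 2%:R * HH e (v iy o0) (v iy o1) * XX (sg e) (v iy) (v iw) = 0.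
  by rewrite -exchange_form /XX !W0 !mulr0 subrr.
have nzy : (v iy o0 != 0) || (v iy o1 != 0).
  by have [k] := nv iy; move: k; apply: I3P; rewrite ?y2 ?eqxx // => ->; rewrite ?orbT.
have H0 e : HH e (v iy o0) (v iy o1) = 0 -> False.
  move=> he; have [j /andP [sj /eqP ej] yj] := HH_roots nzy he.
  have y0 : v iy o0 != 0.
    by apply/eqP => e0; move: nzy; rewrite yj e0 mulr0 eqxx.
  have ne : HH (~~ e) (v iy o0) (v iy o1) != 0.
    rewrite yj -{1}(mulr1 (v iy o0)) [rho j * _]mulrC HH_scale mulf_neq0 ?expf_neq0 //.
    apply: HH_neq0; rewrite ej negbK sj; by case: (eps j).
  have /eqP := X0 (~~ e); rewrite !mulf_eq0 (negPf two0) (negPf ne) /= /XX.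
  rewrite yj ej negbK subr_eq0 => /eqP hX.
  apply: (nc j sj); split=> //.
  apply: (mulfI (mulf_neq0 (rho0 j) y0)); rewrite hX.
  have -> : rho j * v iy o0 * (w j * v iw o0) = rho j * w j * (v iy o0 * v iw o0) by ring.
  by rewrite wofE.
have Xe e : XX (sg e) (v iy) (v iw) = 0.
  have /eqP := X0 e; rewrite !mulf_eq0 (negPf two0) /= => /orP [/eqP/H0 //|/eqP //].
have e1 : v iy o1 * v iw o1 = 0.
  apply: (mulfI two0); rewrite mulr0 -(addr0 0) -{1}(Xe true) -(Xe false) /XX /sg; ring.
have e0 : v iy o0 * v iw o0 = 0.
  apply: (mulfI two0); rewrite mulr0 -(subr0 0) -{1}(Xe false) -(Xe true) /XX /sg; ring.
have nzw : v iw o0 = 0 -> v iw o1 != 0 by exact: nz3.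
have y0 : v iy o0 != 0 -> False.
  move=> y0; move/eqP: e0; rewrite mulf_eq0 (negPf y0) /= => /eqP w0.
  move/eqP: e1; rewrite mulf_eq0 (negPf (nzw w0)) orbF => /eqP y1.
  have := W0 o1; rewrite /W /HH /vec3 /= y1 w0 !(mul0r, mulr0, add0r, addr0) => /eqP.
  rewrite -mulr2n -mulr_natl !mulf_eq0 (negPf two0) (negPf y0) /=.
  by rewrite (negPf (nzw w0)).
have y00 : v iy o0 = 0 by apply/eqP/negPn/negP.
have y1 := nz3 (nv iy) y2 y00.
move/eqP: e1; rewrite mulf_eq0 (negPf y1) /= => /eqP w1.
have w0 : v iw o0 != 0 by apply/eqP => /nzw; rewrite w1 eqxx.
have := W0 o0; rewrite /W /HH /vec3 /= y00 w1 !(mul0r, mulr0, add0r, addr0) => /eqP.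
rewrite -mulr2n -mulr_natl !mulf_eq0 (negPf two0) (negPf y1) /=.
by rewrite (negPf w0).
Qed.

(** The rational exchange map, written with forms that vanish at special points; only its values at
    general points serve as a reference. *)
Definition tgt v i : 'I_3 -> K := chart' (v iy) (W (v iy) (v iw)) i.

Definition gen v := (forall j, v iy o1 - rho j * v iy o0 != 0) /\
  (forall j, v iw o1 - w j * v iw o0 != 0) /\ v iy o0 != 0 /\ v iw o0 != 0.

(** Regularity is treated one factor at a time: a tensor of triples that do not vanish at P does not
    vanish at P. *)
Definition local_rep e0 i (P : 'rV[K]_N.+1) := exists d (g : 'I_3 -> (idx T -> 'I_3 -> K) -> K),
  [/\ forall k, hpoly d (fun x : 'rV[K]_N.+1 => g k (slice x e0)),
      exists k, g k (slice P e0) != 0 &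
      forall v, onY rho w idK v -> nondeg v -> gen v ->
        forall k k', g k v * tgt v i k' = g k' v * tgt v i k].

Lemma par_of (f t : 'I_3 -> K) l m : l != 0 -> (forall k, l * f k = m * t k) ->
  forall k k', f k * t k' = f k' * t k.
Proof.
move=> l0 h k k'; apply: (mulfI l0); rewrite mulrA h mulrA h; ring.
Qed.

Lemma gen_cvec v j : onY rho w idK v -> nondeg v -> gen v ->
  exists2 c, c != 0 & forall k, v (iz j) k = c * cvK j (v iy) (v iw) k.
Proof.
move=> hv nv [gy _]; have [[h _]|//] := center_or_cvec j nv hv.
by have := gy j; rewrite h subrr eqxx.
Qed.

(** The identity y w - eps j = (y - rho j) w + rho j (w - w j), divided by the equation of the
    exceptional curve: the first two coordinates of [iz j] stand for the direction (w - w j : y -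
    rho j). *)
Definition SS j v := v (iz j) o1 * v iw o1 + rho j * (v (iz j) o0 * v iw o0).

Lemma SSE v j c : (forall k, v (iz j) k = c * cvK j (v iy) (v iw) k) ->
  SS j v = c * v iw o0 * XX (sg (eps j)) (v iy) (v iw).
Proof.
move=> h; rewrite /SS !h /cvec /vec3 /= /XX -(wofE eps j); ring.
Qed.

(** For w' the second coordinate of the image, y w' + eps j and y w' - eps j both vanish on the
    exceptional curve of an exchanged centre. [Wp] and [Wq] are what is left after division by its
    equation, through [Hq] for the first and through [SS] for the second. [Wsp] solves them for
    w'. *)
Definition Wp j v := v (iz j) o1 * (Hq (~~ eps j) j (v iy o0) (v iy o1)
  * (v iy o1 * v iw o1 - - sg (eps j) * (v iy o0 * v iw o0))).
Definition Wq j v := HH (eps j) (v iy o0) (v iy o1) * SS j v.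
Definition Wsp j v : 'I_3 -> K :=
  vec3 (sg (eps j) * (v iy o1 * (Wp j v - Wq j v))) (v iy o0 * (Wp j v + Wq j v)) 0.

Lemma Wsp_par v j : sw j -> onY rho w idK v -> nondeg v -> gen v ->
  exists m, forall k, 2%:R * Wsp j v k = m * W (v iy) (v iw) k.
Proof.
move=> sj hv nv gv; have [c c0 hc] := gen_cvec j hv nv gv.
have hS := SSE hc; exists (2%:R * c * v iw o0 * v iy o0 * v iy o1).
have hX1 := exchange_form (eps j) (v iy) (v iw).
have hX2 := exchange_form (~~ eps j) (v iy) (v iw).
rewrite sgN in hX2.
have hb : v (iz j) o1 * Hq (~~ eps j) j (v iy o0) (v iy o1) =
    c * v iw o0 * HH (~~ eps j) (v iy o0) (v iy o1).
  by rewrite -HqE // hc /cvec /vec3 /=; ring.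
have e3 : 2%:R * Wp j v = c * v iw o0 * XX (- sg (eps j)) (v iy) (W (v iy) (v iw)).
  transitivity (2%:R * (v (iz j) o1 * Hq (~~ eps j) j (v iy o0) (v iy o1))
     * XX (- sg (eps j)) (v iy) (v iw)); first by rewrite /Wp /XX; ring.
  by rewrite hb hX2; ring.
have e4 : 2%:R * Wq j v = c * v iw o0 * XX (sg (eps j)) (v iy) (W (v iy) (v iw)).
  by rewrite hX1 /Wq hS; ring.
have s2 := sg2 (eps j).
have [w0E w1E w2E] : [/\ Wsp j v o0 = sg (eps j) * (v iy o1 * (Wp j v - Wq j v)),
  Wsp j v o1 = v iy o0 * (Wp j v + Wq j v) & Wsp j v o2 = 0] by [].
apply: I3P; rewrite ?w0E ?w1E ?w2E.
- transitivity (sg (eps j) * v iy o1 * (2%:R * Wp j v - 2%:R * Wq j v)); first by ring.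
  rewrite e3 e4 /XX; transitivity ((sg (eps j) * sg (eps j)) *
    (2%:R * c * v iw o0 * v iy o0 * v iy o1 * W (v iy) (v iw) o0)); first by ring.
  by rewrite s2 mul1r.
- transitivity (v iy o0 * (2%:R * Wp j v + 2%:R * Wq j v)); first by ring.
  by rewrite e3 e4 /XX; ring.
- by rewrite /W /vec3 /= !mulr0.
Qed.

Lemma center_facts v j : nondeg v -> onY rho w idK v -> center j v ->
  [/\ v iy o0 != 0, v iw o0 != 0, v (iz j) o2 = 0 & (v (iz j) o0 != 0) || (v (iz j) o1 != 0)].
Proof.
move=> nv [y2 w2 hy _] [ey ew].
have y0 : v iy o0 != 0.
  apply/eqP => e; have := nz3 (nv iy) y2 e; by rewrite ey e mulr0 eqxx.
have z0 : v iw o0 != 0.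
  apply/eqP => e; have := nz3 (nv iw) w2 e; by rewrite ew e mulr0 eqxx.
have c0 : v (iz j) o2 = 0.
  move: (hy j); rewrite /= ey subrr mulr0 => /esym/eqP.
  by rewrite mulf_eq0 (negPf y0) orbF => /eqP.
split=> //; have [k] := nv (iz j).
by move: k; apply: I3P; rewrite ?c0 ?eqxx // => ->; rewrite ?orbT.
Qed.

(** At the centre, y, [Hq] and y w + eps j are nonzero. If [Wsp] vanished, so would [Wp] and [Wq],
    which successively kill the two coordinates of the direction. *)
Lemma Wsp_neq0 v j : sw j -> nondeg v -> onY rho w idK v -> center j v ->
  exists k, Wsp j v k != 0.
Proof.
move=> sj nv hv cj; have [y0 w0 c0 ab] := center_facts nv hv cj; have [ey ew] := cj.
have y1 : v iy o1 != 0 by rewrite ey mulf_neq0.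
apply: contrapT => none.
have Wz k : Wsp j v k = 0.
  by apply/eqP/negPn/negP => h; apply: none; exists k.
have /eqP := Wz o0; have /eqP := Wz o1; rewrite /Wsp /vec3 /=.
rewrite !mulf_eq0 (negPf y0) (negPf y1) (negPf (sg_neq0 _)) /=.
set p := Wp j v; set q := Wq j v => /eqP e1 /eqP e2.
have p0 : p = 0 by apply: (mulfI two0); rewrite mulr0 -(addr0 0) -{1}e1 -e2; ring.
have q0 : q = 0 by apply: (mulfI two0); rewrite mulr0 -(subr0 0) -{1}e1 -e2; ring.
have ey' : v iy o1 = v iy o0 * rho j by rewrite mulrC.
have Hq0 : Hq (~~ eps j) j (v iy o0) (v iy o1) != 0.
  rewrite ey' -{1}(mulr1 (v iy o0)) Hq_scale mulf_neq0 ?expf_neq0 //; exact: Hq_neq0.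
have HH0 : HH (eps j) (v iy o0) (v iy o1) != 0.
  rewrite ey' -{1}(mulr1 (v iy o0)) HH_scale mulf_neq0 ?expf_neq0 //.
  by apply: HH_neq0; rewrite sj; case: (eps j).
have X0 : v iy o1 * v iw o1 - - sg (eps j) * (v iy o0 * v iw o0) != 0.
  rewrite ey ew -(wofE eps j).
  have -> : rho j * v iy o0 * (w j * v iw o0) - - (rho j * w j) * (v iy o0 * v iw o0)
     = 2%:R * (rho j * w j) * v iy o0 * v iw o0 by ring.
  exact: (mulf_neq0 (mulf_neq0 (mulf_neq0 two0 (mulf_neq0 (rho0 j) (wof_neq0 _ _))) y0) w0).
have b0 : v (iz j) o1 = 0.
  move/eqP: p0; rewrite /p /Wp !mulf_eq0 (negPf Hq0) (negPf X0) !orbF => /eqP //.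
move: q0; rewrite /q /Wq /SS b0 mul0r add0r => /eqP.
rewrite !mulf_eq0 (negPf HH0) (negPf (rho0 j)) (negPf w0) /= orbF => /eqP a0.
by move: ab; rewrite a0 b0 eqxx.
Qed.

Lemma rep_y e0 P : Y P -> co P e0 != 0 -> local_rep e0 iy P.
Proof.
move=> YP P0; have [nv hv _] := Yset_slice YP P0.
exists 1%N, (fun k v => v iy k); split; first by move=> k; hp.
- exact: (nv iy).
- by move=> v _ _ _ k k'; rewrite mulrC.
Qed.

(* A local representative of the second coordinate, from which the
   other ones are built. *)
Definition wrep e0 (P : 'rV[K]_N.+1) d (g : 'I_3 -> (idx T -> 'I_3 -> K) -> K) :=
  [/\ forall k, hpoly d (fun x : 'rV[K]_N.+1 => g k (slice x e0)),
      exists k, g k (slice P e0) != 0, forall v, g o2 v = 0 &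
      forall v, onY rho w idK v -> nondeg v -> gen v ->
        exists m, forall k, 2%:R * g k v = m * W (v iy) (v iw) k].

Lemma ex_wrep e0 P : Y P -> co P e0 != 0 -> exists d g, wrep e0 P d g.
Proof.
move=> YP P0; have [nv hv _] := Yset_slice YP P0.
have [[j sj cj]|nc] := pselect (exists2 j, sw j & center j (slice P e0)).
  exists 7%N, (fun k v => Wsp j v k); split.
  - by apply: I3P; rewrite /Wsp /vec3 /= /Wp /Wq /SS /HH /Hq; hp.
  - exact: Wsp_neq0.
  - by [].
  - by move=> v hv' nv' gv; exact: Wsp_par.
exists 5%N, (fun k v => W (v iy) (v iw) k); split.
- by apply: I3P; rewrite /W /vec3 /= /HH; hp.
- by apply: W_neq0 => // j sj cj; apply: nc; exists j.
- by [].
- by move=> v _ _ _; exists 2%:R.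
Qed.

Lemma rep_w e0 P : Y P -> co P e0 != 0 -> local_rep e0 iw P.
Proof.
move=> YP P0; have [d [g [h1 h2 h3 h4]]] := ex_wrep YP P0.
exists d, g; split=> // v hv nv gv; have [m hm] := h4 v hv nv gv.
exact: (par_of (f := fun k => g k v) two0 hm).
Qed.

(** The map preserves y, so the image avoids the centre j as well and [cvec'] can be used. *)
Lemma rep_z_generic e0 P j : Y P -> co P e0 != 0 ->
  slice P e0 iy o1 != rho j * slice P e0 iy o0 -> local_rep e0 (iz j) P.
Proof.
move=> YP P0 yj; have [d [g [h1 [k hk] h3 h4]]] := ex_wrep YP P0.
exists d.+1, (fun k v => cvec' j (v iy) (g^~ v) k); split.
- have hD : hpoly d (fun x : 'rV[K]_N.+1 => g o1 (slice x e0) - w' j * g o0 (slice x e0)).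
    by apply: hpolyB => //; apply: hpolyZ; exact: h1.
  apply: I3P; rewrite /cvec /vec3 /=; [rewrite -addn1 | rewrite -add1n | rewrite -add1n];
    (apply: hpolyM; [| by [] || hp]) => //; hp.
- have D0 : slice P e0 iy o1 - rho j * slice P e0 iy o0 != 0 by rewrite subr_eq0.
  have [g0|g0] := eqVneq (g o0 (slice P e0)) 0; last first.
    by exists o1; rewrite /cvec /vec3 /= mulf_neq0.
  exists o2; rewrite /cvec /vec3 /= g0 mulr0 subr0 mulf_neq0 //.
  move: k hk; apply: I3P => //; rewrite ?g0 ?h3 ?eqxx //.
- move=> v hv nv gv; have [m hm] := h4 v hv nv gv.
  apply: (par_of (f := fun k => cvec' j (v iy) (g^~ v) k) two0 (m := m)).
  have e0' := hm o0; have e1' := hm o1.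
  apply: I3P; rewrite /tgt /= /cvec [vec3]lock /= -lock /vec3 /=.
  + transitivity ((2%:R * g o1 v - w' j * (2%:R * g o0 v)) * v iy o0); first by ring.
    by rewrite e0' e1'; ring.
  + transitivity ((v iy o1 - rho j * v iy o0) * (2%:R * g o0 v)); first by ring.
    by rewrite e0'; ring.
  + transitivity ((v iy o1 - rho j * v iy o0) * (2%:R * g o1 v - w' j * (2%:R * g o0 v))); first by ring.
    by rewrite e0' e1'; ring.
Qed.

(** The exchange at j is an elementary transformation: the exceptional curve and the strict
    transform of the line y = rho j trade places. The forms of [cvec'] times [rho j] are divisible
    by y - rho j, because the form y w' + eps j of the image contains the factor [HH (~~ eps j)]; g
    is the quotient. *)
Lemma rep_z_sw e0 P j : Y P -> co P e0 != 0 -> sw j ->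
  slice P e0 iy o1 = rho j * slice P e0 iy o0 -> local_rep e0 (iz j) P.
Proof.
move=> YP P0 sj ey; have [nv hv _] := Yset_slice YP P0.
have ew' : rho j * w' j = - sg (eps j) by rewrite wofE eps'E sj sgN.
pose g k v := vec3
  (2%:R * (Hq (~~ eps j) j (v iy o0) (v iy o1)
    * (v iy o1 * v iw o1 - - sg (eps j) * (v iy o0 * v iw o0))) - W (v iy) (v iw) o1)
  (rho j * W (v iy) (v iw) o0)
  (rho j * (W (v iy) (v iw) o1 - w' j * W (v iy) (v iw) o0)) k.
exists 5%N, g; split.
- by apply: I3P; rewrite /g /W /vec3 /= /HH /Hq; hp.
- set v := slice P e0 in ey nv hv *.
  have y0 : v iy o0 != 0.
    have [y2 _ _ _] := hv.
    apply/eqP => e; have := nz3 (nv iy) y2 e; by rewrite ey e mulr0 eqxx.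
  have ey' : v iy o1 = v iy o0 * rho j by rewrite mulrC.
  have HHz : HH (~~ eps j) (v iy o0) (v iy o1) = 0.
    by rewrite ey' -{1}(mulr1 (v iy o0)) HH_scale HH_root // mulr0.
  have Hq0 : Hq (~~ eps j) j (v iy o0) (v iy o1) != 0.
    by rewrite ey' -{1}(mulr1 (v iy o0)) Hq_scale mulf_neq0 ?expf_neq0 //; exact: Hq_neq0.
  have hX2 := exchange_form (~~ eps j) (v iy) (v iw).
  rewrite HHz mulr0 mul0r sgN /XX ey in hX2.
  have [W00|W00] := eqVneq (W (v iy) (v iw) o0) 0; last first.
    by exists o1; rewrite /g /vec3 /= mulf_neq0.
  have W01 : W (v iy) (v iw) o1 = 0.
    move: hX2; rewrite W00 !mulr0 subr0 => /eqP; rewrite !mulf_eq0 (negPf (rho0 j)).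
    by rewrite (negPf y0) /= => /eqP.
  exists o0; rewrite /g /vec3 /= W01 subr0 !mulf_neq0 //.
  have nW : ~ exists k, W (v iy) (v iw) k != 0.
    by case; apply: I3P; rewrite ?W00 ?W01 eqxx.
  have cj : center j v.
    apply: contrapT => ncj; apply: nW; apply: W_neq0 => // i si [ei1 ei2].
    apply: ncj; suff <- : i = j by [].
    by apply: rho_inj; apply: (mulIf y0); rewrite -ey -ei1.
  have [_ w0 _ _] := center_facts nv hv cj; have [_ ew] := cj.
  rewrite ey ew -(wofE eps j).
  have -> : rho j * v iy o0 * (w j * v iw o0) - - (rho j * w j) * (v iy o0 * v iw o0)
     = 2%:R * (rho j * w j) * v iy o0 * v iw o0 by ring.
  exact: (mulf_neq0 (mulf_neq0 (mulf_neq0 two0 (mulf_neq0 (rho0 j) (wof_neq0 _ _))) y0) w0).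
- move=> v hv' nv' [gy _].
  apply: (par_of (f := g^~ v) (gy j) (m := rho j)).
  have hX2 := exchange_form (~~ eps j) (v iy) (v iw); rewrite sgN in hX2.
  apply: I3P; rewrite /g /tgt /= /cvec [W]lock /vec3 /= -lock; try ring.
  transitivity (2%:R * ((v iy o1 - rho j * v iy o0) * Hq (~~ eps j) j (v iy o0) (v iy o1))
     * XX (- sg (eps j)) (v iy) (v iw) - (v iy o1 - rho j * v iy o0) * W (v iy) (v iw) o1).
    by rewrite /XX; ring.
  by rewrite HqE // -hX2 /XX -ew'; ring.
Qed.

(** On the line y = rho j the exchange is an invertible Moebius map in w that fixes w j, so only the
    centre needs care. There [a'] gives the first coordinate of the new direction, from rho j (w' -
    w j) = (y w' - eps j) - (y - rho j) w'. *)
Lemma rep_z_nsw e0 P j : Y P -> co P e0 != 0 -> ~~ sw j ->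
  slice P e0 iy o1 = rho j * slice P e0 iy o0 -> local_rep e0 (iz j) P.
Proof.
move=> YP P0 sj ey; have [nv hv _] := Yset_slice YP P0.
have ew' : w' j = w j by rewrite /wof eps'E (negPf sj).
set v0 := slice P e0 in ey nv hv.
have y0 : v0 iy o0 != 0.
  have [y2 _ _ _] := hv.
  apply/eqP => e; have := nz3 (nv iy) y2 e; by rewrite ey e mulr0 eqxx.
have nc i : sw i -> ~ center i v0.
  move=> si [e1 _]; have ij : i = j by apply: rho_inj; apply: (mulIf y0); rewrite -ey -e1.
  by rewrite -ij si in sj.
have [k hk] := W_neq0 nv hv nc.
have [wj|wj] := eqVneq (W (v0 iy) (v0 iw) o1) (w' j * W (v0 iy) (v0 iw) o0); last first.
  exists 6%N, (fun k v => cvec' j (v iy) (W (v iy) (v iw)) k); split.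
  - by apply: I3P; rewrite /cvec /W /vec3 /= /HH; hp.
  - by exists o0; rewrite /cvec [W]lock /vec3 /= -lock mulf_neq0 // subr_eq0.
  - by move=> v _ _ _ k1 k2; rewrite mulrC.
have W00 : W (v0 iy) (v0 iw) o0 != 0.
  apply/eqP => e; move: k hk; apply: I3P; rewrite ?wj ?e ?mulr0 ?eqxx //.
have HH0 b : HH b (v0 iy o0) (v0 iy o1) != 0.
  rewrite ey -{1}(mulr1 (v0 iy o0)) [rho j * _]mulrC HH_scale mulf_neq0 ?expf_neq0 //.
  by apply: HH_neq0; rewrite (negPf sj).
have cj : center j v0.
  split=> //; have := exchange_form (eps j) (v0 iy) (v0 iw).
  rewrite /XX wj ew' ey -(wofE eps j).
  have -> : rho j * v0 iy o0 * (w j * W (v0 iy) (v0 iw) o0) -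
    rho j * w j * (v0 iy o0 * W (v0 iy) (v0 iw) o0) = 0 by ring.
  move=> /esym/eqP; rewrite -ey !mulf_eq0 (negPf two0) (negPf (HH0 _)) /= subr_eq0 => /eqP h.
  by apply: (mulfI (mulf_neq0 (rho0 j) y0)); rewrite -ey h ey; ring.
have [_ w0 c0 ab] := center_facts nv hv cj; have [_ ew] := cj.
pose a' v := 2%:R * HH (eps j) (v iy o0) (v iy o1) * SS j v
   - v (iz j) o1 * W (v iy) (v iw) o1.
pose g k v := vec3 (a' v * v iy o0)
   (rho j * (v (iz j) o1 * W (v iy) (v iw) o0) * v iy o0)
   (a' v * (v iy o1 - rho j * v iy o0)) k.
exists 7%N, g; split.
- by apply: I3P; rewrite /g /a' /SS /W /vec3 /= /HH; hp.
- have [b0|b0] := eqVneq (v0 (iz j) o1) 0; last first.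
    by exists o1; rewrite /g [W]lock /vec3 /= -lock !mulf_neq0.
  exists o0; rewrite /g /vec3 /= /a' /SS -/v0 b0 !mul0r add0r subr0 !mulf_neq0 //.
  by move: ab; rewrite b0 eqxx orbF.
- move=> v hv' nv' gv; have [c cn0 hc] := gen_cvec j hv' nv' gv.
  have hX := exchange_form (eps j) (v iy) (v iw).
  apply: (par_of (f := g^~ v) (oner_neq0 _) (m := rho j * c * v iw o0 * v iy o0)).
  have ea : a' v = c * v iw o0 * (rho j * v iy o0 * (W (v iy) (v iw) o1 - w j * W (v iy) (v iw) o0)).
    rewrite /a' (SSE hc).
    transitivity (c * v iw o0 * (2%:R * HH (eps j) (v iy o0) (v iy o1) * XX (sg (eps j)) (v iy) (v iw))
       - v (iz j) o1 * W (v iy) (v iw) o1); first by ring.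
    by rewrite -hX hc /XX -(wofE eps j) /cvec [W]lock /vec3 /=; ring.
  apply: I3P; rewrite /g /tgt /= /cvec [W]lock /vec3 /= -lock ?ea ?ew' ?hc /cvec /vec3 /=; ring.
Qed.

Lemma local_reps e0 P i : Y P -> co P e0 != 0 -> local_rep e0 i P.
Proof.
move=> YP P0; case: i => [[j|]|]; [|exact: rep_w|exact: rep_y].
have [ey|ey] := eqVneq (slice P e0 iy o1) (rho j * slice P e0 iy o0).
  have [sj|sj] := boolP (sw j); [exact: rep_z_sw | exact: rep_z_nsw].
exact: rep_z_generic.
Qed.

End Exchange.

Record exchange (T : finType) (K : closedFieldType) (rho : T -> K)
    (eps eps' : T -> bool) (cc : bool -> K) (sw : pred T) : Prop := Exchange {
  ex_two : (2%:R : K) != 0;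
  ex_inj : injective rho;
  ex_rho0 : forall j, rho j != 0;
  ex_root : forall j, sw j -> HH cc (~~ eps j) 1 (rho j) = 0;
  ex_neq0 : forall j b, ~~ (sw j && (b == ~~ eps j)) -> HH cc b 1 (rho j) != 0;
  ex_Hq : forall j, sw j -> Hq rho cc (~~ eps j) j 1 (rho j) != 0;
  ex_roots : forall b y0 y1, (y0 != 0) || (y1 != 0) -> HH cc b y0 y1 = 0 ->
    exists2 j : T, sw j && (b == ~~ eps j) & y1 = rho j * y0;
  ex_eps' : forall j, eps' j = (if sw j then ~~ eps j else eps j) }.

(** The new signs swap the roles of the two quartics. *)
Lemma exchange_sym (T : finType) (K : closedFieldType) (rho : T -> K)
    (eps eps' : T -> bool) (cc : bool -> K) (sw : pred T) :
  exchange rho eps eps' cc sw -> exchange rho eps' eps (cc \o negb) sw.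
Proof.
case=> two0 inj r0 hr hn hq hrs he; split=> //.
- by move=> j sj; rewrite he sj /HH /= negbK; exact: (hr j sj).
- move=> j b h; apply: (hn j (~~ b)); apply: contra h => /andP [sj /eqP e].
  by move: e; rewrite sj he sj; case: b; case: (eps j).
- by move=> j sj; rewrite he sj /Hq /= negbK; exact: (hq j sj).
- move=> b y0 y1 ny h; have [j /andP [sj /eqP e] yj] := hrs (~~ b) y0 y1 ny h.
  by exists j => //; move: e; rewrite sj he sj; case: (b); case: (eps j).
- by move=> j; rewrite he; case: (sw j); rewrite ?negbK.
Qed.

(** * The exchange as a regular map *)

Section ExchangeMap.
Variables (T : finType) (K : closedFieldType) (rho : T -> K).

Local Notation idK := (idfun : {rmorphism K -> K}).
Local Notation N := (amb T).
Implicit Types (v u : idx T -> 'I_3 -> K) (y z : 'I_3 -> K).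

Lemma slice_prop v x e0 : same_point (mkx (tens v)) x -> co x e0 != 0 ->
  exists l : idx T -> K, (forall i, l i != 0) /\ forall i k, slice x e0 i k = l i * v i k.
Proof.
move=> [c c0 ->]; have cz e : co (c *: mkx (tens v)) e = c * tens v e.
  by rewrite /co mxE -/(co _ _) coE.
rewrite cz mulf_eq0 negb_or => /andP [_ /prodf_neq0 h].
exists (fun i => c * \prod_(i' | i' != i) v i' (e0 i')); split.
  by move=> i; rewrite mulf_neq0 //; apply/prodf_neq0 => i' _; exact: h.
by move=> i k; rewrite /slice cz tens_upd mulrA.
Qed.

Lemma tgt_scale e' cc v u (l : idx T -> K) : (forall i, l i != 0) ->
  (forall i k, v i k = l i * u i k) ->
  exists m : idx T -> K, (forall i, m i != 0) /\
    forall i k, tgt rho e' cc v i k = m i * tgt rho e' cc u i k.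
Proof.
move=> l0 h; have WE k : W cc (v iy) (v iw) k = l iy ^+ 4 * l iw * W cc (u iy) (u iw) k.
  by rewrite -W_scale; congr (W _ _ _ _); apply/funext => k'; rewrite h.
exists (fun i => match i with None => l iy | Some None => l iy ^+ 4 * l iw
   | _ => l iy * (l iy ^+ 4 * l iw) end); split.
  by case=> [[j|]|]; rewrite ?mulf_neq0 ?expf_neq0.
apply: idxP => [k|k|j]; rewrite /tgt /=; [exact: h | exact: WE |].
apply: I3P; rewrite /cvec [W]lock /vec3 /= -lock !WE !h; ring.
Qed.

Variables (eps eps' : T -> bool) (cc : bool -> K) (sw : pred T).
Hypothesis E : exchange rho eps eps' cc sw.
Local Notation w := (wof rho eps).
Local Notation w' := (wof rho eps').
Local Notation Y := (Yset rho w).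
Local Notation Y' := (Yset rho w').

Lemma gen_slice x : qY rho w x != 0 -> gen rho eps (slice x (e00 T)).
Proof.
have u0 i : upd (e00 T) i o0 = e00 T by apply/ffunP => i'; rewrite !ffunE; case: eqP.
rewrite /qY /qform !mulf_eq0 !negb_or => /andP [/andP [x0 /prodf_neq0 hy] /prodf_neq0 hw].
by rewrite /gen /slice !u0; split=> [j|]; [exact: (hy j isT) | split=> [j|//]; exact: (hw j isT)].
Qed.

Lemma gen_scale v u (l : idx T -> K) : (forall i, l i != 0) ->
  (forall i k, v i k = l i * u i k) -> gen rho eps u -> gen rho eps v.
Proof.
move=> l0 h [g1 [g2 [g3 g4]]]; split=> [j|].
  by rewrite !h mulrCA -mulrBr mulf_neq0.
split=> [j|]; first by rewrite !h mulrCA -mulrBr mulf_neq0.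
by rewrite !h !mulf_neq0.
Qed.

Lemma tgt_Y v : nondeg v -> onY rho w idK v -> gen rho eps v ->
  nondeg (tgt rho eps' cc v) /\ Y' (mkx (tens (tgt rho eps' cc v))).
Proof.
move=> nv hv [gy _]; have [y2 w2 _ _] := hv.
have nW : exists k, W cc (v iy) (v iw) k != 0.
  apply: (W_neq0 (ex_two E) (ex_rho0 E) (ex_neq0 E) (ex_roots E) nv hv) => j sj [h _].
  by have := gy j; rewrite h subrr eqxx.
have nd : nondeg (tgt rho eps' cc v).
  apply: chart_nondeg => // j.
  have [W0|W0] := eqVneq (W cc (v iy) (v iw) o0) 0; last first.
    by exists o1; rewrite /cvec [W]lock /vec3 /= -lock mulf_neq0.
  have W1 := nz3 nW erefl W0; exists o2.
  by rewrite /cvec [W]lock /vec3 /= -lock W0 mulr0 subr0 mulf_neq0.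
by split=> //; apply: chart_Y.
Qed.

Definition phi0 (x : 'rV[K]_N.+1) : 'rV[K]_N.+1 := mkx (tens (tgt rho eps' cc (slice x (e00 T)))).

Lemma W_hpoly e0 k :
  hpoly 5 (fun x : 'rV[K]_N.+1 => W cc (slice x e0 iy) (slice x e0 iw) k).
Proof. by move: k; apply: I3P; rewrite /W /vec3 /= /HH; hp. Qed.

Lemma tgt_hpoly e0 : exists d : idx T -> nat, forall i k,
  hpoly (d i) (fun x : 'rV[K]_N.+1 => tgt rho eps' cc (slice x e0) i k).
Proof.
exists (fun i => match i with None => 1 | Some None => 5 | _ => 6 end)%N.
apply: idxP => [k|k|j]; rewrite /tgt /=; [by hp | exact: W_hpoly |].
have hW := W_hpoly e0.
have hD : hpoly 5 (fun x : 'rV[K]_N.+1 => W cc (slice x e0 iy) (slice x e0 iw) o1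
   - w' j * W cc (slice x e0 iy) (slice x e0 iw) o0).
  by apply: hpolyB => //; exact: hpolyZ.
apply: I3P; rewrite /cvec [W]lock /vec3 /= -lock.
- by apply: (@hpolyM _ _ 5 1) => //; hp.
- by apply: (@hpolyM _ _ 1 5) => //; hp.
- by apply: (@hpolyM _ _ 1 5) => //; hp.
Qed.

Lemma tens_par (f g : idx T -> 'I_3 -> K) : (forall i k k', f i k * g i k' = f i k' * g i k) ->
  forall e e', tens f e * tens g e' = tens f e' * tens g e.
Proof. by move=> h e e'; rewrite /tens -!big_split; apply: eq_bigr => i _; exact: h. Qed.

Lemma exchange_map : exists2 phi, regmap Y Y' phi &
  forall x, Y x -> qY rho w x != 0 -> same_point (phi0 x) (phi x).
Proof.
have inj := ex_inj E; have iY := Y_irreducible w inj.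
have [dq hq] := qY_hpoly rho w.
have [a0 [b0 g0]] := ex_generic rho w.
have gY := gpt_Y g0; have gq := qY_gpt g0.
apply: (regmap_extend iY _ hq _ (@Yset_closed _ _ _ _)).
- exact: Yset_neq0.
- by exists (gpt rho w a0 b0).
- move=> x Yx qx; have gx := gen_slice qx.
  have x0 : co x (e00 T) != 0 by move: qx; rewrite /qY /qform !mulf_eq0 !negb_or => /andP [/andP []].
  by have [nv hv _] := Yset_slice Yx x0; have [] := tgt_Y nv hv gx.
move=> P YP; have [e0 P0] := co_neq0 (Yset_neq0 YP).
have /choice [d hd] := fun i => local_reps (ex_two E) inj (ex_rho0 E) (ex_root E)
  (ex_neq0 E) (ex_Hq E) (ex_roots E) (ex_eps' E) i YP P0.
have {hd} /choice [g hg] := hd.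
have hG l : hpoly (\sum_i d i) (fun x : 'rV[K]_N.+1 => tens (fun i k => g i k (slice x e0)) (dec l)).
  by apply: hpoly_prod => i; case: (hg i).
exists (\sum_i d i)%N, (fun l x => tens (fun i k => g i k (slice x e0)) (dec l)); split=> //.
  have [|e he] := @tens_neq0 _ _ (fun i k => g i k (slice P e0)).
    by move=> i; case: (hg i).
  by apply: (@rV_neq0P _ _ _ (enc e)); rewrite mxE encK.
have [t ht] := tgt_hpoly (e00 T).
have hp0 l : hpoly (\sum_i t i) (fun x => phi0 x 0 l).
  apply: (hpoly_ext (F := fun x => tens (tgt rho eps' cc (slice x (e00 T))) (dec l))).
    by move=> x; rewrite /phi0 mxE.
  by apply: hpoly_prod => i.
move=> x Yx qx l m; rewrite !mxE -/(phi0 x 0 l) -/(phi0 x 0 m).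
set G := fun l (x : 'rV[K]_N.+1) => tens (fun i k => g i k (slice x e0)) (dec l).
rewrite -!/(G _ x).
pose F x := G l x * phi0 x 0 m - G m x * phi0 x 0 l.
suff : F x = 0 by move/eqP; rewrite /F subr_eq0 !mxE => /eqP.
have hF : hpoly (\sum_i d i + \sum_i t i) F.
  exact: (hpolyB (hpolyM (hG l) (hp0 m)) (hpolyM (hG m) (hp0 l))).
have Y0 x' : Y x' -> x' != 0 by exact: Yset_neq0.
(* The slices at [e0] and at [e00] differ by scalars only where both reference coordinates are
   nonzero; two uses of the identity principle restrict to such points. *)
apply: (irreducible_vanish iY Y0 hF (hpoly_co K e0)) Yx; first by exists P.
move=> {qx} x Yx x0.
apply: (mulfI x0); rewrite mulr0.
apply: (irreducible_vanish iY Y0 (hpolyM (hpoly_co K e0) hF) hq) Yx; first by exists (gpt rho w a0 b0).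
move=> {x0} x Yx qx.
have [->|x0] := eqVneq (co x e0) 0; first by rewrite mul0r.
have x00 : co x (e00 T) != 0 by move: qx; rewrite /qY /qform !mulf_eq0 !negb_or => /andP [/andP []].
have [nu hu [c c0 xE]] := Yset_slice Yx x00.
have [nv hv _] := Yset_slice Yx x0.
have [|l' [l0 le]] := slice_prop (v := slice x (e00 T)) _ x0; first by exists c.
have gv := gen_scale l0 le (gen_slice qx).
have [t' [t0 te]] := tgt_scale eps' cc l0 le.
apply/eqP; rewrite mulf_eq0 (negPf x0) /= /F subr_eq0 /G /phi0 !mxE; apply/eqP.
apply: tens_par => i k k'; have [_ _ H] := hg i.
by apply: (mulfI (t0 i)); rewrite mulrCA -te H // te mulrCA.
Qed.

Lemma phi0_gpt a b x : generic rho w a b -> same_point (gpt rho w a b) x -> qY rho w x != 0 ->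
  same_point (mkx (tens (tgt rho eps' cc (chart rho w idK (pt 1 a) (pt 1 b))))) (phi0 x).
Proof.
move=> g sp qx.
have x0 : co x (e00 T) != 0 by move: qx; rewrite /qY /qform !mulf_eq0 !negb_or => /andP [/andP []].
have [l [l0 le]] := slice_prop sp x0; have [t [t0 te]] := tgt_scale eps' cc l0 le.
exact: mkx_tensZ t0 te.
Qed.

(* Outside of the zeros of this form, the image under the exchange map is generic. *)
Definition q2 (x : 'rV[K]_N.+1) : K :=
  let y := slice x (e00 T) iy in let z := slice x (e00 T) iw in
  qY rho w x * (W cc y z o0 * \prod_j (W cc y z o1 - w' j * W cc y z o0)).

Lemma q2_hpoly : exists d, hpoly d q2.
Proof.
have [d hd] := qY_hpoly rho w; have hW := W_hpoly (e00 T).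
exists (d + (5 + \sum_(j : T) 5))%N; apply: hpolyM => //; apply: hpolyM => //.
by apply: hpoly_prod => j; apply: hpolyB => //; exact: hpolyZ.
Qed.

Lemma W_lin a (b : K) k : W cc (pt 1 a) (pt 1 b) k =
  W cc (pt 1 a) (pt 1 0) k + b * W cc (pt 1 a) (pt 0 1) k.
Proof. by move: k; apply: I3P; rewrite /W /pt /vec3 /=; ring. Qed.

Lemma W_det2 a : W cc (pt 1 a) (pt 1 0) o0 * W cc (pt 1 a) (pt 0 1) o1
   - W cc (pt 1 a) (pt 1 0) o1 * W cc (pt 1 a) (pt 0 1) o0 =
  4%:R * HH cc false 1 a * HH cc true 1 a.
Proof. by rewrite /W /HH /pt /vec3 /=; ring. Qed.

Lemma HH_generic a e : (forall j, a != rho j) -> HH cc e 1 a != 0.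
Proof.
move=> ha; apply/eqP => h; have [|j _] := ex_roots E _ h; first by rewrite oner_neq0.
by rewrite mulr1 => /eqP; rewrite (negPf (ha j)).
Qed.

(** For a general a, W is affine in b and the determinant [W_det2] is nonzero, so each condition
    excludes at most one value of b. *)
Lemma ex_generic2 : exists a b, [/\ generic rho w a b,
  W cc (pt 1 a) (pt 1 b) o0 != 0 &
  forall j, W cc (pt 1 a) (pt 1 b) o1 - w' j * W cc (pt 1 a) (pt 1 b) o0 != 0].
Proof.
have [a ha] := generic_avoid (codom rho).
have ga j : a != rho j by apply/eqP => e; move: ha; rewrite e codom_f.
pose p k := W cc (pt 1 a) (pt 1 0) k; pose q k := W cc (pt 1 a) (pt 0 1) k.
have D0 : p o0 * q o1 - p o1 * q o0 != 0.
  rewrite W_det2 !mulf_neq0 ?HH_generic //.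
  by rewrite (_ : 4%:R = 2%:R * 2%:R :> K) ?mulf_neq0 ?(ex_two E) // -natrM.
pose c (s : option T) : K * K := match s with None => (0, 1) | Some j => (1, - w' j) end.
pose f s : K := (c s).1 * p o1 + (c s).2 * p o0.
pose h s : K := (c s).1 * q o1 + (c s).2 * q o0.
have fh s : (f s != 0) || (h s != 0).
  rewrite -negb_and; apply/negP => /andP [/eqP e1 /eqP e2].
  have : (c s).1 * (p o0 * q o1 - p o1 * q o0) = 0.
    transitivity (p o0 * h s - q o0 * f s); first by rewrite /f /h; ring.
    by rewrite e1 e2 !mulr0 subrr.
  move/eqP; rewrite mulf_eq0 (negPf D0) orbF => /eqP c1.
  have : (c s).2 * (p o0 * q o1 - p o1 * q o0) = 0.
    transitivity (q o1 * f s - p o1 * h s); first by rewrite /f /h; ring.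
    by rewrite e1 e2 !mulr0 subrr.
  move/eqP; rewrite mulf_eq0 (negPf D0) orbF => /eqP c2.
  by case: s {e1 e2} c1 c2 => [j|] /= /eqP; rewrite ?oner_eq0 // => _ /eqP; rewrite oner_eq0.
have [b hb] := generic_avoid (codom w ++ codom (fun s => - f s / h s)).
move: hb; rewrite mem_cat negb_or => /andP [hb hb'].
have key s : f s + b * h s != 0.
  have [h0|h0] := eqVneq (h s) 0; first by have := fh s; rewrite h0 mulr0 addr0 eqxx orbF.
  apply/eqP => e; move: hb'; rewrite (_ : b = - f s / h s) ?codom_f //.
  apply: (mulIf h0); rewrite divfK //; apply/eqP; rewrite -subr_eq0 opprK addrC; exact/eqP.
have gb j : b != w j by apply/eqP => e; move: hb; rewrite e codom_f.
exists a, b; split=> //.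
  by have := key None; rewrite /f /h /= !mul0r !add0r !mul1r W_lin.
move=> j; have := key (Some j); rewrite /f /h /= !mul1r !(W_lin a b).
congr (_ != 0); rewrite /p /q; ring.
Qed.

Lemma q2_point : exists2 x, Y x & q2 x != 0.
Proof.
have [a [b [g W0 W1]]] := ex_generic2; exists (gpt rho w a b); first exact: gpt_Y.
have qx := qY_gpt g; have x0 : co (gpt rho w a b) (e00 T) != 0.
  by move: qx; rewrite /qY /qform !mulf_eq0 !negb_or => /andP [/andP []].
have [l [l0 le]] := slice_prop (same_point_refl _) x0.
have WE k : W cc (slice (gpt rho w a b) (e00 T) iy) (slice (gpt rho w a b) (e00 T) iw) k
  = l iy ^+ 4 * l iw * W cc (pt 1 a) (pt 1 b) k.
  by rewrite -W_scale; congr (W _ _ _ _); apply/funext => k'; rewrite le.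
rewrite /q2 !WE mulf_neq0 // mulf_neq0 ?mulf_neq0 ?expf_neq0 //.
by apply/prodf_neq0 => j _; rewrite mulrCA -mulrBr mulf_neq0 // mulf_neq0 ?expf_neq0.
Qed.

Lemma q2_generic x : Y x -> q2 x != 0 -> exists a b, [/\ generic rho w a b,
  same_point (gpt rho w a b) x, qY rho w x != 0, W cc (pt 1 a) (pt 1 b) o0 != 0 &
  forall j, W cc (pt 1 a) (pt 1 b) o1 - w' j * W cc (pt 1 a) (pt 1 b) o0 != 0].
Proof.
move=> Yx; rewrite /q2 /= mulf_eq0 negb_or => /andP [qx].
have [a [b [g sp]]] := qY_generic Yx qx.
have x0 : co x (e00 T) != 0.
  by move: qx; rewrite /qY /qform !mulf_eq0 !negb_or => /andP [/andP []].
have [l [l0 le]] := slice_prop sp x0.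
have WE k : W cc (slice x (e00 T) iy) (slice x (e00 T) iw) k
  = l iy ^+ 4 * l iw * W cc (pt 1 a) (pt 1 b) k.
  by rewrite -W_scale; congr (W _ _ _ _); apply/funext => k'; rewrite le.
rewrite !WE mulf_eq0 negb_or => /andP []; rewrite mulf_eq0 negb_or => /andP [_ W0] /prodf_neq0 h.
exists a, b; split=> // j; have := h j isT.
by rewrite mulrCA -mulrBr mulf_eq0 negb_or => /andP [].
Qed.

End ExchangeMap.

(** * The inverse of the exchange *)

Section ExchangeIso.
Variables (T : finType) (K : closedFieldType) (rho : T -> K).
Local Notation idK := (idfun : {rmorphism K -> K}).

(** For fixed y, W acts linearly on z. Swapping the quartics changes the sign of the off-diagonal
    entries only, and so gives the adjugate matrix. *)
Lemma W_inv (cc : bool -> K) (y z : 'I_3 -> K) k : z o2 = 0 ->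
  W (cc \o negb) y (W cc y z) k = 4%:R * HH cc false (y o0) (y o1) * HH cc true (y o0) (y o1) * z k.
Proof. by move=> z2; move: k; apply: I3P; rewrite /W /HH /vec3 /= ?z2; ring. Qed.

(** By density it suffices to look at generic points whose image is generic, where both maps are
    given by explicit formulas. *)
Lemma exchange_inverse eps eps' cc sw phi psi : exchange rho eps eps' cc sw ->
  regmap (Yset rho (wof rho eps)) (Yset rho (wof rho eps')) phi ->
  (forall x, Yset rho (wof rho eps) x -> qY rho (wof rho eps) x != 0 ->
    same_point (phi0 rho eps' cc x) (phi x)) ->
  regmap (Yset rho (wof rho eps')) (Yset rho (wof rho eps)) psi ->
  (forall x, Yset rho (wof rho eps') x -> qY rho (wof rho eps') x != 0 ->
    same_point (phi0 rho eps (cc \o negb) x) (psi x)) ->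
  forall x, Yset rho (wof rho eps) x -> same_point x (psi (phi x)).
Proof.
move=> E r1 h1 r2 h2; have inj := ex_inj E.
have [d hd] := q2_hpoly rho eps eps' cc.
have Y0 (e : T -> bool) x : Yset rho (wof rho e) x -> x != 0 by exact: Yset_neq0.
apply: (regmap_eq_dense (Y_irreducible _ inj) (Y0 _) hd (q2_point E)
  (regmap_id (Y0 _)) (regmap_comp r1 r2) (Y0 _)) => x Yx q2x.
have [a [b [g sp qx W0 W1]]] := q2_generic Yx q2x; rewrite /=.
have s1 : same_point (mkx (tens (tgt rho eps' cc (chart rho (wof rho eps) idK (pt 1 a) (pt 1 b)))))
   (phi x).
  by apply: same_point_trans (h1 _ Yx qx); exact: phi0_gpt.
pose b' := W cc (pt 1 a) (pt 1 b) o1 / W cc (pt 1 a) (pt 1 b) o0.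
have WE k : W cc (pt 1 a) (pt 1 b) k = W cc (pt 1 a) (pt 1 b) o0 * pt 1 b' k.
  move: k; apply: I3P; rewrite /b' [W]lock /pt /vec3 /= -lock ?mulr1 //.
    by rewrite mulrC divfK.
  by rewrite mulr0.
have g' : generic rho (wof rho eps') a b'.
  split=> [|j]; first by case: g.
  have := W1 j; apply: contra => /eqP e; rewrite [W cc _ _ o1]WE -[pt 1 b' o1]/b' e.
  by rewrite mulrC subrr.
have s2 : same_point (gpt rho (wof rho eps') a b') (phi x).
  apply: same_point_trans s1.
  apply: (@mkx_tensZ _ _ _ _ (fun i => match i with None => 1 | _ => W cc (pt 1 a) (pt 1 b) o0 end)).
    by case=> [[j|]|] //; exact: oner_neq0.
  apply: idxP => [k|k|j]; rewrite /tgt /=; first by rewrite mul1r.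
    exact: WE.
  by apply: I3P; rewrite /cvec [W]lock /vec3 /= -lock ?[W _ _ _ o1]WE /pt /vec3 /=; ring.
have q' : qY rho (wof rho eps') (phi x) != 0.
  have [dq hq] := qY_hpoly rho (wof rho eps').
  by rewrite (hpoly_same_point hq s2); exact: qY_gpt.
have s3 := phi0_gpt eps (cc \o negb) g' s2 q'.
apply: same_point_trans (h2 _ (r1.1 _ Yx) q'); apply: same_point_trans s3.
apply: same_point_trans (same_point_sym sp) _.
have ga : forall j, a != rho j by case: g.
pose m := 4%:R * HH cc false 1 a * HH cc true 1 a.
have m0 : m != 0.
  rewrite !mulf_neq0 ?(HH_generic E) //.
  by rewrite (_ : 4%:R = 2%:R * 2%:R :> K) ?mulf_neq0 ?(ex_two E) // -natrM.
have W2 k : W (cc \o negb) (pt 1 a) (pt 1 b') k = (m / W cc (pt 1 a) (pt 1 b) o0) * pt 1 b k.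
  apply: (mulfI W0); rewrite mulrA [_ * (m / _)]mulrC divfK //.
  transitivity (W (cc \o negb) (fun k => 1 * pt 1 a k)
     (fun k => W cc (pt 1 a) (pt 1 b) o0 * pt 1 b' k) k).
    by rewrite W_scale expr1n mul1r.
  rewrite (_ : (fun k => 1 * pt 1 a k) = pt 1 a); last by apply/funext => k'; rewrite mul1r.
  rewrite (_ : (fun k => _ * pt 1 b' k) = W cc (pt 1 a) (pt 1 b)); last first.
    by apply/funext => k'; rewrite -WE.
  by rewrite W_inv.
set l := m / _ in W2.
have l0 : l != 0 by rewrite mulf_neq0 // invr_eq0.
apply: (@mkx_tensZ _ _ _ _ (fun i => match i with None => 1 | _ => l end)).
  by case=> [[j|]|] //; exact: oner_neq0.
apply: idxP => [k|k|j]; rewrite /tgt /=; first by rewrite mul1r.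
  exact: W2.
by apply: I3P; rewrite /cvec [W]lock /vec3 /= -lock !W2 /pt /vec3 /=; ring.
Qed.

Lemma exchange_iso eps eps' cc sw : exchange rho eps eps' cc sw ->
  ziso (Yset rho (wof rho eps)) (Yset rho (wof rho eps')).
Proof.
move=> E; have E' := exchange_sym E.
have [phi r1 h1] := exchange_map E; have [psi r2 h2] := exchange_map E'.
exists phi, psi; split=> //; first exact: exchange_inverse E r1 h1 r2 h2.
apply: (exchange_inverse E' r2 h2 r1) => x Yx qx.
rewrite (_ : _ \o negb = cc); first exact: h1.
by apply/funext => b /=; rewrite negbK.
Qed.

End ExchangeIso.

(** * Bihomogeneous forms without common factor *)

Section Hev.
Variable K : closedFieldType.

Section Over.
Variables (L : comNzRingType) (k : {rmorphism K -> L}).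

(* The bihomogeneous form of bidegree (n, m) attached to P, in which the inner
   variable of P is y1 / y0 and the outer one w1 / w0. *)
Definition hev n m (P : {poly {poly K}}) (y0 y1 w0 w1 : L) : L :=
  \sum_(b < m.+1) \sum_(a < n.+1)
    k P`_b`_a * (y1 ^+ a * y0 ^+ (n - a) * (w1 ^+ b * w0 ^+ (m - b))).

End Over.

Lemma rmorph_hev (L L' : comNzRingType) (k : {rmorphism K -> L}) (h : {rmorphism L -> L'})
    (k' : {rmorphism K -> L'}) n m P y0 y1 w0 w1 :
  (forall c, h (k c) = k' c) ->
  h (hev k n m P y0 y1 w0 w1) = hev k' n m P (h y0) (h y1) (h w0) (h w1).
Proof.
move=> hk; rewrite rmorph_sum; apply: eq_bigr => b _; rewrite rmorph_sum.
by apply: eq_bigr => a _; rewrite !rmorphM !rmorphXn hk.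
Qed.

Local Notation idK := (idfun : {rmorphism K -> K}).
Local Notation kk := ((polyC \o polyC) : {rmorphism K -> {poly {poly K}}}).
Local Notation cK := (polyC : {rmorphism K -> {poly K}}).

Definition bidegree n m (P : {poly {poly K}}) :=
  (size P <= m.+1)%N /\ forall b, (size (P`_b)%R <= n.+1)%N.

Lemma hev_ev2 n m P y0 y1 w0 w1 : bidegree n m P -> y0 != 0 -> w0 != 0 ->
  hev idK n m P y0 y1 w0 w1 = y0 ^+ n * w0 ^+ m * ev2 (y1 / y0) (w1 / w0) P.
Proof.
move=> [sP sPb] y00 w00; rewrite /hev /ev2 (horner_coef_wide _ sP) horner_sum mulr_sumr.
apply: eq_bigr => b _; rewrite hornerM -rmorphXn hornerC (horner_coef_wide _ (sPb b)).
rewrite mulr_suml mulr_sumr; apply: eq_bigr => a _.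
have an : (a <= n)%N by rewrite -ltnS.
have bm : (b <= m)%N by rewrite -ltnS.
have -> : y0 ^+ n = y0 ^+ a * y0 ^+ (n - a) by rewrite -exprD subnKC.
have -> : w0 ^+ m = w0 ^+ b * w0 ^+ (m - b) by rewrite -exprD subnKC.
rewrite !expr_div_n /=; field.
by rewrite !expf_neq0.
Qed.

Lemma ev2_hev s t n m P y0 y1 w0 w1 :
  ev2 s t (hev kk n m P y0 y1 w0 w1) =
  hev idK n m P (ev2 s t y0) (ev2 s t y1) (ev2 s t w0) (ev2 s t w1).
Proof.
by rewrite -[LHS]/(ev2m s t _) (rmorph_hev _ _ _ _ _ _ _ (ev2CC s t : forall c, ev2m s t (kk c) = idK c)).
Qed.

Lemma horner_hev t n m P y0 y1 w0 w1 :
  (hev cK n m P y0 y1 w0 w1).[t] = hev idK n m P y0.[t] y1.[t] w0.[t] w1.[t].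
Proof.
rewrite -horner_evalE.
by rewrite (rmorph_hev _ _ _ _ _ _ _ ((fun c => hornerC c t) : forall c, horner_eval t (cK c) = idK c)).
Qed.

Lemma poly_eq0P (p : {poly K}) : (forall x, p.[x] = 0) -> p = 0.
Proof.
move=> h; apply/eqP/negPn/negP => /closed_nonrootP [x]; by rewrite /root h eqxx.
Qed.

Lemma ev2_eq0 (f : {poly {poly K}}) : (forall s t, ev2 s t f = 0) -> f = 0.
Proof.
move=> h; apply/polyP => b; rewrite coef0; apply: poly_eq0P => s.
have e : subs0 s f = 0 by apply: poly_eq0P => t; rewrite -ev2_subs0.
by have := congr1 (fun p : {poly K} => p`_b) e; rewrite coef_map coef0.
Qed.

Lemma ev2_dense (D f : {poly {poly K}}) : D != 0 ->
  (forall s t, ev2 s t D != 0 -> ev2 s t f = 0) -> f = 0.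
Proof.
move=> D0 h; have : f * D = 0.
  apply: ev2_eq0 => s t; rewrite ev2M; have [->|/h ->] := eqVneq (ev2 s t D) 0.
    by rewrite mulr0.
  by rewrite mul0r.
by move/eqP; rewrite mulf_eq0 (negPf D0) orbF => /eqP.
Qed.

Definition xs : {poly {poly K}} := 'X%:P.
Definition xt : {poly {poly K}} := 'X.

Lemma dvd_s (f : {poly {poly K}}) : subs0 0 f = 0 -> exists g, f = xs * g.
Proof. by move=> /subs0_eq0 [g ->]; exists g; rewrite subr0. Qed.

Lemma dvd_t (f : {poly {poly K}}) : f`_0 = 0 -> exists g, f = xt * g.
Proof.
move=> h; have /factor_theorem [q ->] : root f 0 by rewrite /root horner_coef0 h.
by exists q; rewrite subr0 mulrC.
Qed.

Lemma subs0M z (f g : {poly {poly K}}) : subs0 z (f * g) = subs0 z f * subs0 z g.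
Proof. exact: rmorphM. Qed.

Lemma subs0_xs z : subs0 z xs = z%:P.
Proof. by rewrite /subs0 /xs map_polyC /= /horner_eval hornerX. Qed.

(* If a tuple G is proportional to a tuple p that does not vanish at the origin,
   then locally G = h p, and the function h can only have the prime factors s and t. *)
Lemma peel (I : finType) (G p A : I -> {poly {poly K}}) i0 v a b :
  (forall i j, G i * p j = G j * p i) -> ev2 0 0 (p i0) != 0 -> ev2 0 0 v != 0 ->
  \sum_i A i * G i = xs ^+ a * xt ^+ b * v ->
  (exists i, subs0 0 (G i) != 0) -> (exists i, (G i)`_0 != 0) -> ev2 0 0 (G i0) != 0.
Proof.
move=> par p0 v0 bez [is_ nis] [it nit].
have s0 : subs0 0 (G i0) != 0.
  apply: contra nis => /eqP e; have := congr1 (subs0 0) (par is_ i0).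
  rewrite !subs0M e mul0r => /eqP; rewrite mulf_eq0 => /orP [//|/eqP e'].
  by case/eqP: p0; rewrite ev2_subs0 e' horner0.
have t0 : (G i0)`_0 != 0.
  apply: contra nit => /eqP e; have := congr1 (fun q : {poly {poly K}} => q`_0) (par it i0).
  rewrite !coef0M e mul0r => /eqP; rewrite mulf_eq0 => /orP [//|/eqP e'].
  by case/eqP: p0; rewrite /ev2 polyC0 (horner_coef0 (p i0)) e' horner0.
(* Neither s nor t divides [G i0], so the powers of s and t on the right divide the other factor and
   can be stripped off. *)
have main : G i0 * (\sum_i A i * p i) = xs ^+ a * xt ^+ b * (v * p i0).
  rewrite mulrA -bez mulr_suml mulr_sumr; apply: eq_bigr => i _.
  by rewrite mulrCA par mulrA.
have vp0 : ev2 0 0 (v * p i0) != 0 by rewrite ev2M mulf_neq0.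
move: (\sum_i _) (v * p i0) vp0 main => S q q0 {bez}.
have xs0 : xs != 0 by rewrite /xs polyC_eq0 polyX_eq0.
have xt0 : xt != 0 by rewrite /xt polyX_eq0.
elim: a S => [|a IHa] S.
  elim: b S => [|b IHb] S.
    by rewrite !mul1r => e; move: q0; rewrite -e ev2M mulf_eq0 negb_or => /andP [].
  rewrite mul1r => e; have [|S' eS] := @dvd_t S.
    have := congr1 (fun q : {poly {poly K}} => q`_0) e.
    rewrite exprS -mulrA !coef0M /xt coefX mul0r => /eqP.
    by rewrite mulf_eq0 (negPf t0) => /eqP.
  apply: (IHb S'); apply: (mulfI xt0).
  by rewrite mul1r mulrCA -eS e exprS -mulrA.
move=> e; have [|S' eS] := @dvd_s S.
  have := congr1 (subs0 0) e; rewrite exprS -!mulrA !subs0M.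
  rewrite subs0_xs polyC0 mul0r => /eqP.
  by rewrite mulf_eq0 (negPf s0) => /eqP.
apply: (IHa S'); apply: (mulfI xs0).
by rewrite mulrCA -eS e exprS -!mulrA.
Qed.

Definition proportional (I : Type) (P G : I -> {poly {poly K}}) :=
  forall i j, P i * G j = P j * G i.

Lemma proportional_trans (I : Type) (Q P G : I -> {poly {poly K}}) :
  (exists i, P i != 0) -> proportional Q P -> proportional P G -> proportional Q G.
Proof.
move=> [l Pl] h1 h2 i j; apply: (mulfI Pl).
transitivity (Q l * (P i * G j)); first by rewrite mulrA -h1; ring.
by rewrite h2 mulrA h1; ring.
Qed.

Definition bezout (I : finType) (P A : I -> {poly {poly K}}) (c : {poly K}) :=
  \sum_i A i * P i = c%:P.

(** In the ideal of the tuple over K[s], take a nonzero h of least degree in t. If t does not occur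
    in it, it is the constant c. Otherwise pseudo-division shows that h divides every member up to a
    factor in s, and the quotients form a proportional tuple of smaller degree in t. *)
Lemma ex_bezout (I : finType) (G : I -> {poly {poly K}}) : (exists i, G i != 0) ->
  exists P A c, [/\ proportional P G, exists i, P i != 0, c != 0 & bezout P A c].
Proof.
move=> nG; pose good P := proportional P G /\ exists i, P i != 0.
suff H n : forall P, good P -> (forall i, (size (P i) <= n)%N) ->
   exists P A c, [/\ proportional P G, exists i, P i != 0, c != 0 & bezout P A c].
  apply: (H (\max_i size (G i))%N G); last by move=> i; exact: leq_bigmax.
  by split=> // i j; rewrite mulrC.
elim: n => [|n IH] P [pP [i1 nP]] sP.
  by have := sP i1; rewrite leqn0 size_poly_eq0 (negPf nP).
pose ideal (h : {poly {poly K}}) := exists A : I -> _, h = \sum_i A i * P i.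
have idP i : ideal (P i).
  exists (fun j => (j == i)%:R); rewrite (bigD1 i) //= eqxx mul1r big1 ?addr0 // => j /negPf ->.
  by rewrite mul0r.
pose Q k := `[< exists h, [/\ ideal h, h != 0 & size h = k] >].
have exQ : exists k, Q k by exists (size (P i1)); apply/asboolP; exists (P i1).
case: (ex_minnP exQ) => k /asboolP [h [ih h0 sh]] min.
have [A hA] := ih.
have [k1|k1] := leqP k 1.
  have hC : h = (h`_0)%:P by apply: size1_polyC; rewrite sh.
  exists P, A, h`_0; split=> //; first by exists i1.
    by apply/eqP => e; move: h0; rewrite hC e eqxx.
  by rewrite /bezout -hA.
have rem i : P i %% h = 0.
  apply/eqP/negPn/negP => r0; have : (k <= size (P i %% h)%R)%N.
    apply: min; apply/asboolP; exists (P i %% h); split=> //.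
    exists (fun j => (lead_coef h ^+ scalp (P i) h)%:P * (j == i)%:R - (P i %/ h) * A j).
    under eq_bigr => j _ do rewrite mulrBl -!mulrA.
    rewrite sumrB -!mulr_sumr -hA.
    rewrite (bigD1 i) //= eqxx mul1r big1 ?addr0 => [|j /negPf ->]; last by rewrite mul0r.
    by rewrite mul_polyC Pdiv.WeakIdomain.divp_eq addrC addKr.
  by rewrite leqNgt -sh ltn_modp h0.
pose c i := lead_coef h ^+ scalp (P i) h.
have c0 i : c i != 0 by rewrite expf_neq0 // lead_coef_eq0.
(* The multipliers of the pseudo-divisions are brought to their common product, so that the
   quotients stay proportional to P. *)
pose R i := (\prod_(j | j != i) c j)%:P * (P i %/ h).
have RE i : R i * h = (\prod_j c j)%:P * P i.
  transitivity ((\prod_(j | j != i) c j)%:P * ((c i)%:P * P i)).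
    have dE := Pdiv.WeakIdomain.divp_eq (P i) h.
    by rewrite rem addr0 -mul_polyC -/(c i) in dE; rewrite dE /R mulrA.
  by rewrite [in RHS](bigD1 i) //= polyCM; ring.
have C0 : \prod_j c j != 0 by apply/prodf_neq0.
have CP0 : (\prod_j c j)%:P != 0 :> {poly {poly K}} by rewrite polyC_eq0.
have propR : proportional R P.
  move=> i j; apply: (mulfI h0); transitivity ((R i * h) * P j); first by ring.
  transitivity ((R j * h) * P i); last by ring.
  by rewrite !RE; ring.
have nR : R i1 != 0.
  by apply/eqP => e; have /esym/eqP := RE i1; rewrite e mul0r mulf_eq0 (negPf CP0) (negPf nP).
have [||P' [A' [c' [h1 h2 h3 h4]]]] := IH R.
- split; last by exists i1.
  by apply: proportional_trans propR pP; exists i1.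
- move=> i; have [->|Ri0] := eqVneq (R i) 0; first by rewrite size_poly0.
  have := sP i; rewrite -(size_Cmul (P i) C0) -RE size_mul // sh.
  by rewrite -(subnKC k1) addnA addn2 !addSn /= ltnS; apply: leq_trans; exact: leq_addr.
- by exists P', A', c'.
Qed.

End Hev.

(** * Tuples of forms without common factor *)

Section GoodTuples.
Variables (K : closedFieldType) (I : finType).
Local Notation idK := (idfun : {rmorphism K -> K}).
Local Notation kk := ((polyC \o polyC) : {rmorphism K -> {poly {poly K}}}).
Local Notation cK := (polyC : {rmorphism K -> {poly K}}).
Local Notation L := {poly {poly K}}.
Implicit Types P A G : I -> L.

(** Absence of a common factor in usable form: [good_bez] excludes factors that involve t,
    [good_line] the factors s - a, and [good_n] and [good_m] the factors y0 and w0 of the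
    homogenized forms. *)
Record good P A (c : {poly K}) n m : Prop := Good {
  good_bi : forall i, bidegree n m (P i);
  good_c : c != 0;
  good_bez : bezout P A c;
  good_line : forall a, exists i, subs0 a (P i) != 0;
  good_n : exists i b, (P i)`_b`_n != 0;
  good_m : exists i, (P i)`_m != 0 }.

(** A common factor s - a of the tuple divides c too, so the degree of c bounds the number of
    removals. *)
Lemma ex_bezout2 G : (exists i, G i != 0) ->
  exists P A c, [/\ proportional P G, c != 0, bezout P A c & forall a, exists i, subs0 a (P i) != 0].
Proof.
move=> nG; have [P0 [A0 [c0 [h1 h2 h3 h4]]]] := ex_bezout nG.
suff H n : forall P A (c : {poly K}), (size c <= n)%N -> proportional P G ->
    (exists i, P i != 0) -> c != 0 -> bezout P A c ->
  exists P A c, [/\ proportional P G, c != 0, bezout P A c & forall a, exists i, subs0 a (P i) != 0].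
  exact: (H (size c0) P0 A0 c0).
elim: n => [|n IH] P A c sc pP nP c0' bez.
  by move: sc; rewrite leqn0 size_poly_eq0 (negPf c0').
have [|/existsNP [a na]] := pselect (forall a, exists i, subs0 a (P i) != 0).
  by exists P, A, c.
have all0 i : subs0 a (P i) = 0.
  by apply/eqP/negPn/negP => h; apply: na; exists i.
have /choice [P' hP'] := fun i => subs0_eq0 (all0 i).
have X0 : ('X - a%:P)%:P != 0 :> L by rewrite polyC_eq0 polyXsubC_eq0.
pose S := \sum_i A i * P' i.
have eS : ('X - a%:P)%:P * S = c%:P.
  rewrite -bez mulr_sumr; apply: eq_bigr => i _; rewrite [in RHS]hP'; ring.
have SC : S = (S`_0)%:P.
  apply: size1_polyC; rewrite -(@size_Cmul _ ('X - a%:P)) ?polyXsubC_eq0 // eS.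
  exact: size_polyC_leq1.
have ec : ('X - a%:P) * S`_0 = c by apply: polyC_inj; rewrite -eS polyCM -SC.
have S0 : S`_0 != 0 by apply: contra c0' => /eqP e; rewrite -ec e mulr0.
apply: (IH P' A S`_0) => //.
- by move: sc; rewrite -ec size_mul ?polyXsubC_eq0 // size_XsubC addSn ltnS.
- move=> i j; apply: (mulfI X0).
  transitivity (P i * G j); first by rewrite [in RHS]hP'; ring.
  by rewrite pP [in LHS]hP'; ring.
- by have [i nPi] := nP; exists i; apply: contra nPi => /eqP e; rewrite hP' e mulr0.
Qed.

Lemma ex_good G : (exists i, G i != 0) ->
  exists P A c n m, proportional P G /\ good P A c n m.
Proof.
move=> nG; have [P [A [c [h1 h2 h3 h4]]]] := ex_bezout2 nG.
have nP : exists i, P i != 0.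
  have [i hi] := h4 0; exists i; apply: contra hi => /eqP ->; by rewrite /subs0 rmorph0.
pose Qn n := [forall i, [forall b : 'I_(size (P i)), (size ((P i)`_b)%R <= n.+1)%N]].
have QnP n : Qn n -> forall i b, (size ((P i)`_b)%R <= n.+1)%N.
  move=> /forallP h i b; have [lt|ge] := ltnP b (size (P i)).
    by have /forallP /(_ (Ordinal lt)) := h i.
  by rewrite nth_default // size_poly0.
pose Qm m := [forall i, (size (P i) <= m.+1)%N].
have exn : exists n, Qn n.
  exists (\max_i \max_(b < size (P i)) size ((P i)`_b)%R)%N.
  apply/forallP => i; apply/forallP => b; apply: leqW.
  apply: leq_trans (leq_bigmax i); exact: (leq_bigmax b).
have exm : exists m, Qm m.
  exists (\max_i size (P i))%N; apply/forallP => i; apply: leqW.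
  exact: (leq_bigmax i).
case: (ex_minnP exn) => n /QnP hn minn; case: (ex_minnP exm) => m /forallP hm minm.
exists P, A, c, n, m; split=> //; split=> //.
- apply: contrapT => none.
  have z i b : (P i)`_b`_n = 0.
    by apply/eqP/negPn/negP => h; apply: none; exists i, b.
  have sz i b : (size ((P i)`_b)%R <= n)%N.
    apply/leq_sizeP => j; rewrite leq_eqVlt => /orP [/eqP <- //|lt].
    by apply: nth_default; apply: leq_trans (hn i b) lt.
  case: n {hn z none} minn sz => [|n] minn sz.
    have [i hi] := nP; case/eqP: hi; apply/polyP => b; apply/eqP.
    by rewrite coef0 -size_poly_eq0 -leqn0.
  have := minn n; rewrite ltnn => H; suff : false by []; apply: H.
  by apply/forallP => i; apply/forallP => b.
- apply: contrapT => none.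
  have z i : (P i)`_m = 0.
    by apply/eqP/negPn/negP => h; apply: none; exists i.
  have sz i : (size (P i) <= m)%N.
    apply/leq_sizeP => j; rewrite leq_eqVlt => /orP [/eqP <- //|lt].
    by apply: nth_default; apply: leq_trans (hm i) lt.
  case: m {hm z none} minm sz => [|m] minm sz.
    have [i hi] := nP; case/eqP: hi; apply/eqP.
    by rewrite -size_poly_eq0 -leqn0.
  have := minm m; rewrite ltnn => H; suff : false by []; apply: H.
  by apply/forallP => i.
Qed.

(* The pair (d0 : d1) complements (e0 : e1) to a basis. *)
Definition dir (e0 e1 : K) : K * K := if e0 == 0 then (1, 0) else (0, 1).

(** The parametrized line sweeps P^1 up to one point, so it reaches finite points that are not roots
    of p. *)
Lemma reach e0 e1 (p : {poly K}) : (e0 != 0) || (e1 != 0) -> p != 0 ->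
  exists t, e0 + t * (dir e0 e1).1 != 0 /\
    p.[(e1 + t * (dir e0 e1).2) / (e0 + t * (dir e0 e1).1)] != 0.
Proof.
rewrite /dir; have [->|e00 _] := eqVneq e0 0 => /= [e10|] p0.
  have /closed_nonrootP [a] : p * 'X != 0 by rewrite mulf_neq0 ?polyX_eq0.
  rewrite /root hornerM hornerX mulf_eq0 negb_or => /andP [pa a0].
  have e1a : e1 / a != 0 by rewrite mulf_neq0 ?invr_eq0.
  exists (e1 / a); rewrite add0r mulr1 mulr0 addr0; split=> //.
  by rewrite invf_div mulrCA divff ?mulr1.
have /closed_nonrootP [a pa] := p0.
exists (a * e0 - e1); rewrite mulr0 addr0 mulr1 addrC subrK mulfK //.
Qed.

Lemma hev_y0 n m (P0 : L) (y1 w0 w1 : K) : w0 != 0 ->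
  hev idK n m P0 0 y1 w0 w1 = y1 ^+ n * w0 ^+ m * (\poly_(b < m.+1) P0`_b`_n).[w1 / w0].
Proof.
move=> w00; rewrite horner_poly /hev mulr_sumr; apply: eq_bigr => b _.
rewrite big_ord_recr /= subnn expr0 mulr1 big1 ?add0r => [|a _]; last first.
  by rewrite [0 ^+ _]expr0n subn_eq0 leqNgt ltn_ord /= mulr0 mul0r mulr0.
have bm : (b <= m)%N by rewrite -ltnS.
have -> : w0 ^+ m = w0 ^+ b * w0 ^+ (m - b) by rewrite -exprD subnKC.
by rewrite expr_div_n; field; rewrite expf_neq0.
Qed.

Lemma hev_w0 n m (P0 : L) (y0 y1 w1 : K) : (size (P0`_m)%R <= n.+1)%N -> y0 != 0 ->
  hev idK n m P0 y0 y1 0 w1 = w1 ^+ m * y0 ^+ n * (P0`_m).[y1 / y0].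
Proof.
move=> sP y00; rewrite /hev big_ord_recr /= subnn expr0 big1 ?add0r => [|b _]; last first.
  by rewrite big1 // => a _; rewrite [0 ^+ _]expr0n subn_eq0 leqNgt ltn_ord /= !mulr0.
rewrite (horner_coef_wide _ sP) mulr_sumr; apply: eq_bigr => a _.
have an : (a <= n)%N by rewrite -ltnS.
have -> : y0 ^+ n = y0 ^+ a * y0 ^+ (n - a) by rewrite -exprD subnKC.
by rewrite expr_div_n; field; rewrite expf_neq0.
Qed.

Lemma ex_bidegree A : exists k l, forall i, bidegree k l (A i).
Proof.
exists (\max_i \max_(b < size (A i)) size ((A i)`_b)%R)%N, (\max_i size (A i))%N.
move=> i; split; first by apply: leqW; exact: (leq_bigmax i).
move=> b; have [lt|ge] := ltnP b (size (A i)); last by rewrite nth_default // size_poly0.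
by apply: leqW; apply: leq_trans (leq_bigmax i); exact: (leq_bigmax (Ordinal lt)).
Qed.

Lemma bidegreeW n m n' m' (P0 : L) : (n <= n')%N -> (m <= m')%N -> bidegree n m P0 -> bidegree n' m' P0.
Proof.
move=> hn hm [h1 h2]; split; first by apply: leq_trans h1 _.
by move=> b; apply: leq_trans (h2 b) _.
Qed.

Lemma root_split (p : {poly K}) z : p != 0 -> exists a (q : {poly K}), q.[z] != 0 /\ p = ('X - z%:P) ^+ a * q.
Proof.
move=> p0; have [a [q hq e]] := multiplicity_XsubC p z.
by exists a, q; rewrite mulrC; split=> //; rewrite p0 in hq.
Qed.

Definition line (e d : K) (x : L) : L := e%:P%:P + x * d%:P%:P.

Lemma ev2_line s t e d x : ev2 s t (line e d x) = e + ev2 s t x * d.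
Proof. by rewrite /line ev2D ev2M !ev2CC. Qed.

Lemma ev2_xs (s t : K) : ev2 s t (@xs K) = s. Proof. exact: ev2_s. Qed.
Lemma ev2_xt (s t : K) : ev2 s t (@xt K) = t. Proof. exact: ev2_t. Qed.

Lemma ev2_sum (s t : K) (F : I -> L) : ev2 s t (\sum_i F i) = \sum_i ev2 s t (F i).
Proof. exact: (rmorph_sum (ev2m s t)). Qed.

Lemma ev2X (s t : K) f n : ev2 s t (f ^+ n) = ev2 s t f ^+ n.
Proof. exact: (rmorphXn (ev2m s t)). Qed.

Definition chart_hev n m (P0 : L) (e0 e1 f0 f1 : K) : L :=
  hev kk n m P0 (line e0 (dir e0 e1).1 (@xs K)) (line e1 (dir e0 e1).2 (@xs K))
                (line f0 (dir f0 f1).1 (@xt K)) (line f1 (dir f0 f1).2 (@xt K)).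

Lemma ev2_chart_hev s t n m (P0 : L) e0 e1 f0 f1 : ev2 s t (chart_hev n m P0 e0 e1 f0 f1) =
  hev idK n m P0 (e0 + s * (dir e0 e1).1) (e1 + s * (dir e0 e1).2)
                 (f0 + t * (dir f0 f1).1) (f1 + t * (dir f0 f1).2).
Proof. by rewrite ev2_hev !ev2_line ev2_xs ev2_xt. Qed.

Lemma line_neq0 (e0 e1 : K) x : (e0 != 0) || (e1 != 0) -> (exists s t, ev2 s t x = 1) ->
  (exists s t, ev2 s t x = 0) ->
  line e0 (dir e0 e1).1 x != 0.
Proof.
move=> ne [s [t h]] [s' [t' h']]; apply/eqP => e.
have := congr1 (ev2 s t) e; have := congr1 (ev2 s' t') e.
rewrite !ev2_line h h' !ev2_0 mul0r addr0 /dir => e00; rewrite e00 eqxx /= add0r mulr1.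
by move/eqP; rewrite oner_eq0.
Qed.

Section Point.
Variables (P A : I -> L) (c : {poly K}) (n m : nat).
Hypothesis gd : good P A c n m.

Lemma bez_point a b : \sum_i ev2 a b (A i) * ev2 a b (P i) = c.[a].
Proof.
rewrite -(ev2C a b c) -(good_bez gd) ev2_sum; apply: eq_bigr => i _; by rewrite ev2M.
Qed.

(** One nonvanishing local representative is enough for the forms themselves not to vanish. In the
    chart, the homogenized Bezout relation has on its right a product of powers of the two local
    coordinates and of a unit, as [peel] requires. *)
Lemma good_point e0 e1 f0 f1 (p : I -> L) i0 : (e0 != 0) || (e1 != 0) -> (f0 != 0) || (f1 != 0) ->
  (forall i j, chart_hev n m (P i) e0 e1 f0 f1 * p j = chart_hev n m (P j) e0 e1 f0 f1 * p i) ->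
  ev2 0 0 (p i0) != 0 -> hev idK n m (P i0) e0 e1 f0 f1 != 0.
Proof.
move=> ne nf par p0.
(* k is raised so that c can be homogenized in degree n + k. *)
have [k0 [l hA0]] := ex_bidegree A; pose k := maxn k0 (size c).
have hA i : bidegree k l (A i) by apply: bidegreeW (hA0 i) => //; exact: leq_maxl.
have hc : bidegree (n + k) 0 (c%:P).
  split; first exact: size_polyC_leq1.
  move=> b; rewrite coefC; case: ifP => _; last by rewrite size_poly0.
  by apply: leqW; apply: leq_trans (leq_addl _ _); exact: leq_maxr.
pose y0 := line e0 (dir e0 e1).1 (@xs K); pose w0 := line f0 (dir f0 f1).1 (@xt K).
have y00 : y0 != 0.
  apply: line_neq0 => //; [exists 1, 0 | exists 0, 0]; exact: ev2_xs.
have w00 : w0 != 0.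
  apply: line_neq0 => //; [exists 0, 1 | exists 0, 0]; exact: ev2_xt.
pose h : {poly K} := hev cK (n + k) 0 c%:P (e0%:P + 'X * (dir e0 e1).1%:P)
   (e1%:P + 'X * (dir e0 e1).2%:P) 1 1.
have hE s : h.[s] = hev idK (n + k) 0 c%:P (e0 + s * (dir e0 e1).1) (e1 + s * (dir e0 e1).2) 1 1.
  by rewrite /h horner_hev !(hornerD, hornerM, hornerX, hornerC).
have hE' s : e0 + s * (dir e0 e1).1 != 0 -> h.[s] = (e0 + s * (dir e0 e1).1) ^+ (n + k) *
   c.[(e1 + s * (dir e0 e1).2) / (e0 + s * (dir e0 e1).1)].
  by move=> nz; rewrite hE hev_ev2 ?oner_neq0 // expr1n mulr1 ev2C.
have h0 : h != 0.
  have [s [s0 cs]] := reach ne (good_c gd); apply/eqP => e.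
  by have := hE' s s0; rewrite e horner0 => /esym/eqP; rewrite mulf_eq0 expf_eq0 (negPf s0) andbF (negPf cs).
have [a [q [q0 hq]]] := root_split 0 h0.
have main : \sum_i chart_hev k l (A i) e0 e1 f0 f1 * chart_hev n m (P i) e0 e1 f0 f1 =
    h%:P * w0 ^+ (m + l).
  apply/eqP; rewrite -subr_eq0; apply/eqP.
  apply: (ev2_dense (mulf_neq0 y00 w00)) => s t; rewrite ev2M mulf_eq0 negb_or.
  rewrite {1}/y0 {1}/w0 !ev2_line ev2_xs ev2_xt => /andP [ys ws].
  rewrite ev2D ev2N ev2_sum ev2M ev2C hE' // ev2X /w0 ev2_line ev2_xt -(bez_point _ ((f1 + t * (dir f0 f1).2) / (f0 + t * (dir f0 f1).1))).
  rewrite !mulr_sumr mulr_suml -sumrB big1 // => i _.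
  have gi := good_bi gd i.
  by rewrite ev2M !ev2_chart_hev !hev_ev2 // !exprD; ring.
(* At f0 = 0 the denominator is the coordinate t itself; otherwise it is a nonzero constant in the
   chart. *)
have [b [u [u0 hu]]] : exists b u, ev2 0 0 u != 0 /\ w0 ^+ (m + l) = (@xt K) ^+ b * u.
  rewrite /w0 /dir; case: eqP => [->|/eqP f00] /=.
    exists (m + l)%N, 1; rewrite ev2_1 oner_neq0 mulr1 /line !polyC0 add0r !polyC1 mulr1; split=> //.
  exists 0%N, ((f0%:P)%:P ^+ (m + l)); rewrite ev2X ev2CC expf_neq0 // mul1r /line !polyC0 mulr0 addr0.
  by split.
have peeled : \sum_i chart_hev k l (A i) e0 e1 f0 f1 * chart_hev n m (P i) e0 e1 f0 f1 =
   (@xs K) ^+ a * (@xt K) ^+ b * (q%:P * u).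
  rewrite main hu hq subr0 polyCM -polyC_exp -/(@xs K); ring.
have v0 : ev2 0 0 (q%:P * u) != 0 by rewrite ev2M ev2C mulf_neq0.
suff : ev2 0 0 (chart_hev n m (P i0) e0 e1 f0 f1) != 0.
  by rewrite ev2_chart_hev !mul0r !addr0.
apply: (peel par p0 v0 peeled).
- apply: contrapT => none.
  have z i t : hev idK n m (P i) e0 e1 (f0 + t * (dir f0 f1).1) (f1 + t * (dir f0 f1).2) = 0.
    have : subs0 0 (chart_hev n m (P i) e0 e1 f0 f1) = 0.
      by apply/eqP/negPn/negP => nz; apply: none; exists i.
    by move/(congr1 (horner^~ t)); rewrite -ev2_subs0 ev2_chart_hev !mul0r !addr0 horner0.
  have [e00|e00] := eqVneq e0 0.
    have e10 : e1 != 0 by move: ne; rewrite e00 eqxx.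
    have [i [b' hb]] := good_n gd.
    have p0' : \poly_(b < m.+1) (P i)`_b`_n != 0.
      apply/eqP => e; have := congr1 (fun r : {poly K} => r`_b') e; rewrite coef0 coef_poly.
      case: ltnP => [_ /eqP|le _]; first by rewrite (negPf hb).
      have [sP _] := good_bi gd i; move: hb; rewrite (nth_default _ (leq_trans sP le)) coef0.
      by rewrite eqxx.
    have [t [t0 ht]] := reach nf p0'.
    have := z i t; rewrite e00 hev_y0 // => /eqP.
    by rewrite !mulf_eq0 !expf_eq0 (negPf e10) (negPf t0) !andbF (negPf ht).
  have [i hi] := good_line gd (e1 / e0).
  have [t [t0 ht]] := reach nf hi.
  have := z i t; rewrite hev_ev2 //; last exact: good_bi gd i.
  by rewrite ev2_subs0 => /eqP; rewrite !mulf_eq0 !expf_eq0 (negPf e00) (negPf t0) !andbF (negPf ht).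
- apply: contrapT => none.
  have z i s : hev idK n m (P i) (e0 + s * (dir e0 e1).1) (e1 + s * (dir e0 e1).2) f0 f1 = 0.
    have : (chart_hev n m (P i) e0 e1 f0 f1)`_0 = 0.
      by apply/eqP/negPn/negP => nz; apply: none; exists i.
    move/(congr1 (horner^~ s)); rewrite -horner_coef0 -{1}polyC0 -[X in X = _]/(ev2 s 0 _).
    by rewrite ev2_chart_hev !mul0r !addr0 horner0.
  have [f00|f00] := eqVneq f0 0.
    have f10 : f1 != 0 by move: nf; rewrite f00 eqxx.
    have [i hi] := good_m gd.
    have [s [s0 hs]] := reach ne hi.
    have := z i s; rewrite f00 hev_w0 //; last by have [_] := good_bi gd i; apply.
    by move=> /eqP; rewrite !mulf_eq0 !expf_eq0 (negPf f10) (negPf s0) !andbF (negPf hs).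
  have [s [s0 hs]] := reach ne (good_c gd).
  case/eqP: hs; rewrite -(bez_point _ (f1 / f0)) big1 // => i _.
  have := z i s; rewrite hev_ev2 //; last exact: good_bi gd i.
  by move=> /eqP; rewrite !mulf_eq0 !expf_eq0 (negPf f00) (negPf s0) !andbF /= => /eqP ->; rewrite mulr0.
Qed.

End Point.
End GoodTuples.

(** * Taylor expansions at a centre *)

Section Taylor.
Variable K : closedFieldType.
Local Notation idK := (idfun : {rmorphism K -> K}).
Local Notation kk := ((polyC \o polyC) : {rmorphism K -> {poly {poly K}}}).
Local Notation cK := (polyC : {rmorphism K -> {poly K}}).
Local Notation L := {poly {poly K}}.

(** The polynomial P(s + r, t + q), written through coefficients so that the bound on the bidegree
    is visible. *)
Definition shift2 n m (P : L) (r q : K) : L :=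
  \sum_(b < m.+1) \sum_(a < n.+1)
    (P`_b`_a)%:P%:P * ((('X + r%:P) ^+ a)%:P * map_poly polyC (('X + q%:P) ^+ b)).

Lemma ev2_map s t (p : {poly K}) : ev2 s t (map_poly polyC p) = p.[t].
Proof. by rewrite /ev2 horner_map /= hornerC. Qed.

Lemma ev2_shift2 n m P r q x z : bidegree n m P -> ev2 x z (shift2 n m P r q) = ev2 (x + r) (z + q) P.
Proof.
move=> [sP sPb]; rewrite /shift2 -[LHS]/(ev2m x z _) rmorph_sum.
rewrite [in RHS]/ev2 (horner_coef_wide _ sP) horner_sum; apply: eq_bigr => b _.
rewrite rmorph_sum -rmorphXn hornerM hornerC (horner_coef_wide _ (sPb b)) mulr_suml.
apply: eq_bigr => a _; rewrite -[LHS]/(ev2 x z _) !ev2M ev2CC ev2C ev2_map -mulrA.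
by rewrite !horner_exp !hornerD !hornerX !hornerC.
Qed.

Lemma bidegreeD n m (P Q : L) : bidegree n m P -> bidegree n m Q -> bidegree n m (P + Q).
Proof.
move=> [h1 h2] [h3 h4]; split.
  by apply: leq_trans (size_polyD _ _) _; rewrite geq_max h1 h3.
by move=> b; rewrite coefD; apply: leq_trans (size_polyD _ _) _; rewrite geq_max h2 h4.
Qed.

Lemma bidegree_sum n m d (F : 'I_d -> L) : (forall i, bidegree n m (F i)) ->
  bidegree n m (\sum_i F i).
Proof.
move=> h; apply: (big_ind (bidegree n m)) => //; last by move=> *; apply: bidegreeD.
by split=> [|b]; rewrite ?coef0 size_poly0.
Qed.

Lemma size_shift_exp (r : K) a : size (('X + r%:P) ^+ a) = a.+1.
Proof. by rewrite -[r]opprK polyCN size_exp_XsubC. Qed.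

Lemma bidegree_shift2 n m P r q : bidegree n m (shift2 n m P r q).
Proof.
apply: bidegree_sum => b; apply: bidegree_sum => a; split.
  rewrite mul_polyC; apply: leq_trans (size_scale_leq _ _) _.
  rewrite mul_polyC; apply: leq_trans (size_scale_leq _ _) _.
  by rewrite size_map_polyC size_shift_exp.
move=> b'; rewrite !coefCM coef_map /= mul_polyC; apply: leq_trans (size_scale_leq _ _) _.
by rewrite mulrC mul_polyC; apply: leq_trans (size_scale_leq _ _) _; rewrite size_shift_exp.
Qed.

(* The Taylor expansion of order al: [tay] is the form attached to P, with y1 = D p
   and w1 = D q, divided by D ^ al. *)
Definition tay (M : comNzRingType) (k : {rmorphism K -> M}) n m al (P : L) (y0 p w0 q D : M) : M :=
  \sum_(b < m.+1) \sum_(a < n.+1) if (al <= a + b)%N then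
    k P`_b`_a * (p ^+ a * y0 ^+ (n - a) * (q ^+ b * w0 ^+ (m - b))) * D ^+ (a + b - al) else 0.

Lemma hev_tay (M : comNzRingType) (k : {rmorphism K -> M}) n m al (P : L) (y0 p w0 q D : M) :
  (forall a b, (a + b < al)%N -> P`_b`_a = 0) ->
  hev k n m P y0 (D * p) w0 (D * q) = D ^+ al * tay k n m al P y0 p w0 q D.
Proof.
move=> h; rewrite /hev /tay mulr_sumr; apply: eq_bigr => b _; rewrite mulr_sumr.
apply: eq_bigr => a _; case: leqP => [le|/h ->]; last by rewrite rmorph0 mul0r mulr0.
have -> : D ^+ al * (k P`_b`_a * (p ^+ a * y0 ^+ (n - a) * (q ^+ b * w0 ^+ (m - b))) * D ^+ (a + b - al))
  = k P`_b`_a * (p ^+ a * y0 ^+ (n - a) * (q ^+ b * w0 ^+ (m - b))) * (D ^+ al * D ^+ (a + b - al)).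
  by ring.
by rewrite -exprD subnKC // exprD !exprMn; ring.
Qed.

Lemma rmorph_tay (M M' : comNzRingType) (k : {rmorphism K -> M}) (h : {rmorphism M -> M'})
    (k' : {rmorphism K -> M'}) n m al P y0 p w0 q D :
  (forall c, h (k c) = k' c) ->
  h (tay k n m al P y0 p w0 q D) = tay k' n m al P (h y0) (h p) (h w0) (h q) (h D).
Proof.
move=> hk; rewrite rmorph_sum; apply: eq_bigr => b _; rewrite rmorph_sum.
apply: eq_bigr => a _; case: ifP => _; last exact: rmorph0.
by rewrite !rmorphM !rmorphXn hk.
Qed.

Lemma ev2_tay s t n m al P y0 p w0 q D :
  ev2 s t (tay kk n m al P y0 p w0 q D) =
  tay idK n m al P (ev2 s t y0) (ev2 s t p) (ev2 s t w0) (ev2 s t q) (ev2 s t D).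
Proof.
by rewrite -[LHS]/(ev2m s t _) (rmorph_tay _ _ _ _ _ _ _ _ _ (ev2CC s t : forall c, ev2m s t (kk c) = idK c)).
Qed.

Lemma horner_tay t n m al P y0 p w0 q D :
  (tay cK n m al P y0 p w0 q D).[t] = tay idK n m al P y0.[t] p.[t] w0.[t] q.[t] D.[t].
Proof.
rewrite -horner_evalE.
by rewrite (rmorph_tay _ _ _ _ _ _ _ _ _ ((fun c => hornerC c t) : forall c, horner_eval t (cK c) = idK c)).
Qed.

(** On the exceptional curve D = 0 only the terms of total degree al survive: this is the leading
    form, evaluated at the direction. *)
Lemma tay_lead n m al P (p q : K) : bidegree n m P -> p != 0 ->
  tay idK n m al P 1 p 1 q 0 = p ^+ al * (\poly_(b < al.+1) P`_b`_(al - b)).[q / p].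
Proof.
move=> [sP sPb] p0; rewrite horner_poly mulr_sumr.
pose F b := P`_b`_(al - b) * (p ^+ (al - b) * q ^+ b).
have lhs b : \sum_(a < n.+1) (if (al <= a + b)%N then idK P`_b`_a *
    (p ^+ a * 1 ^+ (n - a) * (q ^+ b * 1 ^+ (m - b))) * 0 ^+ (a + b - al) else 0)
    = if (b <= al)%N then F b else 0.
  case: leqP => [ba|ab]; last first.
    rewrite big1 // => a _; case: ifP => // le.
    rewrite expr0n subn_eq0; case: leqP => [h|_]; last by rewrite mulr0.
    by have := leq_trans ab (leq_trans (leq_addl a b) h); rewrite ltnn.
  have [lt|ge] := ltnP (al - b) n.+1.
    rewrite (bigD1 (Ordinal lt)) //= subnK // leqnn subnn expr0 mulr1 !expr1n !mulr1 big1 ?addr0 //.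
    move=> a /eqP na; case: ifP => // le; rewrite expr0n subn_eq0.
    case: leqP => [h|_]; last by rewrite mulr0.
    case: na; apply/val_inj => /=; apply/eqP.
    by rewrite -(eqn_add2r b) subnK // eqn_leq h le.
  rewrite /F (nth_default 0 (leq_trans (sPb b) ge)) mul0r.
  rewrite big1 // => a _; case: ifP => // le; rewrite expr0n subn_eq0.
  case: leqP => [h|_]; last by rewrite mulr0.
  have e : (a = al - b :> nat)%N by apply/eqP; rewrite -(eqn_add2r b) subnK // eqn_leq h le.
  by have := leq_trans (ltn_ord a) ge; rewrite e ltnn.
rewrite /tay (eq_bigr (fun b : 'I_m.+1 => if (b <= al)%N then F b else 0)) => [|b _]; last exact: lhs.
transitivity (\sum_(b < al.+1 | (b <= m)%N) F b).
  rewrite -big_mkcond (@big_ord_widen_cond _ _ _ m.+1 (m + al).+1 (fun b => (b <= al)%N) F) ?ltnS ?leq_addr //.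
  rewrite (@big_ord_widen_cond _ _ _ al.+1 (m + al).+1 (fun b => (b <= m)%N) F) ?ltnS ?leq_addl //.
  by apply: eq_bigl => b; rewrite !ltnS andbC.
rewrite big_mkcond; apply: eq_bigr => b _.
have bal : (b <= al)%N by rewrite -ltnS.
have -> : p ^+ al = p ^+ b * p ^+ (al - b) by rewrite -exprD subnKC.
case: leqP => [_|mb]; last by rewrite [P`__]nth_default ?coef0 ?mul0r ?mulr0 //; exact: leq_trans sP mb.
by rewrite /F expr_div_n; field; rewrite expf_neq0.
Qed.

End Taylor.

(** * Multiplicity of a tuple at a centre *)

Section Center.
Variables (K : closedFieldType) (I : finType).
Local Notation idK := (idfun : {rmorphism K -> K}).
Local Notation kk := ((polyC \o polyC) : {rmorphism K -> {poly {poly K}}}).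
Local Notation L := {poly {poly K}}.
Variables (P A : I -> L) (c : {poly K}) (n m : nat).
Hypothesis gd : good P A c n m.
Variables r q : K.
Local Notation sh i := (shift2 n m (P i) r q).

Definition chart_tay al (P0 : L) (e1 e2 : K) : L :=
  tay kk n m al P0 1 (line e1 (dir e1 e2).1 (@xt K)) 1 (line e2 (dir e1 e2).2 (@xt K)) (@xs K).

Lemma ev2_chart_tay s t al P0 e1 e2 : ev2 s t (chart_tay al P0 e1 e2) =
  tay idK n m al P0 1 (e1 + t * (dir e1 e2).1) 1 (e2 + t * (dir e1 e2).2) s.
Proof. by rewrite ev2_tay !ev2_line ev2_xs ev2_xt ev2_1. Qed.

Lemma hev1 P0 (x z : K) : bidegree n m P0 -> hev idK n m P0 1 x 1 z = ev2 x z P0.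
Proof. by move=> h; rewrite hev_ev2 ?oner_neq0 // !expr1n !mul1r !divr1. Qed.

Lemma ev2_tay_shift al i p w s : (forall a b, (a + b < al)%N -> (sh i)`_b`_a = 0) ->
  s ^+ al * tay idK n m al (sh i) 1 p 1 w s = ev2 (r + s * p) (q + s * w) (P i).
Proof.
move=> h; rewrite -hev_tay // hev1; last exact: bidegree_shift2.
by rewrite ev2_shift2 ?[r + _]addrC ?[q + _]addrC //; exact: good_bi gd i.
Qed.

(** al is the multiplicity of the tuple at (r, q), the least total degree that occurs in the shifted
    forms. The argument of [good_point] is repeated in the chart of the blow-up, where s is the
    equation of the exceptional curve and t the direction; by a nonzero leading form, s does not
    divide the whole tuple. *)
Lemma good_center : exists al, (forall i a b, (a + b < al)%N -> (sh i)`_b`_a = 0) /\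
  forall e1 e2 (p : I -> L) i0, (e1 != 0) || (e2 != 0) ->
  (forall i j, chart_tay al (sh i) e1 e2 * p j = chart_tay al (sh j) e1 e2 * p i) ->
  ev2 0 0 (p i0) != 0 -> tay idK n m al (sh i0) 1 e1 1 e2 0 != 0.
Proof.
pose Q k := `[< exists i a b, (a + b)%N = k /\ (sh i)`_b`_a != 0 >].
have exQ : exists k, Q k.
  have [i hi] := good_line gd 0.
  have [s0|s0] := eqVneq (sh i) 0.
    case/eqP: hi; suff -> : P i = 0 by rewrite /subs0 rmorph0.
    apply: ev2_eq0 => s t; rewrite -[s](subrK r) -[t](subrK q).
    by rewrite -(@ev2_shift2 _ n m _ r q) ?s0 ?ev2_0 //; exact: good_bi gd i.
  have /eqP := s0; move=> /polyP /existsNP [b]; rewrite coef0 => /polyP /existsNP [a].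
  by rewrite coef0 => /eqP h; exists (a + b)%N; apply/asboolP; exists i, a, b.
case: (ex_minnP exQ) => al /asboolP [i1 [a1 [b1 [e1b nz1]]]] min.
have low i a b : (a + b < al)%N -> (sh i)`_b`_a = 0.
  move=> lt; apply/eqP/negPn/negP => h; move: lt; rewrite ltnNge min //.
  by apply/asboolP; exists i, a, b.
exists al; split=> // e1 e2 p i0 ne par p0.
have [k [l hA]] := ex_bidegree A.
have [Y1 hY1] : exists Y1, Y1 = line e1 (dir e1 e2).1 (@xt K) by eexists.
have [W1 hW1] : exists W1, W1 = line e2 (dir e1 e2).2 (@xt K) by eexists.
(* The factor s^al makes up for the division by s^al in [chart_tay]. *)
pose A' i := hev kk k l (A i) 1 (r%:P%:P + (@xs K) * Y1) 1 (q%:P%:P + (@xs K) * W1) * (@xs K) ^+ al.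
have [h [c' [c'0 hc]]] := root_split r (good_c gd).
pose chat := hev kk (size c') 0 c'%:P 1 (r%:P%:P + (@xs K) * Y1) 1 1.
have bc : bidegree (size c') 0 c'%:P.
  split; first exact: size_polyC_leq1.
  by move=> b; rewrite coefC; case: ifP => _; rewrite ?size_poly0 //.
have main : \sum_i A' i * chart_tay al (sh i) e1 e2 = ((@xs K) * Y1) ^+ h * chat.
  apply/eqP; rewrite -subr_eq0; apply/eqP; apply: ev2_eq0 => s t.
  rewrite ev2D ev2N ev2_sum /chat !(ev2M, ev2X, ev2_xs, ev2_hev, ev2D, ev2CC, ev2_1).
  set y := ev2 s t Y1; set w := ev2 s t W1.
  have bez : \sum_i ev2 (r + s * y) (q + s * w) (A i) * ev2 (r + s * y) (q + s * w) (P i)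
    = (s * y) ^+ h * c'.[r + s * y].
    rewrite (bez_point gd) hc hornerM horner_exp !hornerE /=.
    by rewrite addrAC subrr add0r.
  have -> : hev idK (size c') 0 c'%:P 1 (r + s * y) 1 1 = c'.[r + s * y].
    by rewrite hev_ev2 ?oner_neq0 // !expr1n !mul1r !divr1 ev2C.
  rewrite -bez -sumrB big1 // => i _.
  rewrite !(ev2M, ev2X, ev2_xs, ev2_hev, ev2D, ev2CC, ev2_1) -/y -/w.
  rewrite hev_ev2 ?oner_neq0 // !expr1n !mul1r !divr1 ev2_chart_tay -mulrA.
  have -> : e1 + t * (dir e1 e2).1 = y by rewrite /y hY1 ev2_line ev2_xt.
  have -> : e2 + t * (dir e1 e2).2 = w by rewrite /w hW1 ev2_line ev2_xt.
  by rewrite ev2_tay_shift ?subrr //; exact: low.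
have [b [u [u0 hu]]] : exists b u, ev2 0 0 u != 0 /\ Y1 ^+ h = (@xt K) ^+ b * u.
  rewrite hY1 /dir; case: eqP => [->|/eqP f00] /=.
    by exists h, 1; rewrite ev2_1 oner_neq0 mulr1 /line !polyC0 add0r !polyC1 mulr1.
  exists 0%N, ((e1%:P)%:P ^+ h); rewrite ev2X ev2CC expf_neq0 // mul1r /line !polyC0 mulr0 addr0.
  by split.
have peeled : \sum_i A' i * chart_tay al (sh i) e1 e2 = (@xs K) ^+ h * (@xt K) ^+ b * (u * chat).
  by rewrite main exprMn hu; ring.
have v0 : ev2 0 0 (u * chat) != 0.
  rewrite ev2M mulf_neq0 // /chat ev2_hev hev_ev2 ?ev2_1 ?oner_neq0 // !expr1n !mul1r divr1 ev2C.
  by rewrite ev2D ev2M ev2_xs mul0r addr0 ev2CC.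
suff : ev2 0 0 (chart_tay al (sh i0) e1 e2) != 0.
  by rewrite ev2_chart_tay !mul0r !addr0.
apply: (peel par p0 v0 peeled).
- exists i1.
  have g0 : \poly_(b < al.+1) (sh i1)`_b`_(al - b) != 0.
    apply/eqP => e; have := congr1 (fun f : {poly K} => f`_b1) e; rewrite coef0 coef_poly -e1b.
    by rewrite ltnS leq_addl addnK => /eqP; rewrite (negPf nz1).
  have [t [t0 ht]] := reach ne g0.
  apply/eqP => e; have := congr1 (horner^~ t) e.
  rewrite -ev2_subs0 ev2_chart_tay horner0 tay_lead //; last exact: bidegree_shift2.
  by move/eqP; rewrite mulf_eq0 expf_eq0 (negPf t0) andbF (negPf ht).
- apply: contrapT => none.
  have z i s : ev2 (r + s * e1) (q + s * e2) (P i) = 0.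
    rewrite -(ev2_tay_shift _ _ _ (low i)).
    have : (chart_tay al (sh i) e1 e2)`_0 = 0.
      by apply/eqP/negPn/negP => nz; apply: none; exists i.
    move/(congr1 (horner^~ s)); rewrite -horner_coef0 -{1}polyC0 -[X in X = _]/(ev2 s 0 _).
    by rewrite ev2_chart_tay !mul0r !addr0 horner0 => ->; rewrite mulr0.
  have [e10|e10] := eqVneq e1 0.
    have e20 : e2 != 0 by move: ne; rewrite e10 eqxx.
    have [i hi] := good_line gd r; case/eqP: hi; apply: poly_eq0P => x.
    rewrite -ev2_subs0 -(z i ((x - q) / e2)) e10 mulr0 addr0 divfK //.
    by rewrite addrC subrK.
  case/eqP: (good_c gd); apply: poly_eq0P => x.
  rewrite -(bez_point gd _ (q + (x - r) / e1 * e2)) big1 // => i _.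
  have := z i ((x - r) / e1); rewrite divfK // addrC subrK => ->.
  by rewrite mulr0.
Qed.

End Center.

(** * Degrees of parametrized curves *)

Section Tuples.
Variable K : closedFieldType.
Implicit Types (p q : {poly K}) (d e : nat).

(** A bound on the degree with the coefficient at the bound, zero or not: unlike the exact degree,
    it is compatible with sums. *)
Definition tc d p (x : K) := (size p <= d.+1)%N /\ p`_d = x.

Lemma tcM d e p q x y : tc d p x -> tc e q y -> tc (d + e) (p * q) (x * y).
Proof.
move=> [sp <-] [sq <-]; split.
  apply: leq_trans (size_polyMleq _ _) _.
  by rewrite -subn1 leq_subLR add1n -addnS -addSn leq_add.
rewrite coefM (bigD1 (inord d)) //= inordK ?ltnS ?leq_addr // addKn big1 ?addr0 //.
move=> i ni; have nid : (i : nat) != d.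
  by apply: contra ni => /eqP e1; apply/eqP/val_inj; rewrite /= inordK ?ltnS ?leq_addr.
have [lt|ge] := ltnP d i.
  by rewrite nth_default ?mul0r //; apply: leq_trans sp lt.
rewrite [q`__]nth_default ?mulr0 //; apply: leq_trans sq _.
have lt : (i < d)%N by rewrite ltn_neqAle nid ge.
by rewrite ltn_subRL ltn_add2r.
Qed.

Lemma tcD d p q x y : tc d p x -> tc d q y -> tc d (p + q) (x + y).
Proof.
move=> [sp <-] [sq <-]; split; last by rewrite coefD.
by apply: leq_trans (size_polyD _ _) _; rewrite geq_max sp sq.
Qed.

Lemma tcN d p x : tc d p x -> tc d (- p) (- x).
Proof. by move=> [sp <-]; split; rewrite ?size_polyN ?coefN. Qed.

Lemma tcC c : tc 0 c%:P c.
Proof. by split; [exact: size_polyC_leq1 | rewrite coefC]. Qed.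

Lemma tcZ d c p x : tc d p x -> tc d (c%:P * p) (c * x).
Proof. exact: (tcM (tcC c)). Qed.

Lemma tcX d p x n : tc d p x -> tc (d * n) (p ^+ n) (x ^+ n).
Proof.
move=> h; elim: n => [|n IH]; first by rewrite muln0; exact: tcC.
by rewrite !exprS mulnS; exact: tcM.
Qed.

Lemma tc_sum (J : Type) (r : seq J) d (F : J -> {poly K}) (x : J -> K) :
  (forall j, tc d (F j) (x j)) -> tc d (\sum_(j <- r) F j) (\sum_(j <- r) x j).
Proof.
move=> h; elim/big_rec2: _ => [|j y p _ hp]; last exact: tcD.
by split; rewrite ?size_poly0 ?coef0.
Qed.

Definition isdeg (J : Type) (h : J -> {poly K}) d :=
  (forall j, (size (h j) <= d.+1)%N) /\ exists j, (h j)`_d != 0.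

Lemma isdeg_uniq (J : Type) (h : J -> {poly K}) d e : isdeg h d -> isdeg h e -> d = e.
Proof.
have le d' e' : isdeg h d' -> isdeg h e' -> (d' <= e')%N.
  move=> [_ [j nj]] [s _]; rewrite leqNgt; apply/negP => lt; move: nj.
  by rewrite nth_default ?eqxx //; apply: leq_trans (s j) lt.
by move=> h1 h2; apply/eqP; rewrite eqn_leq !le.
Qed.

Lemma ex_isdeg (J : finType) (h : J -> {poly K}) : (exists j, h j != 0) -> exists d, isdeg h d.
Proof.
move=> [j0 n0]; pose Q d := [forall j, (size (h j) <= d.+1)%N].
have exQ : exists d, Q d.
  exists (\max_j size (h j))%N; apply/forallP => j; apply: leqW; exact: (leq_bigmax j).
case: (ex_minnP exQ) => d /forallP hd mind; exists d; split=> //.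
apply: contrapT => none.
have z j : (h j)`_d = 0 by apply/eqP/negPn/negP => nz; apply: none; exists j.
have sz j : (size (h j) <= d)%N.
  apply/leq_sizeP => l; rewrite leq_eqVlt => /orP [/eqP <- //|lt].
  by apply: nth_default; apply: leq_trans (hd j) lt.
case: d {hd z none} mind sz => [|d] mind sz.
  by have := sz j0; rewrite leqn0 size_poly_eq0 (negPf n0).
have := mind d; rewrite ltnn => H; suff : false by []; apply: H.
by apply/forallP.
Qed.

Lemma isdeg_mul (J : Type) (h f : J -> {poly K}) q d : q != 0 ->
  (forall j, f j = q * h j) -> isdeg h d -> isdeg f ((size q).-1 + d).
Proof.
move=> q0 e [s [j nj]].
have tq : tc (size q).-1 q (lead_coef q).
  by split => //; rewrite prednK // lt0n size_poly_eq0.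
have t l : tc ((size q).-1 + d) (f l) (lead_coef q * (h l)`_d).
  by rewrite e; apply: tcM.
split=> [l|]; first by case: (t l).
by exists j; have [_ ->] := t j; rewrite mulf_neq0 // lead_coef_eq0.
Qed.

Definition primitive (J : Type) (h : J -> {poly K}) := forall t, exists j, (h j).[t] != 0.

Lemma primitive_neq0 (J : Type) (h : J -> {poly K}) : primitive h -> exists j, h j != 0.
Proof.
move=> /(_ 0) [j nj]; exists j; apply: contra nj => /eqP ->; by rewrite horner0.
Qed.

(** Gauss lemma: the roots of p are removed one at a time, some member of the tuple being nonzero at
    each of them. *)
Lemma gauss_tuple (J : Type) (h : J -> {poly K}) p q :
  (forall z, root p z -> exists j, (h j).[z] != 0) ->
  p != 0 -> (forall j, p %| q * h j) -> p %| q.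
Proof.
move: {2}(size p) (leqnn (size p)) => n; elim: n p q => [|n IH] p q.
  by rewrite leqn0 size_poly_eq0 => /eqP -> _; rewrite eqxx.
move=> sp hr p0 dv; have [s1|s1] := eqVneq (size p) 1%N.
  move/eqP: s1 => /size_poly1P [c c0 ->]; apply/dvdpP; exists (c^-1%:P * q).
  by rewrite mulrAC -polyCM mulVf // polyC1 mul1r.
have [z rz] := closed_rootP p s1.
have /factor_theorem [p' ep] := rz.
have p'0 : p' != 0 by apply: contra p0 => /eqP e; rewrite ep e mul0r.
have [j hj] := hr z rz.
have /factor_theorem [q' eq] : root q z.
  have : root (q * h j) z.
    have /dvdpP [u ->] := dv j; by rewrite rootM rz orbT.
  by rewrite rootM => /orP [//|]; rewrite /root (negPf hj).
rewrite ep eq dvdp_mul2r ?polyXsubC_eq0 //; apply: IH => //.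
- by move: sp; rewrite ep size_mul ?polyXsubC_eq0 // size_XsubC addn2 /= ltnS.
- by move=> z' rz'; apply: hr; rewrite ep rootM rz'.
- move=> l; have := dv l; rewrite ep eq mulrAC dvdp_mul2r ?polyXsubC_eq0 //.
Qed.

Lemma primitive_mult (J : Type) (h f : J -> {poly K}) : primitive h ->
  (forall i j, f i * h j = f j * h i) -> exists q, forall j, f j = q * h j.
Proof.
move=> ph par; have [j0 n0] := primitive_neq0 ph.
have /dvdpP [q eq] : h j0 %| f j0.
  by apply: (gauss_tuple (fun z _ => ph z) n0) => j; rewrite par dvdp_mull.
by exists q => j; apply: (mulIf n0); rewrite par eq mulrAC.
Qed.

Lemma ex_primitive (J : finType) (f : J -> {poly K}) : (exists j, f j != 0) ->
  exists h q, [/\ primitive h, q != 0 & forall j, f j = q * h j].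
Proof.
move=> nf; have [d hd] := ex_isdeg nf.
elim: d f nf hd => [|d IH] f nf hd.
  exists f, 1; split; [|exact: oner_neq0|by move=> j; rewrite mul1r].
  move=> t; have [s [j nj]] := hd; exists j.
  by rewrite (size1_polyC (s j)) hornerC.
have [ph|/existsNP [z nz]] := pselect (primitive f).
  by exists f, 1; split; [|exact: oner_neq0|move=> j; rewrite mul1r].
have /choice [g hg] : forall j, exists g, f j = g * ('X - z%:P).
  move=> j; apply/factor_theorem; rewrite /root; apply/negPn/negP => h.
  by apply: nz; exists j.
have X0 : 'X - z%:P != 0 :> {poly K} by rewrite polyXsubC_eq0.
have ng : exists j, g j != 0.
  by have [j nj] := nf; exists j; apply: contra nj => /eqP e; rewrite hg e mul0r.
have [e he] := ex_isdeg ng.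
have de : e = d.
  have := isdeg_mul (f := f) X0 (fun j => etrans (hg j) (mulrC _ _)) he.
  by rewrite size_XsubC /= => /(isdeg_uniq hd) [].
have [|h [q [ph q0 eq]]] := IH g ng; first by rewrite -de.
exists h, (q * ('X - z%:P)); split=> //; first by rewrite mulf_neq0.
by move=> j; rewrite hg eq mulrAC.
Qed.

Lemma primitive_par (J : Type) (f h : J -> {poly K}) : primitive f -> primitive h ->
  (forall i j, f i * h j = f j * h i) ->
  exists2 c : K, c != 0 & forall j, f j = c%:P * h j.
Proof.
move=> pf ph par; have [q eq] := primitive_mult ph par.
have s1 : size q = 1%N.
  apply/eqP/negPn/negP => /closed_rootP [z rz]; have [j] := pf z.
  by rewrite eq hornerM (eqP rz) mul0r eqxx.
move/eqP: s1 => /size_poly1P [c c0 e]; exists c => // j; by rewrite eq e.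
Qed.

Lemma poly_dense (D f : {poly K}) : D != 0 -> (forall t, D.[t] != 0 -> f.[t] = 0) -> f = 0.
Proof.
move=> D0 h; have : f * D = 0.
  apply: poly_eq0P => t; rewrite hornerM; have [->|/h ->] := eqVneq D.[t] 0.
    by rewrite mulr0.
  by rewrite mul0r.
by move/eqP; rewrite mulf_eq0 (negPf D0) orbF => /eqP.
Qed.

Lemma primitive_isdeg_par (J : Type) (f h : J -> {poly K}) d : primitive f -> primitive h ->
  (forall i j, f i * h j = f j * h i) -> isdeg f d -> isdeg h d.
Proof.
move=> pf ph par hd.
have [|c c0 e] := primitive_par ph pf; first by move=> i j; rewrite mulrC par mulrC.
have C0 : c%:P != 0 :> {poly K} by rewrite polyC_eq0.
by have := isdeg_mul C0 e hd; rewrite size_polyC c0.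
Qed.

Lemma prod_dvd (J : eqType) (r : seq J) (D : J -> {poly K}) q : uniq r ->
  (forall j, j \in r -> D j != 0) -> (forall j, j \in r -> D j %| q) ->
  (forall i j z, i != j -> root (D i) z -> ~~ root (D j) z) ->
  \prod_(j <- r) D j %| q.
Proof.
move=> ur D0 dv co; elim: r ur D0 dv => [|j r IH] /=; first by rewrite big_nil dvd1p.
move=> /andP [jr ur] D0 dv; rewrite big_cons.
have /dvdpP [u eu] : \prod_(i <- r) D i %| q.
  by apply: IH => // i ir; [apply: D0 | apply: dv]; rewrite in_cons ir orbT.
rewrite eu dvdp_mul2r; last first.
  by rewrite prodf_seq_neq0; apply/allP => i ir; apply/implyP => _; apply: D0; rewrite in_cons ir orbT.
apply: (gauss_tuple (h := fun _ : unit => \prod_(i <- r) D i)).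
- move=> z rz; exists tt; rewrite horner_prod prodf_seq_neq0; apply/allP => i ir; apply/implyP => _.
  by apply: (co j i z _ rz); apply: contra jr => /eqP ->.
- by apply: D0; rewrite mem_head.
- by move=> _; rewrite -eu; apply: dv; rewrite mem_head.
Qed.

End Tuples.

(** * Regular maps on the blow-up as tuples of forms *)

Section RegularMapsOnY.
Variables (T : finType) (K : closedFieldType) (rho w : T -> K).
Hypothesis rho_inj : injective rho.
Local Notation idK := (idfun : {rmorphism K -> K}).
Local Notation kk := ((polyC \o polyC) : {rmorphism K -> {poly {poly K}}}).
Local Notation L := {poly {poly K}}.
Local Notation Y := (Yset rho w).
Local Notation N := (amb T).
Local Notation xs := (@xs K).
Local Notation xt := (@xt K).
Local Notation gpt := (gpt rho w).

Variables (M : nat) (B : set 'rV[K]_M.+1) (g : 'rV[K]_N.+1 -> 'rV[K]_M.+1).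
Hypothesis rg : regmap Y B g.
Hypothesis B0 : forall x, B x -> x != 0.
Local Notation I := 'I_M.+1.

Definition localrep x d (F : I -> 'rV[K]_N.+1 -> K) :=
  [/\ forall j, hpoly d (F j), \row_j F j x != 0 &
      forall y, Y y -> \row_j F j y != 0 -> same_point (\row_j F j y) (g y)].

Lemma ex_localrep x : Y x -> exists d F, localrep x d F.
Proof. by move=> Yx; have /regmapP [_ /(_ x Yx)] := rg. Qed.

Lemma localrep_neq0 x d F : localrep x d F -> exists j, F j x != 0.
Proof. by move=> [_ /rV_neq0 [j]]; rewrite mxE; exists j. Qed.

Lemma localrep_par x d F y i j : localrep x d F -> Y y -> F i y * g y 0 j = F j y * g y 0 i.
Proof.
move=> [_ _ h] Yy; have [e|ne] := eqVneq (\row_j F j y) 0.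
  have z l : F l y = 0 by have := congr1 (fun r : 'rV[K]_M.+1 => r 0 l) e; rewrite !mxE.
  by rewrite !z !mul0r.
by have := same_point_par (h y Yy ne) i j; rewrite !mxE => ->.
Qed.

Lemma localrep_par2 x d F x' d' F' y i j : localrep x d F -> localrep x' d' F' -> Y y ->
  F i y * F' j y = F j y * F' i y.
Proof.
move=> h h' Yy; have /rV_neq0 [l gl] := B0 (rg.1 y Yy).
apply: (mulIf gl); rewrite -!mulrA !(localrep_par _ l h' Yy) mulrCA [RHS]mulrCA.
by congr (_ * _); rewrite (localrep_par i j h Yy).
Qed.

Lemma gpt_ev2 F d : hpoly d F -> exists f : L, forall a b, ev2 a b f = F (gpt a b).
Proof.
move=> hF.
have [f fE] := hpoly_ev2 (fun l => tens (chart rho w kk (pt 1 xs) (pt 1 xt)) (dec l)) hF.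
exists f => a b; rewrite fE; congr F; apply/rowP => l; rewrite !mxE ev2_tens.
apply: eq_bigr => i _; rewrite ev2_chart.
congr (chart _ _ _ _ _ _ _); apply/funext; apply: I3P;
  by rewrite /pt /vec3 /= ?ev2_1 ?ev2_0 ?ev2_xs ?ev2_xt.
Qed.

Definition genD : L := \prod_j (xs - (rho j)%:P%:P) * \prod_j (xt - (w j)%:P%:P).

Lemma ev2_prod s t (F : T -> L) : ev2 s t (\prod_j F j) = \prod_j ev2 s t (F j).
Proof. exact: (rmorph_prod (ev2m s t)). Qed.

Lemma ev2B (s t : K) f h : ev2 s t (f - h) = ev2 s t f - ev2 s t h.
Proof. by rewrite ev2D ev2N. Qed.

Lemma genD_generic a b : ev2 a b genD != 0 <-> generic rho w a b.
Proof.
rewrite /genD ev2M mulf_eq0 negb_or !ev2_prod; split.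
  move=> /andP [/prodf_neq0 h1 /prodf_neq0 h2]; split=> j.
    by have := h1 j isT; rewrite ev2B ev2_xs ev2CC subr_eq0.
  by have := h2 j isT; rewrite ev2B ev2_xt ev2CC subr_eq0.
move=> [h1 h2]; apply/andP; split; apply/prodf_neq0 => j _; rewrite ev2B ?ev2_xs ?ev2_xt ev2CC subr_eq0 //.
Qed.

Lemma genD_neq0 : genD != 0.
Proof.
have [a [b /genD_generic h]] := ex_generic rho w.
by apply: contra h => /eqP ->; rewrite ev2_0.
Qed.

Variables (P A : I -> L) (c : {poly K}) (n m : nat).

Definition represents := forall a b i j, generic rho w a b ->
  ev2 a b (P i) * g (gpt a b) 0 j = ev2 a b (P j) * g (gpt a b) 0 i.

Hypothesis rep : represents.
Hypothesis gd : good P A c n m.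

Lemma rep_par x d F a b i j : localrep x d F -> generic rho w a b ->
  ev2 a b (P i) * F j (gpt a b) = ev2 a b (P j) * F i (gpt a b).
Proof.
move=> h g0; have Yy := gpt_Y g0; have /rV_neq0 [l gl] := B0 (rg.1 _ Yy).
apply: (mulIf gl); rewrite -!mulrA !(localrep_par _ l h Yy) mulrCA [RHS]mulrCA.
by congr (_ * _); rewrite rep.
Qed.

Lemma center_dec e0 e1 f0 f1 j : ~ (e1 = rho j * e0 /\ f1 = w j * f0) ->
  (e0 != 0) || (e1 != 0) -> (f0 != 0) || (f1 != 0) ->
  exists k, cvec rho w idK j (pt e0 e1) (pt f0 f1) k != 0.
Proof.
move=> nc ne nf; rewrite /cvec /pt /vec3 /=.
have [D1|D1] := eqVneq (e1 - rho j * e0) 0.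
  have e00 : e0 != 0.
    apply/eqP => e; move: ne D1; rewrite e eqxx mulr0 subr0 /= => /eqP h /h //.
  exists o0 => /=; rewrite mulf_neq0 // subr_eq0; apply/eqP => e; apply: nc; split=> //.
  by apply/eqP; rewrite -subr_eq0 D1.
have [f00|f00] := eqVneq f0 0.
  by exists o2 => /=; rewrite f00 mulr0 subr0 mulf_neq0 //; move: nf; rewrite f00 eqxx.
by exists o1 => /=; rewrite mulf_neq0.
Qed.

Lemma pt_nondeg e0 e1 : (e0 != 0) || (e1 != 0) -> exists k, pt e0 e1 k != 0 :> K.
Proof. by case/orP => h; [exists o0 | exists o1]. Qed.

Lemma noncenter_nondeg e0 e1 f0 f1 : (e0 != 0) || (e1 != 0) -> (f0 != 0) || (f1 != 0) ->
  (forall j, ~ (e1 = rho j * e0 /\ f1 = w j * f0)) ->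
  nondeg (chart rho w idK (pt e0 e1) (pt f0 f1)).
Proof.
move=> ne nf nc; apply: chart_nondeg; [exact: pt_nondeg | exact: pt_nondeg |].
by move=> j; exact: center_dec.
Qed.

Lemma chart_gpt (y0 y1 z0 z1 : K) : y0 != 0 -> z0 != 0 ->
  same_point (gpt (y1 / y0) (z1 / z0)) (mkx (tens (chart rho w idK (pt y0 y1) (pt z0 z1)))).
Proof.
move=> y00 z00; apply: (@mkx_tensZ _ _ _ _ (fun i => match i with
   | None => y0 | Some None => z0 | _ => y0 * z0 * (y0 * z0) / (y0 * z0) end)).
  by case=> [[j|]|] //; rewrite mulfK ?mulf_neq0.
apply: idxP => [||j]; apply: I3P; rewrite /= /cvec /pt /vec3 /= ?mulr0 //; field; by rewrite ?y00 ?z00.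
Qed.

Lemma line_form_neq0 (e0 e1 al be : K) (x : L) : (e0 != 0) || (e1 != 0) ->
  (al != 0) || (be != 0) ->
  (exists s t, ev2 s t x = 1) -> (exists s t, ev2 s t x = 0) ->
  al%:P%:P * line e0 (dir e0 e1).1 x + be%:P%:P * line e1 (dir e0 e1).2 x != 0.
Proof.
move=> ne nab [s [t h]] [s' [t' h']]; apply/eqP => e.
have := congr1 (ev2 s t) e; have := congr1 (ev2 s' t') e.
rewrite !(ev2D, ev2M, ev2CC, ev2_line) h h' ?ev2_0 !mul0r !addr0 !mul1r => z1 z2.
move: z1 z2 ne nab; rewrite /dir; case: eqP => [->|/eqP e00] /=.
  rewrite mulr0 !add0r mulr1 addr0 => /eqP; rewrite mulf_eq0 => /orP [] /eqP -> z2.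
    by move: z2; rewrite mul0r addr0 => ->; rewrite eqxx.
  by rewrite eqxx.
rewrite addr0 => z1; rewrite mulrDr mulr1 addrA z1 add0r => be0.
move: z1; rewrite be0 mul0r addr0 => /eqP; rewrite mulf_eq0 (negPf e00) orbF => /eqP ->.
by rewrite eqxx.
Qed.

(** Off the centres, y and w are local coordinates. A local representative of g then gives a tuple
    proportional to P that does not vanish at the point, and [good_point] applies. *)
Lemma deg_point e0 e1 f0 f1 : (e0 != 0) || (e1 != 0) -> (f0 != 0) || (f1 != 0) ->
  (forall j, ~ (e1 = rho j * e0 /\ f1 = w j * f0)) ->
  exists i, hev idK n m (P i) e0 e1 f0 f1 != 0.
Proof.
move=> ne nf nc; have nd := noncenter_nondeg ne nf nc.
pose x' := mkx (tens (chart rho w idK (pt e0 e1) (pt f0 f1))).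
have Yx : Y x' by apply: chart_Y.
have [d [F hF]] := ex_localrep Yx; have [i0 Fi0] := localrep_neq0 hF.
have [y0 hy0] : exists y0, y0 = line e0 (dir e0 e1).1 xs by eexists.
have [y1 hy1] : exists y1, y1 = line e1 (dir e0 e1).2 xs by eexists.
have [z0 hz0] : exists z0, z0 = line f0 (dir f0 f1).1 xt by eexists.
have [z1 hz1] : exists z1, z1 = line f1 (dir f0 f1).2 xt by eexists.
have hp i : hpoly d (F i) by case: hF.
have /choice [p pE] := fun i => hpoly_ev2
  (fun l => tens (chart rho w kk (pt y0 y1) (pt z0 z1)) (dec l)) (hp i).
have pE' i s t : ev2 s t (p i) = F i (mkx (tens (chart rho w idK
    (pt (ev2 s t y0) (ev2 s t y1)) (pt (ev2 s t z0) (ev2 s t z1))))).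
  rewrite pE; congr (F i _); apply/rowP => l; rewrite !mxE ev2_tens.
  apply: eq_bigr => i' _; rewrite ev2_chart.
  congr (chart _ _ _ _ _ _ _); apply/funext; apply: I3P; by rewrite /pt /vec3 /= ?ev2_0.
have sx : exists s t, ev2 s t xs = 1 by exists 1, 0; exact: ev2_xs.
have sx0 : exists s t, ev2 s t xs = 0 by exists 0, 0; exact: ev2_xs.
have tx : exists s t, ev2 s t xt = 1 by exists 0, 1; exact: ev2_xt.
have tx0 : exists s t, ev2 s t xt = 0 by exists 0, 0; exact: ev2_xt.
pose D : L := y0 * z0 * \prod_j (y1 - (rho j)%:P%:P * y0) * \prod_j (z1 - (w j)%:P%:P * z0).
have D0 : D != 0.
  have lf (a b c0 : K) x : (a != 0) || (b != 0) -> (exists s t, ev2 s t x = 1) ->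
     (exists s t, ev2 s t x = 0) ->
     line b (dir a b).2 x - c0%:P%:P * line a (dir a b).1 x != 0.
    move=> nab h1 h2; have := @line_form_neq0 a b (- c0) 1 x nab.
    by rewrite oner_neq0 orbT => /(_ isT h1 h2); rewrite !polyCN !polyC1 mul1r mulNr addrC.
  rewrite !mulf_neq0 //; first by rewrite hy0 line_neq0.
  - by rewrite hz0 line_neq0.
  - by apply/prodf_neq0 => j _; rewrite hy0 hy1; exact: lf.
  - by apply/prodf_neq0 => j _; rewrite hz0 hz1; exact: lf.
exists i0; apply: (good_point gd ne nf (p := p)).
  move=> i j; apply/eqP; rewrite -subr_eq0; apply/eqP; apply: (ev2_dense D0) => s t.
  rewrite /D !ev2M !ev2_prod !mulf_eq0 !negb_or => /andP [/andP [/andP [ys zs] /prodf_neq0 hr] /prodf_neq0 hw].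
  have gab : generic rho w (ev2 s t y1 / ev2 s t y0) (ev2 s t z1 / ev2 s t z0).
    split=> l; apply/eqP => e.
      by have := hr l isT; rewrite ev2B ev2M ev2CC -e divfK // subrr eqxx.
    by have := hw l isT; rewrite ev2B ev2M ev2CC -e divfK // subrr eqxx.
  have [c1 c10 ce] := chart_gpt (ev2 s t y1) (ev2 s t z1) ys zs.
  have gi := good_bi gd i; have gj := good_bi gd j.
  rewrite ev2B !ev2M !pE' ce !(hpoly_scale _ _ (hp _)) !ev2_chart_hev.
  have e0E : e0 + s * (dir e0 e1).1 = ev2 s t y0 by rewrite hy0 ev2_line ev2_xs.
  have e1E : e1 + s * (dir e0 e1).2 = ev2 s t y1 by rewrite hy1 ev2_line ev2_xs.
  have f0E : f0 + t * (dir f0 f1).1 = ev2 s t z0 by rewrite hz0 ev2_line ev2_xt.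
  have f1E : f1 + t * (dir f0 f1).2 = ev2 s t z1 by rewrite hz1 ev2_line ev2_xt.
  rewrite e0E e1E f0E f1E !hev_ev2 //.
  apply/eqP; rewrite subr_eq0; apply/eqP.
  rewrite !(mulrCA (_ * _) (c1 ^+ d)); congr (_ * _); rewrite -!mulrA; congr (_ * (_ * _)).
  exact: rep_par hF gab.
rewrite pE' hy0 hy1 hz0 hz1 !ev2_line ev2_xs ev2_xt !mul0r !addr0.
exact: Fi0.
Qed.

Lemma echart_nondeg j a b : (a != 0) || (b != 0) -> nondeg (echart rho w idK j 0 a b).
Proof.
move=> ab; case=> [[i|]|] /=.
- have [_|nij] := eqVneq i j; first by case/orP: ab => h; [exists o0 | exists o1].
  exists o1; rewrite /cvec /pt /vec3 /= !mul0r !addr0 !mulr1 subr_eq0.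
  by apply: contra nij => /eqP /rho_inj ->.
- by exists o0; rewrite /pt /vec3 /= oner_neq0.
- by exists o0; rewrite /pt /vec3 /= oner_neq0.
Qed.

Lemma echart_gpt j (s a b : K) : s != 0 ->
  same_point (gpt (rho j + s * b) (w j + s * a)) (mkx (tens (echart rho w idK j s a b))).
Proof.
move=> s0; apply: (@mkx_tensZ _ _ _ _ (fun i => match i with
   | Some (Some j') => if j' == j then s^-1 else 1 | _ => 1 end)).
  by case=> [[j'|]|] /=; try case: ifP => _; rewrite ?invr_eq0 ?oner_neq0.
apply: idxP => [k|k|j']; [by rewrite mul1r | by rewrite mul1r |] => /=.
case: eqP => [->|_]; apply: I3P; rewrite /cvec /pt /vec3 /=; try ring; field; exact: s0.
Qed.

(** The analogue on the exceptional curve, by [good_center]. The slope b of y comes first, since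
    [echart] has y = rho j + s b and w = w j + s a. *)
Lemma deg_center j : exists al,
  (forall i a b, (a + b < al)%N -> (shift2 n m (P i) (rho j) (w j))`_b`_a = 0) /\
  forall b a, (b != 0) || (a != 0) ->
    exists i, tay idK n m al (shift2 n m (P i) (rho j) (w j)) 1 b 1 a 0 != 0.
Proof.
have [al [low hal]] := good_center gd (rho j) (w j); exists al; split=> // b a ne.
have ne' : (a != 0) || (b != 0) by rewrite orbC.
pose x' := mkx (tens (echart rho w idK j 0 a b)).
have Yx : Y x' by apply: Yset_tens; [exact: echart_nondeg | exact: echart_onY].
have [d [F hF]] := ex_localrep Yx; have [i0 Fi0] := localrep_neq0 hF.
have [be hbe] : exists be, be = line b (dir b a).1 xt by eexists.
have [ga hga] : exists ga, ga = line a (dir b a).2 xt by eexists.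
have hp i : hpoly d (F i) by case: hF.
have /choice [p pE] := fun i => hpoly_ev2
  (fun l => tens (echart rho w kk j xs ga be) (dec l)) (hp i).
have pE' i s t : ev2 s t (p i) = F i (mkx (tens (echart rho w idK j s (ev2 s t ga) (ev2 s t be)))).
  rewrite pE; congr (F i _); apply/rowP => l; rewrite !mxE ev2_tens.
  by apply: eq_bigr => i' _; rewrite ev2_echart ev2_xs.
exists i0; apply: (hal b a p i0 ne); last first.
  rewrite pE' hbe hga !ev2_line ev2_xt !mul0r !addr0; exact: Fi0.
have be0 : be != 0.
  by rewrite hbe; apply: line_neq0 => //; [exists 0, 1 | exists 0, 0]; exact: ev2_xt.
have ga0 : ga != 0.
  have := @line_form_neq0 b a 0 1 xt ne; rewrite oner_neq0 orbT => /(_ isT).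
  rewrite !polyC0 mul0r add0r !polyC1 mul1r -hga; apply; [exists 0, 1 | exists 0, 0]; exact: ev2_xt.
pose D : L := xs * \prod_l ((rho j - rho l)%:P%:P + xs * be) * \prod_l ((w j - w l)%:P%:P + xs * ga).
have xs0 : xs != 0 by rewrite -[xs]/('X%:P) polyC_eq0 polyX_eq0.
have D0 : D != 0.
  have lf (c0 : K) f : f != 0 -> c0%:P%:P + xs * f != 0.
    move=> f0; apply/eqP => e.
    have c00 : c0 = 0 by have := congr1 (ev2 0 0) e; rewrite ev2D ev2CC ev2M ev2_xs mul0r addr0 ev2_0.
    move/eqP: e; rewrite c00 !polyC0 add0r mulf_eq0 (negPf xs0) (negPf f0) //.
  rewrite !mulf_neq0 //; apply/prodf_neq0 => l _; exact: lf.
move=> i i'; apply/eqP; rewrite -subr_eq0; apply/eqP; apply: (ev2_dense D0) => s t.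
rewrite /D !ev2M !ev2_prod ev2_xs !mulf_eq0 !negb_or => /andP [/andP [s0 /prodf_neq0 hr] /prodf_neq0 hw].
have gab : generic rho w (rho j + s * ev2 s t be) (w j + s * ev2 s t ga).
  split=> l; apply/eqP => e.
    by have := hr l isT; rewrite ev2D ev2CC ev2M ev2_xs addrAC e subrr eqxx.
  by have := hw l isT; rewrite ev2D ev2CC ev2M ev2_xs addrAC e subrr eqxx.
have [c1 c10 ce] := echart_gpt j (ev2 s t ga) (ev2 s t be) s0.
have eM l l' : ev2 s t (chart_tay n m al (shift2 n m (P l) (rho j) (w j)) b a * p l') =
    tay idK n m al (shift2 n m (P l) (rho j) (w j)) 1 (b + t * (dir b a).1) 1 (a + t * (dir b a).2) s
    * (c1 ^+ d * F l' (gpt (rho j + s * ev2 s t be) (w j + s * ev2 s t ga))).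
  by apply: etrans (ev2M _ _ _ _) _; rewrite ev2_chart_tay pE' ce (hpoly_scale _ _ (hp l')).
rewrite ev2B [X in X - _]eM [X in _ - X]eM.
have e1E : b + t * (dir b a).1 = ev2 s t be by rewrite hbe ev2_line ev2_xt.
have e2E : a + t * (dir b a).2 = ev2 s t ga by rewrite hga ev2_line ev2_xt.
rewrite e1E e2E; apply: (mulfI (expf_neq0 al s0)); rewrite mulr0 mulrBr.
rewrite mulrA [X in _ - X]mulrA !(ev2_tay_shift gd) //; try exact: low.
apply/eqP; rewrite subr_eq0; apply/eqP.
by rewrite !(mulrCA _ (c1 ^+ d)) (rep_par _ _ hF gab).
Qed.

End RegularMapsOnY.

Section Representatives.
Variables (T : finType) (K : closedFieldType) (rho w : T -> K).
Hypothesis rho_inj : injective rho.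
Local Notation Y := (Yset rho w).
Local Notation N := (amb T).

(** Common factors are removed from a local representative at one generic point. At another generic
    point, proportionality to g comes from comparison with a representative that does not vanish
    there. *)
Lemma ex_represents M (B : set 'rV[K]_M.+1) (g : 'rV[K]_N.+1 -> 'rV[K]_M.+1) :
  regmap Y B g -> (forall x, B x -> x != 0) ->
  exists P A c n m, represents rho w g P /\ good P A c n m.
Proof.
move=> rg B0; have [a0 [b0 g0]] := ex_generic rho w.
have [d [F hF]] := ex_localrep rg (gpt_Y g0); have [i0 Fi0] := localrep_neq0 hF.
have hp i : hpoly d (F i) by case: hF.
have /choice [G GE] := fun i => gpt_ev2 rho w (hp i).
have nG : exists i, G i != 0.
  by exists i0; apply: contra Fi0 => /eqP e; rewrite -GE e ev2_0.
have [P [A [c [n [m [pPG gd]]]]]] := ex_good nG.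
exists P, A, c, n, m; split=> // a b i j gab.
have [d' [F' hF']] := ex_localrep rg (gpt_Y gab); have [l Fl] := localrep_neq0 hF'.
have hp' k : hpoly d' (F' k) by case: hF'.
have /choice [G' GE'] := fun i => gpt_ev2 rho w (hp' i).
have pGG : proportional G G'.
  move=> k k'; apply/eqP; rewrite -subr_eq0; apply/eqP; apply: (ev2_dense (genD_neq0 rho w)) => s t.
  move=> /genD_generic gst; rewrite ev2B !ev2M !GE !GE'.
  by rewrite (localrep_par2 rg B0 k k' hF hF' (gpt_Y gst)) subrr.
have pPG' := proportional_trans nG pPG pGG.
apply: (mulfI Fl); rewrite mulrCA [RHS]mulrCA.
have e k : F' l (gpt rho w a b) * g (gpt rho w a b) 0 k = F' k (gpt rho w a b) * g (gpt rho w a b) 0 l.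
  exact: (localrep_par l k hF' (gpt_Y gab)).
rewrite !e !mulrA; congr (_ * _); rewrite -!GE' -!ev2M.
by rewrite pPG'.
Qed.

End Representatives.

(** * The degree formula *)

Section DegreeFormula.
Variables (T : finType) (K : closedFieldType) (rho w : T -> K).
Hypothesis rho_inj : injective rho.
Local Notation idK := (idfun : {rmorphism K -> K}).
Local Notation cK := (polyC : {rmorphism K -> {poly K}}).
Local Notation Y := (Yset rho w).
Local Notation N := (amb T).
Local Notation gpt := (gpt rho w).

(** A morphism from the affine line: no factor vanishes at any t, so each factor is a primitive
    tuple. *)
Definition curve (v : idx T -> 'I_3 -> {poly K}) :=
  onY rho w cK v /\ forall t, nondeg (at_ t v).

Definition cpt v t : 'rV[K]_N.+1 := mkx (tens (at_ t v)).

Lemma curve_Y v t : curve v -> Y (cpt v t).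
Proof. by move=> [hv nv]; apply: Yset_tens; [exact: nv | exact: onY_at]. Qed.

Lemma par3 (R : comNzRingType) (f h : 'I_3 -> R) : f o0 * h o1 = f o1 * h o0 ->
  f o0 * h o2 = f o2 * h o0 -> f o1 * h o2 = f o2 * h o1 -> forall i k, f i * h k = f k * h i.
Proof. by move=> h1 h2 h3; apply: I3P; apply: I3P; rewrite ?h1 ?h2 ?h3. Qed.

Lemma onY_par (R : comNzRingType) (k : {rmorphism K -> R}) v j : onY rho w k v ->
  forall i l, cvec rho w k j (v iy) (v iw) i * v (iz j) l = cvec rho w k j (v iy) (v iw) l * v (iz j) i.
Proof.
move=> [_ _ /(_ j) hy /(_ j) hw]; apply: par3; rewrite /cvec /vec3 /=.
- transitivity (v (iz j) o1 * (v iw o1 - k (w j) * v iw o0) * v iy o0); first by ring.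
  transitivity (v (iz j) o0 * (v iy o1 - k (rho j) * v iy o0) * v iw o0); last by ring.
  by rewrite hw hy; ring.
- transitivity ((v iw o1 - k (w j) * v iw o0) * (v (iz j) o2 * v iy o0)); first by ring.
  by rewrite -hy; ring.
- transitivity ((v iy o1 - k (rho j) * v iy o0) * (v (iz j) o2 * v iw o0)); first by ring.
  by rewrite -hw; ring.
Qed.

(** The point at t = infinity is generic, so that no intersection with an exceptional curve is lost
    at infinity. *)
Record genlead (v : idx T -> 'I_3 -> {poly K}) dY dW : Prop := GenLead {
  gl_y0 : (v iy o0)`_dY != 0;
  gl_w0 : (v iw o0)`_dW != 0;
  gl_y : forall j, (v iy o1)`_dY - rho j * (v iy o0)`_dY != 0;
  gl_w : forall j, (v iw o1)`_dW - w j * (v iw o0)`_dW != 0 }.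

Section OneCurve.
Variables (v : idx T -> 'I_3 -> {poly K}) (dY dW : nat) (dZ : T -> nat).
Hypothesis cv : curve v.
Hypothesis hY : isdeg (v iy) dY.
Hypothesis hW : isdeg (v iw) dW.
Hypothesis hZ : forall j, isdeg (v (iz j)) (dZ j).
Hypothesis gl : genlead v dY dW.

Local Notation y0 := (v iy o0).
Local Notation y1 := (v iy o1).
Local Notation w0 := (v iw o0).
Local Notation w1 := (v iw o1).
Let Dy j := y1 - (rho j)%:P * y0.
Let Dw j := w1 - (w j)%:P * w0.

Lemma tcy k : tc dY (v iy k) (v iy k)`_dY. Proof. by case: hY. Qed.
Lemma tcw k : tc dW (v iw k) (v iw k)`_dW. Proof. by case: hW. Qed.

Lemma tcDy j : tc dY (Dy j) (y1`_dY - rho j * y0`_dY).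
Proof. by apply: tcD; [exact: tcy | apply: tcN; apply: tcZ; exact: tcy]. Qed.

Lemma tcDw j : tc dW (Dw j) (w1`_dW - w j * w0`_dW).
Proof. by apply: tcD; [exact: tcw | apply: tcN; apply: tcZ; exact: tcw]. Qed.

Lemma tc_neq0 d (p : {poly K}) x : tc d p x -> x != 0 -> p != 0.
Proof. by move=> [_ <-]; apply: contra => /eqP ->; rewrite coef0. Qed.

Lemma y0_neq0 : y0 != 0. Proof. exact: tc_neq0 (tcy o0) (gl_y0 gl). Qed.
Lemma w0_neq0 : w0 != 0. Proof. exact: tc_neq0 (tcw o0) (gl_w0 gl). Qed.
Lemma Dy_neq0 j : Dy j != 0. Proof. exact: tc_neq0 (tcDy j) (gl_y gl j). Qed.
Lemma Dw_neq0 j : Dw j != 0. Proof. exact: tc_neq0 (tcDw j) (gl_w gl j). Qed.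

Lemma z_primitive i : primitive (v i).
Proof. by move=> t; case: cv => _ /(_ t i). Qed.

Lemma cvec_curve k j : cvec rho w cK j (v iy) (v iw) k = vec3 (Dw j * y0) (Dy j * w0) (Dy j * Dw j) k.
Proof. by []. Qed.

(** D j is a greatest common divisor of y - rho j and w - w j along the curve, and cuts out its
    intersection with the j-th exceptional curve. The factor [iz j] is what remains of [cvec] after
    division by D j, whence its degree. *)
Lemma ex_D : exists D b a : T -> {poly K}, forall j,
  [/\ D j != 0, Dy j = D j * b j, Dw j = D j * a j,
    [/\ v (iz j) o0 = a j * y0, v (iz j) o1 = b j * w0 & v (iz j) o2 = D j * (a j * b j)] &
    (forall z, root (D j) z -> y0.[z] != 0 /\ w0.[z] != 0) /\
    (forall z, ~~ root (D j) z -> ~ (y1.[z] = rho j * y0.[z] /\ w1.[z] = w j * w0.[z])) /\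
    ((size (D j)).-1 + dZ j = dY + dW)%N].
Proof.
suff H j : exists D b a : {poly K},
  [/\ D != 0, Dy j = D * b, Dw j = D * a,
    [/\ v (iz j) o0 = a * y0, v (iz j) o1 = b * w0 & v (iz j) o2 = D * (a * b)] &
    (forall z, root D z -> y0.[z] != 0 /\ w0.[z] != 0) /\
    (forall z, ~~ root D z -> ~ (y1.[z] = rho j * y0.[z] /\ w1.[z] = w j * w0.[z])) /\
    ((size D).-1 + dZ j = dY + dW)%N].
  have /choice [D hD] := H; have {hD} /choice [b hb] := hD; have {hb} /choice [a ha] := hb.
  by exists D, b, a.
have [hv nv] := cv.
have [D hD] := primitive_mult (z_primitive (iz j)) (onY_par j hv).
have e0 := hD o0; have e1 := hD o1; have e2 := hD o2.
rewrite !cvec_curve /vec3 /= in e0 e1 e2.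
have D0 : D != 0.
  by apply/eqP => e; move/eqP: e2; rewrite e mul0r mulf_eq0 (negPf (Dy_neq0 j)) (negPf (Dw_neq0 j)).
have rD z : root D z -> y0.[z] != 0 /\ w0.[z] != 0.
  move=> /eqP rz.
  have z0 : Dw j * y0 = D * v (iz j) o0 by [].
  have E0 := congr1 (horner^~ z) e0; have E1 := congr1 (horner^~ z) e1.
  have E2 := congr1 (horner^~ z) e2; rewrite /= !hornerM rz !mul0r in E0 E1 E2.
  have [y2 w2 _ _] := onY_at z hv; have nzy := nz3 (nv z iy) y2; have nzw := nz3 (nv z iw) w2.
  have Dyz : (Dy j).[z] = y1.[z] - rho j * y0.[z] by rewrite /Dy !(hornerD, hornerN, hornerM, hornerC).
  have Dwz : (Dw j).[z] = w1.[z] - w j * w0.[z] by rewrite /Dw !(hornerD, hornerN, hornerM, hornerC).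
  have yz : y0.[z] != 0.
    apply/eqP => e; have := nzy e; rewrite /at_ => y1z.
    have Dn : (Dy j).[z] != 0 by rewrite Dyz e mulr0 subr0.
    move/eqP: E2; rewrite mulf_eq0 (negPf Dn) /= => /eqP Dw0.
    move/eqP: E1; rewrite mulf_eq0 (negPf Dn) /= => /eqP w00.
    by have := nzw w00; rewrite /at_; move: Dw0; rewrite Dwz w00 mulr0 subr0 => ->; rewrite eqxx.
  split=> //; apply/eqP => e; have := nzw e; rewrite /at_ => w1z.
  have Dn : (Dw j).[z] != 0 by rewrite Dwz e mulr0 subr0.
  by move/eqP: E0; rewrite mulf_eq0 (negPf Dn) (negPf yz).
have /dvdpP [b eb] : D %| Dy j.
  apply: (gauss_tuple (h := fun _ : unit => w0)) => // [z /rD [_ h]|_]; first by exists tt.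
  by rewrite e1 dvdp_mulr.
have /dvdpP [a ea] : D %| Dw j.
  apply: (gauss_tuple (h := fun _ : unit => y0)) => // [z /rD [h _]|_]; first by exists tt.
  by rewrite e0 dvdp_mulr.
exists D, b, a; split=> //; [by rewrite mulrC | by rewrite mulrC | split | split=> //].
- by apply: (mulfI D0); rewrite -e0 ea; ring.
- by apply: (mulfI D0); rewrite -e1 eb; ring.
- by apply: (mulfI D0); rewrite -e2 ea eb; ring.
split.
  move=> z nz [ey ew].
  have c0 k : (cvec rho w cK j (v iy) (v iw) k).[z] = 0.
    have Dyz : (Dy j).[z] = 0 by rewrite /Dy !(hornerD, hornerN, hornerM, hornerC) ey subrr.
    have Dwz : (Dw j).[z] = 0 by rewrite /Dw !(hornerD, hornerN, hornerM, hornerC) ew subrr.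
    by rewrite cvec_curve; move: k; apply: I3P; rewrite /vec3 /= hornerM ?Dyz ?Dwz mul0r.
  have [k hk] := nv z (iz j); move: (c0 k); rewrite hD hornerM => /eqP.
  by rewrite mulf_eq0 [D.[z] == 0](negPf nz) /=; apply/negP.
have dc : isdeg (cvec rho w cK j (v iy) (v iw)) (dW + dY).
  have t k : tc (dW + dY) (cvec rho w cK j (v iy) (v iw) k)
     (vec3 ((w1`_dW - w j * w0`_dW) * y0`_dY) (w0`_dW * (y1`_dY - rho j * y0`_dY))
       ((w1`_dW - w j * w0`_dW) * (y1`_dY - rho j * y0`_dY)) k).
    rewrite cvec_curve; move: k; apply: I3P; rewrite /vec3 /=.
    + by apply: tcM; [exact: tcDw | exact: tcy].
    + by rewrite [Dy j * _]mulrC; apply: tcM; [exact: tcw | exact: tcDy].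
    + by rewrite [Dy j * _]mulrC; apply: tcM; [exact: tcDw | exact: tcDy].
  split; first by move=> k; case: (t k).
  by exists o0; have [_ ->] := t o0; rewrite /vec3 /= mulf_neq0 ?(gl_w gl) ?(gl_y0 gl).
have := isdeg_mul D0 hD (hZ j) => /(isdeg_uniq dc) <-.
exact: addnC.
Qed.

Variables (M : nat) (B : set 'rV[K]_M.+1) (g : 'rV[K]_N.+1 -> 'rV[K]_M.+1).
Hypothesis rg : regmap Y B g.
Hypothesis B0 : forall x, B x -> x != 0.
Local Notation I := 'I_M.+1.
Variables (P A : I -> {poly {poly K}}) (c : {poly K}) (n m : nat).
Hypothesis rep : represents rho w g P.
Hypothesis gd : good P A c n m.
Variables (h : I -> {poly K}) (d : nat).
Hypothesis ph : primitive h.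
Hypothesis hg : forall t, same_point (\row_k (h k).[t]) (g (cpt v t)).
Hypothesis hd : isdeg h d.
Variable al : T -> nat.
Hypothesis low : forall j i a b, (a + b < al j)%N -> (shift2 n m (P i) (rho j) (w j))`_b`_a = 0.
Hypothesis lead : forall j b a, (b != 0) || (a != 0) ->
    exists i, tay idK n m (al j) (shift2 n m (P i) (rho j) (w j)) 1 b 1 a 0 != 0.

Let Q i := hev cK n m (P i) y0 y1 w0 w1.

Lemma Qt i t : (Q i).[t] = hev idK n m (P i) y0.[t] y1.[t] w0.[t] w1.[t].
Proof. exact: horner_hev. Qed.

Lemma point_gpt t : y0.[t] != 0 -> w0.[t] != 0 ->
  (forall j, (Dy j).[t] != 0) -> same_point (gpt (y1.[t] / y0.[t]) (w1.[t] / w0.[t])) (cpt v t).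
Proof.
move=> yt wt gy; have [hv nv] := cv; have hvt := onY_at t hv; have nvt := nv t.
have [y2 w2 _ _] := hvt.
have /choice [c' hc] : forall j, exists c, c != 0 /\
    forall k, at_ t v (iz j) k = c * cvec rho w idK j (at_ t v iy) (at_ t v iw) k.
  move=> j; have [[e _]|[c' c0 e]] := center_or_cvec j nvt hvt; last by exists c'.
  have := gy j; rewrite /Dy !(hornerD, hornerN, hornerM, hornerC).
  by rewrite [y1.[t]]e subrr eqxx.
apply: (@mkx_tensZ _ _ _ _ (fun i => match i with
   | Some (Some j) => c' j * (y0.[t] * w0.[t])
   | Some None => w0.[t] | None => y0.[t] end)).
  by case=> [[j|]|] //; rewrite !mulf_neq0 //; case: (hc j).
apply: idxP => [||j].
- by apply: I3P; rewrite /= /pt /vec3 /= ?mulr1 ?mulr0 // mulrC divfK.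
- by apply: I3P; rewrite /= /pt /vec3 /= ?mulr1 ?mulr0 // mulrC divfK.
- have [_ e] := hc j; apply: I3P; rewrite e /= /cvec /pt /vec3 /= /at_; field; by rewrite ?yt ?wt.
Qed.

Lemma Q_par i k : Q i * h k = Q k * h i.
Proof.
have D0 : y0 * w0 * \prod_j Dy j * \prod_j Dw j != 0.
  rewrite !mulf_neq0 ?y0_neq0 ?w0_neq0 //; apply/prodf_neq0 => j _; [exact: Dy_neq0 | exact: Dw_neq0].
apply/eqP; rewrite -subr_eq0; apply/eqP; apply: (poly_dense D0) => t.
rewrite 3!hornerM !horner_prod !mulf_eq0 !negb_or.
move=> /andP [/andP [/andP [yt wt] /prodf_neq0 gy] /prodf_neq0 gw].
have sp := point_gpt yt wt (fun j => gy j isT).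
have gab : generic rho w (y1.[t] / y0.[t]) (w1.[t] / w0.[t]).
  split=> j; apply/eqP => e.
    have := gy j isT; rewrite /Dy !(hornerD, hornerN, hornerM, hornerC) -e divfK //.
    by rewrite subrr eqxx.
  have := gw j isT; rewrite /Dw !(hornerD, hornerN, hornerM, hornerC) -e divfK //.
  by rewrite subrr eqxx.
have sg := regmap_same_point rg (gpt_Y gab) (curve_Y t cv) sp.
have [c1 c10 e1] := same_point_trans sg (same_point_sym (hg t)).
have hE l : (h l).[t] = c1 * g (gpt (y1.[t] / y0.[t]) (w1.[t] / w0.[t])) 0 l.
  by have := congr1 (fun r : 'rV[K]_M.+1 => r 0 l) e1; rewrite !mxE.
have gi := good_bi gd i; have gk := good_bi gd k.
rewrite hornerD hornerN 2!hornerM !Qt !hE !hev_ev2 //.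
apply/eqP; rewrite subr_eq0; apply/eqP.
transitivity (y0.[t] ^+ n * w0.[t] ^+ m * c1 * (ev2 (y1.[t] / y0.[t]) (w1.[t] / w0.[t]) (P i) *
  g (gpt (y1.[t] / y0.[t]) (w1.[t] / w0.[t])) 0 k)); first by ring.
by rewrite rep //; ring.
Qed.

Lemma tay_scale al' P0 (a0 a1 b0 b1 D : K) : a0 != 0 -> b0 != 0 ->
  tay idK n m al' P0 a0 a1 b0 b1 D = a0 ^+ n * b0 ^+ m * tay idK n m al' P0 1 (a1 / a0) 1 (b1 / b0) D.
Proof.
move=> a00 b00; rewrite /tay mulr_sumr; apply: eq_bigr => b _; rewrite mulr_sumr.
apply: eq_bigr => a _; case: ifP => _; last by rewrite mulr0.
have an : (a <= n)%N by rewrite -ltnS.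
have bm : (b <= m)%N by rewrite -ltnS.
have -> : a0 ^+ n = a0 ^+ a * a0 ^+ (n - a) by rewrite -exprD subnKC.
have -> : b0 ^+ m = b0 ^+ b * b0 ^+ (m - b) by rewrite -exprD subnKC.
rewrite !expr1n !expr_div_n; field; by rewrite !expf_neq0.
Qed.

(** The pullback Q of the forms has degree exactly n dY + m dW, because the point at infinity is no
    centre. It equals E h with h primitive, and E is the product of the D j ^ al j up to a constant.
    The degree of D j is dY + dW - dZ j; terms are moved across to stay in [nat]. *)
Lemma degree_curve :
  (d + \sum_j al j * (dY + dW) = n * dY + m * dW + \sum_j al j * dZ j)%N.
Proof.
have [D [b [a HD]]] := ex_D.
have [E hE] := primitive_mult ph Q_par.
pose tq i j := tay cK n m (al j) (shift2 n m (P i) (rho j) (w j)) y0 (b j) w0 (a j) (D j).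
(* Along the curve y - rho j = D j b j and w - w j = D j a j, up to denominators, so the Taylor
   expansion at the centre yields the factor D j ^ al j. *)
have Qtay i j : Q i = D j ^+ al j * tq i j.
  have [D0 ey ew _ _] := HD j.
  apply/eqP; rewrite -subr_eq0; apply/eqP.
  apply: (poly_dense (mulf_neq0 y0_neq0 w0_neq0)) => t; rewrite hornerM mulf_eq0 negb_or => /andP [yt wt].
  rewrite hornerD hornerN Qt hornerM horner_exp horner_tay.
  rewrite -hev_tay; last by move=> *; exact: low.
  have gi := good_bi gd i.
  have bs := bidegree_shift2 n m (P i) (rho j) (w j).
  rewrite !hev_ev2 // ev2_shift2 //.
  have -> : ((D j).[t] * (b j).[t]) / y0.[t] + rho j = y1.[t] / y0.[t].
    rewrite -hornerM -ey /Dy !(hornerD, hornerN, hornerM, hornerC); field; exact: yt.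
  have -> : ((D j).[t] * (a j).[t]) / w0.[t] + w j = w1.[t] / w0.[t].
    rewrite -hornerM -ew /Dw !(hornerD, hornerN, hornerM, hornerC); field; exact: wt.
  by rewrite subrr.
have tQ i : tc (n * dY + m * dW) (Q i)
    (hev idK n m (P i) y0`_dY y1`_dY w0`_dW w1`_dW).
  apply: tc_sum => b'; apply: tc_sum => a'; apply: tcZ.
  have -> : (n * dY + m * dW = dY * a' + dY * (n - a') + (dW * b' + dW * (m - b')))%N.
    have an : (a' <= n)%N by rewrite -ltnS.
    have bm : (b' <= m)%N by rewrite -ltnS.
    by rewrite -!mulnDr subnKC // subnKC // mulnC [(dW * m)%N]mulnC.
  by apply: tcM; apply: tcM; apply: tcX; (exact: tcy || exact: tcw).
have dQ : isdeg Q (n * dY + m * dW).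
  split; first by move=> i; case: (tQ i).
  have [||j e|i hi] := deg_point rg B0 rep gd
     (e0 := y0`_dY) (e1 := y1`_dY) (f0 := w0`_dW) (f1 := w1`_dW).
  - by rewrite (gl_y0 gl).
  - by rewrite (gl_w0 gl).
  - by case: e => e _; have := gl_y gl j; rewrite e subrr eqxx.
  - by exists i; have [_ ->] := tQ i.
have E0 : E != 0.
  have [_ [i nz]] := dQ; move: nz; rewrite hE; apply: contra => /eqP ->.
  by rewrite mul0r coef0.
have rootX (p : {poly K}) k z : root (p ^+ k) z -> root p z.
  by rewrite /root horner_exp expf_eq0 => /andP [].
have Dal j : D j ^+ al j %| E.
  have [D0 _ _ _ _] := HD j.
  apply: (gauss_tuple (h := h)); [by move=> z _; exact: ph | by rewrite expf_neq0 |].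
  by move=> i; rewrite -hE (Qtay i j) dvdp_mulIl.
(* A common root would give y = rho i and y = rho j at once. *)
have co i j z : i != j -> root (D i ^+ al i) z -> ~~ root (D j ^+ al j) z.
  move=> nij /rootX ri; apply/negP => /rootX rj.
  have [_ eyi _ _ [/(_ z ri) [yz _] _]] := HD i; have [_ eyj _ _ _] := HD j.
  have f1 : y1.[z] = rho i * y0.[z].
    have := congr1 (horner^~ z) eyi; rewrite /Dy !(hornerD, hornerN, hornerM, hornerC) (eqP ri) mul0r.
    by move/eqP; rewrite subr_eq0 => /eqP.
  have f2 : y1.[z] = rho j * y0.[z].
    have := congr1 (horner^~ z) eyj; rewrite /Dy !(hornerD, hornerN, hornerM, hornerC) (eqP rj) mul0r.
    by move/eqP; rewrite subr_eq0 => /eqP.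
  by case/eqP: nij; apply: rho_inj; apply: (mulIf yz); rewrite -f1 f2.
have Dn0 j : D j ^+ al j != 0 by rewrite expf_neq0 //; case: (HD j).
have /dvdpP [E' eE] : \prod_j D j ^+ al j %| E.
  by apply: prod_dvd => //; exact: index_enum_uniq.
have P0 : \prod_j D j ^+ al j != 0 by apply/prodf_neq0 => j _.
have E'0 : E' != 0 by apply: contra E0 => /eqP e; rewrite eE e mul0r.
(* A root of E' off the exceptional curves contradicts [deg_point]; on the j-th one, after
   cancellation of D j ^ al j, it contradicts [lead]. *)
have sE' : size E' = 1%N.
  apply/eqP/negPn/negP => /closed_rootP [z /eqP rz].
  have [[j rj]|nr] := pselect (exists j, root (D j) z).
    have [D0 _ _ [za zb zc] [/(_ z rj) [yz wz] _]] := HD j.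
    have ab : ((b j).[z] / y0.[z] != 0) || ((a j).[z] / w0.[z] != 0).
      have [k] := cv.2 z (iz j); rewrite /at_; move: k; apply: I3P.
      - by rewrite za hornerM mulf_eq0 negb_or => /andP [h1 _]; rewrite [X in _ || X]mulf_neq0 ?invr_eq0 ?orbT.
      - by rewrite zb hornerM mulf_eq0 negb_or => /andP [h1 _]; rewrite mulf_neq0 ?invr_eq0.
      - by rewrite zc hornerM (eqP rj) mul0r eqxx.
    have [i /eqP] := lead j ab; apply.
    apply: (mulfI (mulf_neq0 (expf_neq0 n yz) (expf_neq0 m wz))); rewrite mulr0 -tay_scale //.
    rewrite -(eqP rj) -horner_tay -/(tq i j).
    have : D j ^+ al j * tq i j = D j ^+ al j * (E' * (\prod_(j' | j' != j) D j' ^+ al j') * h i).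
      by rewrite -Qtay hE eE (bigD1 j) //=; ring.
    by move/(mulfI (Dn0 j)) ->; rewrite 2!hornerM rz !mul0r (eqP rj).
  have [||j|i hi] := deg_point rg B0 rep gd
     (e0 := y0.[z]) (e1 := y1.[z]) (f0 := w0.[z]) (f1 := w1.[z]).
  - have [y2 _ _ _] := onY_at z cv.1; have [k] := cv.2 z iy; rewrite /at_.
    by move: k; apply: I3P => [->|->|] //; rewrite ?orbT // [(v iy o2).[z]]y2 eqxx.
  - have [_ w2 _ _] := onY_at z cv.1; have [k] := cv.2 z iw; rewrite /at_.
    by move: k; apply: I3P => [->|->|] //; rewrite ?orbT // [(v iw o2).[z]]w2 eqxx.
  - have [_ _ _ _ [_ [H _]]] := HD j; apply: H; apply/negP => r; apply: nr; by exists j.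
  - by case/eqP: hi; rewrite -Qt hE eE 2!hornerM rz !mul0r.
have dE : ((size E).-1 = \sum_j al j * (size (D j)).-1)%N.
  have sm (p q : {poly K}) : p != 0 -> q != 0 -> (size (p * q)%R).-1 = ((size p).-1 + (size q).-1)%N.
    move=> p0 q0; rewrite size_mul //; move: p0 q0; rewrite -!size_poly_gt0.
    by case: (size p) => // a'; case: (size q) => // b' _ _; rewrite addnS.
  rewrite eE sm // sE' add0n.
  have : forall r : seq T, ((size (\prod_(j <- r) D j ^+ al j)%R).-1 = \sum_(j <- r) al j * (size (D j)).-1)%N.
    elim=> [|j r IH]; first by rewrite !big_nil size_poly1.
    rewrite !big_cons sm // ?IH ?size_exp ?(mulnC (al j)) //.
    by rewrite prodf_seq_neq0; apply/allP => i _; exact: Dn0.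
  exact.
have := isdeg_mul E0 hE hd => /(isdeg_uniq dQ) ->.
rewrite dE.
have -> : (\sum_j al j * (dY + dW) = \sum_j al j * (size (D j)).-1 + \sum_j al j * dZ j)%N.
  rewrite -big_split; apply: eq_bigr => j _; rewrite /= -mulnDr.
  by have [_ _ _ _ [_ [_ ->]]] := HD j.
by rewrite addnA [(d + _)%N]addnC.
Qed.

End OneCurve.

Lemma degree_formula M (B : set 'rV[K]_M.+1) (g : 'rV[K]_N.+1 -> 'rV[K]_M.+1) :
  regmap Y B g -> (forall x, B x -> x != 0) ->
  exists n m (al : T -> nat), forall v dY dW (dZ : T -> nat) (h : 'I_M.+1 -> {poly K}) d,
    curve v -> isdeg (v iy) dY -> isdeg (v iw) dW -> (forall j, isdeg (v (iz j)) (dZ j)) ->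
    genlead v dY dW -> primitive h ->
    (forall t, same_point (\row_k (h k).[t]) (g (cpt v t))) -> isdeg h d ->
    (d + \sum_j al j * (dY + dW) = n * dY + m * dW + \sum_j al j * dZ j)%N.
Proof.
move=> rg B0; have [P [A [c [n [m [rep gd]]]]]] := ex_represents rg B0.
have /choice [al hal] := deg_center rho_inj rg B0 rep gd.
exists n, m, al => v dY dW dZ h d cv hY hW hZ gl ph hg hd.
by apply: (degree_curve cv hY hW hZ gl rg B0 rep gd ph hg hd) => j; case: (hal j).
Qed.

End DegreeFormula.

(** * Images of curves *)

Section Factors.
Variables (T : finType) (K : closedFieldType) (rho w : T -> K).
Hypothesis rho_inj : injective rho.
Local Notation Y := (Yset rho w).
Local Notation N := (amb T).
Local Notation coK := (@co T K).

Lemma tens_same_point_par (a b : idx T -> 'I_3 -> K) : nondeg a ->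
  same_point (mkx (tens a)) (mkx (tens b)) -> forall i k k', a i k * b i k' = a i k' * b i k.
Proof.
move=> na sp i k k'; have [e he] := tens_neq0 na.
have x0 : coK (mkx (tens a)) e != 0 by rewrite coE.
have y0 : coK (mkx (tens b)) e != 0.
  by rewrite (hpoly_same_point (hpoly_co K e) sp).
have [l [l0 hl]] := slice_prop (same_point_refl _) x0.
have [l' [l'0 hl']] := slice_prop (same_point_refl _) y0.
have [c c0 ce] := sp.
have e1 k1 : slice (mkx (tens b)) e i k1 = c * slice (mkx (tens a)) e i k1.
  by rewrite /slice ce /coK mxE.
apply: (mulfI (mulf_neq0 (l0 i) (l'0 i))).
have h1 : l' i * b i k' = c * (l i * a i k') by rewrite -hl' e1 hl.
have h2 : l' i * b i k = c * (l i * a i k) by rewrite -hl' e1 hl.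
transitivity (l i * a i k * (l' i * b i k')); first by ring.
transitivity (l i * a i k' * (l' i * b i k)); last by ring.
by rewrite h1 h2; ring.
Qed.

Definition epick (x : 'rV[K]_N.+1) : mon T :=
  if [pick e | coK x e != 0] is Some e then e else e00 T.

Lemma epickP x : x != 0 -> coK x (epick x) != 0.
Proof.
move=> /co_neq0 [e he]; rewrite /epick; case: pickP => // h.
by rewrite h in he.
Qed.

(** The projection to a factor, read off at some nonzero coordinate; another choice changes it by a
    scalar. *)
Definition fac i (x : 'rV[K]_N.+1) : 'rV[K]_3 := \row_k slice x (epick x) i k.

Lemma fac_tens x v i : nondeg v -> same_point (mkx (tens v)) x ->
  same_point (\row_k v i k) (fac i x).
Proof.
move=> nv sp; have [e he] := tens_neq0 nv.
have x0 : x != 0.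
  apply: same_point_neq0 sp _; apply: (@co_neq0P _ _ _ e); by rewrite coE.
have [l [l0 hl]] := slice_prop sp (epickP x0).
by exists (l i) => //; apply/rowP => k; rewrite !mxE hl.
Qed.

Lemma fac_regmap i : regmap Y (@proj_space K 2) (fac i).
Proof.
apply/regmapP; split=> [x Yx|x Yx].
  have [nv _ _] := Yset_slice Yx (epickP (Yset_neq0 Yx)).
  by have [k hk] := nv i; apply: (@rV_neq0P _ _ _ k); rewrite mxE.
have x0 := epickP (Yset_neq0 Yx).
exists 1%N, (fun k y => slice y (epick x) i k); split.
- by move=> j; exact: hpoly_co.
- have [nv _ _] := Yset_slice Yx x0.
  by have [k hk] := nv i; apply: (@rV_neq0P _ _ _ k); rewrite mxE.
- move=> y Yy ny; have [v [nv hv e]] := YsetP Yy.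
  have sp : same_point (mkx (tens v)) y by rewrite e; exact: same_point_refl.
  have spf := fac_tens i nv sp.
  apply: par_same_point ny _ _.
    apply: same_point_neq0 spf _.
    by have [k hk] := nv i; apply: (@rV_neq0P _ _ _ k); rewrite mxE.
  have [c c0 ->] := spf.
  by move=> k k'; rewrite e !mxE /slice !coE !tens_upd; ring.
Qed.

(** The local representative at t = 0, pulled back and made primitive, serves for all t: it is
    proportional to the pullback of any other one. *)
Lemma curve_rep M (B : set 'rV[K]_M.+1) (g : 'rV[K]_N.+1 -> 'rV[K]_M.+1) v :
  regmap Y B g -> (forall x, B x -> x != 0) -> curve rho w v ->
  exists h : 'I_M.+1 -> {poly K}, primitive h /\
    forall t, same_point (\row_k (h k).[t]) (g (cpt v t)).
Proof.
move=> rg B0 cv.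
have lr t : exists d (F : 'I_M.+1 -> 'rV[K]_N.+1 -> K) (f : 'I_M.+1 -> {poly K}),
   localrep rho w g (cpt v t) d F /\ forall k s, (f k).[s] = F k (cpt v s).
  have [d [F hF]] := ex_localrep rg (curve_Y t cv).
  have hp k : hpoly d (F k) by case: hF.
  have /choice [f fE] := fun k => hpoly_curve (fun l => tens v (dec l)) (hp k).
  exists d, F, f; split=> // k s; rewrite fE; congr (F k _).
  by rewrite -[LHS]/(prow (tens v) s) prow_tens.
have [d0 [F0 [f0 [h0 e0]]]] := lr 0.
have nf0 : exists k, f0 k != 0.
  have [k hk] := localrep_neq0 h0; exists k; apply: contra hk => /eqP e.
  by rewrite -e0 e horner0.
have [h [q [ph q0 eq]]] := ex_primitive nf0.
exists h; split=> // t; have [d [F [f [hF fE]]]] := lr t.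
have par i k : f i * h k = f k * h i.
  apply: (mulfI q0); transitivity (f i * f0 k); first by rewrite eq; ring.
  transitivity (f k * f0 i); last by rewrite eq; ring.
  apply/eqP; rewrite -subr_eq0; apply/eqP; apply: poly_eq0P => s.
  rewrite hornerD hornerN !hornerM !fE !e0.
  by rewrite (localrep_par2 rg B0 i k hF h0 (curve_Y s cv)) subrr.
have nh : \row_k (h k).[t] != 0.
  by have [k hk] := ph t; apply: (@rV_neq0P _ _ _ k); rewrite mxE.
have [_ nF HF] := hF.
apply: same_point_trans (HF _ (curve_Y t cv) nF).
apply: par_same_point nh nF _ => i k; rewrite !mxE -!fE.
by have := congr1 (horner^~ t) (par k i); rewrite /= !hornerM mulrC => ->; rewrite mulrC.
Qed.

Definition leadv (v : idx T -> 'I_3 -> {poly K}) (dg : idx T -> nat) : idx T -> 'I_3 -> K :=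
  fun i k => (v i k)`_(dg i).

(** The polynomial t^d p(1/t), which brings the point at infinity of a curve to t = 0. *)
Definition revp d (p : {poly K}) : {poly K} := \poly_(a < d.+1) p`_(d - a).

Lemma revp0 d (p : {poly K}) : (revp d p).[0] = p`_d.
Proof. by rewrite horner_coef0 coef_poly subn0. Qed.

Lemma horner_revp d (p : {poly K}) (t : K) : (size p <= d.+1)%N -> t != 0 -> (revp d p).[t] = t ^+ d * p.[t^-1].
Proof.
move=> sp t0; rewrite horner_poly (horner_coef_wide _ sp) mulr_sumr.
rewrite (reindex_inj rev_ord_inj) /=; apply: eq_bigr => a _.
have ad : (a <= d)%N by rewrite -ltnS.
have -> : t ^+ d = t ^+ (d - a) * t ^+ a by rewrite -exprD subnK.
by rewrite subSS subKn // exprVn; field; exact: expf_neq0.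
Qed.

Definition revc (v : idx T -> 'I_3 -> {poly K}) (dg : idx T -> nat) : idx T -> 'I_3 -> {poly K} :=
  fun i k => revp (dg i) (v i k).

Lemma onY_scale v u (l : idx T -> K) : (forall i k, v i k = l i * u i k) ->
  onY rho w (idfun : {rmorphism K -> K}) u -> onY rho w (idfun : {rmorphism K -> K}) v.
Proof.
move=> h [y2 w2 hy hw]; split; rewrite ?h ?y2 ?w2 ?mulr0 // => j; rewrite !h /=.
  transitivity (l (iz j) * l iy * (u (iz j) o0 * (u iy o1 - rho j * u iy o0))); first by ring.
  by rewrite hy; ring.
transitivity (l (iz j) * l iw * (u (iz j) o1 * (u iw o1 - w j * u iw o0))); first by ring.
by rewrite hw; ring.
Qed.

Lemma onY_of_points v (D : {poly K}) : D != 0 ->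
  (forall t, D.[t] != 0 -> onY rho w (idfun : {rmorphism K -> K}) (at_ t v)) ->
  onY rho w (polyC : {rmorphism K -> {poly K}}) v.
Proof.
move=> D0 h.
split=> [||j|j].
- by apply: (poly_dense D0) => t /h [].
- by apply: (poly_dense D0) => t /h [].
- apply/eqP; rewrite -subr_eq0; apply/eqP; apply: (poly_dense D0) => t /h [_ _ hy _].
  by have := hy j; rewrite /at_ /= !(hornerD, hornerN, hornerM, hornerC) => ->; rewrite subrr.
- apply/eqP; rewrite -subr_eq0; apply/eqP; apply: (poly_dense D0) => t /h [_ _ _ hw].
  by have := hw j; rewrite /at_ /= !(hornerD, hornerN, hornerM, hornerC) => ->; rewrite subrr.
Qed.

Lemma revc_at v dg t : (forall i, isdeg (v i) (dg i)) -> t != 0 ->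
  forall i k, at_ t (revc v dg) i k = t ^+ dg i * at_ t^-1 v i k.
Proof. by move=> hd t0 i k; rewrite /at_ horner_revp //; case: (hd i). Qed.

Lemma revc_curve v dg : curve rho w v -> (forall i, isdeg (v i) (dg i)) -> curve rho w (revc v dg).
Proof.
move=> [hv nv] hd; split.
  apply: (@onY_of_points _ 'X); first by rewrite polyX_eq0.
  move=> t; rewrite hornerX => t0; apply: onY_scale (revc_at hd t0) _; exact: onY_at.
move=> t i; have [->|t0] := eqVneq t 0.
  by have [_ [k hk]] := hd i; exists k; rewrite /at_ revp0.
have [k hk] := nv t^-1 i; exists k; rewrite revc_at // mulf_neq0 //; exact: expf_neq0.
Qed.

Lemma revc_cpt v dg t : (forall i, isdeg (v i) (dg i)) -> t != 0 ->
  same_point (cpt v t^-1) (cpt (revc v dg) t).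
Proof.
move=> hd t0; apply: mkx_tensZ (revc_at hd t0) => i; exact: expf_neq0.
Qed.

Lemma revc_cpt0 v dg : cpt (revc v dg) 0 = mkx (tens (leadv v dg)).
Proof. by congr (mkx (tens _)); apply/funext => i; apply/funext => k; rewrite /at_ revp0. Qed.

Lemma ex_dg v : curve rho w v -> exists dg : idx T -> nat, forall i, isdeg (v i) (dg i).
Proof.
move=> [_ nv]; have H i : exists d, isdeg (v i) d.
  apply: ex_isdeg; have [k hk] := nv 0 i; exists k.
  by apply: contra hk => /eqP e; rewrite /at_ e horner0.
by have /choice [dg hdg] := H; exists dg.
Qed.

Lemma curve_par v u : curve rho w v -> (forall t i, exists k, at_ t u i k != 0) -> 
  forall (D : {poly K}), D != 0 ->
  (forall t, D.[t] != 0 -> same_point (cpt v t) (cpt u t)) ->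
  forall i k k', v i k * u i k' = v i k' * u i k.
Proof.
move=> [hv nv] nu D D0 h i k k'.
apply/eqP; rewrite -subr_eq0; apply/eqP; apply: (poly_dense D0) => t /h sp.
rewrite hornerD hornerN !hornerM.
by have := tens_same_point_par (nv t) sp i k k'; rewrite /at_ => ->; rewrite subrr.
Qed.

Lemma generic_genlead v dg : curve rho w v -> (forall i, isdeg (v i) (dg i)) ->
  qY rho w (mkx (tens (leadv v dg))) != 0 -> genlead rho w v (dg iy) (dg iw).
Proof.
move=> cv hd; rewrite /qY (_ : co _ = tens (leadv v dg)); last first.
  by apply/funext => e; rewrite coE.
rewrite qform_tens => /and3P [t0 /forallP hy /forallP hw]; split.
- by move: t0 => /prodf_neq0 /(_ iy isT); rewrite ffunE.
- by move: t0 => /prodf_neq0 /(_ iw isT); rewrite ffunE.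
- exact: hy.
- exact: hw.
Qed.

End Factors.

(** * Images under a regular map between two blow-ups *)

Section Images.
Variables (T T' : finType) (K : closedFieldType) (rho w : T -> K) (rho' w' : T' -> K).
Hypothesis rho_inj : injective rho.
Local Notation Y := (Yset rho w).
Local Notation Y' := (Yset rho' w').
Local Notation N := (amb T).
Local Notation N' := (amb T').
Variable F : 'rV[K]_N.+1 -> 'rV[K]_N'.+1.
Hypothesis rF : regmap Y Y' F.

Lemma image_curve v : curve rho w v ->
  exists u, curve rho' w' u /\ forall t, same_point (cpt u t) (F (cpt v t)).
Proof.
move=> cv.
have /choice [u hu] : forall i, exists h : 'I_3 -> {poly K}, primitive h /\
    forall t, same_point (\row_k (h k).[t]) (fac i (F (cpt v t))).
  move=> i; have := regmap_comp rF (fac_regmap rho' w' i) => r.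
  by have [h hh] := curve_rep r (fun x h => h) cv; exists h.
have key t : exists v', [/\ nondeg v', onY rho' w' (idfun : {rmorphism K -> K}) v',
    F (cpt v t) = mkx (tens v') & exists l : idx T' -> K, (forall i, l i != 0) /\
      forall i k, at_ t u i k = l i * v' i k].
  have YF := rF.1 _ (curve_Y t cv); have [v' [nv hv e]] := YsetP YF.
  exists v'; split=> //.
  have /choice [l hl] : forall i, exists c, c != 0 /\ forall k, at_ t u i k = c * v' i k.
    move=> i; have [_ hi] := hu i; have sp := hi t; rewrite e in sp.
    have sp2 := fac_tens i nv (same_point_refl (mkx (tens v'))).
    have [c c0 ce] := same_point_trans sp2 (same_point_sym sp).
    exists c; split=> // k; have := congr1 (fun r : 'rV[K]_3 => r 0 k) ce.
    by rewrite !mxE.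
  by exists l; split=> i; case: (hl i).
exists u; split; first split.
- apply: (@onY_of_points _ _ _ _ _ 1); first exact: oner_neq0.
  by move=> t _; have [v' [_ hv _ [l [_ hl]]]] := key t; exact: onY_scale hl hv.
- by move=> t i; have [hp _] := hu i; exact: hp.
- move=> t; have [v' [nv hv -> [l [l0 hl]]]] := key t.
  by apply: same_point_sym; exact: mkx_tensZ l0 hl.
Qed.

(** The image of the reversed curve and the reversed image are primitive and proportional, hence
    equal up to constants factor by factor; at t = 0 they give the points at infinity. *)
Lemma lead_image v u dg dg' : curve rho w v -> curve rho' w' u ->
  (forall t, same_point (cpt u t) (F (cpt v t))) ->
  (forall i, isdeg (v i) (dg i)) -> (forall i, isdeg (u i) (dg' i)) ->
  same_point (mkx (tens (leadv u dg'))) (F (mkx (tens (leadv v dg)))).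
Proof.
move=> cv cu h hd hd'.
have crv := revc_curve cv hd; have cru := revc_curve cu hd'.
have [u' [cu' hu']] := image_curve crv.
have X0 : 'X != 0 :> {poly K} by rewrite polyX_eq0.
have sp t : ('X : {poly K}).[t] != 0 -> same_point (cpt (revc u dg') t) (cpt u' t).
  rewrite hornerX => t0; apply: same_point_trans (same_point_sym (hu' t)).
  apply: same_point_trans (same_point_sym (revc_cpt hd' t0)) _.
  apply: same_point_trans (h t^-1) _.
  by apply: (regmap_same_point rF) (revc_cpt hd t0); exact: curve_Y.
have par := curve_par cru (fun t => cu'.2 t) X0 sp.
have pr i : primitive (revc u dg' i) by move=> t; exact: (cru.2 t i).
have pu i : primitive (u' i) by move=> t; exact: (cu'.2 t i).
have /choice [c hc] : forall i, exists c : K, c != 0 /\ forall k, u' i k = c%:P * revc u dg' i k.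
  move=> i; have [|c c0 e] := primitive_par (pu i) (pr i); last by exists c.
  by move=> k k'; rewrite mulrC par mulrC.
rewrite -(revc_cpt0 u) -(revc_cpt0 v); apply: same_point_trans (hu' 0).
apply: (mkx_tensZ (c := c)) => i; first by case: (hc i).
by move=> k; have [_ e] := hc i; rewrite /at_ e hornerM hornerC.
Qed.

(** The condition pulls back to a form that is nonzero at x1, hence, by density of the generic
    points, to a nonzero polynomial in y and w. *)
Lemma generic_image x1 : Y x1 -> qY rho' w' (F x1) != 0 ->
  exists f : {poly {poly K}}, f != 0 /\ forall a b, generic rho w a b -> ev2 a b f != 0 ->
    qY rho' w' (F (gpt rho w a b)) != 0.
Proof.
move=> Yx q1; have [d [G hG]] := ex_localrep rF Yx.
have [dq hq] := qY_hpoly rho' w'.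
have hp k : hpoly d (G k) by case: hG.
have hR := hpoly_comp hq hp.
have [_ nG HG] := hG.
have R1 : qY rho' w' (\row_i G i x1) != 0 by rewrite -(hpoly_same_point hq (HG x1 Yx nG)).
have [f fE] := gpt_ev2 rho w hR; exists f; split.
  apply/eqP => f0; case/eqP: R1; apply: (Y_dense rho_inj hR) Yx => x Yx' qx.
  have [a [b [g sp]]] := qY_generic Yx' qx.
  by apply/eqP; rewrite (hpoly_same_point hR sp) -fE f0 ev2_0.
move=> a b g; rewrite fE => ne.
have nz : \row_i G i (gpt rho w a b) != 0.
  apply: contra ne => /eqP ->; rewrite /qY /qform (_ : co 0 _ = 0) ?mul0r //.
  by rewrite /co mxE.
by rewrite (hpoly_same_point hq (HG _ (gpt_Y g) nz)).
Qed.

End Images.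

(** * Real curves and the rank inequality *)

Section LineCurves.
Variables (T : finType) (K : closedFieldType) (rho w : T -> K).
Local Notation cK := (polyC : {rmorphism K -> {poly K}}).
Variables (a b l m l' m' : K) (hit : pred T) (tt : T -> K).
Hypothesis gab : generic rho w a b.
Hypothesis l0 : l != 0.
Hypothesis l'0 : l' != 0.

(* The curve y = a + 1 / (l t + m), w = b + 1 / (l' t + m'); it meets E_j at the
   parameter t when 1 / (rho_j - a) = l t + m and 1 / (w_j - b) = l' t + m'. *)
Definition meets j t := 1 = (rho j - a) * (l * t + m) /\ 1 = (w j - b) * (l' * t + m').

Hypothesis hitP : forall j, hit j -> meets j (tt j).
Hypothesis hitN : forall j t, ~~ hit j -> ~ meets j t.

Definition ln (p q : K) : {poly K} := p%:P * 'X + q%:P.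

(** The point (a, b) is reached at t = infinity. At a centre that the line meets, [cvec] has the
    common factor t - tt j, and the quotient is used. *)
Definition lcurve (i : idx T) : 'I_3 -> {poly K} :=
  let y := pt (ln l m) (a%:P * ln l m + 1) in let z := pt (ln l' m') (b%:P * ln l' m' + 1) in
  match i with
  | None => y | Some None => z
  | Some (Some j) => if hit j then
      vec3 (- ((w j - b) * l')%:P * ln l m) (- ((rho j - a) * l)%:P * ln l' m')
           (((rho j - a) * l * ((w j - b) * l'))%:P * ('X - (tt j)%:P))
    else cvec rho w cK j y z
  end.

Lemma horner_ln p q t : (ln p q).[t] = p * t + q.
Proof. by rewrite /ln hornerD hornerM !hornerC hornerX. Qed.

Lemma tc_ln p q : tc 1 (ln p q) p.
Proof.
split; last by rewrite coefD coefCM coefX coefC mulr1 addr0.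
apply: leq_trans (size_polyD _ _) _; rewrite geq_max; apply/andP; split.
  by rewrite mul_polyC; apply: leq_trans (size_scale_leq _ _) _; rewrite size_polyX.
exact: leq_trans (size_polyC_leq1 _) _.
Qed.

Lemma tc_aff c p q : tc 1 (c%:P * ln p q + 1) (c * p).
Proof.
rewrite -[c * p]addr0; apply: tcD; first by apply: tcZ; exact: tc_ln.
by split; rewrite ?coef1 // size_poly1.
Qed.

Lemma hit_y j : hit j ->
  (a%:P * ln l m + 1) - (rho j)%:P * ln l m = - ((rho j - a) * l)%:P * ('X - (tt j)%:P).
Proof.
move=> /hitP [h _]; rewrite /ln.
have -> : (1 : {poly K}) = ((rho j - a) * (l * tt j + m))%:P by rewrite -h polyC1.
by rewrite !(polyCM, polyCD, polyCN); ring.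
Qed.

Lemma hit_w j : hit j ->
  (b%:P * ln l' m' + 1) - (w j)%:P * ln l' m' = - ((w j - b) * l')%:P * ('X - (tt j)%:P).
Proof.
move=> /hitP [_ h]; rewrite /ln.
have -> : (1 : {poly K}) = ((w j - b) * (l' * tt j + m'))%:P by rewrite -h polyC1.
by rewrite !(polyCM, polyCD, polyCN); ring.
Qed.

Lemma kappa j : rho j - a != 0.
Proof. by rewrite subr_eq0 eq_sym; case: gab. Qed.
Lemma kappa' j : w j - b != 0.
Proof. by rewrite subr_eq0 eq_sym; case: gab. Qed.

Lemma lcurve_curve : curve rho w lcurve.
Proof.
split; first split.
- by [].
- by [].
- move=> j /=; case: ifP => [hj|_]; last by rewrite /cvec /pt /vec3 /=; ring.
  rewrite /pt /vec3 /= (hit_y hj) !(polyCM, polyCD, polyCN); ring.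
- move=> j /=; case: ifP => [hj|_]; last by rewrite /cvec /pt /vec3 /=; ring.
  rewrite /pt /vec3 /= (hit_w hj) !(polyCM, polyCD, polyCN); ring.
have aff c p q t : (ln p q).[t] = 0 -> (c%:P * ln p q + 1).[t] != 0.
  by move=> e; rewrite hornerD hornerM e mulr0 add0r hornerC oner_neq0.
move=> t; apply: idxP => [||j].
- have [e|ne] := eqVneq (ln l m).[t] 0; last by exists o0.
  by exists o1; rewrite /at_ /= /pt /vec3 /= aff.
- have [e|ne] := eqVneq (ln l' m').[t] 0; last by exists o0.
  by exists o1; rewrite /at_ /= /pt /vec3 /= aff.
have [hj|nj] := boolP (hit j).
  have [tj|tj] := eqVneq t (tt j); last first.
    exists o2; rewrite /at_ /= hj /vec3 /= hornerM hornerD hornerN hornerX !hornerC.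
    by rewrite !mulf_neq0 ?kappa ?kappa' // subr_eq0.
  exists o0; rewrite /at_ /= hj /vec3 /= hornerM hornerN hornerC horner_ln tj.
  have [h _] := hitP hj; rewrite mulf_neq0 // ?oppr_eq0 ?mulf_neq0 ?kappa' //.
  by apply/eqP => e; move/eqP: h; rewrite e mulr0 oner_eq0.
have [k hk] : exists k, cvec rho w (idfun : {rmorphism K -> K}) j
    (pt (ln l m).[t] (a%:P * ln l m + 1).[t]) (pt (ln l' m').[t] (b%:P * ln l' m' + 1).[t]) k != 0.
  apply: center_dec.
  - rewrite !(horner_ln, hornerD, hornerM, hornerC) => -[e1 e2]; apply: (hitN (j := j) (t := t) nj).
    split; apply/eqP; rewrite -subr_eq0.
      by move/eqP: e1; rewrite -subr_eq0; congr (_ == 0); ring.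
    by move/eqP: e2; rewrite -subr_eq0; congr (_ == 0); ring.
  - by have [e|//] := eqVneq (ln l m).[t] 0; rewrite aff ?orbT.
  - by have [e|//] := eqVneq (ln l' m').[t] 0; rewrite aff ?orbT.
exists k; move: hk; rewrite /at_ /= (negPf nj); move: k; apply: I3P;
  by rewrite /cvec /pt /vec3 /= !(hornerM, hornerD, hornerN, hornerC).
Qed.

(** [cvec] has degree 2 along the line; one is lost when the line meets the centre. *)
Definition ldg (i : idx T) : nat :=
  match i with Some (Some j) => if hit j then 1 else 2 | _ => 1 end.

Definition ltop (i : idx T) : K := match i with None => l | Some None => l' | _ => l * l' end.

Lemma lcurve_tc i k : tc (ldg i) (lcurve i k)
  (ltop i * chart rho w (idfun : {rmorphism K -> K}) (pt 1 a) (pt 1 b) i k).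
Proof.
have tc0 d : tc d (0 : {poly K}) 0 by split; rewrite ?size_poly0 ?coef0.
move: i k; apply: idxP => [||j]; [apply: I3P | apply: I3P |];
  rewrite /= /pt /vec3 /= ?mulr1 ?mulr0 ?[_ * a]mulrC ?[_ * b]mulrC; try exact: tc0;
  try exact: tc_ln; try exact: tc_aff.
have tX c0 : tc 1 ('X - c0%:P : {poly K}) 1.
  by split; rewrite ?size_XsubC // coefB coefX coefC subr0.
have ty : tc 1 ((a%:P * ln l m + 1) - (rho j)%:P * ln l m) (a * l - rho j * l).
  by apply: tcD; [exact: tc_aff | apply: tcN; apply: tcZ; exact: tc_ln].
have tw : tc 1 ((b%:P * ln l' m' + 1) - (w j)%:P * ln l' m') (b * l' - w j * l').
  by apply: tcD; [exact: tc_aff | apply: tcN; apply: tcZ; exact: tc_ln].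
case: ifP => hj.
  apply: I3P; rewrite /cvec /vec3 /= ?mulr1.
  - rewrite (_ : l * l' * _ = - ((w j - b) * l') * l); last by ring.
    by rewrite -polyCN; apply: tcZ; exact: tc_ln.
  - rewrite (_ : l * l' * _ = - ((rho j - a) * l) * l'); last by ring.
    by rewrite -polyCN; apply: tcZ; exact: tc_ln.
  - rewrite (_ : l * l' * _ = ((rho j - a) * l * ((w j - b) * l')) * 1); last by ring.
    by apply: tcZ; exact: tX.
apply: I3P; rewrite /cvec /vec3 /= ?mulr1.
- rewrite (_ : l * l' * _ = (b * l' - w j * l') * l); last by ring.
  exact: (tcM tw (tc_ln l m)).
- rewrite (_ : l * l' * _ = (a * l - rho j * l) * l'); last by ring.
  exact: (tcM ty (tc_ln l' m')).
- rewrite (_ : l * l' * _ = (a * l - rho j * l) * (b * l' - w j * l')); last by ring.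
  exact: (tcM ty tw).
Qed.

Lemma lcurve_isdeg i : isdeg (lcurve i) (ldg i).
Proof.
split=> [k|]; first by case: (lcurve_tc i k).
have [k hk] := generic_nondeg gab i; exists k.
have [_ ->] := lcurve_tc i k; rewrite mulf_neq0 //.
by case: i {hk} => [[j|]|] //=; rewrite mulf_neq0.
Qed.

Lemma lcurve_lead : same_point (gpt rho w a b) (mkx (tens (leadv lcurve ldg))).
Proof.
apply: (mkx_tensZ (c := ltop)) => i; first by case: i => [[j|]|] //=; rewrite mulf_neq0.
by move=> k; have [_ e] := lcurve_tc i k.
Qed.

End LineCurves.

(** * The antiholomorphic involution of the blow-up *)

Section Theta.
Variables (T : finType) (R : realType).
Local Notation C := R[i].
Local Notation conj := (@conjc R).
Local Notation N := (amb T).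
Variables (pi : T -> T).
Hypothesis piK : involutive pi.

(** (y, w) -> (conj w, conj y) swaps the first two factors and permutes the planes by [pi]. Inside a
    plane it swaps 1/(y - rho j) and 1/(w - w j), whence [s01]. *)
Definition tau (i : idx T) : idx T :=
  match i with None => iw | Some None => iy | Some (Some j) => iz (pi j) end.
Definition s01 (k : 'I_3) : 'I_3 := if k == o0 then o1 else if k == o1 then o0 else k.
Definition kap (i : idx T) (k : 'I_3) : 'I_3 := match i with Some (Some _) => s01 k | _ => k end.
Definition sig (e : mon T) : mon T := [ffun i => kap i (e (tau i))].
Definition sperm (k : 'I_N.+1) : 'I_N.+1 := enc (sig (dec k)).

Lemma tauK : involutive tau.
Proof. by case=> [[j|]|] //=; rewrite piK. Qed.

Lemma s01K : involutive s01.
Proof. by apply: I3P. Qed.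

Lemma kapK i : involutive (kap i).
Proof. by case: i => [[j|]|] // k; exact: s01K. Qed.

Lemma kap_tau i : kap (tau i) = kap i.
Proof. by case: i => [[j|]|]. Qed.

Lemma sigK : involutive sig.
Proof. by move=> e; apply/ffunP => i; rewrite !ffunE kap_tau tauK kapK. Qed.

Lemma spermK : involutive sperm.
Proof. by move=> k; rewrite /sperm encK sigK decK. Qed.

Definition vth (v : idx T -> 'I_3 -> C) : idx T -> 'I_3 -> C :=
  fun i k => conj (v (tau i) (kap i k)).

Lemma theta_tens v : theta sperm (mkx (tens v)) = mkx (tens (vth v)).
Proof.
apply/rowP => k; rewrite !mxE /sperm encK /tens rmorph_prod.
rewrite (reindex_inj (inv_inj tauK)); apply: eq_bigr => i _.
by rewrite ffunE tauK kap_tau.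
Qed.

Lemma vth_nondeg v : nondeg v -> nondeg (vth v).
Proof.
move=> nv i; have [k hk] := nv (tau i); exists (kap i k).
by rewrite /vth kapK conjc_eq0.
Qed.

Variables (rho w : T -> C).
Hypothesis hpi : forall j, w (pi j) = conj (rho j).
Local Notation Y := (Yset rho w).
Local Notation idC := (idfun : {rmorphism C -> C}).

Lemma rho_pi j : rho (pi j) = conj (w j).
Proof. by rewrite -[w j](congr1 w (piK j)) hpi conjcK. Qed.

Lemma vth_onY v : onY rho w idC v -> onY rho w idC (vth v).
Proof.
move=> [y2 w2 hy hw]; split.
- by rewrite /vth /= w2 conjc0.
- by rewrite /vth /= y2 conjc0.
- move=> j; rewrite /vth /= -[rho j]conjcK -hpi -!conjM -conjN -conjD -conjM.
  by congr conj; exact: hw.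
- move=> j; rewrite /vth /= -[w j]conjcK -rho_pi -!conjM -conjN -conjD -conjM.
  by congr conj; exact: hy.
Qed.

Lemma Y_theta x : Y x -> Y (theta sperm x).
Proof.
move=> /YsetP [v [nv hv ->]]; rewrite theta_tens.
by apply: Yset_tens; [exact: vth_nondeg | exact: vth_onY].
Qed.

Definition vconj (v : idx T -> 'I_3 -> {poly C}) : idx T -> 'I_3 -> {poly C} :=
  fun i k => map_poly conj (v (tau i) (kap i k)).

Lemma horner_conj (p : {poly C}) t : (map_poly conj p).[t] = conj p.[conj t].
Proof. by rewrite -{1}[t]conjcK horner_map. Qed.

Lemma vconj_at v t : at_ t (vconj v) = vth (at_ (conj t) v).
Proof. by apply/funext => i; apply/funext => k; rewrite /at_ horner_conj. Qed.

Lemma vconj_cpt v t : cpt (vconj v) t = theta sperm (cpt v (conj t)).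
Proof. by rewrite /cpt theta_tens vconj_at. Qed.

Lemma vconj_curve v : curve rho w v -> curve rho w (vconj v).
Proof.
move=> [hv nv]; split=> [|t]; last by rewrite vconj_at; apply: vth_nondeg.
apply: (@onY_of_points _ _ _ _ _ 1); first exact: oner_neq0.
by move=> t _; rewrite vconj_at; apply: vth_onY; exact: onY_at.
Qed.

Lemma vconj_isdeg v i d : isdeg (v (tau i)) d -> isdeg (vconj v i) d.
Proof.
move=> [s [k hk]]; split=> [k'|].
  by rewrite /vconj size_map_poly.
by exists (kap i k); rewrite /vconj kapK coef_map conjc_eq0.
Qed.

(** By [vconj_cpt], the involution sends the point of parameter conj t to the point of parameter
    t. *)
Definition realc (v : idx T -> 'I_3 -> {poly C}) :=
  forall t, same_point (cpt (vconj v) t) (cpt v t).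

(** A real curve and its conjugate are proportional and primitive in each factor. Hence the degrees
    in y and w agree, and those in the planes are constant on the orbits of [pi]. *)
Lemma real_isdeg v i d : curve rho w v -> realc v -> isdeg (v (tau i)) d -> isdeg (v i) d.
Proof.
move=> cv rv hd; have cv' := vconj_curve cv.
apply: (primitive_isdeg_par (f := vconj v i)); last exact: vconj_isdeg.
- by move=> t; exact: (cv'.2 t i).
- by move=> t; exact: (cv.2 t i).
- by move=> k k'; apply: (curve_par cv' cv.2 (oner_neq0 _)) => t _.
Qed.

Lemma realc_of_base v : curve rho w v -> (forall k, vconj v iy k = v iy k) ->
  (forall k, vconj v iw k = v iw k) ->
  (forall j, exists k, cvec rho w (polyC : {rmorphism C -> {poly C}}) j (v iy) (v iw) k != 0) ->
  realc v.
Proof.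
move=> cv ey ew nc; have cv' := vconj_curve cv.
have /choice [c hc] : forall i, exists c : C, c != 0 /\ forall k, v i k = c%:P * vconj v i k.
  move=> i; have [||k k'|c c0 e] := @primitive_par _ _ (v i) (vconj v i); last by exists c.
  - by move=> t; exact: (cv.2 t i).
  - by move=> t; exact: (cv'.2 t i).
  move: i k k'; apply: idxP => [k k'|k k'|j k k'].
  - by rewrite !ey mulrC.
  - by rewrite !ew mulrC.
  have [q hq] := nc j; apply: (mulfI (mulf_neq0 hq hq)).
  have h1 := onY_par j cv.1 q; have h2 := onY_par j cv'.1 q.
  have eyf : vconj v iy = v iy by apply/funext.
  have ewf : vconj v iw = v iw by apply/funext.
  rewrite eyf ewf in h2; set f := cvec _ _ _ _ _ _ in hq h1 h2 *.
  transitivity ((f q * v (iz j) k) * (f q * vconj v (iz j) k')); first by ring.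
  transitivity ((f q * v (iz j) k') * (f q * vconj v (iz j) k)); last by ring.
  by rewrite !h1 !h2; ring.
move=> t; apply: (mkx_tensZ (c := c)) => i; first by case: (hc i).
by move=> k; have [_ e] := hc i; rewrite /at_ e hornerM hornerC.
Qed.

End Theta.

(** The identity matrix of size #|A| factors through a space of dimension #|B|. *)
Lemma biorthogonal_card (A B : finType) (f : A -> B -> rat) (g : B -> A -> rat) :
  (forall a a', \sum_b f a b * g b a' = (a == a')%:R) -> (#|A| <= #|B|)%N.
Proof.
move=> h; pose M1 : 'M[rat]_(#|A|, #|B|) := \matrix_(i, j) f (enum_val i) (enum_val j).
pose M2 : 'M[rat]_(#|B|, #|A|) := \matrix_(i, j) g (enum_val i) (enum_val j).
have e : M1 *m M2 = 1%:M.
  apply/matrixP => i j; rewrite !mxE -(inj_eq enum_val_inj) -h.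
  rewrite [RHS](reindex (@enum_val _ B)) /=; last first.
    by exists enum_rank => x _; rewrite ?enum_valK ?enum_rankK.
  by apply: eq_bigr => k _; rewrite !mxE.
have := mxrankM_maxl M1 M2; rewrite e mxrank1 => /leq_trans; apply; exact: rank_leq_col.
Qed.

(** * Zariski density of the real points *)

Section Density.
Variable R : realType.
Local Notation C := R[i].
Local Notation conj := (@conjc R).
Local Notation rc := (real_complex R : {rmorphism R -> C}).
Local Notation ci := (Complex 0 1 : C).

Lemma zeros_eq0 (p : {poly C}) (phi : R -> C) : injective phi ->
  (forall r, p.[phi r] = 0) -> p = 0.
Proof.
move=> inj h; apply/eqP/negPn/negP => p0.
have := @max_poly_roots _ p [seq phi k%:R | k <- iota 0 (size p)] p0.
rewrite size_map size_iota ltnn; case: allP => [_|n _]; last first.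
  apply: n => x /mapP [k _ ->]; by rewrite /root h.
rewrite map_inj_uniq ?iota_uniq // => [/(_ isT isT) //|k k' /inj /eqP].
by rewrite eqr_nat => /eqP.
Qed.

Lemma avoid (s : seq C) (phi : R -> C) : injective phi -> exists r, phi r \notin s.
Proof.
move=> inj; apply: contrapT => none.
have p0 : \prod_(c <- s) ('X - c%:P) != 0 :> {poly C}.
  rewrite prodf_seq_neq0; apply/allP => c _; apply/implyP => _; by rewrite polyXsubC_eq0.
case/eqP: p0; apply: (zeros_eq0 inj) => r; apply/eqP; rewrite -[_ == 0]/(root _ _).
by rewrite root_prod_XsubC; apply/negPn/negP => h; apply: none; exists r.
Qed.

Lemma rc_inj : injective rc. Proof. exact: complexI. Qed.

Lemma ci_neq0 : ci != 0. Proof. by rewrite eq_complex /= oner_eq0 andbF. Qed.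

(** The set t = conj s is Zariski dense: for a fixed imaginary part c, the numbers s = r + i c give
    infinitely many points of the line s - t = 2 i c, and then c varies. *)
Lemma real_dense (f : {poly {poly C}}) : f != 0 -> exists a, ev2 a (conj a) f != 0.
Proof.
move=> f0; apply: contrapT => none.
have h a : ev2 a (conj a) f = 0 by apply/eqP/negPn/negP => e; apply: none; exists a.
case/eqP: f0; apply: ev2_eq0 => s t; rewrite ev2_subs0.
suff -> : subs0 s f = 0 by rewrite horner0.
apply: (@zeros_eq0 _ (fun c => s - 2%:R * ci * rc c)) => [c c' /addrI /oppr_inj|c].
  by move/(mulfI (mulf_neq0 (two_neq0 R) ci_neq0)) => /rc_inj.
rewrite -ev2_subs0.
pose d : {poly C} := 'X - (2%:R * ci * rc c)%:P.
have e x : ev2 x (x - 2%:R * ci * rc c) f = (f.[d]).[x].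
  rewrite ev2_subs0 /subs0 -[in RHS]/(horner_eval x (f.[d])) -horner_map /=.
  by rewrite /horner_eval /d !(hornerD, hornerN, hornerC, hornerX).
rewrite e; suff -> : f.[d] = 0 by rewrite horner0.
apply: (@zeros_eq0 _ (fun r => rc r + ci * rc c)) => [r r' /addIr /rc_inj //|r].
rewrite -e -[X in ev2 _ X]/(_); set x := _ + _; rewrite (_ : x - _ = conj x) ?h //.
by rewrite /x conjD conjM conj_ci !conj_rc; ring.
Qed.

End Density.

(** * Orbits of an involution and the linear algebra of degrees *)

Section Orbits.
Variables (T : finType) (pi : T -> T).
Hypothesis piK : involutive pi.

Definition rep j := if (enum_rank j <= enum_rank (pi j))%N then j else pi j.

Lemma rep_case j : rep j = j \/ rep j = pi j.
Proof. by rewrite /rep; case: ifP; [left | right]. Qed.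

Lemma rep_pi j : rep (pi j) = rep j.
Proof.
rewrite /rep piK; case: leqP => h1; case: leqP => h2 //; last by move: (ltn_trans h1 h2); rewrite ltnn.
by apply: enum_rank_inj; apply/val_inj/eqP; rewrite eqn_leq h1.
Qed.

Lemma rep_idem j : rep (rep j) == rep j.
Proof. by case: (rep_case j) => e; rewrite {1}e ?rep_pi. Qed.

Definition reps := {j | rep j == j}.
Definition to_rep (j : T) : reps := exist _ (rep j) (rep_idem j).

Definition orbit_of (r : option reps) : pred T :=
  if r is Some s then [pred j | (j == val s) || (j == pi (val s))] else pred0.

Lemma orbit_of_rep (r : reps) (o : option reps) : orbit_of o (val r) = (o == Some r).
Proof.
case: o => [s|] //=; rewrite -[Some s == _]/(s == r) -(inj_eq val_inj) eq_sym.
have [//|ne /=] := eqVneq (val s) (val r); apply/eqP => e; case/eqP: ne.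
have := congr1 rep e; rewrite rep_pi.
by move=> h; apply/esym; apply: etrans (esym (eqP (valP r))) (etrans h (eqP (valP s))).
Qed.

(** The representatives and their images under [pi] cover T and overlap in the fixed points. *)
Lemma card_reps : (2 * #|{: reps}| = #|T| + #|[pred j | pi j == j]|)%N.
Proof.
rewrite card_sig; set P := [set j | rep j == j]%SET.
have eP : #|[pred j | rep j == j]| = #|P| by rewrite cardsE.
have injp : injective pi by exact: inv_inj.
have e2 : #|pi @: P| = #|P| by rewrite card_imset.
rewrite eP mulSn mul1n -{2}e2 -cardsUI; congr (_ + _)%N.
  apply: eq_card => j; rewrite !inE; have [//|h /=] := boolP (rep j == j).
  apply/imsetP; exists (pi j); last by rewrite piK.
  by rewrite inE rep_pi; case: (rep_case j) h => -> //; rewrite eqxx.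
apply: eq_card => j; rewrite !inE; apply/andP/eqP => [[/eqP hj /imsetP [k]]|e].
  by rewrite inE => /eqP hk e; rewrite e piK -{1}hk -rep_pi -e.
have hj : rep j == j by rewrite /rep e leqnn.
by split=> //; apply/imsetP; exists j; rewrite ?inE.
Qed.

End Orbits.

Section OrbitRank.
Variables (T T' : finType) (pi : T -> T) (pi' : T' -> T').
Hypotheses (piK : involutive pi) (piK' : involutive pi').
Local Notation A := (option (reps pi)).
Local Notation A' := (option (reps pi')).

(** Functionals dual to the degree vectors of the lines: 2 X_y - X_z is the intersection number with
    an exceptional curve when the degrees in y and w agree, and the last functional detects the line
    through no centre. *)
Definition phi (a : A) (X : idx T -> rat) : rat :=
  let ps r := 2%:R * X iy - X (iz (val (r : reps pi))) in
  if a is Some r then ps r else X iy - \sum_r ps r.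

Lemma phi_sum (B : finType) (V : B -> rat) (U : B -> idx T -> rat) a :
  phi a (fun i => \sum_b V b * U b i) = \sum_b V b * phi a (U b).
Proof.
have ps r : 2%:R * (\sum_b V b * U b iy) - \sum_b V b * U b (iz (val (r : reps pi))) =
    \sum_b V b * (2%:R * U b iy - U b (iz (val r))).
  by rewrite mulr_sumr -sumrB; apply: eq_bigr => b _; ring.
case: a => [r|]; first exact: ps.
rewrite /phi (eq_bigr _ (fun r _ => ps r)) exchange_big /= -sumrB; apply: eq_bigr => b _.
by rewrite mulrBr mulr_sumr.
Qed.

Lemma phi_ldg (a o : A) :
  phi a (fun i => (ldg (orbit_of o) i)%:R) = (o == a)%:R.
Proof.
have ps r : 2%:R * (ldg (orbit_of o) iy)%:R - (ldg (orbit_of o) (iz (val (r : reps pi))))%:R =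
    (o == Some r)%:R :> rat.
  by rewrite /= orbit_of_rep //; case: (o == _).
case: a => [r|]; first exact: ps.
rewrite /phi (eq_bigr _ (fun r _ => ps r)).
case: o {ps} => [s|] /=; last by rewrite big1 ?subr0.
rewrite (bigD1 s) //= eqxx big1 ?addr0 ?subrr // => r.
by rewrite eq_sym -[Some s == _]/(s == r) => /negPf ->.
Qed.

(** The degree vectors of the lines depend linearly on D and on one value of Z for each orbit of
    [pi']. The functionals [phi] make them independent, so there are at most as many of them; both
    counts are one plus a number of orbits. *)
Lemma orbit_rank (D : A -> nat) (Z : A -> T' -> nat) (n m : idx T -> nat)
    (al : idx T -> T' -> nat) :
  (forall o j, Z o (pi' j) = Z o j) ->
  (forall o i, ldg (orbit_of o) i + \sum_j al i j * (D o + D o) =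
     n i * D o + m i * D o + \sum_j al i j * Z o j)%N ->
  (#|{: reps pi}| <= #|{: reps pi'}|)%N.
Proof.
move=> hZ h.
pose V (o b : _) : rat := if b is Some r then (Z o (val (r : reps pi')))%:R else (D o)%:R.
(* The coefficients [al] are summed over each orbit of [pi'], on which Z is constant. *)
pose U (b : A') i : rat := if b is Some r then \sum_(j | to_rep piK' j == r) (al i j)%:R
  else (n i)%:R + (m i)%:R - \sum_j (al i j)%:R * 2%:R.
have hU o i : (ldg (orbit_of o) i)%:R = \sum_b V o b * U b i.
  have e := congr1 (fun k : nat => k%:R : rat) (h o i).
  rewrite !natrD !natrM !natr_sum in e.
  have {e} -> : (ldg (orbit_of o) i)%:R =
      V o None * U None i + \sum_j (al i j)%:R * (Z o j)%:R :> rat.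
    have e1 : \sum_j (al i j * (D o + D o))%:R = (D o)%:R * \sum_j (al i j)%:R * 2%:R :> rat.
      by rewrite mulr_sumr; apply: eq_bigr => j _; rewrite natrM natrD; ring.
    have e2 : \sum_j (al i j * Z o j)%:R = \sum_j (al i j)%:R * (Z o j)%:R :> rat.
      by apply: eq_bigr => j _; rewrite natrM.
    by apply: (addIr (\sum_j (al i j * (D o + D o))%:R)); rewrite e e1 e2 /V /U; ring.
  rewrite [in RHS](bigD1 None) //=; congr (_ + _).
  rewrite (reindex_omap Some (fun x => x)) /=; last by case.
  rewrite (partition_big (to_rep piK') predT) //=; apply: eq_big => [r|r _]; first by rewrite eqxx.
  rewrite mulr_sumr; apply: eq_bigr => j /eqP <- /=; rewrite mulrC; congr (_%:R * _).
  by case: (rep_case pi' j) => ->.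
have := @biorthogonal_card A A' V (fun b a => phi a (U b)).
rewrite !card_option ltnS; apply=> a a'.
rewrite -phi_sum -phi_ldg; congr (phi _ _); apply/funext => i; by rewrite hU.
Qed.

End OrbitRank.

Lemma ln_curve_neq0 (K : closedFieldType) (c q r : K) (l m : K) : c - r != 0 -> l != 0 ->
  (c%:P * ln l m + 1) - r%:P * ln l m != 0.
Proof.
move=> cr l0; have h : tc 1 ((c%:P * ln l m + 1) - r%:P * ln l m) (c * l - r * l).
  by apply: tcD; [exact: tc_aff | apply: tcN; apply: tcZ; exact: tc_ln].
by apply: (tc_neq0 h); rewrite -mulrBl mulf_neq0.
Qed.

(** * Real lines through the centres of one orbit *)

Section Lines.
Variables (T : finType) (R : realType).
Local Notation C := R[i].
Local Notation conj := (@conjc R).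
Local Notation rc := (real_complex R : {rmorphism R -> C}).
Local Notation ci := (Complex 0 1 : C).
Variables (pi : T -> T) (rho w : T -> C).
Hypothesis piK : involutive pi.
Hypothesis rho_inj : injective rho.
Hypothesis hpi : forall j, w (pi j) = conj (rho j).

(** In the coordinates 1/(y - a) and 1/(w - b) the curves [lcurve] are straight lines. This is the
    collinearity of the centres r, pi r and j, without denominators, as a polynomial in a and b. *)
Definition collin (r j : T) : {poly {poly C}} :=
  ((rho r - rho j) * (w r - w (pi r)))%:P%:P *
    (((w j)%:P%:P - 'X) * ((rho (pi r))%:P%:P - 'X%:P)) -
  ((w r - w j) * (rho r - rho (pi r)))%:P%:P *
    (((rho j)%:P%:P - 'X%:P) * ((w (pi r))%:P%:P - 'X)).

Lemma ev2_collin r j a b : ev2 a b (collin r j) =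
  (rho r - rho j) * (w r - w (pi r)) * ((w j - b) * (rho (pi r) - a)) -
  (w r - w j) * (rho r - rho (pi r)) * ((rho j - a) * (w (pi r) - b)).
Proof. by rewrite /collin !(ev2D, ev2N, ev2M, ev2CC, ev2_s, ev2_t). Qed.

Lemma w_inj : injective w.
Proof.
move=> j j'; rewrite -[j](piK j) -[j'](piK j') !hpi => /(congr1 conj).
by rewrite !conjcK => /rho_inj ->.
Qed.

Lemma collin_neq0 r j : j != r -> j != pi r -> pi r != r -> collin r j != 0.
Proof.
(* At a = rho (pi r) the first product vanishes, and b = w (pi r) + 1 makes the last factor of the
   second one -1. *)
move=> jr jp pr; apply/eqP => e; have := ev2_collin r j (rho (pi r)) (w (pi r) + 1).
rewrite e ev2_0 subrr !mulr0 sub0r => /esym/eqP; rewrite oppr_eq0 !mulf_eq0 !subr_eq0.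
rewrite !(inj_eq rho_inj) (inj_eq w_inj) ![r == _]eq_sym (negPf jr) (negPf jp) (negPf pr) /=.
by rewrite -subr_eq0 opprD addrA subrr sub0r oppr_eq0 oner_eq0.
Qed.

Definition special a := [/\ generic rho w a (conj a) &
  forall r j, j != r -> j != pi r -> pi r != r -> ev2 a (conj a) (collin r j) != 0].

Lemma ex_special (f : {poly {poly C}}) : f != 0 -> exists a, special a /\ ev2 a (conj a) f != 0.
Proof.
move=> f0; pose c r j := if [&& j != r, j != pi r & pi r != r] then collin r j else 1.
have c0 r j : c r j != 0.
  by rewrite /c; case: ifP => [/and3P [h1 h2 h3]|_]; rewrite ?collin_neq0 ?oner_neq0.
have [D hD] : exists D, D = genD rho w by eexists.
have [|a] := @real_dense R (D * f * \prod_r \prod_j c r j).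
  apply: mulf_neq0; first by apply: mulf_neq0 => //; rewrite hD; exact: genD_neq0.
  apply/prodf_neq0 => r _.
  by apply/prodf_neq0 => j _.
rewrite !ev2M !mulf_eq0 !negb_or => /andP [/andP [g hf] hc].
exists a; split=> //; split=> [|r j h1 h2 h3]; first by move: g; rewrite hD => /genD_generic.
move: hc; rewrite (bigD1 r) //= ev2M mulf_eq0 negb_or => /andP [+ _].
by rewrite (bigD1 j) //= ev2M mulf_eq0 negb_or /c h1 h2 h3 => /andP [].
Qed.

Variable a : C.
Hypothesis ha : special a.
Local Notation b := (conj a).
Local Notation A j := ((rho j - a)^-1).

(** The condition on w at j is the conjugate of the condition on y at pi j. *)
Lemma meetsP l m j t : meets rho w a b l m (conj l) (conj m) j t <->
  A j = l * t + m /\ A (pi j) = l * conj t + m.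
Proof.
have [[ga gb] _] := ha.
have k0 i : rho i - a != 0 by rewrite subr_eq0 eq_sym.
have inv i x : 1 = (rho i - a) * x <-> A i = x.
  split=> [e|<-]; last by rewrite divff.
  by apply: (mulfI (k0 i)); rewrite divff.
have e : 1 = (rho (pi j) - a) * (l * conj t + m) <-> 1 = (w j - b) * (conj l * t + conj m).
  have -> : rho (pi j) - a = conj (w j - b) by rewrite (rho_pi piK hpi) conjD conjN conjcK.
  have -> : l * conj t + m = conj (conj l * t + conj m) by rewrite conjD conjM !conjcK.
  rewrite -conjM -{1}[1]conj1; split=> [|<- //]; exact: (can_inj (@conjcK R)).
by split=> -[h1 h2]; split; [apply/inv | apply/inv/e | apply/inv | apply/e/inv].
Qed.

Definition line_for (o : option (reps pi)) : Prop := exists l m (tt : T -> C),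
  [/\ l != 0, forall j, orbit_of o j -> meets rho w a b l m (conj l) (conj m) j (tt j) &
      forall j t, ~~ orbit_of o j -> ~ meets rho w a b l m (conj l) (conj m) j t].

Lemma line_none : line_for None.
Proof.
have inj2 : injective (fun r => 2%:R * ci * rc r).
  by move=> r r' /(mulfI (mulf_neq0 (two_neq0 R) (ci_neq0 R))) /(@rc_inj R).
(* With l = 1 and m = i mu, meeting the centre j would force 2 i mu = A (pi j) - conj (A j). *)
have [mu hmu] := avoid [seq A (pi j) - conj (A j) | j <- enum T] inj2.
exists 1, (ci * rc mu), (fun=> 0); split=> [|//|j t _]; first exact: oner_neq0.
move=> /meetsP [h1 h2]; case/negP: hmu; apply/mapP; exists j; first by rewrite mem_enum.
by rewrite h1 h2 !conjD !conjM conj1 conj_ci conj_rc; ring.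
Qed.

Lemma inv_inj j j' : A j = A j' -> j = j'.
Proof. by move/invr_inj/addIr/rho_inj. Qed.

Lemma line_fixed (r : reps pi) : pi (val r) = val r -> line_for (Some r).
Proof.
set s := val r => hs; pose m := A s.
pose P j := A (pi j) - m; pose Q j := conj (A j - m).
(* With l = c + i the line passes through s at t = 0. Meeting j as well gives P = (c + i) conj t and
   Q = (c - i) conj t, hence c = i (P + Q) / (P - Q). *)
have [c hc] := avoid [seq ci * (P j + Q j) / (P j - Q j) | j <- enum T] (@rc_inj R).
have l0 : rc c + ci != 0.
  by rewrite eq_complex /= add0r oner_eq0 andbF.
exists (rc c + ci), m, (fun=> 0); split=> // [j|j t].
  by rewrite /= -/s hs orbb => /eqP ->; apply/meetsP; rewrite hs conjc0 mulr0 add0r.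
rewrite /= -/s hs orbb => js /meetsP [h1 h2].
have hP : P j = (rc c + ci) * conj t by rewrite /P h2 addrK.
have hQ : Q j = (rc c - ci) * conj t.
  by rewrite /Q h1 addrK conjM conjD conj_ci conj_rc.
have PQ : P j - Q j = 2%:R * ci * conj t by rewrite hP hQ; ring.
have [t0|t0] := eqVneq (conj t) 0.
  by case/eqP: js; apply: inv_inj; rewrite -/m h1 -[t]conjcK t0 conjc0 mulr0 add0r.
case/negP: hc; apply/mapP; exists j; first by rewrite mem_enum.
have ci2 : ci != 0 := ci_neq0 R.
by rewrite PQ hP hQ; field; rewrite t0 ci2.
Qed.

(** The two centres determine the line up to its parametrization; that it misses all others is
    ensured by the choice of a in [special]. *)
Lemma line_pair (r : reps pi) : pi (val r) != val r -> line_for (Some r).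
Proof.
set s := val r => hs; have ci0 : ci != 0 := ci_neq0 R.
(* The two conjugate centres are to be met at t = i and t = - i. *)
pose l := (A s - A (pi s)) / (2%:R * ci); pose m := (A s + A (pi s)) / 2%:R.
have l0 : l != 0.
  rewrite mulf_neq0 ?invr_eq0 ?mulf_neq0 ?two_neq0 // subr_eq0.
  by apply: contra hs => /eqP /inv_inj <-.
have lin x y : x = (x - y) / (2%:R * ci) * ci + (x + y) / 2%:R :> C by field.
have e1 : A s = l * ci + m := lin _ _.
have e2 : A (pi s) = l * - ci + m.
  by rewrite [LHS](lin _ (A s)) [A (pi s) + A s]addrC mulrN -mulNr -mulNr opprB.
have [[ga gb] hcol] := ha.
exists l, m, (fun j => if j == s then ci else - ci); split=> // [j|j t].
  rewrite /= -/s; have [->|js /= /eqP ej] := eqVneq j s.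
    by move=> _; apply/meetsP; rewrite conj_ci.
  by apply/meetsP; rewrite ej piK conjN conj_ci opprK.
rewrite /= -/s negb_or => /andP [js jp] mj; have /eqP := hcol s j js jp hs; apply.
rewrite ev2_collin.
have [m1 m2] : meets rho w a b l m (conj l) (conj m) s ci by apply/meetsP; rewrite conj_ci.
have [m3 m4] : meets rho w a b l m (conj l) (conj m) (pi s) (- ci).
  by apply/meetsP; rewrite piK conjN conj_ci opprK.
case: mj => m5 m6; move: m1 m2 m3 m4 m5 m6.
have [l' hl'] : exists l', l' = conj l by eexists.
have [m' hm'] : exists m', m' = conj m by eexists.
have [b' hb'] : exists b', b' = b by eexists.
rewrite -hl' -hm' -hb' => m1 m2 m3 m4 m5 m6.
have nz (x y : C) : 1 = x * y -> y != 0.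
  by move=> e; apply/eqP => y0; move/eqP: e; rewrite y0 mulr0 oner_eq0.
have iv (x y z : C) : 1 = (x - z) * y -> x = z + y^-1.
  move=> e; have y0 := nz _ _ e; apply: (mulIf y0); rewrite mulrDl mulVf //.
  by move: e; rewrite mulrBl => ->; rewrite addrC subrK.
have n1 := nz _ _ m1; have n2 := nz _ _ m2; have n3 := nz _ _ m3.
have n4 := nz _ _ m4; have n5 := nz _ _ m5; have n6 := nz _ _ m6.
rewrite (iv _ _ _ m1) (iv _ _ _ m2) (iv _ _ _ m3) (iv _ _ _ m4) (iv _ _ _ m5) (iv _ _ _ m6).
by field; rewrite n1 n2 n3 n4 n5 n6.
Qed.

Lemma ex_line o : line_for o.
Proof.
case: o => [r|]; last exact: line_none.
by have [e|ne] := eqVneq (pi (val r)) (val r); [exact: line_fixed | exact: line_pair].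
Qed.

End Lines.

(** * Comparison of the numbers of orbits *)

Section RankLe.
Variables (T T' : finType) (R : realType).
Local Notation C := R[i].
Local Notation conj := (@conjc R).
Variables (pi : T -> T) (pi' : T' -> T') (rho w : T -> C) (rho' w' : T' -> C).
Hypotheses (piK : involutive pi) (piK' : involutive pi').
Hypotheses (rho_inj : injective rho) (rho_inj' : injective rho').
Hypothesis hpi : forall j, w (pi j) = conj (rho j).
Hypothesis hpi' : forall j, w' (pi' j) = conj (rho' j).
Local Notation Y := (Yset rho w).
Local Notation Y' := (Yset rho' w').
Local Notation idK := (idfun : {rmorphism C -> C}).
Local Notation cK := (polyC : {rmorphism C -> {poly C}}).
Variables (F : 'rV[C]_(amb T).+1 -> 'rV[C]_(amb T').+1) (G : 'rV[C]_(amb T').+1 -> 'rV[C]_(amb T).+1).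
Hypotheses (rF : regmap Y Y' F) (rG : regmap Y' Y G).
Hypothesis FK : forall x, Y x -> same_point x (G (F x)).
Hypothesis GK : forall y, Y' y -> same_point y (F (G y)).
Hypothesis Fth : forall x, Y x -> same_point (F (theta (sperm pi) x)) (theta (sperm pi') (F x)).

Lemma lcurve_cvec a b l m l' m' hit (tt : T -> C) j : generic rho w a b -> l != 0 -> l' != 0 ->
  exists k, cvec rho w cK j (lcurve rho w a b l m l' m' hit tt iy)
    (lcurve rho w a b l m l' m' hit tt iw) k != 0.
Proof.
move=> [ga gb] l0 l'0; exists o2; rewrite /cvec /vec3 /lcurve /=.
by apply: mulf_neq0; apply: ln_curve_neq0 => //; rewrite subr_eq0.
Qed.

Lemma lcurve_vconj a l m hit (tt : T -> C) k :
  let v := lcurve rho w a (conj a) l m (conj l) (conj m) hit tt in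
  vconj pi v iy k = v iy k /\ vconj pi v iw k = v iw k.
Proof.
have e p q : map_poly conj (ln p q) = ln (conj p) (conj q).
  by rewrite /ln rmorphD rmorphM /= !map_polyC map_polyX.
have e' c p q : map_poly conj (c%:P * ln p q + 1) = (conj c)%:P * ln (conj p) (conj q) + 1.
  by rewrite rmorphD rmorphM rmorph1 /= map_polyC e.
by move: k; apply: I3P; rewrite /vconj /= /pt /vec3 /= ?rmorph0 ?e' ?e ?conjcK.
Qed.

Lemma ex_source : exists x1, Y x1 /\ qY rho' w' (F x1) != 0.
Proof.
have [a [b g]] := ex_generic rho' w'; have Yg := gpt_Y g.
exists (G (gpt rho' w' a b)); split; first exact: rG.1.
have [d hq] := qY_hpoly rho' w'.
by rewrite (hpoly_same_point hq (GK Yg)) qY_gpt.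
Qed.

(* [v] is the real line through the points of the orbit [o], [u] its image. *)
Lemma ex_image_degrees (o : option (reps pi)) a : special pi rho w a ->
  qY rho' w' (F (gpt rho w a (conj a))) != 0 ->
  exists v u D Z, [/\ curve rho w v, forall i, isdeg (v i) (ldg (orbit_of o) i),
    curve rho' w' u /\ forall t, same_point (cpt u t) (F (cpt v t)),
    [/\ isdeg (u iy) D, isdeg (u iw) D, forall j, isdeg (u (iz j)) (Z j) & genlead rho' w' u D D] &
    forall j, Z (pi' j) = Z j].
Proof.
move=> ha qF; have [g _] := ha.
have [l [m [tt [l0 hP hN]]]] := ex_line piK rho_inj hpi ha o.
have l'0 : conj l != 0 by rewrite conjc_eq0.
pose v := lcurve rho w a (conj a) l m (conj l) (conj m) (orbit_of o) tt.
have cv : curve rho w v by exact: lcurve_curve.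
have dv i : isdeg (v i) (ldg (orbit_of o) i) by exact: lcurve_isdeg.
have rv : realc pi v.
  apply: (realc_of_base piK hpi cv) => [k|k|j].
  - by case: (lcurve_vconj a l m (orbit_of o) tt k).
  - by case: (lcurve_vconj a l m (orbit_of o) tt k).
  - exact: lcurve_cvec.
have lv : same_point (gpt rho w a (conj a)) (mkx (tens (leadv v (ldg (orbit_of o))))).
  exact: lcurve_lead.
have [u [cu hu]] := image_curve rF cv.
have ru : realc pi' u.
  move=> t; have Yc s := curve_Y s cv.
  rewrite (vconj_cpt piK'); apply: same_point_trans (same_point_theta _ (hu (conj t))) _.
  apply: same_point_trans (same_point_sym (Fth (Yc (conj t)))) _.
  rewrite -(vconj_cpt piK); apply: same_point_trans (same_point_sym (hu t)).
  exact: (regmap_same_point rF (curve_Y t (vconj_curve piK hpi cv)) (Yc t) (rv t)).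
have [dg hdg] := ex_dg cu.
have gl : genlead rho' w' u (dg iy) (dg iw).
  apply: (generic_genlead cu hdg); have [d hq] := qY_hpoly rho' w'.
  have sp : same_point (F (gpt rho w a (conj a))) (mkx (tens (leadv u dg))).
    apply: same_point_trans (same_point_sym (lead_image rF cv cu hu dv hdg)).
    exact: (regmap_same_point rF (gpt_Y g) (zclosed_same_point (Yset_closed rho w) lv (gpt_Y g)) lv).
  by rewrite (hpoly_same_point hq sp).
have dt i : dg (tau pi' i) = dg i := isdeg_uniq (real_isdeg piK' hpi' cu ru (hdg (tau pi' i))) (hdg i).
have dw : dg iw = dg iy := dt iy.
exists v, u, (dg iy), (fun j => dg (iz j)); split=> // [|j]; last exact: (dt (iz j)).
rewrite dw in gl; by split=> //; rewrite -dw.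
Qed.

(** A single a serves for all orbits. The degree formula for G followed by each projection, applied
    to the images of the lines, recovers the degrees of the lines linearly from those of the images,
    with coefficients that do not depend on the orbit. *)
Theorem rank_le : (#|{: reps pi}| <= #|{: reps pi'}|)%N.
Proof.
have [x1 [Yx1 q1]] := ex_source.
have [f [f0 hf]] := generic_image rho_inj rF Yx1 q1.
have [a [ha /hf]] := ex_special piK rho_inj hpi f0.
case: (ha) => g _ /(_ g) qF.
have /choice [v] := fun o => ex_image_degrees o ha qF.
move=> /choice [u] /choice [D] /choice [Z] h.
have hdeg i := degree_formula rho_inj' (regmap_comp rG (fac_regmap rho w i)) (fun x hx => hx).
have /choice [n /choice [m /choice [al hal]]] := hdeg.
apply: (orbit_rank piK piK' (D := D) (Z := Z) (n := n) (m := m) (al := al)) => [o|o i].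
  by case: (h o).
have [cv dv [cu hu] [dy dw dz gl] _] := h o.
apply: (hal i (u o) (D o) (D o) (Z o) (v o i)) => // [t|t].
  exact: (cv.2 t i).
have Yc := curve_Y t cv.
have sp : same_point (cpt (v o) t) (G (cpt (u o) t)).
  apply: same_point_trans (FK Yc) _.
  exact: (regmap_same_point rG (rF.1 _ Yc) (curve_Y t cu) (same_point_sym (hu t))).
exact: (fac_tens i (cv.2 t) sp).
Qed.

End RankLe.

(** * The family of blow-ups *)

Section BasePoints.
Variable R : realType.
Local Notation C := R[i].
Local Notation conj := (@conjc R).
Local Notation rc := (real_complex R : {rmorphism R -> C}).
Local Notation ci := (Complex 0 1 : C).

(* The square of [cu u] below. *)
Definition cusq (u : bool) : R := if u then -1 else 1.

(** Both sides have the sign of [cusq], which separates the two kinds. Square roots then give (t -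
    t') (t t' + k) = 0, where t t' is at least 4 and k is 1 or -1. *)
Lemma cusq_inj (t t' : R) u u' : 2%:R <= t -> 2%:R <= t' ->
  t ^+ 2 * cusq u * (t' ^+ 2 - cusq u') ^+ 2 = t' ^+ 2 * cusq u' * (t ^+ 2 - cusq u) ^+ 2 ->
  u = u' /\ t = t'.
Proof.
have pos s v : 2%:R <= s -> 0 < s ^+ 2 - cusq v.
  by move=> hs; rewrite /cusq; case: v; nra.
move=> ht ht' e; have t0 : 0 < t by lra. have t0' : 0 < t' by lra.
have p : 0 < t ^+ 2 * (t' ^+ 2 - cusq u') ^+ 2 by rewrite mulr_gt0 ?exprn_gt0 ?pos.
have p' : 0 < t' ^+ 2 * (t ^+ 2 - cusq u) ^+ 2 by rewrite mulr_gt0 ?exprn_gt0 ?pos.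
have uu : u = u'.
  by move: e p p'; rewrite /cusq; case: u; case: u' => // e p p'; exfalso; nra.
split=> //; move: e p p'; rewrite -uu => {uu} e _ _.
have k0 : cusq u != 0 by rewrite /cusq; case: (u); rewrite ?oppr_eq0 oner_eq0.
have /eqP : (t * (t' ^+ 2 - cusq u)) ^+ 2 = (t' * (t ^+ 2 - cusq u)) ^+ 2.
  apply: (mulfI k0); transitivity (t ^+ 2 * cusq u * (t' ^+ 2 - cusq u) ^+ 2); first by ring.
  by rewrite e; ring.
have p := mulr_gt0 t0 (pos _ u ht'); have p' := mulr_gt0 t0' (pos _ u ht).
rewrite eqf_sqr => /orP [/eqP e1|/eqP e1]; last by move: p; rewrite e1; lra.
have : (t - t') * (t * t' + cusq u) = 0.
  by apply/eqP; rewrite -oppr_eq0; apply/eqP; move/eqP: e1; rewrite -subr_eq0 => /eqP <-; ring.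
move/eqP; rewrite mulf_eq0 => /orP [|/eqP e2]; first by rewrite subr_eq0 => /eqP.
by move: e2; rewrite /cusq; case: (u); nra.
Qed.

Definition cu (u : bool) : C := if u then ci else 1.

(** With t = b.1 + 2, the quotient (t + c) / (t - c) lies on the unit circle if c is the imaginary
    unit and is real if c = 1; t is at least 2, so the denominator never vanishes. *)
Definition base (b : nat * bool) : C := (b.1.+2%:R + cu b.2) / (b.1.+2%:R - cu b.2).
Definition Eb (b : nat * bool) : C := base b ^+ 2 + (base b ^+ 2)^-1.

Lemma cu2 u : cu u * cu u = rc (cusq u).
Proof.
by case: u => /=; apply/eqP; rewrite eq_complex /= ?(mul0r, mulr0, mulr1, add0r, addr0, sub0r, oppr0) !eqxx.
Qed.

Lemma base_den i u : i.+2%:R - cu u != 0 /\ i.+2%:R + cu u != 0.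
Proof.
have h : (i.+2%:R - cu u) * (i.+2%:R + cu u) != 0.
  rewrite (_ : _ * _ = rc (i.+2%:R ^+ 2 - cusq u)); last first.
    by rewrite rmorphB rmorphXn rmorph_nat -cu2; ring.
  rewrite fmorph_eq0; apply/eqP; have : (2%:R : R) <= i.+2%:R by rewrite ler_nat.
  by move=> h; rewrite /cusq; case: u; nra.
by move: h; rewrite mulf_eq0 negb_or => /andP.
Qed.

Lemma base_neq0 b : base b != 0.
Proof. by case: b => i u; have [h1 h2] := base_den i u; rewrite mulf_neq0 ?invr_eq0. Qed.

Lemma base_conj b : conj (base b) = if b.2 then (base b)^-1 else base b.
Proof.
case: b => i u; have ct : conj i.+2%:R = i.+2%:R :> C := rmorph_nat conj _.
have cc : conj (cu u) = if u then - cu u else cu u.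
  by rewrite /cu; case: u; rewrite ?conj1 ?conj_ci.
rewrite /base /=; move: (i.+2%:R : C) ct => t ct.
have cV x : conj x^-1 = (conj x)^-1 := fmorphV conj x.
by rewrite conjM cV !conjD conjN ct cc; case: u {cc}; rewrite ?opprK ?invf_div.
Qed.

(** z^2 + 1/z^2 - 2 is the square of z - 1/z = 4 t c / (t^2 - c^2). The result is below 2 for
    circular blocks and above 2 for real ones. *)
Lemma EbE i u : Eb (i, u) =
  rc (2%:R + 16%:R * (i.+2%:R ^+ 2 * cusq u) / (i.+2%:R ^+ 2 - cusq u) ^+ 2).
Proof.
have [h1 h2] := base_den i u.
have rE (t k : R) : rc (2%:R + 16%:R * (t ^+ 2 * k) / (t ^+ 2 - k) ^+ 2) =
    2%:R + 16%:R * (rc t ^+ 2 * rc k) / (rc t ^+ 2 - rc k) ^+ 2.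
  rewrite rmorphD; congr (_ + _); first exact: rmorph_nat.
  rewrite rmorphM; congr (_ * _); first by rewrite rmorphM rmorphM rmorphXn rmorph_nat.
  by rewrite fmorphV rmorphXn rmorphB rmorphXn.
rewrite rE rmorph_nat -cu2 /Eb /base /=.
have e : (i.+2%:R ^+ 2 - cu u * cu u) = (i.+2%:R - cu u) * (i.+2%:R + cu u) :> C by ring.
rewrite e; move: (cu u) (i.+2%:R : C) h1 h2 => c t h1 h2; field; by rewrite h1 h2.
Qed.

Lemma Eb_inj : injective Eb.
Proof.
move=> [i u] [i' u']; rewrite !EbE => /(@complexI R) /addrI.
have h j v : (j.+2%:R ^+ 2 - cusq v) ^+ 2 != 0.
  have hj : (2%:R : R) <= j.+2%:R by rewrite ler_nat.
  rewrite expf_neq0 //; apply/eqP; rewrite /cusq; case: v; nra.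
move/eqP; rewrite eqr_div // => /eqP e.
have n16 : 16%:R != 0 :> R by rewrite pnatr_eq0.
have [|||-> /eqP] := @cusq_inj i.+2%:R i'.+2%:R u u'; rewrite ?ler_nat //.
  apply: (mulfI n16); move: (i.+2%:R : R) (i'.+2%:R : R) e => t t' e.
  transitivity (16%:R * (t ^+ 2 * cusq u) * (t' ^+ 2 - cusq u') ^+ 2); first by ring.
  by rewrite e; ring.
by rewrite eqr_nat => /eqP [->].
Qed.

(** This keeps the members z, -z, 1/z, -1/z of a block distinct. *)
Lemma base4 b : base b ^+ 2 != 1 /\ base b ^+ 2 != - 1.
Proof.
have [h1 h2] := base_den b.1 b.2; have two0 : (2%:R : C) != 0 := two_neq0 R.
have c0 : cu b.2 != 0 by rewrite /cu; case: b.2; rewrite ?oner_eq0 // ci_neq0.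
have t0 : (b.1.+2%:R : C) != 0 by rewrite pnatr_eq0.
have hk : b.1.+2%:R ^+ 2 + cu b.2 * cu b.2 != 0.
  rewrite (_ : _ + _ = rc (b.1.+2%:R ^+ 2 + cusq b.2)); last first.
    by rewrite rmorphD rmorphXn rmorph_nat -cu2.
  rewrite fmorph_eq0; apply/eqP; have : (2%:R : R) <= b.1.+2%:R by rewrite ler_nat.
  by move=> h; rewrite /cusq; case: b.2; nra.
rewrite /base; split; rewrite -subr_eq0.
  rewrite (_ : _ - 1 = 2%:R * 2%:R * b.1.+2%:R * cu b.2 / (b.1.+2%:R - cu b.2) ^+ 2).
    by rewrite !mulf_neq0 ?invr_eq0 ?expf_neq0.
  by move: (cu b.2) (b.1.+2%:R : C) h1 h2 => c t h1 h2; field.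
rewrite (_ : _ - - 1 = 2%:R * (b.1.+2%:R ^+ 2 + cu b.2 * cu b.2) / (b.1.+2%:R - cu b.2) ^+ 2).
  by rewrite !mulf_neq0 ?invr_eq0 ?expf_neq0.
by move: (cu b.2) (b.1.+2%:R : C) h1 h2 => c t h1 h2; field.
Qed.

End BasePoints.

Lemma card_proper_pred (T : finType) (P Q : pred T) j0 : (forall j, P j -> Q j) ->
  Q j0 -> ~~ P j0 -> (#|P| < #|Q|)%N.
Proof.
move=> PQ q0 p0; apply: proper_card; apply/properP; split; last by exists j0.
by apply/fintype.subsetP => j; exact: PQ.
Qed.

Section Family.
Variables (R : realType) (r : nat).
Local Notation C := R[i].
Local Notation conj := (@conjc R).

(** The components are the number of a pair of blocks, whether the block is circular, the sign of
    the member, and whether it is z or 1/z up to sign. *)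
Definition ix : finType := ('I_r * bool * bool * bool)%type.
Definition blk (j : ix) : nat * bool := (j.1.1.1 : nat, j.1.1.2).
Definition rho (j : ix) : C :=
  sg C j.1.2 * (if j.2 then base R (blk j) else (base R (blk j))^-1).
(** The two blocks of number i always have opposite signs, the circular one being positive when k <=
    i. Passing from k to k + 1 exchanges the pair of number k alone. *)
Definition eps (k : nat) (j : ix) : bool := j.1.1.2 == (k <= j.1.1.1)%N.
(** The index of e / conj z: the sign changes when e = -1, and z is inverted only in real blocks,
    since conj z = 1/z on the circle. *)
Definition conj_ix (k : nat) (j : ix) : ix :=
  (j.1.1, (if eps k j then j.1.2 else ~~ j.1.2), (if j.1.1.2 then j.2 else ~~ j.2)).
Local Notation wk k := (wof rho (eps k)).

Lemma rho_neq0 j : rho j != 0.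
Proof. by rewrite /rho mulf_neq0 ?sg_neq0 //; case: ifP; rewrite ?invr_eq0 base_neq0. Qed.

Lemma rho_sq j : rho j ^+ 2 = if j.2 then base R (blk j) ^+ 2 else (base R (blk j) ^+ 2)^-1.
Proof. by rewrite /rho expr2 mulrACA sg2 mul1r -expr2; case: ifP; rewrite ?exprVn. Qed.

Lemma rho_E j : rho j ^+ 2 + (rho j ^+ 2)^-1 = Eb R (blk j).
Proof. by rewrite rho_sq; case: ifP; rewrite /Eb ?invrK // addrC. Qed.

Lemma rho_inj : injective rho.
Proof.
move=> j j' e; have := rho_E j; rewrite e rho_E => /Eb_inj eb.
have eb' : blk j' = blk j by rewrite eb.
move: e; rewrite /rho eb'.
have [n1 n2] := base4 R (blk j); have z0 := base_neq0 R (blk j).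
move: (base R _) n1 n2 z0 => z n1 n2 z0.
suff st : sg C j.1.2 * (if j.2 then z else z^-1) = sg C j'.1.2 * (if j'.2 then z else z^-1) ->
    j.1.2 = j'.1.2 /\ j.2 = j'.2.
  move=> e; have := st e; move: eb'; rewrite /blk => -[]; case: j {st e eb} => [[[i u] s] t]; case: j' => [[[i' u'] s'] t'] /=.
  by move=> /ord_inj -> -> [-> ->].
have two : (2%:R : C) != 0 := two_neq0 R.
have n0 : z != - z by rewrite -subr_eq0 opprK -mulr2n -mulr_natl mulf_neq0.
have h1 : z != z^-1.
  by apply: contra n1 => /eqP h; rewrite expr2 {1}h mulVf.
have h2 : z != - z^-1.
  by apply: contra n2 => /eqP h; rewrite expr2 {1}h mulNr mulVf.
have h0 : z^-1 != - z^-1 by rewrite -invrN (inj_eq invr_inj).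
have h3 : z^-1 != - z by rewrite eq_sym eqr_oppLR.
have h4 : z^-1 != z by rewrite eq_sym.
by case: j.1.2; case: j'.1.2; case: j.2; case: j'.2 => //; rewrite /sg ?mulN1r ?mul1r;
  move/eqP; rewrite ?eqr_opp ?eqr_oppLR ?(negPf n0) ?(negPf h0) ?(negPf h1) ?(negPf h2)
    ?(negPf h3) ?(negPf h4).
Qed.

Lemma conj_ixK k : involutive (conj_ix k).
Proof.
by case=> [[[i u] s] t]; rewrite /conj_ix /eps /=; case: (_ == _); case: u; rewrite /= ?negbK.
Qed.

Lemma conj_rho j : conj (rho j) = if j.1.1.2 then sg C j.1.2 * (sg C j.1.2 * rho j)^-1 else rho j.
Proof.
have cs b : conj (sg C b) = sg C b by case: b; rewrite /sg ?conjN conj1.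
have cV x : conj x^-1 = (conj x)^-1 := fmorphV conj x.
rewrite /rho mulrA sg2 mul1r conjM cs.
have := base_conj R (blk j); rewrite /blk /=; case: j.1.1.2 => e; case: j.2; rewrite ?cV e ?invrK //.
Qed.

Lemma w_conj k j : wk k (conj_ix k j) = conj (rho j).
Proof.
have sV b : (sg C b)^-1 = sg C b by apply: (mulfI (sg_neq0 C b)); rewrite sg2 divff ?sg_neq0.
have es : eps k (conj_ix k j) = eps k j by [].
rewrite conj_rho /wof es /rho /conj_ix /blk /=; move: (base R _) => z.
case: (eps k j); case: j.1.1.2; case: j.2; case: j.1.2; rewrite /sg /= ?invfM ?invrK ?invrN ?invr1;
  by rewrite ?(mul1r, mulN1r, mulrNN, mulr1, mulrN1, opprK, invrK, mulNr, mulrN).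
Qed.

(** The fixed indices are those of the circular blocks of number at least k. *)
Lemma card_fix k : (k < r)%N -> forall l, (k < l)%N ->
  (#|[pred j | conj_ix l j == j]| < #|[pred j | conj_ix k j == j]|)%N.
Proof.
have fixE m j : (conj_ix m j == j) = j.1.1.2 && (m <= j.1.1.1)%N.
  case: j => [[[i u] s] t]; rewrite /conj_ix /eps /= !xpair_eqE !eqxx /=.
  by case: (m <= i)%N; case: u; case: s; case: t.
move=> kr l kl; apply: (@card_proper_pred _ _ _ (Ordinal kr, true, true, true)).
- by move=> j /=; rewrite !fixE => /andP [-> lj]; exact: leq_trans (ltnW kl) lj.
- by rewrite /= fixE /= leqnn.
- by rewrite /= fixE /= -ltnNge.
Qed.

(** At stage k the block (k, u) has sign u. The roots of [HH b] must have sign opposite to b, so it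
    is the quartic of the block (k, ~~ b), with middle coefficient minus [Eb]. *)
Lemma exchange_step k : (k < r)%N ->
  exchange rho (eps k) (eps k.+1) (fun b => - Eb R (k, ~~ b)) [pred j : ix | j.1.1.1 == k :> nat].
Proof.
move=> kr; have HE b y : y != 0 -> HH (fun b => - Eb R (k, ~~ b)) b 1 y =
    y ^+ 2 * (y ^+ 2 + (y ^+ 2)^-1 - Eb R (k, ~~ b)).
  by move=> y0; rewrite /HH; move: (Eb _ _) => E; field.
have rho2 j : rho j ^+ 2 != 0 by rewrite expf_neq0 // rho_neq0.
split.
- exact: two_neq0.
- exact: rho_inj.
- exact: rho_neq0.
- move=> j /eqP jk; rewrite HE ?rho_neq0 // rho_E /blk jk negbK.
  have -> : eps k j = j.1.1.2 by rewrite /eps jk leqnn eqb_id.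
  by rewrite subrr mulr0.
- move=> j b nb; rewrite HE ?rho_neq0 // rho_E mulf_neq0 // subr_eq0.
  apply: contra nb => /eqP /Eb_inj [jk jb]; rewrite inE jk eqxx /eps jk leqnn /= jb.
  by case: b {jb}.
- move=> j /eqP jk; have [n1 n2] := base4 R (blk j).
  have r0 := rho_neq0 j.
  (* This is the derivative of the quartic at its root, nonzero because the four roots are
     simple. *)
  have -> : Hq rho (fun b => - Eb R (k, ~~ b)) (~~ eps k j) j 1 (rho j) =
      2%:R * rho j * (rho j ^+ 2 - (rho j ^+ 2)^-1).
    have -> : eps k j = j.1.1.2 by rewrite /eps jk leqnn eqb_id.
    rewrite /Hq negbK (_ : (k, _) = blk j) -?rho_E; last by rewrite /blk -jk.
    by field.
  apply: mulf_neq0; first by apply: mulf_neq0 => //; exact: two_neq0.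
  rewrite subr_eq0 rho_sq.
  have b0 : base R (blk j) ^+ 2 != 0 by rewrite expf_neq0 // base_neq0.
  have h : base R (blk j) ^+ 2 != (base R (blk j) ^+ 2)^-1.
    rewrite -(inj_eq (mulfI b0)) divff // -expr2 -subr_eq0 subr_sqr_1 mulf_neq0 ?subr_eq0 //.
    by rewrite addr_eq0.
  by case: ifP; rewrite ?invrK // eq_sym.
- move=> b y0 y1 y01 e.
  have y00 : y0 != 0.
    apply: contraTneq y01 => y00; move: e; rewrite /HH y00 !(mulr0, addr0) => /eqP.
    by rewrite !mulf_eq0 !orbb eqxx /= negbK.
  pose z := base R (k, ~~ b); pose y := y1 / y0.
  have z0 : z != 0 by exact: base_neq0.
  have yE : y1 = y * y0 by rewrite /y divfK.
  have : (y - z) * (y + z) * ((y - z^-1) * (y + z^-1)) = 0.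
    apply: (mulfI (expf_neq0 4 y00)); rewrite mulr0 -e yE /HH /Eb -/z; field.
    exact: z0.
  have jE s t : exists2 j : ix, [pred j : ix | j.1.1.1 == k :> nat] j && (b == ~~ eps k j) &
      rho j = sg C s * (if t then z else z^-1).
    exists (Ordinal kr, ~~ b, s, t) => //.
    by rewrite /eps /= eqxx leqnn /=; case: b {z z0 y y01 e yE}.
  have out s t : y = sg C s * (if t then z else z^-1) ->
      exists2 j : ix, [pred j : ix | j.1.1.1 == k :> nat] j && (b == ~~ eps k j) & y1 = rho j * y0.
    by move=> h; have [j hj hr] := jE s t; exists j; rewrite ?hr -?h.
  move/eqP; rewrite !mulf_eq0 !subr_eq0 !addr_eq0 -!orbA.
  case/or4P => /eqP h; [apply: (out true true) | apply: (out false true) |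
    apply: (out true false) | apply: (out false false)]; by rewrite h /sg ?mul1r ?mulN1r.
- move=> j; rewrite /= /eps; have [->|ne] := eqVneq (j.1.1.1 : nat) k.
    by rewrite leqnn ltnn; case: j.1.1.2.
  by rewrite [in LHS]ltn_neqAle [k == _]eq_sym ne.
Qed.

End Family.

Lemma Yset_zeros (T : finType) (K : closedFieldType) (rho w : T -> K) :
  Yset rho w = zeros [set` Y_eqns rho w].
Proof.
rewrite /Yset /points /=; congr zeros; apply/seteqP; split=> p /=.
  by move=> /mapP [q hq ->]; rewrite map_mpoly_idfun.
by move=> hp; apply/mapP; exists p; rewrite ?map_mpoly_idfun.
Qed.

(** * Real models of the blow-ups and conclusion *)

Section RealFormsOfY.
Variables (T : finType) (R : realType).
Local Notation C := R[i].
Local Notation conj := (@conjc R).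
Variables (pi : T -> T) (rho w : T -> C).
Hypothesis piK : involutive pi.
Hypothesis hpi : forall j, w (pi j) = conj (rho j).

Definition models (X0 : projvar R) : Prop :=
  exists (S : seq {mpoly R[(amb T).+1]}) (hS : all (fun p => p \is homog mdeg) S),
    X0 = ProjVar hS /\
    @complexification R (ProjVar hS) = [set x | Yset rho w (x *m bm R (sperm pi))].

Lemma ex_models : exists X0, models X0.
Proof.
have [x|S [hS h]] := real_model (spermK piK) (Y_eqns_homog rho w).
  by rewrite -Yset_zeros => Yx; exact: (Y_theta piK hpi).
by exists (ProjVar hS), S, hS; split=> //; rewrite Yset_zeros.
Qed.

Lemma models_ziso X0 : models X0 -> ziso (@complexification R X0) (Yset rho w).
Proof.
move=> [S [hS [-> h]]]; apply: (real_form_model (spermK piK) _ h); exact: Yset_neq0.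
Qed.

End RealFormsOfY.

(** [card_reps] turns the inequality between numbers of orbits into one between numbers of fixed
    points, the index set being the same. *)
Lemma iso_rank_le (T : finType) (R : realType) (pi pi' : T -> T) (rho w w' : T -> R[i]) X0 X0' :
  injective rho -> involutive pi -> involutive pi' ->
  (forall j, w (pi j) = (rho j)^*%C) -> (forall j, w' (pi' j) = (rho j)^*%C) ->
  models pi rho w X0 -> models pi' rho w' X0' -> isomorphic_over_R X0 X0' ->
  (#|[pred j | pi j == j]| <= #|[pred j | pi' j == j]|)%N.
Proof.
move=> rho_inj piK piK' hpi hpi' [S [hS [-> h]]] [S' [hS' [-> h']]] iso.
have [||x|x|F [G [rF rG FK GK Fth]]] := real_iso_theta (spermK piK) (spermK piK') _ _ _ _ h h' iso.
- exact: Yset_neq0.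
- exact: Yset_neq0.
- exact: (Y_theta piK hpi).
- exact: (Y_theta piK' hpi').
have le := rank_le piK piK' rho_inj rho_inj hpi hpi' rF rG FK GK Fth.
by rewrite -(leq_add2l #|T|) -!card_reps // leq_mul2l le orbT.
Qed.

Theorem theorem1p2 (R : realType) (r : nat) (hr : (0 < r)%N) :
  exists X : projvar R[i],
    smooth_rational_surface X /\
    exists X0 : 'I_r -> projvar R,
      (forall k, real_form X (X0 k)) /\
      (forall k l, k != l -> ~ isomorphic_over_R (X0 k) (X0 l)).
Proof.
pose rh := @rho R r; pose w k := wof rh (eps k).
have inj : injective rh by exact: rho_inj.
have hw k j : w k (conj_ix k j) = (rh j)^*%C by exact: w_conj.
have pK k : involutive (@conj_ix r k) by exact: conj_ixK.
exists (Yvar rh (w 0)); split.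
  split; first exact: (Y_irreducible (w 0) inj).
    split; first exact: (Y_dim (w 0) inj).
    exact: (Y_smooth inj).
  exact: Y_rational.
have /choice [X0 hX0] := fun k : 'I_r => ex_models (pK k) (hw k).
(* All complex surfaces are linked to the first one by exchanges, one pair of blocks at a time. *)
have chain k : (k <= r)%N -> ziso (Yset rh (w k)) (Yset rh (w 0)).
  elim: k => [_|k IH kr]; first by apply: ziso_refl => x; exact: Yset_neq0.
  apply: ziso_trans (IH (ltnW kr)); apply: ziso_sym.
  exact: (exchange_iso (exchange_step R kr)).
exists X0; split=> [k|k l kl iso].
  exact: (ziso_trans (models_ziso (pK k) (hX0 k)) (chain _ (ltnW (ltn_ord k)))).
(* Each direction of the isomorphism gives one inequality; whichever of k and l is smaller, one of
   the two contradicts [card_fix]. *)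
have iso' : isomorphic_over_R (X0 l) (X0 k).
  by case: iso => phi [psi [h1 h2 h3 h4]]; exists psi, phi; split.
have le1 := iso_rank_le inj (pK k) (pK l) (hw k) (hw l) (hX0 k) (hX0 l) iso.
have le2 := iso_rank_le inj (pK l) (pK k) (hw l) (hw k) (hX0 l) (hX0 k) iso'.
case: (ltngtP k l) => [lt|lt|e].
- by have := card_fix (ltn_ord k) lt; rewrite ltnNge le1.
- by have := card_fix (ltn_ord l) lt; rewrite ltnNge le2.
by case/eqP: kl; apply: val_inj.
Qed.
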